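(* Let $(X/\Delta)$ be a compact orbifold, let $\Delta_1$ denote the union of the components of $\Delta$ of weight $1$, and fix a hermitian metric on $X$. Assume that the orbifold Kobayashi pseudodistance (resp. the classical orbifold Kobayashi pseudodistance) of $(X/\Delta)$ on $X\setminus|\Delta_1|$ is not a distance. Then there exists a non-constant holomorphic map $f:\mathbb{C}\to X$ such that either $f$ is an orbifold morphism (resp. a classical orbifold morphism) from $\mathbb{C}$ to $(X/\Delta)$, or $f(\mathbb{C})\subset|\Delta|$. Furthermore $f$ can be chosen such that $\sup_{z\in\mathbb{C}}\|f'(z)\|=\|f'(0)\|>0$, where the norm is taken with respect to the Euclidean metric on $\mathbb{C}$ and the hermitian metric on $X$.
   Context: All complex spaces are irreducible, reduced, normal, Hausdorff and paracompact. An orbifold $(X/\Delta)$ is a complex space $X$ together with a Weil divisor with rational coefficients $\Delta=\sum_i a_i[Z_i]$, where the $Z_i$ are pairwise distinct irreducible reduced hypersurfaces and $a_i=1-\frac{1}{m_i}$ with $m_i\in\{2,3,\dots\}\cup\{\infty\}$ ($\frac1\infty=0$). The number $a_i$ is the weight and $m_i$ the multiplicity of $Z_i$; $|\Delta|=\bigcup_i Z_i$. $\Delta_1$ is the union of the $Z_i$ of weight $1$ (multiplicity $\infty$). The orbifold is compact if $X$ is compact and no component of $\Delta$ has weight $1$. Let $D=\{z\in\mathbb{C}:|z|<1\}$. A holomorphic map $h:D\to X$ is an orbifold morphism (resp. classical orbifold morphism) from $D$ to $(X/\Delta)$ if $h(D)\not\subset|\Delta|$, for every $i$ with $m_i<\infty$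 and every $x\in D$ with $h(x)\in Z_i$ the multiplicity $\mathrm{mult}_x(h^*Z_i)$ is $\ge m_i$ (resp. is a multiple of $m_i$), and $h(D)\cap Z_i=\emptyset$ if $m_i=\infty$. A holomorphic map $f:\mathbb{C}\to X$ is a (classical) orbifold morphism from $\mathbb{C}$ to $(X/\Delta)$ if $f(\mathbb{C})\not\subset|\Delta|$ and for every holomorphic map $g:D\to\mathbb{C}$ with $g(D)\not\subset f^{-1}(|\Delta|)$ the composition $f\circ g$ is a (classical) orbifold morphism from $D$ to $(X/\Delta)$. The (classical) orbifold Kobayashi pseudodistance of $(X/\Delta)$ is the largest pseudodistance on $X\setminus|\Delta_1|$ such that every (classical) orbifold morphism $D\to(X/\Delta)$ is distance-decreasing with respect to the Poincaré distance on $D$.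
   Formalization: The multiplicity of h^*Z_i at x is ord_x(φ∘h)/k, where φ is a local equation of kZ_i near h(x); at points where no multiple of the Weil divisor Z_i is locally principal, h^*Z_i is undefined and no multiplicity condition is imposed. *)

(* Defs.v *)
From HB Require Import structures.
From mathcomp Require Import all_boot all_order all_algebra complex.
From mathcomp Require Import all_classical all_reals all_analysis.

Set Implicit Arguments.
Unset Strict Implicit.
Unset Printing Implicit Defensive.

Import Order.TTheory GRing.Theory Num.Theory.
Import numFieldNormedType.Exports.

Local Open Scope classical_set_scope.
Local Open Scope ring_scope.

(* The complex numbers over R, as a normed space over themselves: [differentiable]
   and [derive1] then mean complex differentiability and complex derivative. *)
Notation CC R := ((complex R)^o).

Definition holo_germ (R : realType) (V : normedModType (complex R)) (w : V)
    (F : V -> CC R) : Prop :=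
  \forall w' \near w, differentiable F w'.

(* A structure sheaf of continuous functions is given by its germs:
   [O x f] says that [f] is defined near [x] by a section of the sheaf. Only the
   values of [f] near [x] are relevant. *)
Definition germ_pred (R : realType) (X : topologicalType) : Type :=
  X -> (X -> CC R) -> Prop.

Definition analytic_at (R : realType) (X : topologicalType) (O : germ_pred R X)
    (A : set X) (x : X) : Prop :=
  exists (k : nat) (F : 'I_k -> X -> CC R),
    (forall i, O x (F i)) /\
    \forall y \near x, A y <-> forall i, F i y = 0.

Definition analytic_subset (R : realType) (X : topologicalType)
    (O : germ_pred R X) (A : set X) : Prop :=
  forall x, analytic_at O A x.

(* [phi] is an isomorphism of [U] onto the analytic subset [phi @` U] of the open
   set [W] of C^n, the latter with the sheaf of restrictions of holomorphic
   functions. *)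
Definition local_model (R : realType) (X : topologicalType) (O : germ_pred R X)
    (U : set X) (n : nat) (phi : X -> 'rV[CC R]_n)
    (W : set 'rV[CC R]_n) : Prop :=
  [/\ open U /\ open W,
      phi @` U `<=` W,
      forall w, W w -> analytic_at (@holo_germ R 'rV[CC R]_n) (phi @` U) w,
      {within U, continuous phi} /\
      (exists psi : 'rV[CC R]_n -> X,
         {within phi @` U, continuous psi} /\ forall x, U x -> psi (phi x) = x) &
      forall x f, U x ->
        (O x f <-> exists2 F, holo_germ (phi x) F &
                              \forall y \near x, f y = F (phi y))].

Definition irreducible_subset (R : realType) (X : topologicalType)
    (O : germ_pred R X) (Z : set X) : Prop :=
  [/\ analytic_subset O Z, Z !=set0 &
      forall A B, analytic_subset O A -> analytic_subset O B ->
        Z = A `|` B -> A = Z \/ B = Z].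

Definition germ_regular (R : realType) (X : topologicalType) (O : germ_pred R X)
    (x : X) (b : X -> CC R) : Prop :=
  O x b /\ forall c, O x c ->
    (\forall y \near x, b y * c y = 0) -> \forall y \near x, c y = 0.

(* The local ring at [x] is integrally closed in its total ring of fractions: if
   [a / b] satisfies the monic equation T^n + \sum_(i < n) c_i T^i = 0, written
   without denominators, then [b] divides [a]. *)
Definition normal_at (R : realType) (X : topologicalType) (O : germ_pred R X)
    (x : X) : Prop :=
  forall (a b : X -> CC R) (n : nat) (c : 'I_n -> X -> CC R),
    O x a -> germ_regular O x b -> (forall i, O x (c i)) ->
    (\forall y \near x,
       a y ^+ n + \sum_(i < n) c i y * a y ^+ i * b y ^+ (n - i) = 0) ->
    exists2 q, O x q & \forall y \near x, a y = q y * b y.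

Definition paracompact (X : topologicalType) : Prop :=
  forall P : set (set X), (forall U, P U -> open U) -> \bigcup_(U in P) U = setT ->
  exists Q : set (set X),
    [/\ forall V, Q V -> open V,
        \bigcup_(V in Q) V = setT,
        forall V, Q V -> exists2 U, P U & V `<=` U &
        forall x : X, exists2 W, nbhs x W &
          finite_set [set V | Q V /\ V `&` W !=set0]].

(* Reducedness is built in, the sections being functions. *)
Record complex_space (R : realType) := ComplexSpace {
  cs_top :> topologicalType;
  cs_germ : germ_pred R cs_top;
  cs_local : forall p : cs_top, exists U n phi W,
    @local_model R cs_top cs_germ U n phi W /\ U p;
  cs_hausdorff : hausdorff_space cs_top;
  cs_paracompact : paracompact cs_top;
  cs_irreducible : irreducible_subset cs_germ [set: cs_top];
  cs_normal : forall x, normal_at cs_germ x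
}.

(* Chevalley dimension at [x] of the analytic subset [Z]: the least number of
   germs vanishing at [x] whose common zero set on [Z] has [x] as isolated point. *)
Definition isolated_by (R : realType) (X : complex_space R) (Z : set X) (x : X)
    (d : nat) : Prop :=
  exists g : 'I_d -> X -> CC R,
    (forall i, cs_germ x (g i) /\ g i x = 0) /\
    \forall y \near x, Z y -> (forall i, g i y = 0) -> y = x.

Definition local_dim (R : realType) (X : complex_space R) (Z : set X) (x : X)
    (d : nat) : Prop :=
  isolated_by Z x d /\ forall e, isolated_by Z x e -> (d <= e)%N.

Definition irreducible_hypersurface (R : realType) (X : complex_space R)
    (Z : set X) : Prop :=
  irreducible_subset (@cs_germ R X) Z /\
  forall x, Z x -> exists d, local_dim Z x d /\ local_dim [set: X] x d.+1.

Definition unit_disc (R : realType) : set (CC R) := [set z | `|z| < 1].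

Definition holomorphic_on (R : realType) (X : complex_space R) (E : set (CC R))
    (h : CC R -> X) : Prop :=
  forall z, E z -> {for z, continuous h} /\
    forall g, cs_germ (h z) g -> holo_germ z (g \o h).

Definition germ_in_ideal (R : realType) (X : complex_space R) (Z : set X) (x : X)
    (g : X -> CC R) : Prop :=
  cs_germ x g /\ \forall y \near x, Z y -> g y = 0.

Definition ideal_generator (R : realType) (X : complex_space R) (Z : set X) (x : X)
    (g : X -> CC R) : Prop :=
  germ_in_ideal Z x g /\
  forall f, germ_in_ideal Z x f ->
    exists2 q, cs_germ x q & \forall y \near x, f y = q y * g y.

(* [phi] is holomorphic on the open set [U] and div(phi) = k Z there. The ideal of
   [Z] is principal off [Z] (generated by 1) and, [X] being normal, off a subset of
   codimension 2 in [X] (in particular at the common smooth points of [X] and [Z]).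
   At each such point, [phi] must be a unit times the k-th power of a generator. *)
Definition local_equation (R : realType) (X : complex_space R) (Z : set X)
    (k : nat) (U : set X) (phi : X -> CC R) : Prop :=
  [/\ open U, forall y, U y -> cs_germ y phi &
      forall y g, U y -> ideal_generator Z y g ->
        exists u, [/\ cs_germ y u, u y != 0 &
                      \forall t \near y, phi t = u t * g t ^+ k]].

Definition vanishing_order (R : realType) (F : CC R -> CC R) (x : CC R) (n : nat) :
    Prop :=
  exists u : CC R -> CC R,
    [/\ holo_germ x u, u x != 0 & \forall t \near x, F t = (t - x) ^+ n * u t].

(* [q] is the multiplicity of h^*Z at [x]. As usual for Weil divisors, the pullback
   is defined through local equations: if phi is an equation of kZ near h(x), then
   h^*Z = (1/k) div(phi \o h) near x. One can take k = 1 when [Z] is Cartier at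
   h(x), e.g. if h(x) is a smooth point of [X]. The value [q] does not depend on the
   choices; there is none where no multiple of [Z] is Cartier at h(x), the pullback
   divisor being undefined there. *)
Definition pullback_mult (R : realType) (X : complex_space R) (h : CC R -> X)
    (x : CC R) (Z : set X) (q : rat) : Prop :=
  exists k U phi n,
    [/\ (0 < k)%N, local_equation Z k U phi, U (h x),
        vanishing_order (phi \o h) x n & q = n%:R / k%:R].

(* [None] stands for the multiplicity infinity. *)
Record orbifold (R : realType) (X : complex_space R) := Orbifold {
  component : Type;
  hyp : component -> set X;
  orb_mult : component -> option nat;
  hyp_inj : injective hyp;
  hyp_hypersurface : forall i, irreducible_hypersurface (hyp i);
  hyp_locally_finite : forall x : X, exists2 W, nbhs x W &
    finite_set [set i | hyp i `&` W !=set0];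
  orb_mult_ge2 : forall i m, orb_mult i = Some m -> (2 <= m)%N
}.

Section Orbifold.
Variables (R : realType) (X : complex_space R) (Delta : orbifold X).

Definition weight (i : component Delta) : rat :=
  if orb_mult i is Some m then 1 - m%:R^-1 else 1.

Definition orb_support : set X := \bigcup_i hyp (o := Delta) i.

Definition orb_support1 : set X := \bigcup_(i in [set i | weight i = 1]) hyp i.

Definition compact_orbifold : Prop :=
  compact [set: X] /\ forall i, weight i <> 1.

End Orbifold.

Variant morphism_kind := Nonclassical | Classical.

Definition admissible_mult (c : morphism_kind) (m : nat) (q : rat) : Prop :=
  match c with
  | Nonclassical => m%:R <= q
  | Classical => exists j : nat, q = (j * m)%:R
  end.

Section Morphisms.
Variables (R : realType) (X : complex_space R) (Delta : orbifold X).
Variable c : morphism_kind.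

Definition disc_morphism (h : CC R -> X) : Prop :=
  [/\ holomorphic_on (@unit_disc R) h,
      ~ (h @` (@unit_disc R) `<=` orb_support Delta),
      (forall i m x q, orb_mult (o := Delta) i = Some m -> unit_disc x ->
         hyp i (h x) -> pullback_mult h x (hyp i) q -> admissible_mult c m q) &
      (forall i, orb_mult (o := Delta) i = None ->
         h @` (@unit_disc R) `&` hyp i = set0)].

Definition plane_morphism (f : CC R -> X) : Prop :=
  [/\ holomorphic_on setT f,
      ~ (f @` setT `<=` orb_support Delta) &
      forall g : CC R -> CC R,
        (forall z, unit_disc z -> differentiable g z) ->
        ~ (g @` (@unit_disc R) `<=` f @^-1` orb_support Delta) ->
        disc_morphism (f \o g)].

(* The Poincare distance of curvature -1. *)
Definition poincare (z w : CC R) : R :=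
  let r := complex.Re `|(z - w) / (1 - conjc w * z)| in
  ln ((1 + r) / (1 - r)).

Definition pseudodistance_on (S : set X) (d : X -> X -> R) : Prop :=
  [/\ forall p, S p -> d p p = 0,
      forall p q, S p -> S q -> 0 <= d p q,
      forall p q, S p -> S q -> d p q = d q p &
      forall p q r, S p -> S q -> S r -> d p r <= d p q + d q r].

Definition disc_decreasing (d : X -> X -> R) : Prop :=
  forall h, disc_morphism h -> forall z w, unit_disc z -> unit_disc w ->
    d (h z) (h w) <= poincare z w.

(* The largest pseudodistance is the pointwise supremum, taken in the extended
   reals (it is +oo between points not joined by a chain of discs). Only its
   values on the complement of [orb_support1 Delta] are meaningful. *)
Definition kobayashi (p q : X) : \bar R :=
  ereal_sup [set (d p q)%:E | d in
    [set d | pseudodistance_on (~` orb_support1 Delta) d /\ disc_decreasing d]].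

(* The other axioms of a distance hold for every supremum of pseudodistances. *)
Definition kobayashi_is_distance : Prop :=
  forall p q, ~ orb_support1 Delta p -> ~ orb_support1 Delta q ->
    kobayashi p q = 0%E -> p = q.

End Morphisms.

(* Zariski tangent vectors, as point derivations of the local ring. *)
Definition tangent_vector (R : realType) (X : complex_space R) (x : X)
    (v : (X -> CC R) -> CC R) : Prop :=
  [/\ forall a b, cs_germ x a -> cs_germ x b ->
        (\forall y \near x, a y = b y) -> v a = v b,
      forall a b, cs_germ x a -> cs_germ x b -> v (fun y => a y + b y) = v a + v b,
      forall (l : CC R) a, cs_germ x a -> v (fun y => l * a y) = l * v a &
      forall a b, cs_germ x a -> cs_germ x b ->
        v (fun y => a y * b y) = a x * v b + b x * v a].

(* C^k regularity over the reals, by iterated real directional derivatives. *)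
Fixpoint Ck_on (R : realType) (n : nat) (W : set 'rV[CC R]_n) (k : nat)
    (g : 'rV[CC R]_n -> R) : Prop :=
  (forall w, W w -> {for w, continuous g}) /\
  if k is k'.+1 then
    forall v : 'rV[CC R]_n,
      (forall w, W w -> derivable (fun t : R => g (w + real_complex R t *: v)) 0 1) /\
      Ck_on W k' (fun w => derive1 (fun t : R => g (w + real_complex R t *: v)) 0)
  else True.

Definition smooth_on (R : realType) (n : nat) (W : set 'rV[CC R]_n)
    (g : 'rV[CC R]_n -> CC R) : Prop :=
  forall k, Ck_on W k (fun w => complex.Re (g w)) /\
            Ck_on W k (fun w => complex.Im (g w)).

Definition herm_form (R : realType) (n : nat) (H : 'M[CC R]_n)
    (v : 'I_n -> CC R) : CC R :=
  \sum_i \sum_j H i j * v i * conjc (v j).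

Definition hermitian_metric_on (R : realType) (n : nat)
    (W : set 'rV[CC R]_n) (H : 'rV[CC R]_n -> 'M[CC R]_n) : Prop :=
  [/\ forall i j, smooth_on W (fun w => H w i j),
      forall w i j, W w -> H w i j = conjc (H w j i) &
      forall w v, W w -> (exists i, v i != 0) -> 0 < herm_form (H w) v].

(* The length function of a hermitian metric; locally it is induced from a
   hermitian metric on the ambient space of a local model, the components of the
   image of [v] in C^n being the derivatives [v (phi_i)]. *)
Record hermitian_metric (R : realType) (X : complex_space R) := HermitianMetric {
  hnorm :> X -> ((X -> CC R) -> CC R) -> R;
  hnorm_ge0 : forall x v, tangent_vector x v -> 0 <= hnorm x v;
  hnorm_local : forall p : X, exists U n phi W H,
    [/\ @local_model R X (@cs_germ R X) U n phi W, U p, hermitian_metric_on W H &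
        forall x v, U x -> tangent_vector x v ->
          real_complex R (hnorm x v ^+ 2) =
            herm_form (H (phi x)) (fun i => v (fun y => phi y 0 i))]
}.

(* f'(z) as a point derivation. *)
Definition velocity (R : realType) (X : complex_space R) (f : CC R -> X)
    (z : CC R) : (X -> CC R) -> CC R :=
  fun g => derive1 (g \o f : CC R -> CC R) z.

Definition speed (R : realType) (X : complex_space R) (N : hermitian_metric X)
    (f : CC R -> X) (z : CC R) : R := N (f z) (velocity f z).

(* Main.v *)
Require Import Defs.
From HB Require Import structures.
From mathcomp Require Import all_boot all_order all_algebra complex.
From mathcomp Require Import all_classical all_reals all_analysis.
From mathcomp Require Import ring lra zify.
Import Order.TTheory GRing.Theory Num.Theory.
Import numFieldNormedType.Exports.
Local Open Scope classical_set_scope.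
Local Open Scope ring_scope.

Set Implicit Arguments.
Unset Strict Implicit.
Unset Printing Implicit Defensive.

(** Brody's argument. If the speeds at 0 of the orbifold discs were bounded, then by
    invariance under disc automorphisms a truncated coordinate distance to a given
    point would be decreased by all of them, up to a factor, and the pseudodistance
    would separate points. So there are discs of arbitrarily large speed.
    Reparametrised by a Moebius map centred at a point where (1 - |z|^2) |h'(z)| is
    almost maximal, and rescaled to speed 1 at 0, they converge locally uniformly
    along an ultrafilter (the local distances give equicontinuity, compactness of X
    the pointwise limits) to an entire curve whose speed is maximal, equal to 1, at 0.

    Multiplicities pass to the limit by Hurwitz's theorem: if phi is an equation of
    kZ at f(x), the zeros of phi \o f_n near x are points of Z, their orders add up to
    the order of phi \o f at x, and each of them is at least (resp. divisible by) mk.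
    This needs that phi vanishes on Z, although the divisor of phi is only prescribed
    at points where the ideal of Z is principal. Such points are dense in Z. Indeed,
    choose functions w, as few as possible, immersing Z near some point, and a
    function c that vanishes on Z such that (c, w) isolates that point in X. Z is then
    a graph over w, defined near there by functions z_j that are nilpotent modulo c.
    Take a monomial a in the z_j that is not in (c) while all a z_j = c f_j are. If all
    f_j vanished on Z, Cayley-Hamilton would make a / c integral, contradicting
    normality. So some f_l is a unit at some point of Z, where z_l generates the ideal. *)

(** * One complex variable *)

Section RealNorm.
Variable R : realType.
Local Notation C := (CC R).

(** Three obstacles shape the proof. [X] may be singular and comes without a distance: discs are
    studied through the ambient coordinates of a local model, where a lower bound for the hermitian
    metric controls the derivatives of the coordinates by the speed. Convergence in [X] is expressed
    by neighbourhoods, and one ultrafilter replaces the extraction of a subsequence for each point.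
    The supremum of (1 - |z|^2) |h'(z)| may be infinite or not attained; hence the passage to
    h(z/2), and to points that are maximal up to a factor 1 + eps, with eps tending to 0 along the
    family.

    As for principal points, dimension is only known as the least number of germs that isolate a
    point. The bridge to algebra is the Nullstellensatz for an isolated zero: powers of the
    coordinates lie in the ideal of these germs, so all germs are finite combinations of monomials
    over functions of them, and therefore integral. The analysis behind this rests on Cauchy's
    formula on squares. Its constants are rough; what matters is that they are the same for all
    members of a family. *)

Definition nm (V : normedModType (complex R)) (v : V) : R := complex.Re `|v|.

Section V.
Variable V : normedModType (complex R).
Implicit Types u v : V.

Lemma nmE v : `|v| = real_complex R (nm v).
Proof. by rewrite /nm RRe_real ?normr_real. Qed.

Lemma nm_ge0 v : 0 <= nm v.
Proof. by have := normr_ge0 v; rewrite nmE -[0]/(real_complex R 0) lecR. Qed.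

Lemma nm0 : nm (0 : V) = 0.
Proof. by rewrite /nm normr0. Qed.

Lemma nm_eq0 v : (nm v == 0) = (v == 0).
Proof. by rewrite -(inj_eq (@complexI R)) -nmE rmorph0 normr_eq0. Qed.

Lemma nm_gt0 v : (0 < nm v) = (v != 0).
Proof. by rewrite lt_neqAle nm_ge0 andbT eq_sym nm_eq0. Qed.

Lemma nmD u v : nm (u + v) <= nm u + nm v.
Proof. by rewrite -lecR rmorphD /= -!nmE ler_normD. Qed.

Lemma nmN v : nm (- v) = nm v.
Proof. by rewrite /nm normrN. Qed.

Lemma nmB u v : nm (u - v) <= nm u + nm v.
Proof. by rewrite -(nmN v) nmD. Qed.

Lemma nm_sub u v : nm (u - v) = nm (v - u).
Proof. by rewrite -nmN opprB. Qed.

Lemma nm_tri w u v : nm (u - v) <= nm (u - w) + nm (w - v).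
Proof. by rewrite -[u - v](subrKA w) nmD. Qed.

Lemma nm_subge u v : nm u - nm v <= nm (u - v).
Proof. by rewrite lerBlDr -{1}(subrK v u) nmD. Qed.

Lemma nm_sum (I : Type) (r : seq I) (P : pred I) (F : I -> V) :
  nm (\sum_(i <- r | P i) F i) <= \sum_(i <- r | P i) nm (F i).
Proof.
elim/big_ind2: _ => //; first by rewrite nm0.
by move=> x1 x2 y1 y2 h1 h2; apply: (le_trans (nmD _ _)); apply: lerD.
Qed.

(** The norm of a module over [complex R] is itself an element of [complex R]. With [nm] and this
    lemma all estimates use real radii. *)
Lemma nm_nearP (x : V) (P : set V) :
  (\forall z \near x, P z) <-> exists2 e : R, 0 < e & forall z, nm (z - x) < e -> P z.
Proof.
split.
- case/nbhs_ballP => e /= e0 H; exists (complex.Re e).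
    by move: e0; rewrite ltcE /= => /andP[].
  move=> z zx; apply: H; rewrite -ball_normE /= distrC nmE.
  have {1}-> : e = real_complex R (complex.Re e).
    by rewrite RRe_real // gtr0_real.
  by rewrite ltcR.
- case=> e e0 H; apply/nbhs_ballP; exists (real_complex R e) => /=.
    by rewrite -[0]/(real_complex R 0) ltcR.
  move=> z; rewrite -ball_normE /= distrC nmE ltcR; exact: H.
Qed.

End V.

Lemma nm1 : nm (1 : C) = 1.
Proof. by rewrite /nm normr1. Qed.

Lemma nmM (x y : C) : nm (x * y) = nm x * nm y.
Proof. by apply: (@complexI R); rewrite rmorphM /= -!nmE normrM. Qed.

Lemma nmZ (V : normedModType (complex R)) (l : C) (v : V) : nm (l *: v) = nm l * nm v.
Proof. by apply: (@complexI R); rewrite rmorphM /= -!nmE normrZ. Qed.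

Lemma nmX (x : C) n : nm (x ^+ n) = nm x ^+ n.
Proof. by elim: n => [|n IH]; rewrite ?expr0 ?nm1 // !exprS nmM IH. Qed.

Lemma nmV (x : C) : nm x^-1 = (nm x)^-1.
Proof.
apply: (@complexI R); rewrite -nmE; rewrite (normfV (x : complex R)).
by rewrite fmorphV /= -nmE.
Qed.

Lemma nm_nat n : nm (n%:R : C) = n%:R.
Proof. by rewrite /nm normr_nat /= raddfMn. Qed.

Lemma nm_real (x : R) : nm (real_complex R x : C) = `|x|.
Proof.
by rewrite /nm (normc_def (real_complex R x)) /= expr0n /= addr0 sqrtr_sqr.
Qed.

Lemma nm_Re (z : C) : `|complex.Re z| <= nm z.
Proof. by rewrite -lecR -nmE normc_ge_Re. Qed.

Lemma nm_i : nm ('i%C : C) = 1.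
Proof. by rewrite /nm (normc_def 'i%C) /= expr0n /= add0r expr1n sqrtr1. Qed.

Lemma nm_Im (z : C) : `|complex.Im z| <= nm z.
Proof.
rewrite -normrN -ReiNIm; apply: (le_trans (nm_Re _)).
by rewrite nmM nm_i mulr1.
Qed.

Lemma nm_ReIm (z : C) : nm z <= `|complex.Re z| + `|complex.Im z|.
Proof.
rewrite {1}[z]complexE; apply: (le_trans (nmD _ _)).
by rewrite nmM nm_i mul1r !nm_real.
Qed.

Lemma nm_conj (z : C) : nm (conjc z : C) = nm z.
Proof. by rewrite /nm normcJ. Qed.

Lemma nm_sqr (z : C) : real_complex R (nm z ^+ 2) = z * conjc z.
Proof. by rewrite rmorphXn /= -nmE sqr_normc. Qed.

End RealNorm.

(** * Integrals of continuous functions on segments *)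

Section Integral.
Variable R : realType.
Local Notation C := (CC R).

Definition rint (f : R -> R) (a b : R) : R := \int[lebesgue_measure]_(t in `[a, b]) f t.

(** Continuity relative to the segment, hence one-sided at its ends. *)
Definition ccont (u : R -> C) (a b : R) := forall t, a <= t <= b -> forall e : R, 0 < e ->
  exists2 d : R, 0 < d & forall s, a <= s <= b -> `|s - t| < d -> nm (u s - u t) < e.

Definition rcont (u : R -> R) (a b : R) := forall t, a <= t <= b -> forall e : R, 0 < e ->
  exists2 d : R, 0 < d & forall s, a <= s <= b -> `|s - t| < d -> `|u s - u t| < e.


Lemma rcont_within u a b : rcont u a b -> {within `[a, b], continuous (u : R^o -> R^o)}.
Proof.
move=> cu; apply/subspace_continuousP => t /=; rewrite in_itv /= => tab.
apply/cvgrPdist_lt => e e0; have [d d0 H] := cu t tab e e0.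
rewrite near_withinE; apply/nbhs_ballP; exists d => // s.
rewrite /ball /= => sd sab; rewrite distrC; apply: H; last by rewrite distrC.
by move: sab; rewrite in_itv.
Qed.

Lemma rcont_integrable u a b : rcont u a b ->
  lebesgue_measure.-integrable `[a, b] (EFin \o (u : R -> R)).
Proof.
move=> cu; apply: continuous_compact_integrable; first exact: segment_compact.
exact: rcont_within.
Qed.

Lemma rint_chasles u a b c : a <= b -> b <= c -> rcont u a c ->
  rint u a c = rint u a b + rint u b c.
Proof.
move=> ab bc cu; have iu := rcont_integrable cu.
have := @Rintegral_itvB R u (BLeft a) (BRight c) b iu.
rewrite !bnd_simp => /(_ ab bc) /eqP; rewrite subr_eq => /eqP; rewrite /rint addrC => ->.
congr (_ + _); apply: Rintegral_itv_obnd_cbnd.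
apply: (integrableS _ _ _ iu) => //.
by apply: subset_itv; rewrite !bnd_simp.
Qed.

Lemma rintD u v a b : rcont u a b -> rcont v a b ->
  rint (fun t => u t + v t) a b = rint u a b + rint v a b.
Proof. by move=> cu cv; apply: RintegralD => //; exact: rcont_integrable. Qed.

Lemma rintZ k u a b : rcont u a b -> rint (fun t => k * u t) a b = k * rint u a b.
Proof. by move=> cu; apply: RintegralZl => //; exact: rcont_integrable. Qed.

Lemma rint_cst k a b : a <= b -> rint (fun=> k) a b = k * (b - a).
Proof.
move=> ab; rewrite /rint Rintegral_cst //= lebesgue_measure_itv /=.
case: ifPn => //=; rewrite lte_fin -leNgt => ba.
by have -> : b = a; [lra|rewrite subrr].
Qed.

Lemma rcont_cst k a b : rcont (fun=> k) a b.
Proof. by move=> t _ e e0; exists 1 => // s _ _; rewrite subrr normr0. Qed.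

Lemma rint_le u v a b : rcont u a b -> rcont v a b ->
  (forall t, a <= t <= b -> u t <= v t) -> rint u a b <= rint v a b.
Proof.
move=> cu cv uv; apply: le_Rintegral; rewrite //; try exact: rcont_integrable.
Qed.

Lemma rint_bound u a b M : a <= b -> rcont u a b ->
  (forall t, a <= t <= b -> `|u t| <= M) -> `|rint u a b| <= M * (b - a).
Proof.
move=> ab cu uM; rewrite ler_norml; apply/andP; split.
  rewrite -mulNr -rint_cst //; apply: rint_le => //; first exact: rcont_cst.
  by move=> t /uM; rewrite ler_norml => /andP[].
rewrite -rint_cst //; apply: rint_le => //; first exact: rcont_cst.
by move=> t /uM; rewrite ler_norml => /andP[].
Qed.

Lemma rint_eq u v a b : (forall t, a <= t <= b -> u t = v t) -> rint u a b = rint v a b.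
Proof.
by move=> uv; apply: eq_Rintegral => x; rewrite inE /= in_itv /=; exact: uv.
Qed.

Lemma rint_id a b : a <= b -> rint id a b = (b - a) * ((a + b) / 2).
Proof.
rewrite le_eqVlt => /orP[/eqP<-|ab].
  rewrite subrr mul0r -(mul0r (a-a)); have := @rint_bound id a a `|a| (lexx a).
  rewrite subrr mulr0 normr_le0 mul0r => H; apply/eqP; apply: H.
    by move=> t _ e e0; exists e.
  by move=> t /andP[h1 h2]; have -> : t = a by lra.
rewrite /rint /Rintegral (@continuous_FTC2 R id (fun x => x ^+ 2 / 2)) //=.
- by rewrite !expr2; field.
- by apply: (@rcont_within id) => t _ e e0; exists e.
- split.
  + move=> x _; apply: derivableM; last exact: derivable_cst.
    exact: exprn_derivable.
  + apply: cvg_at_right_filter; apply: cvgMr_tmp; exact: exprn_continuous.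
  + apply: cvg_at_left_filter; apply: cvgMr_tmp; exact: exprn_continuous.
- move=> x _; rewrite derive1E deriveMr // exp_derive /=.
  by rewrite scaler1 expr1 mulrC -[_ *: x]/(2 * x); field.
Qed.

End Integral.

(** * Complex integrals along boundaries of rectangles *)

Section Rectangles.
Variable R : realType.
Local Notation C := (CC R).
Local Notation rc := (real_complex R).
Local Notation "x +i* y" := (@Complex R x y : CC R).
Local Notation i' := ('i%C : CC R).

Implicit Types (u v : R -> C) (f g : C -> C) (a b c x y M : R) (k p q : C).

Definition cint (u : R -> C) (a b : R) : C :=
  rint (fun t => complex.Re (u t)) a b +i* rint (fun t => complex.Im (u t)) a b.

Lemma ccont_Re u a b : ccont u a b -> rcont (fun t => complex.Re (u t)) a b.
Proof.
move=> cu t tab e e0; have [d d0 H] := cu t tab e e0; exists d => // s sab st.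
by apply: le_lt_trans (H s sab st); rewrite -raddfB nm_Re.
Qed.

Lemma ccont_Im u a b : ccont u a b -> rcont (fun t => complex.Im (u t)) a b.
Proof.
move=> cu t tab e e0; have [d d0 H] := cu t tab e e0; exists d => // s sab st.
by apply: le_lt_trans (H s sab st); rewrite -raddfB nm_Im.
Qed.
Hint Resolve ccont_Re ccont_Im : core.

Lemma ccontD u v a b : ccont u a b -> ccont v a b -> ccont (fun t => u t + v t) a b.
Proof.
move=> cu cv t tab e e0.
have [|d d0 H] := cu t tab (e / 2); first by rewrite divr_gt0.
have [|d' d'0 H'] := cv t tab (e / 2); first by rewrite divr_gt0.
exists (Num.min d d'); first by rewrite lt_min d0.
move=> s sab; rewrite lt_min => /andP[h1 h2].
rewrite opprD addrACA; apply: (le_lt_trans (nmD _ _)).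
by have := H s sab h1; have := H' s sab h2; lra.
Qed.

Lemma ccontZ k u a b : ccont u a b -> ccont (fun t => k * u t) a b.
Proof.
move=> cu t tab e e0; have k0 : 0 < nm k + 1 by rewrite ltr_wpDl ?nm_ge0.
have [|d d0 H] := cu t tab (e / (nm k + 1)); first by rewrite divr_gt0.
exists d => // s sab st; rewrite -mulrBr nmM.
have := H s sab st; rewrite ltr_pdivlMr // => h.
apply: le_lt_trans h; rewrite mulrC ler_wpM2l ?nm_ge0 //; lra.
Qed.

Lemma rcontZ (k : R) (u : R -> R) a b : rcont u a b -> rcont (fun t => k * u t) a b.
Proof.
move=> cu t tab e e0; have k0 : 0 < `|k| + 1 by rewrite ltr_wpDl.
have [|d d0 H] := cu t tab (e / (`|k| + 1)); first by rewrite divr_gt0.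
exists d => // s sab st; rewrite -mulrBr normrM.
have := H s sab st; rewrite ltr_pdivlMr // => h.
apply: le_lt_trans h; rewrite mulrC ler_wpM2l //; lra.
Qed.

Lemma cint_chasles u a b c : a <= b -> b <= c -> ccont u a c ->
  cint u a c = cint u a b + cint u b c.
Proof. by move=> ab bc cu; rewrite /cint !(rint_chasles ab bc) //; auto. Qed.

Lemma cintD u v a b : ccont u a b -> ccont v a b ->
  cint (fun t => u t + v t) a b = cint u a b + cint v a b.
Proof.
move=> cu cv; apply/eqP; rewrite eq_complex; apply/andP; split; apply/eqP => /=.
  by rewrite -rintD; auto; apply: rint_eq => t _; rewrite raddfD.
by rewrite -rintD; auto; apply: rint_eq => t _; rewrite raddfD.
Qed.

Lemma ReM (x y : complex R) : complex.Re (x * y) =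
  complex.Re x * complex.Re y - complex.Im x * complex.Im y.
Proof. by case: x; case: y. Qed.

Lemma ImM (x y : complex R) : complex.Im (x * y) =
  complex.Re x * complex.Im y + complex.Im x * complex.Re y.
Proof. by case: x => a b; case: y. Qed.

Lemma cintZ k u a b : ccont u a b -> cint (fun t => k * u t) a b = k * cint u a b.
Proof.
move=> cu; have cR := ccont_Re cu; have cI := ccont_Im cu.
apply/eqP; rewrite eq_complex; apply/andP; split; apply/eqP => /=.
  rewrite ReM /= -mulNr -!rintZ // -rintD; [|exact: rcontZ..].
  by apply: rint_eq => t _; rewrite ReM mulNr.
rewrite ImM /= -!rintZ // -rintD; [|exact: rcontZ..].
by apply: rint_eq => t _; rewrite ImM.
Qed.

Lemma cint_eq u v a b : (forall t, a <= t <= b -> u t = v t) -> cint u a b = cint v a b.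
Proof. by move=> uv; congr Complex; apply: rint_eq => t tab; rewrite uv. Qed.

(** The factor 2 comes from bounding the real and imaginary parts separately. *)
Lemma cint_bound u a b M : a <= b -> ccont u a b ->
  (forall t, a <= t <= b -> nm (u t) <= M) -> nm (cint u a b) <= 2 * M * (b - a).
Proof.
move=> ab cu uM; apply: (le_trans (nm_ReIm _)) => /=.
rewrite -mulrA mulr_natl mulr2n; apply: lerD; apply: rint_bound; auto => t tab.
  exact: (le_trans (nm_Re _) (uM t tab)).
exact: (le_trans (nm_Im _) (uM t tab)).
Qed.

Lemma ccont_cst k a b : ccont (fun=> k) a b.
Proof. by move=> t _ e e0; exists 1 => // s _ _; rewrite subrr nm0. Qed.

Lemma ccont_id a b : ccont (fun t => rc t) a b.
Proof. by move=> t _ e e0; exists e => // s _; rewrite -rmorphB nm_real. Qed.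

Lemma cint_id a b : a <= b -> cint (fun t => rc t) a b = rc ((b - a) * ((a + b) / 2)).
Proof.
by move=> ab; rewrite /cint /= rint_id // rint_cst // mul0r.
Qed.

Lemma cint_cst k a b : a <= b -> cint (fun=> k) a b = k * rc (b - a).
Proof.
move=> ab; rewrite -{1}[k]mulr1 cintZ; last exact: ccont_cst.
by rewrite /cint /= !rint_cst // mul1r mul0r.
Qed.

Lemma cint_affine p q a b : a <= b ->
  cint (fun t => p * rc t + q) a b = rc (b - a) * (p * rc ((a + b) / 2) + q).
Proof.
move=> ab; rewrite cintD; [|apply: ccontZ; exact: ccont_id|exact: ccont_cst].
rewrite cintZ; last exact: ccont_id.
by rewrite cint_id // cint_cst // rmorphM; ring.
Qed.

(** The integral of f dz along the boundary, counterclockwise: bottom minus top, plus i times right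
    minus left. *)
Definition bd (f : C -> C) x1 x2 y1 y2 : C :=
  cint (fun t => f (t +i* y1)) x1 x2 - cint (fun t => f (t +i* y2)) x1 x2
  + i' * (cint (fun t => f (x2 +i* t)) y1 y2 - cint (fun t => f (x1 +i* t)) y1 y2).

Definition bcont (f : C -> C) x1 x2 y1 y2 :=
  [/\ ccont (fun t => f (t +i* y1)) x1 x2, ccont (fun t => f (t +i* y2)) x1 x2,
      ccont (fun t => f (x2 +i* t)) y1 y2 & ccont (fun t => f (x1 +i* t)) y1 y2].

Definition onrect x1 x2 y1 y2 (z : C) :=
  (x1 <= complex.Re z <= x2) /\ (y1 <= complex.Im z <= y2).

Lemma ccontH f y a b : (forall t, a <= t <= b -> {for (t +i* y), continuous f}) ->
  ccont (fun t => f (t +i* y)) a b.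
Proof.
move=> cf t tab e e0; have := cf t tab.
move=> /(_ _ ((nm_nearP (f (t +i* y)) [set z | nm (z - f (t +i* y)) < e]).2 _)) /=.
case/(_ _)/nm_nearP => [|d d0 H]; first by exists e.
exists d => // s _ st; apply: H.
have -> : s +i* y - t +i* y = rc (s - t) by apply/eqP; rewrite eq_complex /= subrr !eqxx.
by rewrite nm_real.
Qed.

Lemma ccontV f x a b : (forall t, a <= t <= b -> {for (x +i* t), continuous f}) ->
  ccont (fun t => f (x +i* t)) a b.
Proof.
move=> cf t tab e e0; have := cf t tab.
move=> /(_ _ ((nm_nearP (f (x +i* t)) [set z | nm (z - f (x +i* t)) < e]).2 _)) /=.
case/(_ _)/nm_nearP => [|d d0 H]; first by exists e.
exists d => // s _ st; apply: H.
have -> : x +i* s - x +i* t = i' * rc (s - t).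
  by apply/eqP; rewrite eq_complex ReM ImM /= subrr; apply/andP; split; apply/eqP; ring.
by rewrite nmM nm_i mul1r nm_real.
Qed.

Lemma bcont_onrect f x1 x2 y1 y2 : x1 <= x2 -> y1 <= y2 ->
  (forall z, onrect x1 x2 y1 y2 z -> {for z, continuous f}) -> bcont f x1 x2 y1 y2.
Proof.
move=> hx hy cf; split.
- by apply: ccontH => t tab; apply: cf; split; rewrite //= lexx.
- by apply: ccontH => t tab; apply: cf; split; rewrite //= lexx hy.
- by apply: ccontV => t tab; apply: cf; split; rewrite //= lexx hx.
- by apply: ccontV => t tab; apply: cf; split; rewrite //= lexx hx.
Qed.

Lemma bdD f g x1 x2 y1 y2 : bcont f x1 x2 y1 y2 -> bcont g x1 x2 y1 y2 ->
  bd (fun z => f z + g z) x1 x2 y1 y2 = bd f x1 x2 y1 y2 + bd g x1 x2 y1 y2.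
Proof.
by move=> [f1 f2 f3 f4] [g1 g2 g3 g4]; rewrite /bd !cintD //; ring.
Qed.

Lemma bdZ k f x1 x2 y1 y2 : bcont f x1 x2 y1 y2 ->
  bd (fun z => k * f z) x1 x2 y1 y2 = k * bd f x1 x2 y1 y2.
Proof. by move=> [f1 f2 f3 f4]; rewrite /bd !cintZ //; ring. Qed.

Lemma bcontD f g x1 x2 y1 y2 : bcont f x1 x2 y1 y2 -> bcont g x1 x2 y1 y2 ->
  bcont (fun z => f z + g z) x1 x2 y1 y2.
Proof. by move=> [f1 f2 f3 f4] [g1 g2 g3 g4]; split; apply: ccontD. Qed.

Lemma bd_bound f x1 x2 y1 y2 M : x1 <= x2 -> y1 <= y2 -> bcont f x1 x2 y1 y2 ->
  (forall z, onrect x1 x2 y1 y2 z ->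
     [\/ complex.Im z = y1, complex.Im z = y2, complex.Re z = x1 | complex.Re z = x2] ->
     nm (f z) <= M) ->
  nm (bd f x1 x2 y1 y2) <= 4 * M * ((x2 - x1) + (y2 - y1)).
Proof.
move=> hx hy [f1 f2 f3 f4] fM.
apply: (le_trans (nmD _ _)); rewrite nmM nm_i mul1r.
apply: (le_trans (lerD (nmB _ _) (nmB _ _))).
have b1 : nm (cint (fun t => f (t +i* y1)) x1 x2) <= 2 * M * (x2 - x1).
  apply: cint_bound => // t t12; apply: fM; last by constructor.
  by split => //=; rewrite lexx hy.
have b2 : nm (cint (fun t => f (t +i* y2)) x1 x2) <= 2 * M * (x2 - x1).
  apply: cint_bound => // t t12; apply: fM; last by constructor 2.
  by split => //=; rewrite lexx hy.
have b3 : nm (cint (fun t => f (x2 +i* t)) y1 y2) <= 2 * M * (y2 - y1).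
  apply: cint_bound => // t t12; apply: fM; last by constructor 4.
  by split => //=; rewrite lexx hx.
have b4 : nm (cint (fun t => f (x1 +i* t)) y1 y2) <= 2 * M * (y2 - y1).
  apply: cint_bound => // t t12; apply: fM; last by constructor 3.
  by split => //=; rewrite lexx hx.
lra.
Qed.

(** Computed outright. It allows the first order part of a function to be subtracted in Goursat's
    lemma. *)
Lemma bd_affine p q x1 x2 y1 y2 : x1 <= x2 -> y1 <= y2 ->
  bd (fun z => p * z + q) x1 x2 y1 y2 = 0.
Proof.
move=> hx hy; rewrite /bd.
have hE x y : x +i* y = rc x + i' * rc y by exact: complexE.
have H y : cint (fun t => p * (t +i* y) + q) x1 x2 =
    rc (x2 - x1) * (p * rc ((x1 + x2) / 2) + (p * (i' * rc y) + q)).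
  by rewrite -cint_affine //; apply: cint_eq => t _; rewrite hE; ring.
have V x : cint (fun t => p * (x +i* t) + q) y1 y2 =
    rc (y2 - y1) * ((p * i') * rc ((y1 + y2) / 2) + (p * rc x + q)).
  by rewrite -cint_affine //; apply: cint_eq => t _; rewrite hE; ring.
rewrite !H !V !rmorphB /=.
have -> : i' * (((rc y2 - rc y1) * (p * i' * rc ((y1 + y2) / 2) + (p * rc x2 + q)))
  - ((rc y2 - rc y1) * (p * i' * rc ((y1 + y2) / 2) + (p * rc x1 + q)))) =
  i' * (rc y2 - rc y1) * p * (rc x2 - rc x1) by ring.
ring.
Qed.

Lemma bd_cutV f x1 x x2 y1 y2 : x1 <= x -> x <= x2 -> bcont f x1 x2 y1 y2 ->
  bd f x1 x2 y1 y2 = bd f x1 x y1 y2 + bd f x x2 y1 y2.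
Proof.
move=> h1 h2 [f1 f2 f3 f4]; rewrite /bd.
by rewrite (cint_chasles h1 h2 f1) (cint_chasles h1 h2 f2); ring.
Qed.

Lemma bd_cutH f x1 x2 y1 y y2 : y1 <= y -> y <= y2 -> bcont f x1 x2 y1 y2 ->
  bd f x1 x2 y1 y2 = bd f x1 x2 y1 y + bd f x1 x2 y y2.
Proof.
move=> h1 h2 [f1 f2 f3 f4]; rewrite /bd.
by rewrite (cint_chasles h1 h2 f3) (cint_chasles h1 h2 f4); ring.
Qed.

End Rectangles.

(** * Complex differentiability in epsilon form *)

Section Differentiability.
Variable R : realType.
Local Notation C := (CC R).
Local Notation rc := (real_complex R).
Implicit Types V W : normedModType (complex R).

Lemma diff_eps V W (F : V -> W) x : differentiable F x -> forall e : R, 0 < e ->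
  exists2 d : R, 0 < d & forall h, nm h < d -> nm (F (x + h) - F x - 'd F x h) <= e * nm h.
Proof.
move=> dF e e0; have /diff_locallyP[_ /eqaddoP H] := dF.
have e0' : 0 < rc e by rewrite -[0]/(rc 0) ltcR.
have /nm_nearP[d d0 Hd] := H _ e0'; exists d => // h hd.
have := Hd h; rewrite subr0 => /(_ hd).
rewrite !nmE -rmorphM lecR /= /cst /shift /=.
by rewrite -[(_ - _) h]/(_ - _) /= opprD addrA [h + x]addrC.
Qed.

(** The bound [K] makes the linear map continuous, as [differentiable] demands of a differential. *)
Lemma eps_diff V W (F : V -> W) x (L : {linear V -> W}) (K : R) :
  (forall h, nm (L h) <= K * nm h) ->
  (forall e : R, 0 < e -> exists2 d : R, 0 < d &
     forall h, nm h < d -> nm (F (x + h) - F x - L h) <= e * nm h) ->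
  differentiable F x /\ 'd F x = L :> (V -> W).
Proof.
move=> LK H.
have cL : continuous L.
  apply/linear_bounded_continuous/linear_boundedP; near=> r => h.
  have rK : rc K <= r by near: r; apply: nbhs_pinfty_ge; rewrite realE !lecE /= !eqxx /= le_total.
  apply: (@le_trans _ _ (rc K * `|h|)); last by rewrite ler_wpM2r.
  by rewrite !nmE -rmorphM lecR.
have E : F \o shift x = cst (F x) + L +o_ 0 id.
  apply/eqaddoP => e e0.
  have eE : e = rc (complex.Re e) by rewrite RRe_real // gtr0_real.
  rewrite eE; have [|d d0 Hd] := H (complex.Re e); first by rewrite -ltcR -eE.
  apply/nm_nearP; exists d => // h; rewrite subr0 => /Hd.
  rewrite !nmE -rmorphM lecR /= /cst /shift /=.
  by rewrite -[X in _ -> nm X <= _]/(_ - _) /= opprD addrA [h + x]addrC.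
have dE := diff_unique cL E; split => //.
by apply/diff_locallyP; rewrite dE.
Unshelve. all: by end_near. Qed.

Lemma diffC1 (f : C -> C) z : forall h, 'd f z h = h * 'd f z 1.
Proof. by move=> h; rewrite -{1}[h]mulr1 -[h * 1]/(h *: (1 : C)) linearZ. Qed.

Lemma derive1_diff (f : C -> C) z : differentiable f z -> derive1 f z = 'd f z 1.
Proof. by move=> df; rewrite derive1E deriveE. Qed.

Lemma C_eps (f : C -> C) z : differentiable f z -> forall e : R, 0 < e ->
  exists2 d : R, 0 < d & forall w, nm (w - z) < d ->
    nm (f w - f z - (w - z) * derive1 f z) <= e * nm (w - z).
Proof.
move=> df e e0; have [d d0 H] := diff_eps df e0; exists d => // w wd.
by have := H _ wd; rewrite [z + _]addrC subrK diffC1 derive1_diff.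
Qed.

Lemma eps_C (f : C -> C) z (a : C) :
  (forall e : R, 0 < e -> exists2 d : R, 0 < d & forall w, nm (w - z) < d ->
    nm (f w - f z - (w - z) * a) <= e * nm (w - z)) ->
  differentiable f z /\ derive1 f z = a.
Proof.
move=> H; pose L : {linear C -> C} := GRing.scale a.
have [|e e0|df dE] := @eps_diff _ _ f z L (nm a).
- by move=> h; rewrite /L /= nmZ.
- have [d d0 Hd] := H e e0; exists d => // h hd.
  have := Hd (z + h); rewrite addrAC subrr add0r => /(_ hd).
  by rewrite /L /= -[a *: h]/(a * h) [h * a]mulrC.
by split=> //; rewrite derive1_diff // dE /L /= -[a *: _]/(a * _) mulr1.
Qed.

Lemma df_cst V (a : C) (x : V) : differentiable (fun _ : V => a : C) x.
Proof. exact: differentiable_cst. Qed.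

Lemma df_id (x : C) : differentiable (fun t : C => t) x.
Proof. exact: (ex_diff (is_diff_def := is_diff_id x)). Qed.

Lemma dfD V (f g : V -> C) x : differentiable f x -> differentiable g x ->
  differentiable (fun t => f t + g t : C) x.
Proof. exact: differentiableD. Qed.

Lemma dfN V (f : V -> C) x : differentiable f x -> differentiable (fun t => - f t : C) x.
Proof. exact: differentiableN. Qed.

Lemma dfB V (f g : V -> C) x : differentiable f x -> differentiable g x ->
  differentiable (fun t => f t - g t : C) x.
Proof. exact: differentiableB. Qed.

Lemma dfM V (f g : V -> C) x : differentiable f x -> differentiable g x ->
  differentiable (fun t => f t * g t : C) x.
Proof. exact: (@differentiableM _ V f g x). Qed.

Lemma dfX V (f : V -> C) n x : differentiable f x -> differentiable (fun t => f t ^+ n : C) x.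
Proof.
elim: n => [|n IH] df; first exact: differentiable_cst.
by under eq_fun do rewrite exprS; apply: dfM => //; exact: IH.
Qed.

Lemma dfV V (f : V -> C) x : differentiable f x -> f x != 0 ->
  differentiable (fun t => (f t)^-1 : C) x.
Proof. exact: (@differentiableV _ V f x). Qed.

Lemma df_sum V I (r : seq I) (P : pred I) (f : I -> V -> C) x :
  (forall i, P i -> differentiable (f i) x) ->
  differentiable (fun t => \sum_(i <- r | P i) f i t : C) x.
Proof.
move=> df; elim: r => [|i r IH].
  by under eq_fun do rewrite big_nil; exact: differentiable_cst.
under eq_fun do rewrite big_cons.
by case Pi: (P i); [apply: dfD; [exact: df|exact: IH]|exact: IH].
Qed.

Lemma df_comp V W (f : V -> W) (g : W -> C) x :
  differentiable f x -> differentiable g (f x) -> differentiable (fun t => g (f t)) x.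
Proof. by move=> df dg; exact: differentiable_comp. Qed.

Lemma df_near V (f g : V -> C) x :
  (\forall t \near x, f t = g t) -> differentiable f x -> differentiable g x.
Proof.
move=> /nm_nearP[r r0 fg] df.
have fgx : f x = g x by apply: fg; rewrite subrr nm0.
have bL : exists K : R, forall h, nm ('d f x h : C) <= K * nm h.
  have /linear_bounded_continuous/linear_boundedP[K [Kr HK]] := diff_continuous df.
  have K1 : K < rc (complex.Re K + 1) by rewrite -{1}(RRe_real Kr) ltcR ltrDl.
  exists (complex.Re K + 1) => h.
  by rewrite -lecR rmorphM /= -!nmE; exact: HK.
have [K HK] := bL; apply: (proj1 (eps_diff HK _)) => e e0.
have [d d0 Hd] := diff_eps df e0.
exists (Num.min d r); first by rewrite lt_min d0.
move=> h; rewrite lt_min => /andP[hd hr]; rewrite -fgx -fg; first exact: Hd.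
by rewrite addrAC subrr add0r.
Qed.

End Differentiability.

(** * Goursat's lemma on rectangles *)

Section Goursat.
Variable R : realType.
Local Notation C := (CC R).
Local Notation rc := (real_complex R).
Local Notation "x +i* y" := (@Complex R x y : CC R).
Local Notation i' := ('i%C : CC R).
Implicit Types (f g : C -> C) (x y s : R).

(** Nested rectangles: if [P] failed, it would fail on a quarter, on a quarter of that, and so on;
    the quarters shrink to a point, near which [P] holds. [P x y s] speaks of the rectangle with
    lower left corner (x, y) and sides s w and s h. *)
Lemma rect_bisect (w h x0 y0 : R) (P : R -> R -> R -> Prop) : 0 < w -> 0 < h ->
  (forall x y s, 0 < s -> P x y (s / 2) -> P (x + s / 2 * w) y (s / 2) ->
     P x (y + s / 2 * h) (s / 2) -> P (x + s / 2 * w) (y + s / 2 * h) (s / 2) -> P x y s) ->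
  (forall x y, x0 <= x <= x0 + w -> y0 <= y <= y0 + h ->
     exists2 d : R, 0 < d & forall x' y' s, 0 < s < d -> x' <= x <= x' + s * w ->
       y' <= y <= y' + s * h -> P x' y' s) ->
  P x0 y0 1.
Proof.
move=> w0 h0 Hq Hl; apply/not_notP => nP.
(* [q] is the corner of a bad quarter of the bad rectangle with corner [p]. *)
pose Q (s : R) (p q : R * R) := [/\ ~ P q.1 q.2 (s / 2),
  p.1 <= q.1 <= p.1 + s / 2 * w & p.2 <= q.2 <= p.2 + s / 2 * h].
have step (s : R) (p : R * R) : exists q, 0 < s -> ~ P p.1 p.2 s -> Q s p q.
  have [s0|s0] := ltP 0 s; last by exists p; lra.
  have [nPp|] := pselect (~ P p.1 p.2 s); last by exists p.
  have sw : 0 < s / 2 * w by rewrite mulr_gt0 // divr_gt0.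
  have sh : 0 < s / 2 * h by rewrite mulr_gt0 // divr_gt0.
  apply/not_notP => /forallNP nq; apply: nPp; apply: Hq => //; apply/not_notP => H.
  - by apply: (nq (p.1, p.2)) => _ _; split => //=; lra.
  - by apply: (nq (p.1 + s / 2 * w, p.2)) => _ _; split => //=; lra.
  - by apply: (nq (p.1, p.2 + s / 2 * h)) => _ _; split => //=; lra.
  - by apply: (nq (p.1 + s / 2 * w, p.2 + s / 2 * h)) => _ _; split => //=; lra.
pose nx s p := projT1 (cid (step s p)).
pose sq := fix sq n : R * R := if n is n'.+1 then nx (2 ^- n') (sq n') else (x0, y0).
have s0 n : 0 < 2 ^- n :> R by rewrite invr_gt0 exprn_gt0.
have sS n : 2 ^- n.+1 = 2 ^- n / 2 :> R by rewrite exprS invfM mulrC.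
have sP n : ~ P (sq n).1 (sq n).2 (2 ^- n).
  elim: n => [|n IH]; first by rewrite expr0 invr1.
  rewrite sS; rewrite /= -/sq /nx; case: cid => q /= Hqq.
  by have [] := Hqq (s0 n) IH.
have sQ n : Q (2 ^- n) (sq n) (sq n.+1).
  by rewrite /= -/sq /nx; case: cid => q /= Hqq; apply: Hqq.
(* The corners move right and up by at most half of the current side, so they increase to a supremum
   that lies in every nested rectangle. *)
have mono (u : nat -> R) (k : R) : 0 < k ->
    (forall n, u n <= u n.+1 <= u n + 2 ^- n / 2 * k) ->
    exists X, forall n, u n <= X <= u n + 2 ^- n * k.
  move=> k0 Hu.
  have up n m : u n <= u (n + m)%N <= u n + 2 ^- n * k - 2 ^- (n + m) * k.
    elim: m => [|m IH]; first by rewrite addn0; lra.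
    by rewrite addnS sS; have := Hu (n + m)%N; move: IH; lra.
  have ub n m : u m <= u n + 2 ^- n * k.
    have hn := mulr_gt0 (s0 n) k0; have hm := mulr_gt0 (s0 m) k0.
    have [nm|mn] := leqP n m.
      have := up n (m - n)%N; rewrite subnKC //; lra.
    have := up m (n - m)%N; rewrite subnKC; [lra|exact: ltnW].
  have hs : has_sup [set u n | n in [set: nat]].
    split; first by exists (u 0%N), 0%N.
    by exists (u 0%N + 2 ^- 0 * k) => _ [m _ <-]; exact: ub.
  exists (sup [set u n | n in [set: nat]]) => n; apply/andP; split.
    by apply: ub_le_sup; [exact: hs.2|exists n].
  by apply: ge_sup; [exact: hs.1|move=> _ [m _ <-]; exact: ub].
have [X HX] := mono (fun n => (sq n).1) w w0 (fun n => let: And3 _ b _ := sQ n in b).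
have [Y HY] := mono (fun n => (sq n).2) h h0 (fun n => let: And3 _ _ b := sQ n in b).
have [||d d0 Hd] := Hl X Y.
- by have := HX 0%N; rewrite expr0 invr1 mul1r.
- by have := HY 0%N; rewrite expr0 invr1 mul1r.
have [n hn] : exists n, 2 ^- n < d :> R.
  exists (Num.truncn d^-1).+1; rewrite -[ltRHS]invrK ltf_pV2 ?posrE ?exprn_gt0 ?invr_gt0 //.
  apply: (lt_trans (truncnS_gt _)); rewrite -natrX ltr_nat; exact: ltn_expl.
by apply: (sP n); apply: Hd => //; rewrite s0.
Qed.

Lemma bisect_goursat f x1 x2 y1 y2 : x1 < x2 -> y1 < y2 ->
  (forall z, onrect x1 x2 y1 y2 z -> differentiable f z) -> bd f x1 x2 y1 y2 = 0.
Proof.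
move=> hx hy; pose w := x2 - x1; pose h := y2 - y1.
have w0 : 0 < w by rewrite subr_gt0.
have h0 : 0 < h by rewrite subr_gt0.
have [wE hE] : x2 = x1 + w /\ y2 = y1 + h by rewrite /w /h !subrKC.
clearbody w h; subst x2 y2 => df.
have cf z : onrect x1 (x1 + w) y1 (y1 + h) z -> {for z, continuous f}.
  by move=> /df; exact: differentiable_continuous.
apply/eqP; rewrite -nm_eq0 eq_le nm_ge0 andbT; apply/ler_addgt0Pr => e e0; rewrite add0r.
(* The bound e s^2 is additive under quartering, since 4 (s / 2)^2 = s^2. *)
pose P x y s := x1 <= x -> x + s * w <= x1 + w -> y1 <= y -> y + s * h <= y1 + h ->
  nm (bd f x (x + s * w) y (y + s * h)) <= e * s ^+ 2.
have : P x1 y1 1; last first.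
  by rewrite /P !mul1r expr1n mulr1; apply.
apply: (@rect_bisect w h) => //.
- move=> x y s s0 A1 A2 A3 A4 B1 B2 B3 B4.
  have sw : 0 < s / 2 * w by rewrite mulr_gt0 // divr_gt0.
  have sh : 0 < s / 2 * h by rewrite mulr_gt0 // divr_gt0.
  have ew : s * w = s / 2 * w + s / 2 * w by field.
  have eh : s * h = s / 2 * h + s / 2 * h by field.
  have bc p q u v : x1 <= p -> p <= q -> q <= x1 + w -> y1 <= u -> u <= v -> v <= y1 + h ->
      bcont f p q u v.
    move=> a1 a2 a3 a4 a5 a6; apply: bcont_onrect => // z [/andP[c1 c2] /andP[c3 c4]].
    by apply: cf; split; apply/andP; split; clear - a1 a2 a3 a4 a5 a6 c1 c2 c3 c4; lra.
  rewrite (@bd_cutV _ f x (x + s / 2 * w)); [|clear - sw sh ew eh B1 B2 B3 B4; lra|clear - sw sh ew eh B1 B2 B3 B4; lra|by apply: bc; clear - sw sh ew eh B1 B2 B3 B4; lra].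
  rewrite (@bd_cutH _ f x _ y (y + s / 2 * h)); [|clear - sw sh ew eh B1 B2 B3 B4; lra|clear - sw sh ew eh B1 B2 B3 B4; lra|by apply: bc; clear - sw sh ew eh B1 B2 B3 B4; lra].
  rewrite (@bd_cutH _ f (x + s / 2 * w) _ y (y + s / 2 * h)); [|clear - sw sh ew eh B1 B2 B3 B4; lra|clear - sw sh ew eh B1 B2 B3 B4; lra|by apply: bc; clear - sw sh ew eh B1 B2 B3 B4; lra].
  rewrite ew eh (addrA x (s / 2 * w)) (addrA y (s / 2 * h)).
  have := A1 ltac:(clear - sw sh ew eh B1 B2 B3 B4; lra) ltac:(clear - sw sh ew eh B1 B2 B3 B4; lra) ltac:(clear - sw sh ew eh B1 B2 B3 B4; lra) ltac:(clear - sw sh ew eh B1 B2 B3 B4; lra).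
  have := A2 ltac:(clear - sw sh ew eh B1 B2 B3 B4; lra) ltac:(clear - sw sh ew eh B1 B2 B3 B4; lra) ltac:(clear - sw sh ew eh B1 B2 B3 B4; lra) ltac:(clear - sw sh ew eh B1 B2 B3 B4; lra).
  have := A3 ltac:(clear - sw sh ew eh B1 B2 B3 B4; lra) ltac:(clear - sw sh ew eh B1 B2 B3 B4; lra) ltac:(clear - sw sh ew eh B1 B2 B3 B4; lra) ltac:(clear - sw sh ew eh B1 B2 B3 B4; lra).
  have := A4 ltac:(clear - sw sh ew eh B1 B2 B3 B4; lra) ltac:(clear - sw sh ew eh B1 B2 B3 B4; lra) ltac:(clear - sw sh ew eh B1 B2 B3 B4; lra) ltac:(clear - sw sh ew eh B1 B2 B3 B4; lra).
  move=> C4 C3 C2 C1.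
  apply: (le_trans (nmD _ _)).
  apply: (le_trans (lerD (nmD (bd _ _ _ _ _) _) (nmD (bd _ _ _ _ _) _))).
  have -> : e * s ^+ 2 = 4 * (e * (s / 2) ^+ 2) by field.
  by apply: (le_trans (lerD (lerD C1 C3) (lerD C2 C4))); rewrite le_eqVlt; apply/orP; left; apply/eqP; ring.
move=> x y xx yy.
pose z := x +i* y; have zr : onrect x1 (x1 + w) y1 (y1 + h) z by [].
have L0 : 0 < 4 * (w + h) ^+ 2 by rewrite mulr_gt0 // exprn_gt0 // addr_gt0.
(* The remainder is at most this constant times s (w + h) on the boundary, and [bd_bound]
   contributes 4 s (w + h); the product is e s^2. *)
have [|d d0 Hd] := C_eps (df _ zr) (e := e / (4 * (w + h) ^+ 2)); first by rewrite divr_gt0.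
exists (d / (w + h)); first by rewrite divr_gt0 // addr_gt0.
move=> p q s /andP[s0]; rewrite ltr_pdivlMr ?addr_gt0 // => sd px qy B1 B2 B3 B4.
have sw : 0 < s * w by rewrite mulr_gt0.
have sh : 0 < s * h by rewrite mulr_gt0.
(* Subtracting the affine part of [f] at [z] does not change the boundary integral, by
   [bd_affine]. *)
pose g (u : C) : C := f u - f z - (u - z) * derive1 f z.
have sub u : onrect p (p + s * w) q (q + s * h) u -> onrect x1 (x1 + w) y1 (y1 + h) u.
  by case=> /andP[a1 a2] /andP[a3 a4]; split; apply/andP; split; clear - a1 a2 a3 a4 B1 B2 B3 B4; lra.
have pw : p <= p + s * w by rewrite lerDl ltW.
have qh : q <= q + s * h by rewrite lerDl ltW.
have bf : bcont f p (p + s * w) q (q + s * h).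
  by apply: (bcont_onrect pw qh) => u /sub /cf.
have cA a b u : {for u, continuous (fun t : C => a * t + b)}.
  apply: differentiable_continuous; apply: dfD; last exact: df_cst.
  by apply: dfM; [exact: df_cst|exact: df_id].
have bA a b : bcont (fun t : C => a * t + b) p (p + s * w) q (q + s * h).
  by apply: (bcont_onrect pw qh) => u _; exact: cA.
have gE : g = fun u => f u + ((- derive1 f z) * u + (z * derive1 f z - f z)).
  by apply/funext => u; rewrite /g; ring.
have -> : bd f p (p + s * w) q (q + s * h) = bd g p (p + s * w) q (q + s * h).
  by rewrite gE (bdD bf (bA _ _)) (bd_affine _ _ pw qh) addr0.
have bg : bcont g p (p + s * w) q (q + s * h) by rewrite gE; apply: bcontD.
apply: (le_trans (@bd_bound _ _ _ _ _ _ (e / (4 * (w + h) ^+ 2) * (s * (w + h))) pw qh bg _)); last first.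
  have -> : p + s * w - p + (q + s * h - q) = s * (w + h) by ring.
  rewrite le_eqVlt; apply/orP; left; apply/eqP; field.
  by rewrite gt_eqF // addr_gt0.
move=> u [/andP[a1 a2] /andP[a3 a4]] _.
have uz : nm (u - z) <= s * (w + h).
  apply: (le_trans (nm_ReIm _)); rewrite !raddfB /= mulrDr; apply: lerD.
    by rewrite ler_norml; clear - a1 a2 px; lra.
  by rewrite ler_norml; clear - a3 a4 qy; lra.
apply: (le_trans (Hd u (le_lt_trans uz sd))).
by rewrite ler_wpM2l // divr_ge0 // ltW.
Qed.

End Goursat.

(** * Cauchy's formula on squares and Taylor bounds *)

Section CauchyFormula.
Variable R : realType.
Local Notation C := (CC R).
Local Notation rc := (real_complex R).
Local Notation "x +i* y" := (@Complex R x y : CC R).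
Local Notation i' := ('i%C : CC R).
Implicit Types (f g : C -> C) (x y s r M : R) (z c w : C).

Definition onbd x1 x2 y1 y2 z := onrect x1 x2 y1 y2 z /\
  [\/ complex.Im z = y1, complex.Im z = y2, complex.Re z = x1 | complex.Re z = x2].

Lemma bcont_bd f x1 x2 y1 y2 : x1 <= x2 -> y1 <= y2 ->
  (forall z, onbd x1 x2 y1 y2 z -> {for z, continuous f}) -> bcont f x1 x2 y1 y2.
Proof.
move=> hx hy cf; split.
- by apply: ccontH => t tab; apply: cf; split; [split; rewrite //= lexx|constructor 1].
- by apply: ccontH => t tab; apply: cf; split; [split; rewrite //= lexx hy|constructor 2].
- by apply: ccontV => t tab; apply: cf; split; [split; rewrite //= lexx hx|constructor 4].
- by apply: ccontV => t tab; apply: cf; split; [split; rewrite //= lexx hx|constructor 3].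
Qed.

Lemma bd_eq f g x1 x2 y1 y2 : x1 <= x2 -> y1 <= y2 ->
  (forall z, onbd x1 x2 y1 y2 z -> f z = g z) -> bd f x1 x2 y1 y2 = bd g x1 x2 y1 y2.
Proof.
move=> hx hy fg.
have fg1 t : x1 <= t <= x2 -> f (t +i* y1) = g (t +i* y1).
  by move=> tab; apply: fg; split; [split; rewrite //= lexx|constructor 1].
have fg2 t : x1 <= t <= x2 -> f (t +i* y2) = g (t +i* y2).
  by move=> tab; apply: fg; split; [split; rewrite //= lexx hy|constructor 2].
have fg3 t : y1 <= t <= y2 -> f (x2 +i* t) = g (x2 +i* t).
  by move=> tab; apply: fg; split; [split; rewrite //= lexx hx|constructor 4].
have fg4 t : y1 <= t <= y2 -> f (x1 +i* t) = g (x1 +i* t).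
  by move=> tab; apply: fg; split; [split; rewrite //= lexx hx|constructor 3].
by rewrite /bd (cint_eq fg1) (cint_eq fg2) (cint_eq fg3) (cint_eq fg4).
Qed.

(** Two vertical and two horizontal cuts leave the hole and four rectangles to which Goursat's lemma
    applies. *)
Lemma bd_hole f x1 x2 y1 y2 a1 a2 b1 b2 : x1 < a1 -> a1 < a2 -> a2 < x2 ->
  y1 < b1 -> b1 < b2 -> b2 < y2 ->
  (forall z, onrect x1 x2 y1 y2 z ->
     ~ (a1 < complex.Re z < a2 /\ b1 < complex.Im z < b2) -> differentiable f z) ->
  bd f x1 x2 y1 y2 = bd f a1 a2 b1 b2.
Proof.
move=> h1 h2 h3 h4 h5 h6 df.
have G x x' y y' : x1 <= x -> x < x' -> x' <= x2 -> y1 <= y -> y < y' -> y' <= y2 ->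
    [\/ x' <= a1, a2 <= x, y' <= b1 | b2 <= y] -> bd f x x' y y' = 0.
  move=> k1 k2 k3 k4 k5 k6 H; apply: bisect_goursat => // z [/andP[u1 u2] /andP[u3 u4]].
  apply: df; first by split; apply/andP; split; lra.
  by move=> [/andP[v1 v2] /andP[v3 v4]]; case: H => H; lra.
(* The edges of such a piece do not meet the open hole. *)
have B x x' y y' : x1 <= x -> x < x' -> x' <= x2 -> y1 <= y -> y < y' -> y' <= y2 ->
    x <= a1 \/ a2 <= x -> x' <= a1 \/ a2 <= x' ->
    y <= b1 \/ b2 <= y -> y' <= b1 \/ b2 <= y' -> bcont f x x' y y'.
  move=> k1 k2 k3 k4 k5 k6 H1 H2 H3 H4; apply: bcont_bd; [exact: ltW|exact: ltW|].
  move=> z [[/andP[u1 u2] /andP[u3 u4]] H].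
  apply/differentiable_continuous/df; first by split; apply/andP; split; lra.
  move=> [/andP[v1 v2] /andP[v3 v4]]; clear - H H1 H2 H3 H4 v1 v2 v3 v4.
  by case: H => H; [case: H3|case: H4|case: H1|case: H2] => ?; lra.
have l1 := ltW h1; have l2 := ltW h2; have l3 := ltW h3.
have l4 := ltW h4; have l5 := ltW h5; have l6 := ltW h6.
have la := le_trans l1 l2; have lb := le_trans l4 l5.
have lc := le_trans l2 l3; have ld := le_trans l5 l6.
have ka := lt_trans h1 h2; have kb := lt_trans h4 h5.
have kc := lt_trans h2 h3; have kd := lt_trans h5 h6.
rewrite (@bd_cutV _ f x1 a1) //; last first.
  by apply: B; rewrite ?lexx ?(lt_trans ka h3) ?(lt_trans kb h6) //; [left|right|left|right].
rewrite (G x1 a1 y1 y2 (lexx _) h1 lc (lexx _) (lt_trans kb h6) (lexx _) ltac:(by constructor 1)) add0r.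
rewrite (@bd_cutV _ f a1 a2) //; last first.
  by apply: B; rewrite ?lexx ?(lt_trans ka h3) ?(lt_trans kb h6) //; [left|right|left|right].
rewrite (G a2 x2 y1 y2 la h3 (lexx _) (lexx _) (lt_trans kb h6) (lexx _) ltac:(by constructor 2)) addr0.
rewrite (@bd_cutH _ f a1 a2 _ b1) //; last first.
  by apply: B; rewrite ?lexx ?(lt_trans ka h3) ?(lt_trans kb h6) //; [left|right|left|right].
rewrite (G a1 a2 y1 b1 l1 h2 l3 (lexx _) h4 ld ltac:(by constructor 3)) add0r.
rewrite (@bd_cutH _ f a1 a2 _ b2) //; last first.
  by apply: B; rewrite ?lexx //; [left|right|left|right].
by rewrite (G a1 a2 b2) ?addr0 //; constructor 4.
Qed.

Definition bds f c r := bd f (complex.Re c - r) (complex.Re c + r)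
  (complex.Im c - r) (complex.Im c + r).

Definition onsq c r z := onbd (complex.Re c - r) (complex.Re c + r)
  (complex.Im c - r) (complex.Im c + r) z.

(** The rough bound 2 r is the origin of the radius 2 r in the hypotheses of Cauchy's formula. *)
Lemma onsq_nm c r z : onsq c r z -> r <= nm (z - c) <= 2 * r.
Proof.
move=> [[/andP[u1 u2] /andP[u3 u4]] H]; apply/andP; split; last first.
  apply: (le_trans (nm_ReIm _)); rewrite !raddfB /= mulr_natl mulr2n.
  by apply: lerD; rewrite ler_norml; lra.
have hR : `|complex.Re z - complex.Re c| <= nm (z - c).
  by apply: (le_trans _ (nm_Re _)); rewrite raddfB.
have hI : `|complex.Im z - complex.Im c| <= nm (z - c).
  by apply: (le_trans _ (nm_Im _)); rewrite raddfB.
move: hR hI; rewrite !ler_norml => /andP[p1 p2] /andP[p3 p4].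
by case: H => H; lra.
Qed.

Lemma sq_le (a r : R) : 0 < r -> a - r <= a + r.
Proof. lra. Qed.

Lemma bds_bound f c r M : 0 < r ->
  (forall z, onsq c r z -> {for z, continuous f}) ->
  (forall z, onsq c r z -> nm (f z) <= M) -> nm (bds f c r) <= 16 * M * r.
Proof.
move=> r0 cf fM.
have hR := sq_le (complex.Re c) r0; have hI := sq_le (complex.Im c) r0.
apply: (le_trans (@bd_bound _ f _ _ _ _ M hR hI (bcont_bd hR hI cf) _)).
  by move=> z zr H; apply: fM.
by rewrite le_eqVlt; apply/orP; left; apply/eqP; ring.
Qed.

Lemma bdsD f g c r : 0 < r ->
  (forall z, onsq c r z -> {for z, continuous f}) ->
  (forall z, onsq c r z -> {for z, continuous g}) ->
  bds (fun z => f z + g z) c r = bds f c r + bds g c r.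
Proof. by move=> r0 cf cg; apply: bdD; apply: bcont_bd; try exact: sq_le; [exact: cf|exact: cg]. Qed.

Lemma bdsZ k f c r : 0 < r -> (forall z, onsq c r z -> {for z, continuous f}) ->
  bds (fun z => k * f z) c r = k * bds f c r.
Proof. by move=> r0 cf; apply: bdZ; apply: bcont_bd; try exact: sq_le; exact: cf. Qed.

Lemma bds_eq f g c r : 0 < r -> (forall z, onsq c r z -> f z = g z) -> bds f c r = bds g c r.
Proof. by move=> r0 fg; apply: bd_eq; try exact: sq_le; exact: fg. Qed.

Lemma insq c r z : nm (z - c) < r ->
  `|complex.Re z - complex.Re c| < r /\ `|complex.Im z - complex.Im c| < r.
Proof.
by move=> h; split; apply: (le_lt_trans _ h); rewrite -raddfB ?nm_Re ?nm_Im.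
Qed.

Lemma bds_hole f c z r e : 0 < e -> nm (z - c) + e < r ->
  (forall w, nm (w - c) <= 2 * r -> e <= nm (w - z) -> differentiable f w) ->
  bds f c r = bds f z e.
Proof.
move=> e0 er df; have [|hR hI] := @insq c (r - e) z; first lra.
move: hR hI; rewrite !ltr_norml => /andP[p1 p2] /andP[p3 p4].
apply: bd_hole; try lra.
move=> w [/andP[u1 u2] /andP[u3 u4]] H; apply: df.
  apply: (le_trans (nm_ReIm _)); rewrite !raddfB /= mulr_natl mulr2n.
  by apply: lerD; rewrite ler_norml; lra.
rewrite leNgt; apply/negP => /insq[]; rewrite !ltr_norml => /andP[q1 q2] /andP[q3 q4].
by apply: H; split; lra.
Qed.

Lemma df_sub c z : differentiable (fun w => w - c : C) z.
Proof. by apply: dfB; [exact: df_id|exact: df_cst]. Qed.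

Lemma df_inv_sub c z : z != c -> differentiable (fun w => (w - c)^-1 : C) z.
Proof. by move=> zc; apply: dfV; [exact: df_sub|rewrite subr_eq0]. Qed.

Lemma nm_neq (w z : C) e : 0 < e -> e <= nm (w - z) -> w != z.
Proof. by move=> e0; apply: contraTneq => ->; rewrite subrr nm0 -ltNge. Qed.

(** The difference of the two integrands is the difference quotient of [f] at [z]. Its integral may
    be taken over any small square around [z], where the quotient is bounded, so it vanishes. *)
Lemma cauchy_mul f c z r : nm (z - c) < r ->
  (forall w, nm (w - c) <= 2 * r -> differentiable f w) ->
  bds (fun w => f w / (w - z)) c r = f z * bds (fun w => (w - z)^-1) c r.
Proof.
move=> zr df; have r0 := le_lt_trans (nm_ge0 _) zr.
have onz w : onsq c r w -> w != z.
  move=> /onsq_nm/andP[h _]; apply: contraTneq h => ->; by rewrite -ltNge.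
have dfo w : onsq c r w -> differentiable f w by move=> /onsq_nm/andP[_ h]; exact: df.
pose g w := (f w - f z) / (w - z).
have dg w : nm (w - c) <= 2 * r -> w != z -> differentiable g w.
  move=> h1 h2; apply: dfM; last exact: df_inv_sub.
  by apply: dfB; [exact: df|exact: df_cst].
have g0 : bds g c r = 0.
  apply/eqP; rewrite -nm_eq0 eq_le nm_ge0 andbT; apply/ler_addgt0Pr => e e0; rewrite add0r.
  have [|d d0 Hd] := C_eps (df z _) (@ltr01 R); first lra.
  pose K := nm (derive1 f z) + 1.
  have K0 : 0 < K by rewrite ltr_wpDl ?nm_ge0.
  (* Small enough for the quotient to be at most [K], for the small square to lie inside the large
     one, and for 16 K t <= e. *)
  pose t := Num.min (d / 3) (Num.min ((r - nm (z - c)) / 2) (e / (16 * K))).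
  have t0 : 0 < t by rewrite !lt_min !divr_gt0 //= ?subr_gt0 // mulr_gt0.
  have /andP[t1 /andP[t2 t3]] : (t <= d / 3) && ((t <= (r - nm (z - c)) / 2) && (t <= e / (16 * K))).
    by rewrite -!le_min.
  rewrite (@bds_hole g c z r t t0); last 2 first.
  - lra.
  - by move=> w h1 h2; apply: dg => //; exact: nm_neq h2.
  apply: (@le_trans _ _ (16 * K * t)); last first.
    by move: t3; rewrite ler_pdivlMr ?mulr_gt0 // mulrC.
  apply: (bds_bound t0) => w /onsq_nm/andP[h1 h2]; have wz := nm_neq t0 h1.
    apply/differentiable_continuous/dg => //.
    have := nm_tri z w c; lra.
  have wz0 : 0 < nm (w - z) by rewrite nm_gt0 subr_eq0.
  rewrite /g nmM nmV ler_pdivrMr //.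
  have H : nm (f w - f z - (w - z) * derive1 f z) <= 1 * nm (w - z) by apply: Hd; lra.
  apply: (@le_trans _ _ (nm (f w - f z - (w - z) * derive1 f z) + nm ((w - z) * derive1 f z))).
    by rewrite -lerBlDr nm_subge.
  have -> : K * nm (w - z) = 1 * nm (w - z) + nm (w - z) * nm (derive1 f z).
    by rewrite /K; ring.
  by rewrite nmM lerD.
have cinv w : onsq c r w -> differentiable (fun w => (w - z)^-1 : C) w.
  by move=> /onz; exact: df_inv_sub.
rewrite -(bdsZ _ r0); last by move=> w /cinv; exact: differentiable_continuous.
rewrite -[RHS]add0r -g0 -(bdsD r0).
- by apply: (bds_eq r0) => w _; rewrite /g -mulrDl subrK.
- move=> w wo; apply/differentiable_continuous/dg; last exact: onz.
  by have /andP[] := onsq_nm wo.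
- move=> w wo; apply: differentiable_continuous; apply: dfM; first exact: df_cst.
  exact: cinv.
Qed.

Lemma ccont_onsq_inv z e : 0 < e -> forall w, onsq z e w ->
  {for w, continuous (fun w => (w - z)^-1 : C)}.
Proof.
move=> e0 w /onsq_nm/andP[h _]; apply: differentiable_continuous.
by apply: df_inv_sub; exact: nm_neq h.
Qed.

(** Opposite sides are combined: bottom minus top gives i [k], right minus left gives [k], where [k]
    is at least 1 / e on a side of length 2 e. Each pair thus adds at least 2 to the imaginary part.
    The exact value 2 i pi is avoided. *)
Lemma bds_inv_ge4 z e : 0 < e -> 4 <= nm (bds (fun w => (w - z)^-1) z e).
Proof.
move=> e0; pose k a t := 2 * e / ((t - a) ^+ 2 + e ^+ 2).
have q0 (a t : R) : 0 < (t - a) ^+ 2 + e ^+ 2 by rewrite ltr_wpDl ?sqr_ge0 ?exprn_gt0.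
have inv (x y : R) : (x +i* y)^-1 = (x / (x ^+ 2 + y ^+ 2)) +i* (- y / (x ^+ 2 + y ^+ 2)).
  by apply/eqP; rewrite eq_complex /= mulNr !eqxx.
have p1 t : (t +i* (complex.Im z - e) - z)^-1 - (t +i* (complex.Im z + e) - z)^-1 =
    0 +i* k (complex.Re z) t.
  case: z => zx zy /=.
  have -> : t +i* (zy - e) - zx +i* zy = (t - zx) +i* (- e).
    by apply/eqP; rewrite eq_complex /= eqxx /=; apply/eqP; ring.
  have -> : t +i* (zy + e) - zx +i* zy = (t - zx) +i* e.
    by apply/eqP; rewrite eq_complex /= eqxx /=; apply/eqP; ring.
  rewrite !inv sqrrN opprK; apply/eqP; rewrite eq_complex /=.
  by apply/andP; split; apply/eqP; rewrite /k; field; rewrite gt_eqF.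
have p2 t : ((complex.Re z + e) +i* t - z)^-1 - ((complex.Re z - e) +i* t - z)^-1 =
    k (complex.Im z) t +i* 0.
  case: z {p1} => zx zy /=.
  have -> : (zx - e) +i* t - zx +i* zy = (- e) +i* (t - zy).
    by apply/eqP; rewrite eq_complex /= eqxx andbT; apply/eqP; ring.
  have -> : (zx + e) +i* t - zx +i* zy = e +i* (t - zy).
    by apply/eqP; rewrite eq_complex /= eqxx andbT; apply/eqP; ring.
  rewrite !inv sqrrN [e ^+ 2 + _]addrC; apply/eqP; rewrite eq_complex /=.
  by apply/andP; split; apply/eqP; rewrite /k; field; rewrite gt_eqF.
have [] : bcont (fun w => (w - z)^-1 : C) (complex.Re z - e) (complex.Re z + e)
    (complex.Im z - e) (complex.Im z + e).
  by apply: bcont_bd; try exact: sq_le; exact: ccont_onsq_inv.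
move=> c1 c2 c3 c4.
have cN a b (u : R -> C) : ccont u a b -> ccont (fun t => - u t) a b.
  by move=> cu; have := ccontZ (-1) cu; congr ccont; apply/funext => t; rewrite mulN1r.
have cintN a b (u : R -> C) : ccont u a b -> cint (fun t => - u t) a b = - cint u a b.
  by move=> cu; rewrite -mulN1r -cintZ //; apply: cint_eq => t _; rewrite mulN1r.
have kge a t : a - e <= t <= a + e -> e^-1 <= k a t.
  move=> /andP[t1 t2]; rewrite /k ler_pdivlMr // mulrC ler_pdivrMr //.
  have : `|t - a| ^+ 2 <= e ^+ 2 by rewrite ler_sqr ?nnegrE ?(ltW e0) //; rewrite ler_norml; lra.
  by rewrite real_normK ?num_real // => hh; lra.
have E1 := cintD c1 (cN _ _ _ c2); rewrite cintN // (funext p1) in E1.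
have E2 := cintD c3 (cN _ _ _ c4); rewrite cintN // (funext p2) in E2.
have C1 := ccontD c1 (cN _ _ _ c2); rewrite (funext p1) in C1.
have C2 := ccontD c3 (cN _ _ _ c4); rewrite (funext p2) in C2.
have rk a : rcont (k a) (a - e) (a + e) -> 2 <= rint (k a) (a - e) (a + e).
  move=> ck; have -> : 2 = rint (fun=> e^-1) (a - e) (a + e).
    by rewrite rint_cst; [field; rewrite gt_eqF|exact: sq_le].
  by apply: rint_le => //; [exact: rcont_cst|exact: kge].
have I1 := rk _ (ccont_Im C1); have I2 := rk _ (ccont_Re C2).
rewrite /bds /bd -E1 -E2; apply: (le_trans _ (nm_Im _)).
have E (A B : C) : complex.Im (A + i' * B) = complex.Im A + complex.Re B.
  by case: A => a1 a2; case: B => b1 b2 /=; rewrite mul0r add0r mul1r.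
by apply: (le_trans _ (ler_norm _)); rewrite E; move: I1 I2; rewrite /=; lra.
Qed.

(** The two integrands differ by (z - c) / ((w - z) (w - c)), whose integral does not depend on the
    size s of the square and is O(1 / s). *)
Lemma bds_inv_const z c r : nm (z - c) < r ->
  bds (fun w => (w - z)^-1) c r = bds (fun w => (w - c)^-1) c r.
Proof.
move=> zr; have r0 := le_lt_trans (nm_ge0 _) zr.
have onz s w : r <= s -> onsq c s w -> w != z.
  move=> rs /onsq_nm/andP[h _]; apply: contraTneq h => ->; rewrite -ltNge; exact: lt_le_trans rs.
have onc s w : r <= s -> onsq c s w -> w != c.
  move=> rs /onsq_nm/andP[h _]; apply: (nm_neq r0); exact: le_trans h.
pose g w := (z - c) * ((w - z)^-1 * (w - c)^-1).
have dg w : w != z -> w != c -> differentiable g w.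
  move=> h1 h2; apply: dfM; first exact: df_cst.
  by apply: dfM; exact: df_inv_sub.
suff g0 : bds g c r = 0.
  rewrite -[RHS]add0r -g0 -(bdsD r0).
  - apply: (bds_eq r0) => w wo; rewrite /g.
    have := onz _ w (lexx r) wo; have := onc _ w (lexx r) wo.
    by rewrite -[w == c]subr_eq0 -[w == z]subr_eq0 => h1 h2; field; rewrite h1 h2.
  - by move=> w wo; apply/differentiable_continuous/dg; [exact: onz wo|exact: onc wo].
  - by move=> w wo; apply/differentiable_continuous/df_inv_sub; exact: onc wo.
apply/eqP; rewrite -nm_eq0 eq_le nm_ge0 andbT; apply/ler_addgt0Pr => e e0; rewrite add0r.
pose K := 32 * nm (z - c); have K0 : 0 <= K by rewrite mulr_ge0 // nm_ge0.
(* The integral over the square of size [s] is at most K / s, hence at most e. *)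
pose s := 2 * r + K / e.
have Ke : 0 <= K / e by rewrite divr_ge0 // ltW.
have s0 : 0 < s by rewrite ltr_pwDl // mulr_gt0.
have rs : r < s by rewrite /s; lra.
rewrite -(@bds_hole g c c s r r0); last 2 first.
- by rewrite subrr nm0 add0r.
- move=> w _ h; apply: dg; last exact: (nm_neq r0).
  by apply: contraTneq h => ->; rewrite -ltNge.
apply: (@le_trans _ _ (16 * (nm (z - c) * (2 / s * s^-1)) * s)); last first.
  have -> : 16 * (nm (z - c) * (2 / s * s^-1)) * s = K / s.
    by rewrite /K; field; rewrite gt_eqF.
  by rewrite ler_pdivrMr // /s mulrDr [e * (K / e)]mulrC divfK ?gt_eqF // lerDr mulr_ge0 // ?ltW // mulr_gt0.
apply: (bds_bound s0) => w wo.
  by apply/differentiable_continuous/dg; [exact: onz (ltW rs) wo|exact: onc (ltW rs) wo].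
have /andP[h _] := onsq_nm wo.
have hz : s / 2 <= nm (w - z) by have := nm_tri z w c; rewrite /s in h *; lra.
rewrite !nmM !nmV; apply: ler_wpM2l; first exact: nm_ge0.
apply: ler_pM; rewrite ?invr_ge0 ?nm_ge0 //.
  by rewrite -[2 / s]invrK invf_div lef_pV2 // posrE; [apply: lt_le_trans hz|]; rewrite divr_gt0.
by rewrite lef_pV2 // posrE; exact: lt_le_trans h.
Qed.

(* 2 i pi; only its non-vanishing and its independence of the pole are needed. *)
Definition kap c r := bds (fun w => (w - c)^-1) c r.

Lemma kap_ge4 c r : 0 < r -> 4 <= nm (kap c r).
Proof. exact: bds_inv_ge4. Qed.

Lemma kap_neq0 c r : 0 < r -> kap c r != 0.
Proof. by move=> r0; rewrite -nm_gt0; apply: lt_le_trans (kap_ge4 c r0). Qed.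

Lemma cauchy_disc f c z r : nm (z - c) < r ->
  (forall w, nm (w - c) <= 2 * r -> differentiable f w) ->
  f z = (kap c r)^-1 * bds (fun w => f w / (w - z)) c r.
Proof.
move=> zr df; rewrite cauchy_mul // bds_inv_const // mulrCA mulVf ?mulr1 //.
by apply: kap_neq0; exact: le_lt_trans (nm_ge0 _) zr.
Qed.

(** The constant is 16 from [bds_bound] divided by 4 from [kap_ge4]. *)
Lemma kap_bound f c r M : 0 < r -> (forall z, onsq c r z -> {for z, continuous f}) ->
  (forall z, onsq c r z -> nm (f z) <= M) -> nm ((kap c r)^-1 * bds f c r) <= 4 * M * r.
Proof.
move=> r0 cf fM; rewrite nmM nmV mulrC ler_pdivrMr; last first.
  by apply: lt_le_trans (kap_ge4 c r0).
have h := bds_bound r0 cf fM; apply: (le_trans h).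
have -> : 16 * M * r = 4 * M * r * 4 by ring.
have M0 : 0 <= M by have := le_trans (nm_ge0 _) h; rewrite -mulrA pmulr_rge0 // pmulr_lge0.
by apply: ler_wpM2l (kap_ge4 c r0); rewrite !mulr_ge0 // ltW.
Qed.

(* The maximum principle would give M; any constant will do. *)
Lemma max_sq f c r M : 0 < r -> (forall w, nm (w - c) <= 2 * r -> differentiable f w) ->
  (forall w, onsq c r w -> nm (f w) <= M) ->
  forall z, nm (z - c) <= r / 2 -> nm (f z) <= 8 * M.
Proof.
move=> r0 df fM z zr; have zr' : nm (z - c) < r by lra.
have far w : onsq c r w -> r / 2 <= nm (w - z).
  by move=> /onsq_nm/andP[h _]; have := nm_tri z w c; lra.
have r20 : 0 < r / 2 by rewrite divr_gt0.
rewrite (cauchy_disc zr' df); have -> : 8 * M = 4 * (M * (2 / r)) * r by field; rewrite gt_eqF.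
apply: (kap_bound r0) => w wo; have wz := nm_neq r20 (far _ wo).
  apply: differentiable_continuous; apply: dfM; last exact: df_inv_sub.
  by apply: df; have /andP[] := onsq_nm wo.
rewrite nmM nmV; apply: ler_pM; rewrite ?invr_ge0 ?nm_ge0 ?fM //.
by rewrite -[2 / r]invrK invf_div lef_pV2 ?far // posrE //; apply: lt_le_trans (far _ wo).
Qed.

Lemma inv_sqr_le (r x : R) : 0 < r -> r <= x -> x^-1 ^+ 2 <= r^-1 ^+ 2.
Proof.
move=> r0 rx; have x0 := lt_le_trans r0 rx.
by rewrite !exprVn lef_pV2 ?posrE ?exprn_gt0 // lerXn2r // nnegrE ltW.
Qed.

(** Cauchy's formula on the square of half-side rho / 3, with kernel 1 / (w - c)^2 for the
    derivative and h^2 / ((w - c - h) (w - c)^2) for the remainder. It yields 8 M / r and 8 M / r^2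
    with r = rho / 3. *)
Lemma taylor2 f c rho M : 0 < rho ->
  (forall w, nm (w - c) < rho -> differentiable f w) ->
  (forall w, nm (w - c) < rho -> nm (f w) <= M) ->
  nm (derive1 f c) <= 24 * M / rho /\ 
  forall h, nm h <= rho / 6 ->
    nm (f (c + h) - f c - h * derive1 f c) <= 72 * M / rho ^+ 2 * nm h ^+ 2.
Proof.
move=> rho0 df fM; pose r := rho / 3.
have r0 : 0 < r by rewrite divr_gt0.
have df' w : nm (w - c) <= 2 * r -> differentiable f w by move=> h; apply: df; rewrite /r in h; lra.
have fM' w : onsq c r w -> nm (f w) <= M.
  by move=> /onsq_nm/andP[_ h]; apply: fM; rewrite /r in h; lra.
have M0 : 0 <= M by apply: le_trans (nm_ge0 _) (fM c _); rewrite subrr nm0.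
have onc w : onsq c r w -> r <= nm (w - c) by move=> /onsq_nm/andP[].
have dfo w : onsq c r w -> differentiable f w by move=> /onsq_nm/andP[_ h]; exact: df'.
pose a := (kap c r)^-1 * bds (fun w => f w * ((w - c)^-1 ^+ 2)) c r.
have ca w : onsq c r w -> differentiable (fun w => f w * ((w - c)^-1 ^+ 2) : C) w.
  move=> wo; apply: dfM; first exact: dfo.
  by apply: dfX; apply: df_inv_sub; exact: nm_neq (onc _ wo).
have ha : nm a <= 8 * M / r.
  have -> : 8 * M / r = 4 * (M * (2 * r^-1 ^+ 2)) * r by field; rewrite gt_eqF.
  apply: (kap_bound r0) => w wo; first exact/differentiable_continuous/ca.
  rewrite nmM nmX nmV; apply: ler_pM; rewrite ?nm_ge0 ?exprn_ge0 ?invr_ge0 ?nm_ge0 ?fM' //.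
  apply: (@le_trans _ _ (r^-1 ^+ 2)); last by rewrite ler_peMl ?ler1n // exprn_ge0 // invr_ge0 ltW.
  have hw := onc _ wo; have hw0 := lt_le_trans r0 hw.
  exact: inv_sqr_le.
have hh h : nm h <= r / 2 -> nm (f (c + h) - f c - h * a) <= 8 * M / r ^+ 2 * nm h ^+ 2.
  move=> hr; have hr' : nm (c + h - c) < r by rewrite addrAC subrr add0r; lra.
  have far w : onsq c r w -> r / 2 <= nm (w - (c + h)).
    move=> /onc h1; have := nm_subge (w - c) h; rewrite -addrA -opprD; lra.
  have r20 : 0 < r / 2 by rewrite divr_gt0.
  have cr : nm (c - c) < r by rewrite subrr nm0.
  have d1 w : onsq c r w -> differentiable (fun w => f w / (w - (c + h)) : C) w.
    move=> wo; apply: dfM; first exact: dfo.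
    by apply: df_inv_sub; exact: nm_neq (far _ wo).
  have d2 w : onsq c r w -> differentiable (fun w => f w / (w - c) : C) w.
    move=> wo; apply: dfM; first exact: dfo.
    by apply: df_inv_sub; exact: nm_neq (onc _ wo).
  have d3 w : onsq c r w -> differentiable (fun w => -1 * (f w / (w - c)) : C) w.
    by move=> wo; apply: dfM; [exact: df_cst|exact: d2].
  have d4 w : onsq c r w -> differentiable (fun w => - h * (f w * ((w - c)^-1 ^+ 2)) : C) w.
    by move=> wo; apply: dfM; [exact: df_cst|exact: ca].
  have d5 w : onsq c r w -> differentiable (fun w => f w / (w - (c + h)) +  -1 * (f w / (w - c)) : C) w.
    by move=> wo; apply: dfD; [exact: d1|exact: d3].
  have d6 w : onsq c r w -> differentiable (fun w => f w / (w - (c + h)) +  -1 * (f w / (w - c)) - h * (f w * ((w - c)^-1 ^+ 2)) : C) w.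
    move=> wo; apply: dfB; [exact: d5|]; apply: dfM; [exact: df_cst|exact: ca].
  have dc (g : C -> C) : (forall w, onsq c r w -> differentiable g w) ->
      forall w, onsq c r w -> {for w, continuous g}.
    by move=> dg w wo; apply: differentiable_continuous; exact: dg.
  have -> : f (c + h) - f c - h * a = (kap c r)^-1 *
      bds (fun w => h ^+ 2 * (f w * ((w - (c + h))^-1 * ((w - c)^-1 ^+ 2)))) c r.
    rewrite {1}(cauchy_disc hr' df') {1}(cauchy_disc cr df') /a.
    rewrite [h * _]mulrCA -!mulrBr; congr (_ * _).
    rewrite -[- bds (fun w => f w / (w - c)) c r]mulN1r -mulNr.
    rewrite -(bdsZ (-1) r0 (dc _ d2)) -(bdsZ (- h) r0 (dc _ ca)).
    rewrite -(bdsD r0 (dc _ d1) (dc _ d3)) -(bdsD r0 (dc _ d5) (dc _ d4)).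
    apply: (bds_eq r0) => w wo.
    have := nm_neq r20 (far _ wo); have := nm_neq r0 (onc _ wo).
    rewrite -[w == c]subr_eq0 -[w == c + h]subr_eq0 => h1 h2.
    by field; rewrite h1 h2.
  have -> : 8 * M / r ^+ 2 * nm h ^+ 2 = 4 * (nm h ^+ 2 * (M * ((2 / r) * r^-1 ^+ 2))) * r.
    by field; rewrite gt_eqF.
  apply: (kap_bound r0) => w wo.
    apply: differentiable_continuous; apply: dfM; first exact: df_cst.
    apply: dfM; first exact: dfo.
    apply: dfM; first by apply: df_inv_sub; exact: nm_neq (far _ wo).
    by apply: dfX; apply: df_inv_sub; exact: nm_neq (onc _ wo).
  have hw := onc _ wo; have hf := far _ wo; have hf0 := lt_le_trans r20 hf.
  rewrite nmM nmX; apply: ler_wpM2l; first by rewrite exprn_ge0 ?nm_ge0.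
  rewrite nmM; apply: ler_pM; rewrite ?nm_ge0 ?fM' //.
  rewrite nmM nmV nmX nmV; apply: ler_pM; rewrite ?exprn_ge0 ?invr_ge0 ?nm_ge0 //.
    by rewrite -[2 / r]invrK invf_div lef_pV2.
  exact: inv_sqr_le.
have r2 : 0 < r / 2 by rewrite divr_gt0.
(* The quadratic bound [hh] identifies the integral [a] as the derivative. *)
have [_ E] : differentiable f c /\ derive1 f c = a.
  apply: eps_C => e e0; pose K := 8 * M / r ^+ 2.
  have K0 : 0 <= K by apply: divr_ge0; [exact: mulr_ge0|apply: exprn_ge0; exact: ltW].
  exists (Num.min (r / 2) (e / (K + 1))); first by rewrite lt_min r2 divr_gt0 // ltr_wpDl.
  move=> w; rewrite lt_min => /andP[h1]; rewrite ltr_pdivlMr ?ltr_wpDl // => h2.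
  have := hh (w - c) (ltW h1); rewrite subrKC => /le_trans; apply.
  rewrite -/K expr2 mulrA ler_wpM2r ?nm_ge0 //.
  have := nm_ge0 (w - c); move: h2; lra.
rewrite E; split.
  by apply: (le_trans ha); rewrite /r le_eqVlt; apply/orP; left; apply/eqP; field; rewrite gt_eqF.
move=> h hr; have hr' : nm h <= r / 2 by rewrite /r; lra.
apply: (le_trans (hh h hr')).
by rewrite /r le_eqVlt; apply/orP; left; apply/eqP; field; rewrite gt_eqF.
Qed.

End CauchyFormula.

(** * Limits along a filter *)

Section Limits.
Variable R : realType.
Local Notation C := (CC R).
Local Notation rc := (real_complex R).

Definition tends (I : Type) (Fl : set_system I) (V : normedModType (complex R))
  (u : I -> V) (l : V) := forall e : R, 0 < e -> \forall i \near Fl, nm (u i - l) < e.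

Section Tends.
Context (I : Type) (Fl : set_system I) {PF : ProperFilter Fl}.


Lemma tends_cst (V : normedModType (complex R)) (a : V) : tends Fl (fun=> a) a.
Proof. by move=> e e0; apply: filterE => i; rewrite subrr nm0. Qed.

Lemma tendsD (V : normedModType (complex R)) (u v : I -> V) l m :
  tends Fl u l -> tends Fl v m -> tends Fl (fun i => u i + v i) (l + m).
Proof.
move=> ul vm e e0; have e2 : 0 < e / 2 by rewrite divr_gt0.
apply: filterS2 (ul _ e2) (vm _ e2) => i h1 h2; rewrite opprD addrACA.
apply: le_lt_trans (nmD _ _) _; rewrite [ltRHS]splitr; exact: ltrD.
Qed.

Lemma tendsZ (V : normedModType (complex R)) (u : I -> V) l (k : C) :
  tends Fl u l -> tends Fl (fun i => k *: u i) (k *: l).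
Proof.
move=> ul e e0; have k0 : 0 < nm k + 1 by rewrite ltr_wpDl ?nm_ge0.
have := ul (e / (nm k + 1)) (divr_gt0 e0 k0); apply: filterS => i.
rewrite ltr_pdivlMr // => h; rewrite -scalerBr nmZ.
apply: le_lt_trans h; rewrite mulrC ler_wpM2l ?nm_ge0 // lerDl ler01 //.
Qed.

Lemma tendsB (V : normedModType (complex R)) (u v : I -> V) l m :
  tends Fl u l -> tends Fl v m -> tends Fl (fun i => u i - v i) (l - m).
Proof.
move=> ul vm; apply: tendsD => // e e0; apply: filterS (vm e e0) => i.
by rewrite -opprD nmN.
Qed.

Lemma near_ex2 (P Q : set I) : Fl P -> Fl Q -> exists i, P i /\ Q i.
Proof. by move=> HP HQ; apply: (@filter_ex _ Fl PF); exact: filterI. Qed.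

Lemma tendsM (u v : I -> C) (l m : C) : tends Fl u l -> tends Fl v m ->
  tends Fl (fun i => u i * v i : C) (l * m).
Proof.
move=> ul vm e e0.
pose K := nm l + nm m + 1; have K0 : 0 < K by rewrite ltr_wpDl // addr_ge0 ?nm_ge0.
pose d := Num.min 1 (e / (2 * K)).
have d0 : 0 < d by rewrite lt_min ltr01 divr_gt0 // mulr_gt0.
have dl : d * (2 * K) <= e by rewrite -ler_pdivlMr ?mulr_gt0 // /d ge_min lexx orbT.
have d1 : d <= 1 by rewrite /d ge_min lexx.
apply: filterS2 (ul _ d0) (vm _ d0) => i h1 h2.
have -> : u i * v i - l * m = (u i - l) * (v i - m) + (u i - l) * m + l * (v i - m) by ring.
apply: le_lt_trans (nmD _ _) _; apply: le_lt_trans (lerD (nmD _ _) (lexx _)) _.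
rewrite !nmM.
have a1 := nm_ge0 (u i - l); have a2 := nm_ge0 (v i - m).
have a3 := nm_ge0 l; have a4 := nm_ge0 m.
have b1 : nm (u i - l) * nm (v i - m) <= d * 1 by apply: ler_pM => //; lra.
have b2 : nm (u i - l) * nm m <= d * nm m by apply: ler_wpM2r => //; lra.
have b3 : nm l * nm (v i - m) <= nm l * d by apply: ler_wpM2l => //; lra.
apply: lt_le_trans dl; rewrite /K; nra.
Qed.

Lemma tends_sum (J : finType) (u : J -> I -> C) (l : J -> C) :
  (forall j, tends Fl (u j) (l j)) -> tends Fl (fun i => \sum_j u j i : C) (\sum_j l j).
Proof.
move=> ul; elim: (index_enum J) => [|j r IH].
  rewrite big_nil; under eq_fun do rewrite big_nil; exact: tends_cst.
by rewrite big_cons; under eq_fun do rewrite big_cons; apply: tendsD.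
Qed.

Lemma tends_near (V : normedModType (complex R)) (u v : I -> V) l :
  (\forall i \near Fl, u i = v i) -> tends Fl u l -> tends Fl v l.
Proof. by move=> uv ul e e0; apply: filterS2 uv (ul e e0) => i <-. Qed.

Lemma tends_le (V : normedModType (complex R)) (u : I -> V) l (M : R) :
  tends Fl u l -> (\forall i \near Fl, nm (u i) <= M) -> nm l <= M.
Proof.
move=> ul uM; apply/ler_addgt0Pr => e e0.
have [i [h1 h2]] := near_ex2 (ul e e0) uM.
by have := nm_subge l (u i); rewrite nm_sub; lra.
Qed.

Lemma tends_unique (V : normedModType (complex R)) (u : I -> V) l l' :
  tends Fl u l -> tends Fl u l' -> l = l'.
Proof.
move=> h1 h2; apply/eqP; rewrite -subr_eq0 -nm_eq0 eq_le nm_ge0 andbT.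
apply/ler_addgt0Pr => e e0; rewrite add0r.
have e2 : 0 < e / 2 by rewrite divr_gt0.
have [i [k1 k2]] := near_ex2 (h1 _ e2) (h2 _ e2).
by have := nm_tri (u i) l l'; rewrite (nm_sub l (u i)); lra.
Qed.

Lemma tends_complete (u : I -> C) :
  (forall e : R, 0 < e -> exists a : C, \forall i \near Fl, nm (u i - a) < e) ->
  exists l, tends Fl u l.
Proof.
move=> H.
have real (w : I -> R) : (forall e : R, 0 < e -> exists a : R, \forall i \near Fl, `|w i - a| < e) ->
    exists l, forall e : R, 0 < e -> \forall i \near Fl, `|w i - l| < e.
  move=> Hw; have : cauchy (w @ Fl).
    apply: cauchy_exP => e e0; have [a Ha] := Hw e e0; exists a.
    by apply: filterS Ha => i; rewrite /ball /= distrC.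
  move=> /cauchy_cvg cw; exists (lim (w @ Fl)) => e e0.
  have /cvgrPdist_lt Hl := cw; apply: filterS (Hl e e0) => i; by rewrite distrC.
have [a Ha] : exists l, forall e : R, 0 < e -> \forall i \near Fl, `|complex.Re (u i) - l| < e.
  apply: real => e e0; have [a Ha] := H e e0; exists (complex.Re a).
  by apply: filterS Ha => i; apply: le_lt_trans; rewrite -raddfB nm_Re.
have [b Hb] : exists l, forall e : R, 0 < e -> \forall i \near Fl, `|complex.Im (u i) - l| < e.
  apply: real => e e0; have [a' Ha'] := H e e0; exists (complex.Im a').
  by apply: filterS Ha' => i; apply: le_lt_trans; rewrite -raddfB nm_Im.
exists (Complex a b) => e e0; have e2 : 0 < e / 2 by rewrite divr_gt0.
apply: filterS2 (Ha _ e2) (Hb _ e2) => i h1 h2.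
apply: le_lt_trans (nm_ReIm _) _; rewrite !raddfB /= [ltRHS]splitr; exact: ltrD.
Qed.

End Tends.

Lemma tends_harm : tends \oo (fun n => (n.+1%:R^-1 : C)) 0.
Proof.
move=> e e0; have [N hN] : exists N, e^-1 < N%:R.
  by exists (Num.truncn e^-1).+1; exact: truncnS_gt.
exists N => // n /= Nn; rewrite subr0 nmV nm_nat -[ltRHS]invrK ltf_pV2 ?posrE ?invr_gt0 //.
apply: (lt_trans hN); rewrite ltr_nat; exact: leq_ltn_trans Nn _.
Qed.

End Limits.

(** * Weierstrass' convergence theorem in several variables *)

Section Holomorphic.
Variable R : realType.
Local Notation C := (CC R).
Local Notation rc := (real_complex R).
Implicit Types V : normedModType (complex R).

Definition hol V (x : V) (r : R) (F : V -> C) :=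
  forall w, nm (w - x) < r -> differentiable F w.

Lemma df_line V (x h : V) (t : C) : differentiable (fun t : C => x + t *: h) t.
Proof.
apply: differentiableD; first exact: differentiable_cst.
by apply: (@differentiableZl _ _ _ (fun t : C => t)); exact: df_id.
Qed.

Lemma d_line V (F : V -> C) (x h : V) : differentiable F x ->
  derive1 (fun t : C => F (x + t *: h)) 0 = 'd F x h.
Proof.
move=> dF; apply: (proj2 (eps_C _)) => e e0.
have k0 : 0 < nm h + 1 by rewrite ltr_wpDl ?nm_ge0.
have [d d0 Hd] := diff_eps dF (divr_gt0 e0 k0).
exists (d / (nm h + 1)); first exact: divr_gt0.
move=> w; rewrite subr0 scale0r addr0 ltr_pdivlMr // => hw.
have hwd : nm (w *: h) < d.
  by rewrite nmZ; apply: le_lt_trans hw; rewrite ler_wpM2l ?nm_ge0 // lerDl.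
have := Hd _ hwd; rewrite linearZ => /le_trans; apply.
rewrite nmZ.
have -> : e / (nm h + 1) * (nm w * nm h) = e * nm w * (nm h / (nm h + 1)) by ring.
rewrite ler_piMr //; first by rewrite mulr_ge0 ?nm_ge0 // ltW.
by rewrite ler_pdivrMr // mul1r lerDl.
Qed.

Lemma hol_line V (F : V -> C) x r h (s : R) : 0 < r -> hol x r F -> s * nm h <= r ->
  hol (0 : C) s (fun t => F (x + t *: h)).
Proof.
move=> r0 dF sr w; rewrite subr0 => ws.
apply: (@df_comp _ _ _ (fun t : C => x + t *: h) F); first exact: df_line.
apply: dF; rewrite addrAC subrr add0r nmZ.
have [->|h0] := eqVneq h 0; first by rewrite nm0 mulr0.
by apply: lt_le_trans sr; rewrite ltr_pM2r // nm_gt0.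
Qed.

Lemma hol_sub V (F : V -> C) x r y s : hol x r F -> nm (y - x) + s <= r -> hol y s F.
Proof.
move=> dF ys w wy; apply: dF; apply: le_lt_trans (nm_tri y _ _) _; lra.
Qed.

(** The one-variable bounds along the unit vector in the direction of [h]: on that line the function
    is holomorphic and bounded on the same radius. *)
Lemma taylor2V V (F : V -> C) x rho M : 0 < rho -> hol x rho F ->
  (forall w, nm (w - x) < rho -> nm (F w) <= M) ->
  forall h, nm ('d F x h : C) <= 24 * M / rho * nm h /\
  (nm h <= rho / 6 -> nm (F (x + h) - F x - 'd F x h) <= 72 * M / rho ^+ 2 * nm h ^+ 2).
Proof.
move=> rho0 dF FM h.
have dFx : differentiable F x by apply: dF; rewrite subrr nm0.
have [->|h0] := eqVneq h 0.
  by rewrite addr0 subrr sub0r nmN linear0 !nm0 expr0n /= !mulr0.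
have nh0 : 0 < nm h by rewrite nm_gt0.
pose u : V := (rc (nm h)^-1 : C) *: h.
have nu : nm u = 1 by rewrite nmZ nm_real ger0_norm ?invr_ge0 ?nm_ge0 // mulVf // gt_eqF.
have hE : h = (rc (nm h) : C) *: u.
  by rewrite scalerA -[_ * _]rmorphM /= divff ?gt_eqF // scale1r.
have dg := @hol_line V F x rho u rho rho0 dF.
rewrite nu mulr1 in dg; have {}dg := dg (lexx _).
have gM t : nm (t - 0 : C) < rho -> nm (F (x + t *: u)) <= M.
  by rewrite subr0 => ht; apply: FM; rewrite addrAC subrr add0r nmZ nu mulr1.
have [H1 H2] := taylor2 rho0 dg gM; move: H1 H2; rewrite d_line // => H1 H2.
have dE : 'd F x h = (rc (nm h) : C) * 'd F x u by rewrite {1}hE linearZ.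
split; first by rewrite dE nmM nm_real ger0_norm ?nm_ge0 // mulrC ler_wpM2r ?nm_ge0.
move=> hr; have := H2 (rc (nm h)); rewrite nm_real ger0_norm ?nm_ge0 // => /(_ hr).
by rewrite add0r -hE scale0r addr0 -dE.
Qed.

Lemma eps_diff_fun V (F : V -> C) x (Lf : V -> C) (K : R) : linear Lf ->
  (forall h, nm (Lf h) <= K * nm h) ->
  (forall e : R, 0 < e -> exists2 d : R, 0 < d &
     forall h, nm h < d -> nm (F (x + h) - F x - Lf h) <= e * nm h) ->
  differentiable F x /\ forall h, 'd F x h = Lf h.
Proof.
move=> Ll LK H.
pose L : {linear V -> C} := HB.pack Lf (GRing.isLinear.Build _ _ _ _ Lf Ll).
have [dF dE] := @eps_diff R V C F x L K LK H.
by split; [exact: dF|move=> h; rewrite dE].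
Qed.

(** The quadratic Taylor bound is the same for all members of the family, so difference quotients
    with one small step approximate all differentials at once. Pointwise convergence then makes the
    differentials Cauchy, and the Taylor bound itself passes to the limit. *)
Lemma weierstrass V I (Fl : set_system I) {PF : ProperFilter Fl} (F : I -> V -> C)
    (G : V -> C) x0 rho M :
  (\forall i \near Fl, hol x0 rho (F i) /\ forall w, nm (w - x0) < rho -> nm (F i w) <= M) ->
  (forall w, nm (w - x0) < rho -> tends Fl (F^~ w) (G w)) ->
  hol x0 rho G /\
  forall w, nm (w - x0) < rho -> forall h, tends Fl (fun i => 'd (F i) w h : C) ('d G w h).
Proof.
move=> HF FG.
suff H w : nm (w - x0) < rho -> differentiable G w /\
    forall h, tends Fl (fun i => 'd (F i) w h : C) ('d G w h).
  by split=> w wr; have [] := H w wr.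
move=> wr; pose s := rho - nm (w - x0); have s0 : 0 < s by rewrite subr_gt0.
have HF' : \forall i \near Fl, hol w s (F i) /\ forall u, nm (u - w) < s -> nm (F i u) <= M.
  apply: filterS HF => i [h1 h2]; split; first by apply: hol_sub h1 _; rewrite /s; lra.
  by move=> u us; apply: h2; apply: le_lt_trans (nm_tri w _ _) _; rewrite /s in us; lra.
have FG' u : nm (u - w) < s -> tends Fl (F^~ u) (G u).
  by move=> us; apply: FG; apply: le_lt_trans (nm_tri w _ _) _; rewrite /s in us; lra.
have s60 : 0 < s / 6 by rewrite divr_gt0.
have M0 : 0 <= M.
  have [i [_ h2]] := @filter_ex _ Fl PF _ HF'; apply: le_trans (nm_ge0 _) (h2 w _).
  by rewrite subrr nm0.
pose K := 72 * M / s ^+ 2.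
have K0 : 0 <= K by apply: divr_ge0; [exact: mulr_ge0|apply: exprn_ge0; exact: ltW].
have T i h : hol w s (F i) /\ (forall u, nm (u - w) < s -> nm (F i u) <= M) ->
    nm h <= s / 6 -> nm (F i (w + h) - F i w - 'd (F i) w h) <= K * nm h ^+ 2.
  by move=> [h1 h2] hs; have [_] := taylor2V s0 h1 h2 h; apply.
have tw h : nm h <= s / 6 -> tends Fl (fun i => F i (w + h) - F i w) (G (w + h) - G w).
  move=> hs; have hs' : nm (w + h - w) < s by rewrite addrAC subrr add0r; lra.
  by apply: tendsB; apply: FG'; rewrite // subrr nm0.
have ex h : exists l : C, tends Fl (fun i => 'd (F i) w h : C) l.
  apply: tends_complete => e e0.
  pose n := nm h + 1; have n0 : 0 < n by rewrite ltr_wpDl ?nm_ge0.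
  (* The step keeps t h within the range of the Taylor bound and makes the Taylor error, divided by
     t, less than e / 2. *)
  pose t := Num.min (s / 6 / n) (e / (2 * (K + 1) * n ^+ 2)).
  have k0 : 0 < 2 * (K + 1) * n ^+ 2 by rewrite !mulr_gt0 ?exprn_gt0 // ltr_wpDl.
  have t0 : 0 < t by rewrite lt_min !divr_gt0.
  have t1 : t * n <= s / 6 by rewrite -ler_pdivlMr // /t ge_min lexx.
  have t2 : t * (2 * (K + 1) * n ^+ 2) <= e by rewrite -ler_pdivlMr // /t ge_min lexx orbT.
  have hn : nm h <= n by rewrite lerDl.
  pose th : V := (rc t : C) *: h.
  have nth : nm th = t * nm h by rewrite nmZ nm_real gtr0_norm.
  have ths : nm th <= s / 6 by rewrite nth; apply: le_trans t1; rewrite ler_pM2l.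
  exists ((rc t)^-1 * (G (w + th) - G w)).
  have e2 : 0 < e / 2 by rewrite divr_gt0.
  have ht : 0 < t * (e / 2) by rewrite mulr_gt0.
  apply: filterS2 HF' (tw th ths _ ht) => i Hi hi.
  have rt0 : (rc t : C) != 0 by rewrite -nm_eq0 nm_real normr_eq0 gt_eqF.
  have tE : 'd (F i) w h = (rc t)^-1 * 'd (F i) w th :> C.
    by rewrite linearZ /= -[(rc t) *: _]/(rc t * _) mulKf.
  rewrite tE -mulrBr nmM nmV nm_real gtr0_norm // mulrC ltr_pdivrMr //.
  have A := T i th Hi ths; rewrite nth exprMn in A.
  have B : nm ('d (F i) w th - (G (w + th) - G w)) <=
      nm (F i (w + th) - F i w - 'd (F i) w th) + nm (F i (w + th) - F i w - (G (w + th) - G w)).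
    by apply: le_trans (nm_tri (F i (w + th) - F i w) _ _) _; rewrite (nm_sub ('d (F i) w th)).
  apply: (le_lt_trans B); apply: (@lt_le_trans _ _ (t * (e / 2) + t * (e / 2))); last first.
    by rewrite -mulrDr -splitr mulrC.
  apply: ler_ltD => //; apply: (le_trans A).
  rewrite expr2 -mulrA mulrCA ler_pM2l //.
  have nn : nm h ^+ 2 <= n ^+ 2 by rewrite lerXn2r // nnegrE ?nm_ge0 // ltW.
  have : K * (t * nm h ^+ 2) <= (K + 1) * (t * n ^+ 2).
    apply: ler_pM => //; first by rewrite mulr_ge0 ?exprn_ge0 ?nm_ge0 // ltW.
      by rewrite lerDl.
    by rewrite ler_pM2l.
  move: t2; lra.
pose Lf h : C := projT1 (cid (ex h)).
have Lt h : tends Fl (fun i => 'd (F i) w h : C) (Lf h) by rewrite /Lf; case: cid.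
have Ll : linear Lf.
  move=> a u v; apply: (tends_unique (Lt _)).
  under eq_fun do rewrite linearP.
  by apply: tendsD; [apply: tendsZ|].
clearbody Lf.
have [|e e0|dG dE] := @eps_diff_fun V G w Lf (24 * M / s) Ll.
- move=> h; apply: (tends_le (Lt h)).
  by apply: filterS HF' => i [h1 h2]; have [] := taylor2V s0 h1 h2 h.
- exists (Num.min (s / 6) (e / (K + 1))); first by rewrite lt_min s60 divr_gt0 // ltr_wpDl.
  move=> h; rewrite lt_min => /andP[h1]; rewrite ltr_pdivlMr ?ltr_wpDl // => h2.
  apply: (@le_trans _ _ (K * nm h ^+ 2)); last first.
    rewrite expr2 mulrA ler_wpM2r ?nm_ge0 //; have := nm_ge0 h; move: h2; lra.
  have tt : tends Fl (fun i => F i (w + h) - F i w - 'd (F i) w h) (G (w + h) - G w - Lf h).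
    by apply: tendsB; [exact: tw (ltW h1)|exact: Lt].
  apply: (tends_le tt); apply: filterS HF' => i Hi; exact: T (ltW h1).
split; first exact: dG.
by move=> h; exact: (eq_ind_r (tends Fl (fun i => 'd (F i) w h : C)) (Lt h) (dE h)).
Qed.

End Holomorphic.

(** * Derivatives and difference quotients of holomorphic germs *)

Section Germs.
Variable R : realType.
Local Notation C := (CC R).
Local Notation rc := (real_complex R).
Implicit Types V W : normedModType (complex R).

Lemma hgP V (x : V) (F : V -> C) : holo_germ x F <-> exists2 r : R, 0 < r & hol x r F.
Proof. exact: nm_nearP. Qed.

Lemma cont_nm V W (F : V -> W) x : {for x, continuous F} <->
  forall e : R, 0 < e -> exists2 d : R, 0 < d & forall w, nm (w - x) < d -> nm (F w - F x) < e.
Proof.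
split=> [cF e e0|H].
  have := cF _ ((nm_nearP (F x) [set z | nm (z - F x) < e]).2 _).
  by case/(_ _)/nm_nearP => [|d d0 Hd]; [exists e|exists d].
move=> B /nm_nearP[e e0 He]; apply/nm_nearP; have [d d0 Hd] := H e e0.
by exists d => // w wd; apply: He; exact: Hd.
Qed.

Lemma hg_bounded V (x : V) (F : V -> C) : holo_germ x F -> exists r M : R,
  [/\ 0 < r, hol x r F & forall w, nm (w - x) < r -> nm (F w) <= M].
Proof.
move=> /hgP[r r0 hF]; have dFx : differentiable F x by apply: hF; rewrite subrr nm0.
have /cont_nm /(_ _ ltr01)[d d0 Hd] := differentiable_continuous dFx.
exists (Num.min r d), (nm (F x) + 1); split; first by rewrite lt_min r0.
  by move=> w; rewrite lt_min => /andP[h _]; exact: hF.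
move=> w; rewrite lt_min => /andP[_ /Hd h].
by have := nm_subge (F w) (F x); lra.
Qed.

Lemma hol_germ V (x y : V) r (F : V -> C) : hol x r F -> nm (y - x) < r -> holo_germ y F.
Proof.
move=> hF yr; apply/hgP; exists (r - nm (y - x)); first by rewrite subr_gt0.
by apply: hol_sub hF _; lra.
Qed.

(** A partial derivative is the limit of the holomorphic difference quotients with steps 1 / (n +
    1), which are uniformly bounded; [weierstrass] applies. *)
Lemma partial_germ V (x : V) (F : V -> C) (e : V) : holo_germ x F ->
  holo_germ x (fun w => 'd F w e : C).
Proof.
move=> /hg_bounded[r [M [r0 hF FM]]]; apply/hgP; exists (r / 2); first by rewrite divr_gt0.
have r2 : 0 < r / 2 by rewrite divr_gt0.
pose s n : C := n.+1%:R^-1; pose G n w : C := (s n)^-1 * (F (w + s n *: e) - F w).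
pose k := nm e; have k0 : 0 <= k by exact: nm_ge0.
pose A := 24 * M / (r / 2) * k; pose B := 72 * M / (r / 2) ^+ 2 * k ^+ 2.
have sn n : nm (s n) = n.+1%:R^-1 by rewrite nmV nm_nat.
have sn0 n : 0 < nm (s n) by rewrite sn invr_gt0 ltr0n.
have s0 n : s n != 0 by rewrite -nm_gt0.
have key n w : nm (w - x) < r / 2 -> nm (s n) * (k + 1) < r / 12 ->
   nm ('d F w e : C) <= A /\ nm (G n w - 'd F w e) <= B * nm (s n).
  move=> wr sr.
  have h1 : hol w (r / 2) F by apply: hol_sub hF _; lra.
  have h2 u : nm (u - w) < r / 2 -> nm (F u) <= M.
    by move=> us; apply: FM; apply: le_lt_trans (nm_tri w _ _) _; lra.
  have [T1 _] := taylor2V r2 h1 h2 e; split; first exact: T1.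
  have [_ T2] := taylor2V r2 h1 h2 (s n *: e).
  have : nm (s n *: e) <= r / 2 / 6.
    rewrite nmZ -/k; apply: (@le_trans _ _ (nm (s n) * (k + 1))); last by lra.
    by rewrite ler_pM2l // lerDl.
  move=> /T2; rewrite linearZ /= -[s n *: 'd F w e]/(s n * 'd F w e) nmZ => T.
  have -> : G n w - 'd F w e = (s n)^-1 * (F (w + s n *: e) - F w - s n * 'd F w e).
    by rewrite /G [RHS]mulrBr mulKf.
  rewrite nmM nmV mulrC ler_pdivrMr //; apply: (le_trans T).
  rewrite le_eqVlt; apply/orP; left; apply/eqP.
  by rewrite /B /k; move: (72 * M / _) => q; ring.
have d0 : 0 < r / 12 / (k + 1) by rewrite !divr_gt0 // ltr_wpDl.
have near_s : \forall n \near \oo, nm (s n) * (k + 1) < r / 12.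
  apply: filterS (tends_harm d0) => n; rewrite subr0.
  by rewrite ltr_pdivlMr // ltr_wpDl.
apply: (proj1 (@weierstrass R V nat \oo _ G (fun w => 'd F w e) x (r / 2) (A + B) _ _)).
- apply: filterS near_s => n sr; split.
    move=> w wr; apply: dfM; first exact: df_cst.
    apply: dfB; last by apply: hF; lra.
    apply: (@df_comp _ _ _ (fun w => w + s n *: e)).
      by apply: differentiableD; [exact: (ex_diff (is_diff_def := is_diff_id w))|exact: differentiable_cst].
    apply: hF; rewrite addrAC; apply: le_lt_trans (nmD _ _) _; rewrite nmZ -/k.
    have : nm (s n) * k <= nm (s n) * (k + 1) by rewrite ler_pM2l // lerDl.
    lra.
  move=> w wr; have [K1 K2] := key n w wr sr.
  have := nm_subge (G n w) ('d F w e : C).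
  have : B * nm (s n) <= B.
    rewrite ler_piMr //; last by rewrite sn invf_le1 ?ltr0n // ler1n.
    by have := le_trans (nm_ge0 _) K2; rewrite pmulr_lge0.
  lra.
- move=> w wr t t0; have B0 : 0 < `|B| + 1 by rewrite ltr_wpDl.
  apply: filterS2 near_s (tends_harm (divr_gt0 t0 B0)) => n sr; rewrite subr0.
  rewrite ltr_pdivlMr // -/(s n) => h; have [_ K2] := key n w wr sr.
  apply: (le_lt_trans K2); apply: le_lt_trans h; rewrite mulrC ler_pM2l //.
  by have := ler_norm B; lra.
Qed.

(** The difference quotient of [T] along [e], completed by the derivative at t = 0. This is how a
    function is divided by a coordinate. *)
Definition dq V (T : V -> C) (e x : V) (t : C) : C :=
  if t == 0 then 'd T x e else t^-1 * (T (x + t *: e) - T x).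

Lemma dqE V (T : V -> C) e x t : T (x + t *: e) = T x + t * dq T e x t.
Proof.
rewrite /dq; case: eqP => [->|/eqP t0]; first by rewrite scale0r addr0 mul0r addr0.
by rewrite mulVKf // subrKC.
Qed.

(** 36 = 24 + 72 / 6: the bound for the differential plus the Taylor remainder at distance r / 6. *)
Lemma dq_bound V (T : V -> C) e x (r M : R) : 0 < r -> hol x r T ->
  (forall w, nm (w - x) < r -> nm (T w) <= M) ->
  forall t, nm t * nm e <= r / 6 -> nm (dq T e x t) <= 36 * M / r * nm e.
Proof.
move=> r0 hT TM t tr.
have M0 : 0 <= M by apply: le_trans (nm_ge0 _) (TM x _); rewrite subrr nm0.
have [T1 _] := taylor2V r0 hT TM e.
have c1 : 24 * M / r * nm e <= 36 * M / r * nm e.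
  by rewrite ler_wpM2r ?nm_ge0 // ler_pM2r ?invr_gt0 //; lra.
rewrite /dq; case: eqP => [_|/eqP t0]; first exact: le_trans c1.
have [_ T2] := taylor2V r0 hT TM (t *: e).
move: T2; rewrite linearZ /= -[t *: 'd T x e]/(t * 'd T x e) nmZ => /(_ tr) T2.
have nt0 : 0 < nm t by rewrite nm_gt0.
rewrite nmM nmV mulrC ler_pdivrMr //.
have := nm_subge (T (x + t *: e) - T x) (t * 'd T x e); rewrite nmM => h.
have A : nm t * nm ('d T x e : C) <= nm t * (24 * M / r * nm e) by rewrite ler_pM2l.
have B : 72 * M / r ^+ 2 * (nm t * nm e) ^+ 2 <= 72 * M / r ^+ 2 * (nm t * nm e * (r / 6)).
  rewrite ler_wpM2l //; first by rewrite divr_ge0 ?mulr_ge0 ?exprn_ge0 // ltW.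
  by rewrite expr2 ler_wpM2l // mulr_ge0 ?nm_ge0.
have E : 72 * M / r ^+ 2 * (nm t * nm e * (r / 6)) = nm t * (12 * M / r * nm e).
  by field; rewrite gt_eqF.
have -> : 36 * M / r * nm e * nm t = nm t * (24 * M / r * nm e) + nm t * (12 * M / r * nm e).
  by ring.
by rewrite -E; lra.
Qed.

Lemma sum_le_const n (u : 'I_n -> R) (M : R) : (forall k, u k <= M) ->
  \sum_k u k <= M * n%:R.
Proof.
move=> uM; apply: le_trans (ler_sum _ (fun k _ => uM k)) _.
by rewrite sumr_const card_ord mulr_natr.
Qed.

Lemma df_lin_arg V W (a : W -> V) (b : W -> C) (k : C) (e : V) w :
  differentiable a w -> differentiable b w -> differentiable (fun w => a w + (k * b w) *: e) w.
Proof.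
move=> da db; apply: differentiableD; first exact: da.
apply: (@differentiableZl _ _ _ (fun w => k * b w)).
by apply: dfM; [exact: df_cst|exact: db].
Qed.

(** The quotient is the integral over s in [0, 1] of the derivative of T along e at a + s b e. Its
    Riemann sums are holomorphic in w and uniformly bounded, so [weierstrass] applies. *)
Lemma dq_germ0 V W (T : V -> C) (e : V) (a : W -> V) (b : W -> C) (w0 : W) :
  holo_germ (a w0) T -> b w0 = 0 ->
  (\forall w \near w0, differentiable a w) -> holo_germ w0 b ->
  holo_germ w0 (fun w => dq T e (a w) (b w)).
Proof.
move=> hT b0 /nm_nearP[ra ra0 da] /hgP[rb rb0 db].
have [r [M [r0 TT TM]]] := hg_bounded hT.
have [r' [M' [r'0 DT DM]]] := hg_bounded (partial_germ e hT).
pose q := Num.min (r / 2) r'; have q0 : 0 < q by rewrite lt_min r'0 divr_gt0.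
have qr : q <= r / 2 by rewrite /q ge_min lexx.
have qr' : q <= r' by rewrite /q ge_min lexx orbT.
have dcont : {for w0, continuous a}.
  by apply: differentiable_continuous; apply: da; rewrite subrr nm0.
have bcont : {for w0, continuous b}.
  by apply: differentiable_continuous; apply: db; rewrite subrr nm0.
have k0 : 0 < nm e + 1 by rewrite ltr_wpDl ?nm_ge0.
have q6 : 0 < q / 12 by rewrite divr_gt0.
have [ua ua0 Ha] := (cont_nm _ _).1 dcont _ q6.
have [ub ub0 Hb] := (cont_nm _ _).1 bcont _ (divr_gt0 q6 k0).
pose rho := Num.min (Num.min ra rb) (Num.min ua ub).
have rho0 : 0 < rho by rewrite !lt_min ra0 rb0 ua0 ub0.
have inr w : nm (w - w0) < rho -> [/\ nm (w - w0) < ra, nm (w - w0) < rb,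
    nm (a w - a w0) < q / 12 & nm (b w) * nm e < q / 12].
  rewrite !lt_min => /andP[/andP[h1 h2] /andP[h3 h4]]; split => //; first exact: Ha.
  have := Hb w h4; rewrite b0 subr0 ltr_pdivlMr // => h.
  by apply: le_lt_trans h; rewrite ler_wpM2l ?nm_ge0 // lerDl.
(* The Riemann sum with n + 1 equal steps. *)
pose G n w : C := n.+1%:R^-1 * \sum_(k < n.+1) 'd T (a w + (k%:R / n.+1%:R * b w) *: e) e.
have arg n k w : (k <= n.+1)%N -> nm (w - w0) < rho ->
    nm (a w + (k%:R / n.+1%:R * b w) *: e - a w0) < q / 6.
  move=> kn /inr[_ _ h1 h2]; rewrite addrAC; apply: le_lt_trans (nmD _ _) _.
  rewrite nmZ nmM nmM nmV !nm_nat.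
  have : k%:R / n.+1%:R * nm (b w) * nm e <= nm (b w) * nm e.
    rewrite -mulrA ler_piMl ?mulr_ge0 ?nm_ge0 // ler_pdivrMr ?ltr0n // mul1r ler_nat //.
  by move=> h; apply: lt_le_trans (ltr_leD h1 (le_trans h (ltW h2))) _; clear; lra.
apply/hgP; exists rho; first exact: rho0.
apply: (proj1 (@weierstrass R W nat \oo _ G (fun w => dq T e (a w) (b w)) w0 rho M' _ _)).
- apply: filterE => n; split.
    move=> w wr; apply: dfM; first exact: df_cst.
    apply: df_sum => k _.
    apply: (@df_comp _ _ _ (fun w => a w + (k%:R / n.+1%:R * b w) *: e) (fun u => 'd T u e)).
      have [h1 h2 _ _] := inr w wr.
      by apply: df_lin_arg; [exact: da|exact: db].
    by apply: DT; apply: lt_le_trans (arg _ _ _ (ltnW (ltn_ord k)) wr) _; lra.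
  move=> w wr; rewrite nmM nmV nm_nat mulrC ler_pdivrMr ?ltr0n //.
  apply: le_trans (nm_sum _ _ _) _.
  have Hk (k : 'I_n.+1) : nm ('d T (a w + (k%:R / n.+1%:R * b w) *: e) e : C) <= M'.
    by apply: DM; apply: lt_le_trans (arg _ _ _ (ltnW (ltn_ord k)) wr) _; lra.
  exact: sum_le_const Hk.
- move=> w wr; have [h1 h2 h3 h4] := inr w wr.
  rewrite /dq; case: eqP => [bw|/eqP bw].
    apply: (tends_near _ (tends_cst ('d T (a w) e : C))); apply: filterE => n.
    rewrite /G bw; under eq_bigr do rewrite mulr0 scale0r addr0.
    by rewrite sumr_const card_ord -[X in _ * X]mulr_natl mulKf // pnatr_eq0.
  pose t := b w; have t0 : 0 < nm t by rewrite nm_gt0.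
  pose K := 72 * M / (r / 2) ^+ 2 * (nm t * nm e) ^+ 2 / nm t.
  have r2 : 0 < r / 2 by rewrite divr_gt0.
  have M0 : 0 <= M by apply: le_trans (nm_ge0 _) (TM (a w0) _); rewrite subrr nm0.
  have K0 : 0 <= K.
    rewrite /K !mulr_ge0 ?invr_ge0 ?exprn_ge0 ?nm_ge0 // ?mulr_ge0 ?invr_ge0 ?nm_ge0 // ltW //.
  (* The increment of [T] over [0, t] telescopes into n + 1 increments, each of which is linear up
     to an error O(1 / (n + 1)^2). *)
  suff key n : nm (G n w - t^-1 * (T (a w + t *: e) - T (a w))) <= K * n.+1%:R^-1.
    move=> z z0; have k1 : 0 < K + 1 by rewrite ltr_wpDl.
    apply: filterS (tends_harm (divr_gt0 z0 k1)) => n; rewrite subr0 nmV nm_nat ltr_pdivlMr // => h.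
    apply: le_lt_trans (key n) _; apply: le_lt_trans h.
    by rewrite mulrC ler_wpM2l ?invr_ge0 // lerDl.
  pose x k := a w + (k%:R / n.+1%:R * t) *: e.
  have n0 : n.+1%:R != 0 :> C by rewrite pnatr_eq0.
  have alg1 (p t' S S' : C) : t' != 0 -> p * S' - t'^-1 * S = - t'^-1 * (S - p * t' * S').
    by move=> ?; field.
  have xS k : x k.+1 = x k + (n.+1%:R^-1 * t) *: e.
    rewrite /x -addrA -scalerDl; congr (_ + _ *: _).
    by rewrite -[k.+1%:R]natr1 mulrDl mul1r mulrDl.
  have step k : (k < n.+1)%N ->
      nm (T (x k.+1) - T (x k) - n.+1%:R^-1 * t * 'd T (x k) e) <=
      72 * M / (r / 2) ^+ 2 * (n.+1%:R^-1 * (nm t * nm e)) ^+ 2.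
    move=> kn; have xk := arg n k w (ltnW kn) wr.
    have hx1 : hol (x k) (r / 2) T by apply: hol_sub TT _; move: xk; rewrite -/t -/(x k); clear - qr q0; lra.
    have hx2 u : nm (u - x k) < r / 2 -> nm (T u) <= M.
      by move=> us; apply: TM; apply: le_lt_trans (nm_tri (x k) _ _) _; move: xk; rewrite -/t -/(x k); clear - qr q0 us; lra.
    have [_] := taylor2V r2 hx1 hx2 ((n.+1%:R^-1 * t) *: e).
    rewrite linearZ /= -[_ *: 'd T (x k) e]/(_ * 'd T (x k) e) -xS nmZ nmM nmV nm_nat -mulrA.
    apply; apply: (@le_trans _ _ (nm t * nm e)); last by rewrite /t; lra.
    by rewrite ler_piMl ?mulr_ge0 ?nm_ge0 // invf_le1 ?ltr0n // ler1n.
  have tel : T (a w + t *: e) - T (a w) = \sum_(k < n.+1) (T (x k.+1) - T (x k)).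
    rewrite -(big_mkord xpredT (fun k => T (x k.+1) - T (x k))) telescope_sumr //.
    by rewrite /x divff // mul1r mul0r mul0r scale0r addr0.
  have -> : G n w - t^-1 * (T (a w + t *: e) - T (a w)) =
      - t^-1 * \sum_(k < n.+1) (T (x k.+1) - T (x k) - n.+1%:R^-1 * t * 'd T (x k) e).
    have -> : \sum_(k < n.+1) (T (x k.+1) - T (x k) - n.+1%:R^-1 * t * 'd T (x k) e) =
        \sum_(k < n.+1) (T (x k.+1) - T (x k)) - n.+1%:R^-1 * t * \sum_(k < n.+1) 'd T (x k) e.
      by rewrite mulr_sumr -sumrB.
    have -> : G n w = n.+1%:R^-1 * \sum_(k < n.+1) 'd T (x k) e by [].
    by rewrite -tel; exact: alg1.
  rewrite nmM nmN nmV mulrC ler_pdivrMr //; apply: le_trans (nm_sum _ _ _) _.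
  apply: le_trans (sum_le_const (fun k => step k (ltn_ord k))) _.
  rewrite exprMn /K.
  have nR : n.+1%:R != 0 :> R by rewrite pnatr_eq0.
  rewrite le_eqVlt; apply/orP; left; apply/eqP.
  move: (nm t) t0 (n.+1%:R : R) nR => T' T0 N' N0; field.
  by rewrite N0 (gt_eqF T0) (gt_eqF r0).
Qed.

Lemma dq_germ V W (T : V -> C) (e : V) (a : W -> V) (b : W -> C) (w0 : W) :
  holo_germ (a w0) T -> holo_germ (a w0 + b w0 *: e) T ->
  (\forall w \near w0, differentiable a w) -> holo_germ w0 b ->
  holo_germ w0 (fun w => dq T e (a w) (b w)).
Proof.
move=> hT hT' da hb; have [b0|b0] := eqVneq (b w0) 0; first exact: dq_germ0.
have /hgP[rb rb0 db] := hb.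
have [ra ra0 Ha] := (nm_nearP _ _).1 da.
have dw u : nm (u - w0) < ra -> nm (u - w0) < rb -> differentiable (fun w => a w + b w *: e) u.
  move=> h1 h2; apply: differentiableD; first exact: Ha.
  by apply: (@differentiableZl _ _ _ b); exact: db.
have /hgP[r1 r10 T1] := hT; have /hgP[r2 r20 T2] := hT'.
have ww : nm (w0 - w0) < ra /\ nm (w0 - w0) < rb by rewrite subrr nm0.
have [u1 u10 A1] := (cont_nm _ _).1 (differentiable_continuous (Ha w0 ww.1)) _ r10.
have [u2 u20 A2] := (cont_nm _ _).1 (differentiable_continuous (dw w0 ww.1 ww.2)) _ r20.
have b00 : 0 < nm (b w0) by rewrite nm_gt0.
have [u3 u30 A3] := (cont_nm _ _).1 (differentiable_continuous (db w0 ww.2)) _ b00.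
have bn w : nm (w - w0) < u3 -> b w != 0.
  by move=> /A3; apply: contraTneq => ->; rewrite sub0r nmN ltxx.
pose rho := Num.min (Num.min ra rb) (Num.min u1 (Num.min u2 u3)).
apply/hgP; exists rho; first by rewrite !lt_min ra0 rb0 u10 u20.
move=> w; rewrite !lt_min => /andP[/andP[h1 h2] /and3P[h3 h4 h5]].
have dG : differentiable (fun w => (b w)^-1 * (T (a w + b w *: e) - T (a w)) : C) w.
  apply: dfM; first by apply: dfV; [exact: db|exact: bn].
  apply: dfB.
    apply: (@df_comp _ _ _ (fun w => a w + b w *: e) T); first exact: dw.
    by apply: T2; exact: A2.
  by apply: (@df_comp _ _ _ a T); [exact: Ha|apply: T1; exact: A1].
apply: df_near dG; apply/nm_nearP; exists (u3 - nm (w - w0)); first by rewrite subr_gt0.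
move=> z zw; rewrite /dq; case: eqP => // /eqP; rewrite (negbTE (bn _ _)) //.
by apply: le_lt_trans (nm_tri w _ _) _; lra.
Qed.

End Germs.

(** * Orders of zeros, the identity theorem and ultralimits *)

Section OneVariable.
Variable R : realType.
Local Notation C := (CC R).
Local Notation rc := (real_complex R).
Implicit Types (f g u v : C -> C) (x z c : C).

Lemma near_nm (V : normedModType (complex R)) (x : V) (d : R) : 0 < d ->
  \forall t \near x, nm (t - x) < d.
Proof. by move=> d0; apply/nm_nearP; exists d. Qed.

Lemma df_near_id (V : normedModType (complex R)) (x : V) : \forall w \near x, differentiable (fun w : V => w) w.
Proof. by near=> w; exact: (ex_diff (is_diff_def := is_diff_id w)). Unshelve. all: by end_near. Qed.

Lemma factor_dq f c x (r : R) : hol c r f -> nm (x - c) < r ->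
  hol c r (fun t => dq f 1 x (t - x)).
Proof.
move=> hf xr t tr; apply: (nbhs_singleton (_ : holo_germ t _)).
apply: (@dq_germ R _ _ f 1 (fun=> x) (fun t => t - x)).
- exact: hol_germ xr.
- by rewrite -[(t - x) *: 1]/((t - x) * 1) mulr1 subrKC; exact: hol_germ tr.
- by near=> w; exact: differentiable_cst.
- by rewrite /holo_germ; near=> w; apply: df_sub.
Unshelve. all: by end_near. Qed.

Lemma dqE1 f x t : f t = f x + (t - x) * dq f 1 x (t - x).
Proof. by rewrite -dqE -[(t - x) *: 1]/((t - x) * 1) mulr1 subrKC. Qed.

Lemma factor_root f c x (r : R) : hol c r f -> nm (x - c) < r ->
  exists2 g, hol c r g & forall t, f t = f x + (t - x) * g t.
Proof.
move=> hf xr; exists (fun t => dq f 1 x (t - x)); first exact: factor_dq.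
by move=> t; exact: dqE1.
Qed.

Lemma geom_small (K e : R) : 0 < e -> exists n, K * 2 ^- n < e.
Proof.
move=> e0; exists (Num.truncn (`|K| / e)).+1.
have h : `|K| / e < 2 ^+ (Num.truncn (`|K| / e)).+1.
  apply: (lt_trans (truncnS_gt _)); rewrite -natrX ltr_nat; exact: ltn_expl.
rewrite ltr_pdivrMr ?exprn_gt0 //; apply: (le_lt_trans (ler_norm _)).
by rewrite mulrC -ltr_pdivrMr.
Qed.

(** Divide by t - x as long as the quotient vanishes at x. If this never stops, f = (t - x)^n G_n
    for all n with |G_n| <= M s^-n on the square of half-side s = r / 3, so that |f| <= 8 M 2^-n on
    the disc of radius s / 2 = r / 6. *)
Lemma order_dich f x (r M : R) : 0 < r -> hol x r f ->
  (forall w, nm (w - x) < r -> nm (f w) <= M) ->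
  (exists n g, [/\ hol x r g, g x != 0 & forall t, f t = (t - x) ^+ n * g t]) \/
  (forall t, nm (t - x) <= r / 6 -> f t = 0).
Proof.
move=> r0 hf fM.
have xx : nm (x - x) < r by rewrite subrr nm0.
(* The quotient of g - g(x) by t - x; the default is a placeholder for functions that are not
   holomorphic. *)
pose D g := if pselect (hol x r g) is left h then
  projT1 (cid2 (factor_root h xx)) else g.
have DP g : hol x r g -> hol x r (D g) /\ forall t, g t = g x + (t - x) * D g t.
  by move=> h; rewrite /D; case: pselect => // h'; case: cid2.
pose G := fix G n := if n is n'.+1 then D (G n') else f.
have hG n : hol x r (G n) by elim: n => //= n IH; exact: (DP _ IH).1.
have GE n : (forall k, (k < n)%N -> G k x = 0) -> forall t, f t = (t - x) ^+ n * G n t.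
  elim: n => [|n IH] H t; first by rewrite expr0 mul1r.
  rewrite (IH (fun k kn => H k (ltnW kn))) (DP _ (hG n)).2 H // add0r exprSr mulrA //.
have [H|] := pselect (forall n, G n x = 0); last first.
  move=> /existsNP[n0 Hn0]; left.
  have ex : exists n, G n x != 0 by exists n0; apply/eqP.
  case: (ex_minnP ex) => n Gn Hn; exists n, (G n); split; [exact: hG|exact: Gn|].
  apply: GE => k kn; apply/eqP; apply: contraTT kn => /Hn; by rewrite -leqNgt.
right=> t tr; apply/eqP; rewrite -nm_eq0 eq_le nm_ge0 andbT; apply/ler_addgt0Pr => e e0.
rewrite add0r; have [n hn] := geom_small (8 * M) e0; apply: le_trans (ltW hn).
pose s := r / 3; have s0 : 0 < s by rewrite divr_gt0.
have bound w : onsq x s w -> nm (G n w) <= M * s ^- n.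
  move=> wo; have /andP[h1 h2] := onsq_nm wo.
  have wx : 0 < nm (w - x) by apply: lt_le_trans h1.
  have := fM w; rewrite (GE n) // nmM nmX => h.
  have {}h := h ltac:(rewrite /s in h2; lra).
  rewrite ler_pdivlMr ?exprn_gt0 // mulrC; apply: le_trans h.
  by rewrite ler_wpM2r ?nm_ge0 // lerXn2r // nnegrE ?nm_ge0 // ltW.
have hd w : nm (w - x) <= 2 * s -> differentiable (G n) w.
  by move=> h; apply: hG; rewrite /s in h; lra.
have := max_sq s0 hd bound (z := t); rewrite /s => /(_ _) h.
have {}h := h ltac:(lra); rewrite (GE n) // nmM nmX.
have ts : nm (t - x) ^+ n <= (s / 2) ^+ n.
  have ts1 : nm (t - x) <= s / 2 by rewrite /s; lra.
  by apply: lerXn2r => //; rewrite nnegrE ?nm_ge0 //; apply: le_trans ts1; exact: nm_ge0.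
apply: (le_trans (ler_pM _ _ ts h)); rewrite ?exprn_ge0 ?nm_ge0 //.
rewrite -/s expr_div_n le_eqVlt; apply/orP; left; apply/eqP; field.
by rewrite !expf_neq0 // gt_eqF.
Qed.

Lemma order_dich_germ f x : holo_germ x f ->
  (exists n g, [/\ holo_germ x g, g x != 0 & forall t, f t = (t - x) ^+ n * g t]) \/
  (\forall t \near x, f t = 0).
Proof.
move=> /hg_bounded[r [M [r0 hf fM]]]; have [[n [g [hg gx E]]]|H] := order_dich r0 hf fM.
  by left; exists n, g; split => //; apply: hol_germ hg _; rewrite subrr nm0.
right; apply/nm_nearP; exists (r / 6); first by rewrite divr_gt0.
by move=> t /ltW; exact: H.
Qed.

Lemma cont_neq0 (V : normedModType (complex R)) (f : V -> C) (x : V) :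
  {for x, continuous f} -> f x != 0 -> \forall t \near x, f t != 0.
Proof.
move=> cf fx; have f0 : 0 < nm (f x) by rewrite nm_gt0.
have [d d0 Hd] := (cont_nm _ _).1 cf _ f0; apply/nm_nearP; exists d => // w /Hd.
by apply: contraTneq => ->; rewrite sub0r nmN ltxx.
Qed.

Lemma near_punctured (P : set C) x : (\forall t \near x, P t) -> exists2 t, t != x & P t.
Proof.
move=> /nm_nearP[e e0 H]; exists (x + rc (e / 2)).
  by rewrite -subr_eq0 addrAC subrr add0r -nm_gt0 nm_real normr_gt0 gt_eqF // divr_gt0.
by apply: H; rewrite addrAC subrr add0r nm_real gtr0_norm ?divr_gt0 // ltr_pdivrMr // ltr_pMr // ltr1n.
Qed.

(** Cancelling the lower power leaves u = (t - x)^(m - n) v near x, which tends to 0 there. *)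
Lemma order_lt u v x n m : {for x, continuous u} -> {for x, continuous v} ->
  u x != 0 -> (n < m)%N ->
  ~ \forall t \near x, (t - x) ^+ n * u t = (t - x) ^+ m * v t.
Proof.
move=> cu cv ux nm' H.
have H' : \forall t \near x, t != x -> u t = (t - x) ^+ (m - n) * v t.
  near=> t => tx; have : (t - x) ^+ n * u t = (t - x) ^+ m * v t by near: t.
  rewrite -{1}(subnKC (ltnW nm')) exprD -mulrA => /mulfI; apply.
  by rewrite expf_neq0 // subr_eq0.
have u0 : 0 < nm (u x) by rewrite nm_gt0.
have u2 : 0 < nm (u x) / 2 by rewrite divr_gt0.
have [d1 d10 A1] := (cont_nm _ _).1 cu _ u2.
have [d2 d20 A2] := (cont_nm _ _).1 cv _ ltr01.
pose K := nm (v x) + 1; have K0 : 0 < K by rewrite ltr_wpDl ?nm_ge0.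
have k1 : 0 < nm (u x) / 2 / K by exact: divr_gt0.
have [e e0 He] := (nm_nearP _ _).1 H'.
pose q := Num.min (Num.min d1 d2) (Num.min (Num.min 1 e) (nm (u x) / 2 / K)).
have q0 : 0 < q by rewrite !lt_min d10 d20 ltr01 e0 k1.
have [t tx] := near_punctured (near_nm x q0).
rewrite !lt_min => /andP[/andP[/A1 b1 /A2 b2] /andP[/andP[b3 /He b5] b4]].
have {}b5 := b5 tx.
have vt : nm (v t) < K by have := nm_subge (v t) (v x); rewrite /K; clear - b2; lra.
have ut : nm (u x) / 2 < nm (u t).
  by have := nm_subge (u x) (u t); rewrite nm_sub; clear - b1; lra.
have : nm (u t) <= nm (t - x) * K.
  rewrite b5 nmM nmX; apply: ler_pM; rewrite ?exprn_ge0 ?nm_ge0 //; last exact: ltW.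
  rewrite -[leRHS]expr1 ler_wiXn2l ?nm_ge0 //; [exact: ltW|by rewrite subn_gt0].
by rewrite leNgt => /negP; apply; apply: lt_trans ut; rewrite -ltr_pdivlMr.
Unshelve. all: by end_near. Qed.

Lemma order_unique u v x n m : {for x, continuous u} -> {for x, continuous v} ->
  u x != 0 -> v x != 0 ->
  (\forall t \near x, (t - x) ^+ n * u t = (t - x) ^+ m * v t) -> n = m.
Proof.
move=> cu cv ux vx H; case: (ltngtP n m) => // nm'.
  by case: (order_lt cu cv ux nm').
by case: (order_lt cv cu vx nm'); apply: filterS H => t ->.
Qed.

Lemma order_not0 u x n : {for x, continuous u} -> u x != 0 ->
  ~ \forall t \near x, (t - x) ^+ n * u t = 0.
Proof.
move=> cu ux H; have c0 : {for x, continuous (fun=> 0 : C)} by apply: differentiable_continuous; exact: df_cst.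
apply: (order_lt cu c0 ux (ltnSn n)).
by apply: filterS H => t ->; rewrite mulr0.
Qed.

(* Propagation of vanishing along a segment by steps of a sixth of the distance
   to the boundary. *)
Lemma identity_disc f c (r M : R) : hol c r f ->
  (forall w, nm (w - c) < r -> nm (f w) <= M) ->
  (\forall t \near c, f t = 0) -> forall z, nm (z - c) < r -> f z = 0.
Proof.
move=> hf fM f0 z zr; pose s := r - nm (z - c); have s0 : 0 < s by rewrite subr_gt0.
have step y : nm (y - c) <= nm (z - c) -> (\forall t \near y, f t = 0) ->
    forall t, nm (t - y) < s / 6 -> \forall t' \near t, f t' = 0.
  move=> yz fy t ty.
  have h1 : hol y s f by apply: hol_sub hf _; rewrite /s; lra.
  have h2 w : nm (w - y) < s -> nm (f w) <= M.
    by move=> wy; apply: fM; apply: le_lt_trans (nm_tri y _ _) _; rewrite /s in wy; lra.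
  have [[n [g [hg gy E]]]|H] := order_dich s0 h1 h2.
    exfalso; apply: (@order_not0 g y n) => //.
      by apply: differentiable_continuous; apply: hg; rewrite subrr nm0.
    by apply: filterS fy => w; rewrite E.
  apply/nm_nearP; exists (s / 6 - nm (t - y)); first by rewrite subr_gt0.
  by move=> w wt; apply: H; apply: le_trans (nm_tri t _ _) _; lra.
have [N hN] : exists N : nat, nm (z - c) / (s / 6) < N%:R.
  by exists (Num.truncn (nm (z - c) / (s / 6))).+1; exact: truncnS_gt.
have s6 : 0 < s / 6 by rewrite divr_gt0.
have N0 : (0 < N)%N.
  by rewrite -(ltr_nat R); apply: le_lt_trans hN; rewrite divr_ge0 ?nm_ge0 // ltW.
have NR : 0 < N%:R :> R by rewrite ltr0n.
have NC : N%:R != 0 :> C by rewrite pnatr_eq0 -lt0n.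
pose p k : C := c + k%:R / N%:R * (z - c).
have pk k : (k <= N)%N -> nm (p k - c) <= nm (z - c).
  move=> kN; rewrite /p addrAC subrr add0r !nmM nmV !nm_nat ler_piMl ?nm_ge0 //.
  by rewrite ler_pdivrMr // mul1r ler_nat.
have H k : (k <= N)%N -> \forall t \near p k, f t = 0.
  elim: k => [_|k IH kN]; first by rewrite /p mul0r mul0r addr0.
  apply: (step (p k)); [exact: pk (ltnW kN)|exact: IH (ltnW kN)|].
  have -> : p k.+1 - p k = N%:R^-1 * (z - c).
    by rewrite /p -natr1; ring.
  by rewrite nmM nmV nm_nat mulrC ltr_pdivrMr // mulrC -ltr_pdivrMr.
have := H N (leqnn N); rewrite /p divff // mul1r subrKC.
by move=> /nbhs_singleton.
Qed.

(** The image of the ultrafilter has a cluster point in the compact set, and an ultrafilter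
    converges to its cluster points. *)
Lemma ultra_compact (T : topologicalType) I (U : set_system I) {UU : UltraFilter U}
    (A : set T) (u : I -> T) : compact A -> (\forall i \near U, A (u i)) ->
  exists2 p, A p & forall B, nbhs p B -> \forall i \near U, B (u i).
Proof.
move=> cA uA; have [|p [Ap cp]] := cA (u @ U) _; first exact: uA.
exists p => // B pB; have [//|nB] := in_ultra_setVsetC (u @^-1` B) UU.
have [q [q1 q2]] := cp (~` B) B nB pB; by [].
Qed.

Lemma ultra_real I (U : set_system I) {UU : UltraFilter U} (u : I -> R) (B : R) :
  (\forall i \near U, `|u i| <= B) ->
  exists l, forall e : R, 0 < e -> \forall i \near U, `|u i - l| < e.
Proof.
move=> uB; have [||l _ Hl] := @ultra_compact R^o I U UU `[- B, B] u.
- exact: segment_compact.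
- by apply: filterS uB => i; rewrite /= in_itv /= ler_norml.
exists l => e e0; have := Hl (ball (l : R^o) e) (nbhsx_ballx _ _ e0).
by apply: filterS => i; rewrite /ball /= distrC.
Qed.

Lemma ultra_C I (U : set_system I) {UU : UltraFilter U} (u : I -> C) (B : R) :
  (\forall i \near U, nm (u i) <= B) -> exists l : C, tends U u l.
Proof.
move=> uB.
have [a Ha] : exists l, forall e : R, 0 < e -> \forall i \near U, `|complex.Re (u i) - l| < e.
  by apply: (ultra_real (B := B)); apply: filterS uB => i; apply: le_trans; exact: nm_Re.
have [b Hb] : exists l, forall e : R, 0 < e -> \forall i \near U, `|complex.Im (u i) - l| < e.
  by apply: (ultra_real (B := B)); apply: filterS uB => i; apply: le_trans; exact: nm_Im.
exists (Complex a b) => e e0; have e2 : 0 < e / 2 by rewrite divr_gt0.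
apply: filterS2 (Ha _ e2) (Hb _ e2) => i h1 h2.
apply: le_lt_trans (nm_ReIm _) _; rewrite !raddfB /= [ltRHS]splitr; exact: ltrD.
Qed.

Lemma taylor1 f c (r M : R) : 0 < r -> hol c r f -> (forall w, nm (w - c) < r -> nm (f w) <= M) ->
  forall w, nm (w - c) <= r / 6 -> nm (f w - f c) <= 36 * M / r * nm (w - c).
Proof.
move=> r0 hf fM w wc.
rewrite (dqE1 f c w).
rewrite addrAC subrr add0r nmM mulrC ler_wpM2r ?nm_ge0 //.
have := @dq_bound R C f (1 : C) c r M r0 hf fM (w - c); rewrite nm1 !mulr1; exact.
Qed.

(** * Hurwitz's theorem *)

Section Hurwitz.
Context (I : Type) (U : set_system I) {UU : UltraFilter U}.
Variables (y : C) (rho : R).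
Hypothesis rho0 : 0 < rho.

Definition bounded_family (F : I -> C -> C) (M : R) := \forall i \near U,
  hol y rho (F i) /\ forall w, nm (w - y) < rho -> nm (F i w) <= M.

(** A common bound gives a common Lipschitz constant near [l] by [taylor1], so the argument may move
    with the index. *)
Lemma tends_diag F G M (z : I -> C) (l : C) : bounded_family F M ->
  (forall w, nm (w - y) < rho -> tends U (F^~ w) (G w)) ->
  nm (l - y) < rho -> tends U z l -> tends U (fun i => F i (z i)) (G l).
Proof.
move=> HF FG ly zl; pose s := rho - nm (l - y); have s0 : 0 < s by rewrite subr_gt0.
have [i0 [_ HM]] := @filter_ex _ U _ _ HF.
have M0 : 0 <= M by apply: le_trans (nm_ge0 _) (HM l ly).
pose K := 36 * M / s + 1; have K0 : 0 < K by rewrite ltr_wpDl // divr_ge0 ?mulr_ge0 // ltW.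
move=> e e0; have e2 : 0 < e / 2 by rewrite divr_gt0.
have d0 : 0 < Num.min (s / 6) (e / 2 / K) by rewrite lt_min !divr_gt0.
apply: filterS3 HF (FG l ly _ e2) (zl _ d0) => i [h1 h2] h3.
rewrite lt_min => /andP[z1]; rewrite ltr_pdivlMr // => z2.
have k1 : hol l s (F i) by apply: hol_sub h1 _; rewrite /s; lra.
have k2 w : nm (w - l) < s -> nm (F i w) <= M.
  by move=> wl; apply: h2; apply: le_lt_trans (nm_tri l _ _) _; rewrite /s in wl; lra.
have := taylor1 s0 k1 k2 (ltW z1) => h.
have : nm (F i (z i) - F i l) < e / 2.
  apply: le_lt_trans h _; apply: le_lt_trans z2; rewrite mulrC ler_wpM2l ?nm_ge0 //.
  by rewrite /K lerDl.
by have := nm_tri (F i l) (F i (z i)) (G l); lra.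
Qed.

(** For an ultrafilter, failing to hold for almost all indices means having counterexamples for
    almost all indices. [z] chooses one, or 0 where there is none, and boundedness provides its
    limit. *)
Lemma ultra_pick (A : set C) (P : I -> C -> Prop) (B : R) :
  (forall w, A w -> nm w <= B) ->
  ~ (\forall i \near U, forall w, A w -> ~ P i w) ->
  exists z : I -> C, exists2 l, tends U z l & \forall i \near U, A (z i) /\ P i (z i).
Proof.
move=> AB H; pose z i := if pselect (exists w, A w /\ P i w) is left h then projT1 (cid h) else 0.
have zP : \forall i \near U, A (z i) /\ P i (z i).
  have [h|h] := in_ultra_setVsetC [set i | exists w, A w /\ P i w] UU.
    by apply: filterS h => i /= hi; rewrite /z; case: pselect => // h'; case: cid.
  by exfalso; apply: H; apply: filterS h => i /= hi w Aw Pw; apply: hi; exists w.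
have zB : \forall i \near U, nm (z i) <= B by apply: filterS zP => i [/AB].
have [l zl] := ultra_C zB.
by exists z; exists l.
Qed.

Lemma nm_ball_bound (r : R) w : nm (w - y) <= r -> nm w <= r + nm y.
Proof. by move=> h; have := nm_subge w y; lra. Qed.

Lemma tends_ge (u : I -> C) (l : C) (m : R) : tends U u l ->
  (\forall i \near U, m <= nm (u i)) -> m <= nm l.
Proof.
move=> ul um; apply/ler_addgt0Pr => e e0.
have [i [h1 h2]] := near_ex2 (ul e e0) um.
by have := nm_subge (u i) l; lra.
Qed.

Lemma lim_in_ball (z : I -> C) (l : C) (r : R) : tends U z l ->
  (\forall i \near U, nm (z i - y) <= r) -> nm (l - y) <= r.
Proof. by move=> zl; apply: tends_le; apply: tendsB zl (tends_cst y). Qed.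

(** Induction on the order of the limit. For order 0, zeros of the F_i would accumulate at a zero of
    G. For positive order, almost every F_i has a zero z_i, these converge to y, and the quotients
    by w - z_i converge to G / (w - y), whose order is one less. *)
Lemma hurwitz (a : nat) F G M g : bounded_family F M ->
  (forall w, nm (w - y) < rho -> tends U (F^~ w) (G w)) ->
  {for y, continuous g} ->
  (forall w, nm (w - y) < rho -> G w = (w - y) ^+ a * g w /\ g w != 0) ->
  \forall i \near U, exists (s : seq C) (v : C -> C),
    [/\ size s = a, forall t, t \in s -> nm (t - y) <= rho / 2, hol y rho v,
        forall w, nm (w - y) <= rho / 2 -> v w != 0 &
        forall w, F i w = (\prod_(t <- s) (w - t)) * v w].
Proof.
have R0 := rho0; move=> + + cg; elim: a F G M => [|a IH] F G M HF FG Gg.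
  have [H|H] := pselect (\forall i \near U, forall w, nm (w - y) <= rho / 2 -> ~ F i w = 0).
    apply: filterS2 HF H => i [h1 _] h2; exists [::], (F i); split => //.
      by move=> w /h2 /eqP.
    by move=> w; rewrite big_nil mul1r.
  have [z [l zl zP]] := ultra_pick (@nm_ball_bound (rho / 2)) H.
  have ly : nm (l - y) <= rho / 2 by apply: (lim_in_ball zl); apply: filterS zP => i [].
  have ly' : nm (l - y) < rho by lra.
  have [] := Gg l ly'; rewrite expr0 mul1r => GE /eqP; case; rewrite -GE.
  apply: (tends_unique (tends_diag HF FG ly' zl)).
  apply: (tends_near _ (tends_cst 0)); by apply: filterS zP => i [].
have yy : nm (y - y) < rho by rewrite subrr nm0.
have Gy : G y = 0 by rewrite (Gg y yy).1 subrr expr0n mul0r.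
have G0 w : nm (w - y) < rho -> G w = 0 -> w = y.
  move=> wy Gw; apply/eqP; rewrite -subr_eq0; have [E gw] := Gg w wy.
  by move: Gw; rewrite E => /eqP; rewrite mulf_eq0 (negbTE gw) orbF expf_eq0.
have r4 : 0 < rho / 4 by rewrite divr_gt0.
have nz : ~ \forall i \near U, forall w, nm (w - y) <= rho / 2 -> ~ F i w = 0.
  move=> NZ.
  (* If |F_i| > 16 |F_i(y)| on the whole square, [max_sq] for 1 / F_i would give 1 <= 8 / 16. So the
     square contains points where F_i is small, and their limit is a second zero of G. *)
  have H : ~ \forall i \near U, forall w, onsq y (rho / 4) w -> ~ nm (F i w) <= 16 * nm (F i y).
    move=> H; have [i [[[h1 h2] h3] h4]] := near_ex2 (filterI HF NZ) H.
    have y2 : nm (y - y) <= rho / 2 by rewrite subrr nm0 divr_ge0 // ltW.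
    have Fy : 0 < nm (F i y) by rewrite nm_gt0; apply/eqP; exact: h3.
    have : nm ((F i y)^-1 : C) <= 8 * (16 * nm (F i y))^-1.
      apply: (@max_sq _ (fun w => (F i w)^-1 : C) y (rho / 4) _ r4).
      - move=> w wy; apply: dfV; first by apply: h1; lra.
        by apply/eqP; apply: h3; lra.
      - move=> w wo; rewrite nmV; have /negP := h4 w wo; rewrite -ltNge => hw.
        have F16 : 0 < 16 * nm (F i y) by rewrite mulr_gt0.
        by rewrite lef_pV2 ?posrE //; [exact: ltW|exact: lt_trans hw].
      - by rewrite subrr nm0 divr_ge0 // ltW.
    rewrite nmV invfM mulrA => hh; have Fv : 0 < (nm (F i y))^-1 by rewrite invr_gt0.
    by lra.
  have AB w : onsq y (rho / 4) w -> nm w <= rho / 2 + nm y.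
    by move=> /onsq_nm/andP[_ h]; apply: nm_ball_bound; lra.
  have [z [l zl zP]] := ultra_pick AB H.
  have ly : nm (l - y) <= rho / 2.
    by apply: (lim_in_ball zl); apply: filterS zP => i [/onsq_nm/andP[_ h] _]; lra.
  have ly' : nm (l - y) < rho by lra.
  have lge : rho / 4 <= nm (l - y).
    apply: (tends_ge (tendsB zl (tends_cst y))).
    by apply: filterS zP => i [/onsq_nm/andP[]].
  have E : l = y.
    apply: (G0 _ ly'); apply/eqP; rewrite -nm_eq0 eq_le nm_ge0 andbT.
    have T : tends U (fun i => F i (z i)) (G l) := tends_diag HF FG ly' zl.
    have T0 : tends U (fun i => F i y) 0 by rewrite -Gy; exact: FG.
    apply/ler_addgt0Pr => e e0; rewrite add0r.
    apply: (tends_le T); have e16 : 0 < e / 16 by rewrite divr_gt0.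
    by apply: filterS2 (T0 _ e16) zP => i; rewrite subr0 => h [_ h']; lra.
  by move: lge; rewrite E subrr nm0; lra.
have [z [l zl zP]] := ultra_pick (@nm_ball_bound (rho / 2)) nz.
have ly : nm (l - y) <= rho / 2 by apply: (lim_in_ball zl); apply: filterS zP => i [].
have ly' : nm (l - y) < rho by lra.
have El : l = y.
  apply: (G0 _ ly'); apply: (tends_unique (tends_diag HF FG ly' zl)).
  by apply: (tends_near _ (tends_cst 0)); apply: filterS zP => i [].
move: zl; rewrite El => zy {ly ly' El l}.
have [i0 [_ HM]] := @filter_ex _ U _ _ HF.
have M0 : 0 <= M by apply: le_trans (nm_ge0 _) (HM y yy).
(* [dq_bound] on the radius rho / 2 gives 72 M / rho for w within rho / 12 of z_i; farther away the
   quotient is at most 12 M / rho. *)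
pose Gf i t : C := dq (F i) 1 (z i) (t - z i); pose K := 72 * M / rho.
have K0 : 0 <= K by rewrite /K !mulr_ge0 // invr_ge0 ltW.
have Gfb : bounded_family Gf K.
  apply: filterS2 HF zP => i [h1 h2] [h3 h4]; have h3' : nm (z i - y) < rho by lra.
  split; first exact: factor_dq.
  move=> w wy; have r2 : 0 < rho / 2 by rewrite divr_gt0.
  have k1 : hol (z i) (rho / 2) (F i) by apply: hol_sub h1 _; lra.
  have k2 (u : C) : nm (u - z i) < rho / 2 -> nm (F i u) <= M.
    by move=> ui; apply: h2; apply: le_lt_trans (nm_tri (z i) _ _) _; lra.
  have [wz|wz] := leP (nm (w - z i)) (rho / 12).
    have := @dq_bound R C (F i) (1 : C) (z i) (rho / 2) M r2 k1 k2 (w - z i).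
    rewrite nm1 !mulr1 => /(_ _) hh; apply: (le_trans (hh _)); first by lra.
    by rewrite /K le_eqVlt; apply/orP; left; apply/eqP; field; rewrite gt_eqF.
  have := h2 w wy; rewrite (dqE1 (F i) (z i) w) h4 add0r nmM => h.
  have := nm_ge0 (Gf i w); rewrite /K ler_pdivlMr // -/(Gf i w) in h *.
  by move=> hp; rewrite -/(Gf i w); nra.
pose G' w : C := (w - y) ^+ a * g w.
have GG' w : nm (w - y) < rho -> G w = (w - y) * G' w.
  by move=> wy; rewrite (Gg w wy).1 exprS mulrA.
have conv1 w : nm (w - y) < rho -> w != y -> tends U (Gf^~ w) (G' w).
  move=> wy wny; have w0 : w - y != 0 by rewrite subr_eq0.
  have T : tends U (fun i => (w - y)^-1 * (F i w + (z i - y) * Gf i w)) ((w - y)^-1 * (G w + 0)).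
    apply: tendsM; first exact: tends_cst.
    apply: tendsD; first exact: FG.
    move=> e e0; have K1 : 0 < K + 1 by rewrite ltr_wpDl.
    apply: filterS2 Gfb (zy _ (divr_gt0 e0 K1)) => i [_ hb]; rewrite ltr_pdivlMr // => hz.
    rewrite subr0 nmM; apply: le_lt_trans hz; apply: ler_wpM2l; first exact: nm_ge0.
    by apply: le_trans (hb w wy) _; rewrite lerDl.
  move: T; rewrite addr0 GG' // mulKf // => T; apply: tends_near T.
  apply: filterS zP => i [_ h4]; rewrite {1}(dqE1 (F i) (z i) w) h4 add0r -mulrDl.
  by rewrite addrA subrK mulKf.
have cG' : {for y, continuous G'}.
  have c1 : {for y, continuous (fun w : C => (w - y) ^+ a : C)}.
    by apply: differentiable_continuous; apply: dfX; exact: df_sub.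
  exact: (@continuousM _ _ _ _ y c1 cg).
(* At w = y one cannot divide by w - y; equicontinuity carries the limit over from a nearby point
   t. *)
have conv w : nm (w - y) < rho -> tends U (Gf^~ w) (G' w).
  move=> wy; have [{w wy}->|] := eqVneq w y; last exact: conv1.
  move=> e e0; have e3 : 0 < e / 3 by rewrite divr_gt0.
  have [d d0 Hd] := (cont_nm _ _).1 cG' _ e3.
  pose L := 36 * K / rho + 1; have L0 : 0 < L by rewrite ltr_wpDl // !mulr_ge0 // ?invr_ge0 ltW.
  have q0 : 0 < Num.min (Num.min d (e / 3 / L)) (rho / 6) by rewrite !lt_min d0 !divr_gt0.
  have [t ty] := near_punctured (near_nm y q0).
  rewrite !lt_min => /andP[/andP[t1 t2] t3].
  have ty' : nm (t - y) < rho by lra.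
  apply: filterS2 Gfb (conv1 t ty' ty _ e3) => i [h1 h2] h3.
  have h4 := taylor1 rho0 h1 h2 (ltW t3); have h5 := Hd t t1.
  move: t2; rewrite ltr_pdivlMr // => t2.
  have h6 : 36 * K / rho * nm (t - y) <= nm (t - y) * L.
    by rewrite mulrC ler_wpM2l ?nm_ge0 // lerDl.
  have k1 := nm_tri (Gf i t) (Gf i y) (G' y); have k2 := nm_tri (G' t) (Gf i t) (G' y).
  by rewrite (nm_sub (Gf i y) (Gf i t)) in k1; clear - k1 k2 h3 h4 h5 h6 t2; lra.
have := IH Gf G' K Gfb conv (fun w wy => conj erefl (Gg w wy).2).
apply: filterS2 zP => i [h1 h2] [s [v [s1 s2 s3 s4 s5]]].
exists (z i :: s), v; split => //=; first by rewrite s1.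
- by move=> t; rewrite inE => /orP[/eqP->|/s2].
- move=> w; rewrite (dqE1 (F i) (z i) w) h2 add0r big_cons -/(Gf i w) s5.
  by rewrite mulrA.
Qed.

End Hurwitz.

End OneVariable.

(** * Germs of holomorphic functions *)

Section RowVectors.
Variable R : realType.
Local Notation C := (CC R).
Local Notation rc := (real_complex R).

Lemma nm_mx n (x : 'rV[C]_n) : nm x = complex.Re (mx_norm x).
Proof. by []. Qed.

Lemma nm_coord n (x : 'rV[C]_n) i : nm (x 0 i : C) <= nm x.
Proof.
have : `|x 0 i| <= mx_norm x.
  have := lexx (mx_norm x); rewrite !mx_normE num_le => /bigmax_leP[_ H].
  by have := H (0, i) isT; rewrite -num_le /=.
by rewrite -[mx_norm x]/(`|x|) !nmE lecR.
Qed.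

Lemma nm_row_lt n (x : 'rV[C]_n) (r : R) : 0 < r ->
  (forall i, nm (x 0 i : C) < r) -> nm x < r.
Proof.
move=> r0 H; rewrite nm_mx; have [->|x0] := eqVneq (mx_norm x) 0; first by [].
by have [[i j] /= ->] := mx_norm_neq0 x0; rewrite (ord1 i) H.
Qed.

Lemma nm_row_le n (x : 'rV[C]_n) (r : R) : 0 <= r ->
  (forall i, nm (x 0 i : C) <= r) -> nm x <= r.
Proof.
move=> r0 H; apply/ler_addgt0Pr => e e0; apply/ltW/nm_row_lt; first by lra.
by move=> i; have := H i; lra.
Qed.

Lemma df_row (W : normedModType (complex R)) n (F : W -> 'rV[C]_n) w :
  (forall i, differentiable (fun w => F w 0 i : C) w) -> differentiable F w.
Proof.
move=> dF.
have -> : F = \sum_i (fun w => F w 0 i *: delta_mx 0 i : 'rV[C]_n).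
  by apply/funext => v; rewrite fct_sumE; exact: row_sum_delta.
apply: differentiable_sum => i.
exact: differentiableZl.
Qed.

Lemma holo_row (W : normedModType (complex R)) n (g : W -> 'rV[C]_n) y :
  (forall j, holo_germ y (fun x => g x 0 j : C)) -> \forall x \near y, differentiable g x.
Proof. by move=> /filter_forall H; apply: filterS H => x Hx; exact: df_row. Qed.

Lemma row_near (W : normedModType (complex R)) n (g : W -> 'rV[C]_n) y (d : R) : 0 < d ->
  (forall j, holo_germ y (fun x => g x 0 j : C)) -> \forall x \near y, nm (g x - g y) < d.
Proof.
move=> d0 /holo_row/nbhs_singleton/differentiable_continuous/cont_nm/(_ d d0)[r r0 H].
by apply: filterS (near_nm y r0).
Qed.

End RowVectors.

(** * Division by powers of the coordinates *)

Section Decomposition.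
Variables (R : realType) (n : nat).
Local Notation C := (CC R).
Local Notation rc := (real_complex R).
Local Notation V := 'rV[C]_n.
Variable y : V.
Implicit Types (x w : V) (i j : 'I_n) (h : V -> C).

Definition upd i x : V := x - (x 0 i - y 0 i) *: delta_mx 0 i.
(* Division of [h] by the i-th coordinate: [upd i] replaces it by [y 0 i]. *)
Definition Dop i h x : C := dq h (delta_mx 0 i) (upd i x) (x 0 i - y 0 i).

Lemma updE i x j : upd i x 0 j = if j == i then y 0 i else x 0 j.
Proof.
rewrite !mxE eqxx /=; case: eqVneq => [->|_] /=; last by rewrite mulr0 subr0.
by rewrite mulr1 subKr.
Qed.

Lemma upd_lineE i x (t : C) j :
  (upd i x + t *: delta_mx 0 i) 0 j = if j == i then y 0 i + t else x 0 j.
Proof.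
have -> : (upd i x + t *: delta_mx 0 i) 0 j = upd i x 0 j + t * (j == i)%:R.
  by rewrite !mxE eqxx.
by rewrite updE; case: ifP => _ /=; rewrite ?mulr1 // mulr0 addr0.
Qed.

Lemma lineE i x (t : C) j :
  (upd i x + t *: delta_mx 0 i - y) 0 j = if j == i then t else x 0 j - y 0 j.
Proof.
have -> : (upd i x + t *: delta_mx 0 i - y) 0 j = (upd i x + t *: delta_mx 0 i) 0 j - y 0 j.
  by rewrite mxE [X in _ + X]mxE.
by rewrite upd_lineE; case: eqP => [->|//]; rewrite addrAC subrr add0r.
Qed.

Lemma updBE i x j : (upd i x - y) 0 j = if j == i then 0 else x 0 j - y 0 j.
Proof. by rewrite -lineE scale0r addr0. Qed.

Lemma DopE i h x : h x = h (upd i x) + (x 0 i - y 0 i) * Dop i h x.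
Proof. by rewrite /Dop -dqE /upd subrK. Qed.

Lemma upd_ball i x rho : 0 < rho -> nm (x - y) < rho -> nm (upd i x - y) < rho.
Proof.
move=> r0 H; apply: nm_row_lt => // j; rewrite updBE; case: ifP => _; first by rewrite nm0.
by apply: le_lt_trans H; have := nm_coord (x - y) j; rewrite !mxE.
Qed.

Lemma df_upd i w : differentiable (upd i) w.
Proof.
apply: df_row => j; apply: (@df_near _ _ (fun w : V => if j == i then y 0 i else w 0 j : C)).
  by near=> x; rewrite updE.
by case: eqP => _; [exact: df_cst | exact: differentiable_coord].
Unshelve. all: by end_near.
Qed.

Lemma Dop_hol i h rho : hol y rho h -> hol y rho (Dop i h).
Proof.
move=> hh x xr; have r0 : 0 < rho by apply: le_lt_trans xr; exact: nm_ge0.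
suff : holo_germ x (Dop i h) by exact: nbhs_singleton.
apply: dq_germ.
- exact: hol_germ hh (upd_ball _ _ _).
- by rewrite /upd subrK; exact: hol_germ hh _.
- by near=> w; exact: df_upd.
- near=> w; apply: dfB; last exact: df_cst.
  exact: differentiable_coord.
Unshelve. all: by end_near. Qed.

(** The ball of the maximum norm contains the line through x in direction i up to radius rho, so
    [dq_bound] in one variable applies when the coordinate is at most rho / 6. Otherwise the
    quotient is at most 2 M divided by rho / 6. No radius is lost, so division can be iterated. *)
Lemma Dop_bound i h rho M : 0 < rho -> hol y rho h ->
  (forall x, nm (x - y) < rho -> nm (h x) <= M) ->
  forall x, nm (x - y) < rho -> nm (Dop i h x) <= 36 * M / rho.
Proof.
move=> r0 hh hM x xr.
have line t : nm (t : C) < rho -> nm (upd i x + t *: delta_mx 0 i - y) < rho.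
  move=> tr; apply: nm_row_lt => // j; rewrite lineE; case: ifP => _ //; apply: le_lt_trans xr.
  by have := nm_coord (x - y) j; rewrite !mxE.
pose T (t : C) := h (upd i x + t *: delta_mx 0 i).
have dl t : nm (t : C) < rho -> differentiable T t.
  move=> tr; apply: (df_comp (f := fun t : C => upd i x + t *: delta_mx 0 i)).
    exact: df_line.
  exact/hh/line.
have -> : Dop i h x = dq T 1 0 (x 0 i - y 0 i).
  rewrite /Dop /dq /T add0r scale0r addr0 [_ *: 1]mulr1; case: eqP => // _.
  rewrite -d_line; last exact/hh/upd_ball.
  rewrite -derive1_diff //; apply: dl; by rewrite nm0.
have xi : nm (x 0 i - y 0 i : C) < rho.
  by apply: le_lt_trans xr; have := nm_coord (x - y) i; rewrite !mxE.
have [small|big] := leP (nm (x 0 i - y 0 i : C)) (rho / 6).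
  have := @dq_bound _ _ T 1 0 rho M r0; rewrite nm1 mulr1; apply.
  - by move=> w; rewrite subr0; exact: dl.
  - by move=> w; rewrite subr0 => wr; exact/hM/line.
  - by rewrite mulr1.
have M0 : 0 <= M by apply: le_trans (hM x xr); exact: nm_ge0.
have t0 : x 0 i - y 0 i != 0 by rewrite -nm_gt0; apply: lt_trans big; lra.
rewrite /dq (negbTE t0) nmM nmV; set u := nm _ in big *.
have up : 0 < u by lra.
rewrite ler_pdivrMl //; apply: (@le_trans _ _ (M + M)).
  apply: le_trans (nmB _ _) _; apply: lerD; apply/hM/line.
    by rewrite add0r [_ *: 1]mulr1.
  by rewrite nm0.
have -> : u * (36 * M / rho) = M * (36 * (u / rho)) by ring.
have : 1 <= 6 * (u / rho) by rewrite mulrA ler_pdivlMr //; lra.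
by move: (u / rho) M0 => v; nra.
Qed.

Lemma d1_near (f g : C -> C) z : (\forall t \near z, f t = g t) -> derive1 f z = derive1 g z.
Proof. by move=> e; rewrite !derive1E; exact: near_eq_derive. Qed.

Section Ball.
Variable rho : R.
Hypothesis rho0 : 0 < rho.

Definition indep (S : pred 'I_n) h := forall x w, nm (x - y) < rho -> nm (w - y) < rho ->
  (forall j, ~~ S j -> x 0 j = w 0 j) -> h x = h w.

Lemma indep_upd S i h : indep S h -> indep (fun j => (j == i) || S j) (fun x => h (upd i x)).
Proof.
move=> ih x w xr wr xw; apply: ih; try exact: upd_ball.
move=> j Sj; rewrite !updE; case: eqVneq => // ji.
by apply: xw; rewrite negb_or ji.
Qed.

Lemma indep_Dop S i h : hol y rho h -> ~~ S i -> indep S h -> indep S (Dop i h).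
Proof.
move=> hh Si ih x w xr wr xw.
have line z t : nm (z - y) < rho -> nm (t : C) < rho ->
    nm (upd i z + t *: delta_mx 0 i - y) < rho.
  move=> zr tr; apply: nm_row_lt => // j.
  rewrite lineE; case: ifP => _ //; apply: le_lt_trans zr.
  by have := nm_coord (z - y) j; rewrite !mxE.
have e t : nm (t : C) < rho ->
    h (upd i x + t *: delta_mx 0 i) = h (upd i w + t *: delta_mx 0 i).
  move=> tr; apply: ih; try exact: line.
  move=> k Sk; refine (etrans (upd_lineE i x t k) (etrans _ (esym (upd_lineE i w t k)))).
  rewrite (xw k Sk); reflexivity.
have xwi : x 0 i = w 0 i by exact: xw.
rewrite /Dop /dq xwi; case: eqP => [z0|_].
  have dx := hh _ (upd_ball i rho0 xr); have dw := hh _ (upd_ball i rho0 wr).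
  refine (etrans (etrans (esym (d_line _ dx)) (d1_near _)) (d_line _ dw)).
  apply: filterS (near_nm (0 : C) rho0) => t; rewrite subr0; exact: e.
have wi : nm (w 0 i - y 0 i : C) < rho.
  by apply: le_lt_trans wr; have := nm_coord (w - y) i; rewrite !mxE.
have e0 : h (upd i x) = h (upd i w).
  by have := e 0; rewrite !scale0r !addr0; apply; rewrite nm0.
exact: (congr2 (fun a b : C => (w 0 i - y 0 i)^-1 * (a - b)) (e _ wi) e0).
Qed.

Lemma Dop_power i h N x : h x =
  \sum_(l < N) (x 0 i - y 0 i) ^+ l * iter l (Dop i) h (upd i x) +
  (x 0 i - y 0 i) ^+ N * iter N (Dop i) h x.
Proof.
elim: N => [|N IH]; first by rewrite big_ord0 add0r expr0 mul1r.
rewrite {1}IH big_ord_recr /= -addrA; congr (_ + _).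
by rewrite {1}(DopE i (iter N (Dop i) h)) mulrDr mulrA -exprSr.
Qed.

Definition bded h (M : R) := hol y rho h /\ forall x, nm (x - y) < rho -> nm (h x) <= M.

Lemma iter_Dop_bded i h M l : bded h M -> bded (iter l (Dop i) h) ((36 / rho) ^+ l * M).
Proof.
move=> hM; elim: l => [|l [IH1 IH2]] /=; first by rewrite expr0 mul1r.
split; first exact: Dop_hol.
move=> x xr; apply: le_trans (Dop_bound i rho0 IH1 IH2 xr) _.
by rewrite exprS le_eqVlt; apply/orP; left; apply/eqP; ring.
Qed.

Lemma bded_upd i h M : bded h M -> bded (fun x => h (upd i x)) M.
Proof.
move=> [h1 h2]; split => x xr; last exact/h2/upd_ball.
apply: (df_comp (f := upd i)); first exact: df_upd.
exact/h1/upd_ball.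
Qed.

Hypothesis rho1 : rho <= 1.

Lemma nm_coord_ball x i : nm (x - y) < rho -> nm (x 0 i - y 0 i : C) < rho.
Proof. by apply: le_lt_trans; have := nm_coord (x - y) i; rewrite !mxE. Qed.

Lemma bded_mono i l : bded (fun x => (x 0 i - y 0 i) ^+ l) 1.
Proof.
split=> x xr.
  by apply: dfX; apply: dfB; [exact: differentiable_coord | exact: df_cst].
rewrite nmX exprn_ile1 ?nm_ge0 //; apply/ltW/(lt_le_trans (nm_coord_ball i xr)).
exact: rho1.
Qed.

Lemma bdedM h k M M' : bded h M -> bded k M' -> bded (fun x => h x * k x) (M * M').
Proof.
move=> [h1 h2] [k1 k2]; split => x xr; first by apply: dfM; [exact: h1 | exact: k1].
by rewrite nmM ler_pM ?nm_ge0 ?h2 ?k2.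
Qed.

Lemma bded_sum (J : finType) (f : J -> V -> C) M : (forall a, bded (f a) M) ->
  bded (fun x => \sum_a f a x) (M *+ #|J|).
Proof.
move=> hM; split => x xr; first by apply: df_sum => a _; exact: (hM a).1.
apply: le_trans (nm_sum _ _ _) _; rewrite -sumr_const; apply: ler_sum => a _.
exact: (hM a).2.
Qed.

Lemma bded_le h M M' : M <= M' -> bded h M -> bded h M'.
Proof. by move=> MM [h1 h2]; split => // x xr; apply: le_trans MM; exact: h2. Qed.

Definition pow_max (a : R) N := \sum_(l < N.+1) a ^+ l.

Lemma pow_maxP (a : R) N l : 0 <= a -> (l <= N)%N -> a ^+ l <= pow_max a N.
Proof.
move=> a0 lN; rewrite /pow_max (bigD1 (Ordinal (lN : (l < N.+1)%N))) //= lerDl.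
by apply: sumr_ge0 => i _; exact: exprn_ge0.
Qed.

End Ball.

(** One coordinate at a time: [Dop_power] expands each coefficient in the k-th coordinate up to the
    exponent N k, and the new coefficients no longer depend on it. For k = n they are constant on
    the ball. The monomials do not depend on rho, and the bound [K] does not depend on h, which
    permits iteration. *)
Lemma decomp (N : 'I_n -> nat) : (forall i, 0 < N i)%N -> forall k, (k <= n)%N ->
  exists (J : finType) (e : J -> V -> C),
  [/\ (exists a, forall x, e a x = 1), (forall a, exists m : 'I_n -> nat,
     (forall i, m i < N i /\ (k <= i -> m i = 0))%N /\ forall x, e a x = \prod_i (x 0 i - y 0 i) ^+ m i) &
 
  forall rho, 0 < rho -> rho <= 1 ->
  (forall a, bded rho (e a) 1) /\
  exists (K : R) (A : (V -> C) -> J -> V -> C) (Q : (V -> C) -> 'I_n -> V -> C),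
  0 <= K /\ forall h M, bded rho h M ->
       [/\ forall a, bded rho (A h a) (K * M), forall i, bded rho (Q h i) (K * M),
           forall a, indep rho (fun j => (j < k)%N) (A h a) &
           forall x, h x = \sum_a A h a x * e a x +
             \sum_i (x 0 i - y 0 i) ^+ N i * Q h i x]].
Proof.
move=> N0; elim=> [_|k IH kn].
  exists unit, (fun _ _ => 1); split.
  - by exists tt.
  - move=> _; exists (fun=> 0%N); split=> [i|x]; first by split; first exact: N0.
    by rewrite big1 // => i _; rewrite expr0.
  move=> rho rho0 rho1; split.
    by move=> _; split=> x xr; [exact: df_cst | rewrite nm1].
  exists 1, (fun h _ => h), (fun _ _ _ => 0); split; first exact: ler01.
  move=> h M hM; split.
    + by move=> _; rewrite mul1r.
    + move=> i; split=> x xr; first exact: df_cst.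
      by rewrite nm0 mul1r; apply: le_trans (hM.2 _ xr); exact: nm_ge0.
    + move=> _ x w xr wr xw; congr h; apply/rowP => j; exact: xw.
    + move=> x; rewrite big_const card_unit /= mulr1 addr0 big1 ?addr0 // => i _.
      by rewrite mulr0.
have [J [e [[a0 ea0] e1 H0]]] := IH (ltnW kn).
pose i0 := Ordinal kn.
exists (J * 'I_(N i0))%type, (fun (al : J * 'I_(N i0)) x => e al.1 x * (x 0 i0 - y 0 i0) ^+ al.2).
split.
- by exists (a0, Ordinal (N0 i0)) => x; rewrite ea0 mul1r.
- move=> [a l] /=; have [m [mN em]] := e1 a.
  exists (fun i => if i == i0 then l : nat else m i); split=> [i|x].
    case: eqVneq => [->|ii0]; first by rewrite ltn_ord ltnn.
    split=> [|ki]; first exact: (mN i).1.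
    by apply: (mN i).2; exact: ltnW.
  have mi0 : m i0 = 0%N by apply: (mN i0).2.
  rewrite em (bigD1 i0) //= mi0 expr0 mul1r mulrC [RHS](bigD1 i0) //= eqxx; congr (_ * _).
  by apply: eq_bigr => i /negbTE ->.
move=> rho rho0 rho1; have [be [K [A [Q [K0 H]]]]] := H0 rho rho0 rho1.
split.
  by move=> [a l]; rewrite -[1]mulr1; apply: bdedM => //; exact: bded_mono.
pose B := pow_max (36 / rho) (N i0).
have r36 : 0 <= 36 / rho by rewrite divr_ge0 // ltW.
have B1 : 1 <= B by have := pow_maxP (N := N i0) r36 (leq0n _); rewrite expr0.
exists (B * K *+ #|J| + B * K),
  (fun h (al : J * 'I_(N i0)) x => iter al.2 (Dop i0) (A h al.1) (upd i0 x)),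
  (fun h i x => if i == i0 then Q h i x + \sum_a iter (N i0) (Dop i0) (A h a) x * e a x
                else Q h i x).
have BK : 0 <= B * K by nra.
have BKJ : 0 <= B * K *+ #|J| by rewrite mulrn_wge0.
split; first by rewrite addr_ge0.
move=> h M hM; have [H1 H2 H3 H4] := H h M hM.
have M0 : 0 <= M by apply: le_trans (hM.2 y _); rewrite ?nm_ge0 // subrr nm0.
have bit a l : (l <= N i0)%N -> bded rho (iter l (Dop i0) (A h a)) (B * K * M).
  move=> lN; apply: bded_le (iter_Dop_bded rho0 i0 l (H1 a)).
  by rewrite mulrA ler_wpM2r // ler_wpM2r // pow_maxP.
split.
- move=> [a l] /=; apply: bded_le (bded_upd rho0 i0 (bit a l (ltnW (ltn_ord l)))).
  by rewrite ler_wpM2r // lerDr.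
- move=> i; case: eqP => _; last first.
    apply: bded_le (H2 i); rewrite ler_wpM2r //; nra.
  have b2 : bded rho (fun x => \sum_a iter (N i0) (Dop i0) (A h a) x * e a x) (B * K * M * 1 *+ #|J|).
    by apply: bded_sum => a; apply: bdedM => //; exact: bit.
  split=> x xr; first by apply: dfD; [exact: (H2 i).1 | exact: b2.1].
  apply: le_trans (nmD _ _) _; rewrite addrC mulrDl; apply: lerD.
    by apply: le_trans (b2.2 _ xr) _; rewrite mulr1 mulrnAl.
  apply: le_trans ((H2 i).2 _ xr) _; rewrite ler_wpM2r //; nra.
- move=> [a l] /=.
  have ii : indep rho (fun j => (j < k)%N) (iter l (Dop i0) (A h a)).
    elim: (l : nat) (ltnW (ltn_ord l)) => [|m IHm] mN /=; first exact: H3.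
    by apply: (indep_Dop rho0); [exact: (bit _ _ (ltnW mN)).1 | rewrite ltnn | exact/IHm/ltnW].
  move=> x w xr wr xw; apply: (indep_upd rho0 ii) => // j.
  by rewrite negb_or => /andP[ji jk]; apply: xw; rewrite ltnS leq_eqVlt negb_or ji.
move=> x; rewrite {1}H4.
have -> : \sum_a A h a x * e a x =
    \sum_(al : J * 'I_(N i0)) iter al.2 (Dop i0) (A h al.1) (upd i0 x) *
      (e al.1 x * (x 0 i0 - y 0 i0) ^+ al.2) +
    (x 0 i0 - y 0 i0) ^+ N i0 * \sum_a iter (N i0) (Dop i0) (A h a) x * e a x.
  rewrite mulr_sumr -(pair_big xpredT xpredT (fun a (l : 'I_(N i0)) =>
    iter l (Dop i0) (A h a) (upd i0 x) * (e a x * (x 0 i0 - y 0 i0) ^+ l))) /=.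
  rewrite -big_split /=; apply: eq_bigr => a _.
  rewrite (Dop_power i0 (A h a) (N i0) x) mulrDl mulr_suml mulrA; congr (_ + _).
  by apply: eq_bigr => l _; ring.
rewrite -addrA; congr (_ + _).
rewrite addrC [in RHS](bigD1 i0) //= eqxx mulrDr (bigD1 i0) //= -!addrA; congr (_ + _).
by rewrite addrC; congr (_ + _); apply: eq_bigr => i /negbTE ->.
Qed.

Lemma bdedS rho r h M : r <= rho -> bded rho h M -> bded r h M.
Proof. by move=> rr [h1 h2]; split=> x xr; [apply: h1 | apply: h2]; apply: lt_le_trans rr. Qed.

Lemma bded_germs (J : finType) (f : J -> V -> C) : (forall a, holo_germ y (f a)) ->
  exists rho M, [/\ 0 < rho, rho <= 1, 0 <= M & forall a, bded rho (f a) M].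
Proof.
move=> hf.
have /choice[r hr] a : exists p : R * R, 0 < p.1 /\ bded p.1 (f a) p.2.
  by have [r [M [r0 h1 h2]]] := hg_bounded (hf a); exists (r, M).
exists (\big[Num.min/1]_a (r a).1), (\sum_a `|(r a).2|); split.
- elim/big_ind: _ => [|u v u0 v0|a _]; [by [] | by rewrite lt_min u0 | exact: (hr a).1].
- exact: bigmin_le_id.
- by apply: sumr_ge0 => a _.
- move=> a; apply: (@bdedS (r a).1); first exact: bigmin_le_cond.
  apply: bded_le (hr a).2; rewrite (bigD1 a) //=; apply: le_trans (ler_norm _) _.
  by rewrite lerDl; apply: sumr_ge0 => k _.
Qed.

End Decomposition.

(** * Finiteness over functions whose ideal contains powers of the coordinates *)

Section FiniteDivision.
Variables (R : realType) (n m : nat).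
Local Notation C := (CC R).
Local Notation V := 'rV[C]_n.
Variables (y : V) (J : finType) (b : 'rV[C]_m) (A : (V -> C) -> J -> V -> C)
  (S : (V -> C) -> 'I_m -> V -> C) (e : J -> V -> C) (rho L : R).
Hypothesis AS : forall h M, bded y rho h M ->
  (forall a, nm (A h a y) <= L * M) /\ forall j, bded y rho (S h j) (L * M).

(** Partial sums of power series in t - b. The remainder of a division is a combination of the g_j -
    b_j with coefficients [S h j], which are divided in turn, k times over; [A h a y] is the
    constant term. *)
Fixpoint coef k h a (t : 'rV[C]_m) : C :=
  if k is k'.+1 then A h a y + \sum_j (t 0 j - b 0 j) * coef k' (S h j) a t else 0.

Lemma coef_df k h a t : differentiable (coef k h a) t.
Proof.
elim: k h => [|k IH] h /=; first exact: df_cst.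
apply: dfD; first exact: df_cst.
apply: df_sum => j _; apply: dfM; last exact: IH.
apply: dfB; [exact: differentiable_coord | exact: df_cst].
Qed.

Definition small t := nm (t - b) * (m%:R * L) <= 1 / 2.

Lemma small_sum t (u : 'I_m -> C) M : small t -> (forall j, nm (u j) <= L * M) -> 0 <= M ->
  nm (\sum_j (t 0 j - b 0 j) * u j) <= M / 2.
Proof.
move=> st uM M0; apply: le_trans (nm_sum _ _ _) _.
apply: (@le_trans _ _ (\sum_(j < m) nm (t - b) * (L * M))).
  apply: ler_sum => j _; rewrite nmM ler_pM ?nm_ge0 //.
  by have := nm_coord (t - b) j; rewrite !mxE.
rewrite sumr_const card_ord -[leLHS]mulr_natr; move: st; rewrite /small => st.
have -> : nm (t - b) * (L * M) * m%:R = nm (t - b) * (m%:R * L) * M by ring.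
by move: (nm (t - b) * _) st => v; nra.
Qed.

Lemma coef_bound k h a t M : bded y rho h M -> small t -> nm (coef k h a t) <= 2 * (L * M).
Proof.
elim: k h M => [|k IH] h M hM st /=.
  have := nm_ge0 (A h a y); have [/(_ a) + _] := AS hM.
  by rewrite nm0; lra.
have [/(_ a) AM SM] := AS hM.
have LM : 0 <= L * M by apply: le_trans AM; exact: nm_ge0.
apply: le_trans (nmD _ _) _.
have : nm (\sum_j (t 0 j - b 0 j) * coef k (S h j) a t) <= (2 * (L * M)) / 2.
  apply: small_sum => // [j|]; last lra.
  apply: le_trans (IH _ _ (SM j) st) _; rewrite mulrCA; lra.
by lra.
Qed.

(** For [small (g x)], each round of division halves the bound for the remainder. *)
Lemma coef_error (g : V -> 'rV[C]_m) x k h M : bded y rho h M -> small (g x) ->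
  nm (x - y) < rho ->
  (forall h M, bded y rho h M ->
     h x = \sum_a A h a y * e a x + \sum_j (g x 0 j - b 0 j) * S h j x) ->
  nm (h x - \sum_a coef k h a (g x) * e a x) <= M * 2 ^- k.
Proof.
move=> hM sg xr E; elim: k h M hM => [|k IH] h M hM /=.
  rewrite big1 ?subr0 ?expr0 ?invr1 ?mulr1; first exact: hM.2.
  by move=> a _; rewrite mul0r.
have [_ SM] := AS hM.
have -> : h x - \sum_a (A h a y + \sum_j (g x 0 j - b 0 j) * coef k (S h j) a (g x)) * e a x =
  \sum_j (g x 0 j - b 0 j) * (S h j x - \sum_a coef k (S h j) a (g x) * e a x).
  rewrite (E h M hM).
  under [X in _ - X]eq_bigr do rewrite mulrDl.
  rewrite big_split /= opprD addrACA subrr add0r.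
  under [X in _ - X]eq_bigr do rewrite mulr_suml.
  rewrite exchange_big /= -sumrB; apply: eq_bigr => j _.
  by rewrite mulrBr mulr_sumr; congr (_ - _); apply: eq_bigr => a _; rewrite mulrA.
have M0 : 0 <= M by apply: le_trans (hM.2 _ xr); exact: nm_ge0.
have p0 : 0 < (2 : R) ^- k by rewrite invr_gt0 exprn_gt0.
apply: (@le_trans _ _ (M * 2 ^- k / 2)).
  apply: small_sum => // [j|]; last by rewrite mulr_ge0 // ltW.
  by rewrite mulrA; exact: IH (SM j).
by rewrite -mulrA -invfM -exprSr.
Qed.

End FiniteDivision.

(** A form of Weierstrass division. In [decomp] the powers of the coordinates are replaced by
    combinations of the g_j - g_j(y), and the division is repeated on their coefficients. The
    partial sums [coef] are uniformly bounded, so they have limits along an ultrafilter, which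
    [weierstrass] shows to be holomorphic. *)
Lemma finite_division (R : realType) (n m : nat) (N : 'I_n -> nat) (y : 'rV[CC R]_n) (A : set 'rV[CC R]_n) (g : 'rV[CC R]_n -> 'rV[CC R]_m) (q : 'I_n -> 'I_m -> 'rV[CC R]_n -> CC R) :
  (forall i, 0 < N i)%N -> (forall j, holo_germ y (fun x => g x 0 j : CC R)) ->
  (forall i j, holo_germ y (q i j)) ->
  (\forall x \near y, A x -> forall i,
     (x 0 i - y 0 i) ^+ N i = \sum_j q i j x * (g x 0 j - g y 0 j)) ->
  exists (J : finType) (e : J -> 'rV[CC R]_n -> CC R),
  [/\ (exists a, forall x, e a x = 1), (forall a, exists m : 'I_n -> nat, (forall i, m i < N i)%N /\
     forall x, e a x = \prod_i (x 0 i - y 0 i) ^+ m i),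
   (forall a, holo_germ y (e a)) &
   forall h, holo_germ y h -> exists c : J -> 'rV[CC R]_m -> CC R,
     (forall a, holo_germ (g y) (c a)) /\
     \forall x \near y, A x -> h x = \sum_a c a (g x) * e a x].
Proof.
move=> N0 hg hq HA.
have [J [e [e1 eN HJ]]] := decomp y N0 (leqnn n).
have he a : holo_germ y (e a).
  by apply/hgP; exists 1; [exact: ltr01 | exact: ((HJ 1 ltr01 (lexx 1)).1 a).1].
exists J, e; split=> //.
  by move=> a; have [m' [mN em]] := eN a; exists m'; split=> // i; exact: (mN i).1.
move=> h hh.
have [rho [Mq [rho0 rho1 Mq0 bq]]] : exists rho M, [/\ 0 < rho, rho <= 1, 0 <= M &
    bded y rho h M /\ forall i j, bded y rho (q i j) M].
  (* [h] and all [q i j] in one finite family, to obtain a common radius and bound. *)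
  pose f (o : option ('I_n * 'I_m)) := if o is Some p then q p.1 p.2 else h.
  have /bded_germs[rho [M [r0 r1 M0 H]]] o : holo_germ y (f o) by case: o => [[i j]|] /=.
  by exists rho, M; split=> //; split=> [|i j]; [exact: (H None) | exact: (H (Some (i, j)))].
have [be [K [A0 [Q [K0 H]]]]] := HJ rho rho0 rho1.
pose S h j x := \sum_i q i j x * Q h i x.
pose L := Mq * K *+ n + K.
have MK : 0 <= Mq * K by rewrite mulr_ge0.
have L0 : 0 <= L by rewrite addr_ge0 // mulrn_wge0.
have AS : forall h M, bded y rho h M ->
    (forall a, nm (A0 h a y) <= L * M) /\ forall j, bded y rho (S h j) (L * M).
  move=> f M fM; have [H1 H2 _ _] := H f M fM.
  have M0 : 0 <= M by apply: le_trans (fM.2 y _); rewrite ?nm_ge0 // subrr nm0.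
  split=> [a|j].
    apply: le_trans ((H1 a).2 _ _) _; first by rewrite subrr nm0.
    by rewrite ler_wpM2r // lerDr mulrn_wge0.
  apply: bded_le (bded_sum (fun i => bdedM (bq.2 i j) (H2 i))).
  rewrite card_ord mulrA -mulrnAl ler_wpM2r // lerDl //.
have [U [UU Uoo]] := ultraFilterLemma (F := \oo) _.
pose c k a t := coef y (g y) A0 S k h a t.
(* Within [del] of g y, [small] holds; the [+ 1] covers the case m L = 0. *)
pose del : R := 1 / (2 * (m%:R * L + 1)).
have mL : 0 <= m%:R * L by rewrite mulr_ge0.
have del0 : 0 < del by rewrite divr_gt0 //; lra.
have sm t : nm (t - g y) < del -> small (g y) L t.
  rewrite /small /del ltr_pdivlMr; last lra.
  by have := nm_ge0 (t - g y); move: (nm _) (m%:R * L) mL => u v; nra.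
have /choice[cl Hcl] (p : J * 'rV[CC R]_m) : exists l : CC R,
    nm (p.2 - g y) < del -> tends U (fun k => c k p.1 p.2) l.
  have [pd|pd] := ltP (nm (p.2 - g y)) del; last by exists 0.
  have [|l Hl] := @ultra_C R _ U UU (fun k => c k p.1 p.2) (2 * (L * Mq)).
    by apply: filterE => k; apply: (coef_bound AS _ _ bq.1); exact: sm.
  by exists l.
exists (fun a t => cl (a, t)); split=> [a|].
  apply/hgP; exists del => //.
  apply: (proj1 (@weierstrass _ _ _ U _ (fun k => c k a) _ (g y) del (2 * (L * Mq)) _ _)).
    apply: filterE => k; split=> t td; first exact: coef_df.
    by apply: (coef_bound AS _ _ bq.1); exact: sm.
  by move=> t td; exact: (Hcl (a, t)).
have gcont := row_near del0 hg.
have yball := near_nm y rho0.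
near=> x => Ax.
have gx : nm (g x - g y) < del by near: x.
have xr : nm (x - y) < rho by near: x.
have yr : nm (y - y) < rho by rewrite subrr nm0.
have Ex i : (x 0 i - y 0 i) ^+ N i = \sum_j q i j x * (g x 0 j - g y 0 j).
  by move: Ax i; near: x.
have E f M : bded y rho f M -> f x = \sum_a A0 f a y * e a x +
    \sum_j (g x 0 j - g y 0 j) * S f j x.
  move=> fM; have [_ _ H3 H4] := H f M fM; rewrite {1}H4; congr (_ + _).
    apply: eq_bigr => a _; congr (_ * _); apply: H3 => // j.
    by rewrite ltn_ord.
  under eq_bigr do rewrite Ex mulr_suml.
  rewrite exchange_big /=; apply: eq_bigr => j _; rewrite /S mulr_sumr.
  by apply: eq_bigr => i _; ring.
have T1 : tends U (fun k => \sum_a c k a (g x) * e a x : CC R) (\sum_a cl (a, g x) * e a x).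
  by apply: tends_sum => a; apply: tendsM; [exact: (Hcl (a, g x)) | exact: tends_cst].
apply: (tends_unique (Fl := U)) T1.
move=> eps eps0; apply: Uoo.
have [k0 Hk0] := geom_small Mq eps0.
near=> k; rewrite nm_sub.
apply: le_lt_trans (coef_error AS k bq.1 (sm _ gx) xr E) _.
apply: le_lt_trans Hk0; rewrite ler_wpM2l // lef_pV2 ?posrE ?exprn_gt0 //.
by apply: ler_weXn2l; [lra | near: k; exact: nbhs_infty_ge].
Unshelve. all: by end_near. Qed.

(** * Operations on germs, and ideals *)

Section GermAlgebra.
Variable R : realType.
Local Notation C := (CC R).
Lemma near_all (V : normedModType (complex R)) (x : V) (P : V -> Prop) :
  (forall t, P t) -> \forall t \near x, P t.
Proof. exact: nearW. Qed.

Section Closure.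
Variable V : normedModType (complex R).
Implicit Types (x y : V) (f g : V -> C).

Lemma hg_cst y (a : C) : holo_germ y (fun=> a).
Proof. by apply: near_all => x; exact: df_cst. Qed.

Lemma hgD y f g : holo_germ y f -> holo_germ y g -> holo_germ y (fun x => f x + g x).
Proof. by apply: filterS2 => x; exact: dfD. Qed.

Lemma hgN y f : holo_germ y f -> holo_germ y (fun x => - f x).
Proof. by apply: filterS => x; exact: dfN. Qed.

Lemma hgB y f g : holo_germ y f -> holo_germ y g -> holo_germ y (fun x => f x - g x).
Proof. by apply: filterS2 => x; exact: dfB. Qed.

Lemma hgM y f g : holo_germ y f -> holo_germ y g -> holo_germ y (fun x => f x * g x).
Proof. by apply: filterS2 => x; exact: dfM. Qed.

Lemma hgX y f k : holo_germ y f -> holo_germ y (fun x => f x ^+ k).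
Proof. by apply: filterS => x; exact: dfX. Qed.

Lemma hg_sum I (r : seq I) (P : pred I) y (f : I -> V -> C) : (forall i, holo_germ y (f i)) ->
  holo_germ y (fun x => \sum_(i <- r | P i) f i x).
Proof.
move=> hf; elim: r => [|i r IH].
  by under eq_fun do rewrite big_nil; exact: hg_cst.
under eq_fun do rewrite big_cons.
by case: (P i) => //; exact: hgD.
Qed.

Lemma hg_prod I (r : seq I) (P : pred I) y (f : I -> V -> C) : (forall i, holo_germ y (f i)) ->
  holo_germ y (fun x => \prod_(i <- r | P i) f i x).
Proof.
move=> hf; elim: r => [|i r IH].
  by under eq_fun do rewrite big_nil; exact: hg_cst.
under eq_fun do rewrite big_cons.
by case: (P i) => //; exact: hgM.
Qed.

Lemma hgcont y f : holo_germ y f -> {for y, continuous f}.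
Proof. by move/nbhs_singleton/differentiable_continuous. Qed.

Lemma hgV y f : holo_germ y f -> f y != 0 -> holo_germ y (fun x => (f x)^-1).
Proof.
move=> hf fy; have := cont_neq0 (hgcont hf) fy.
by move: hf; apply: filterS2 => x; exact: dfV.
Qed.

Lemma hg_near y f : holo_germ y f -> \forall x \near y, holo_germ x f.
Proof.
move=> /hgP[r r0 hr]; apply: filterS (near_nm y r0) => x; exact: hol_germ hr.
Qed.

End Closure.

Lemma cont_near (V W : normedModType (complex R)) (g : V -> W) y (P : W -> Prop) :
  {for y, continuous g} -> (\forall t \near g y, P t) -> \forall x \near y, P (g x).
Proof. by move=> /(_ _) cg H; exact: cg. Qed.

Lemma hg_comp (V W : normedModType (complex R)) (g : V -> W) (c : W -> C) y :
  (\forall x \near y, differentiable g x) -> holo_germ (g y) c ->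
  holo_germ y (fun x => c (g x)).
Proof.
move=> dg hc.
have cg : {for y, continuous g} by apply: differentiable_continuous; exact: nbhs_singleton dg.
have := cont_near cg hc; move: dg; apply: filterS2 => x; exact: df_comp.
Qed.

Definition rhol (V : normedModType (complex R)) m (y : V) (g : V -> 'rV[C]_m) :=
  forall j, holo_germ y (fun x => g x 0 j : C).

Section Rhol.
Variables (V : normedModType (complex R)) (m : nat).
Implicit Types (y : V) (g : V -> 'rV[C]_m).

Lemma rhol_comp y g (c : 'rV[C]_m -> C) : rhol y g -> holo_germ (g y) c ->
  holo_germ y (fun x => c (g x)).
Proof. by move=> /holo_row; exact: hg_comp. Qed.

Lemma rhol_cont y g : rhol y g -> {for y, continuous g}.
Proof. by move=> /holo_row/nbhs_singleton/differentiable_continuous. Qed.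

Lemma rhol_near y g : rhol y g -> \forall x \near y, rhol x g.
Proof. by move=> hg; apply: filter_forall => j; exact/hg_near/hg. Qed.

End Rhol.

Lemma hg_coord n (y : 'rV[C]_n) i : holo_germ y (fun x : 'rV[C]_n => x 0 i : C).
Proof. by apply: near_all => x; exact: differentiable_coord. Qed.

Lemma rhol_id n (y : 'rV[C]_n) : rhol y id.
Proof. by move=> j; exact: hg_coord. Qed.

Section Ideals.
Variable n : nat.
Local Notation V := 'rV[C]_n.
Variables (A : set V) (y : V).
Implicit Types (f h k : V -> C).

Definition upds (s : seq 'I_n) (x : V) := foldr (upd y) x s.

Lemma updsE s x j : upds s x 0 j = if j \in s then y 0 j else x 0 j.
Proof.
elim: s => //= i s IH; rewrite updE IH inE.
by case: eqVneq => [->|].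
Qed.

(** The coordinates in [s] are reset to those of [y] one by one; each reset splits off a multiple of
    that coordinate, by [DopE]. *)
Lemma hadamard_part s h : holo_germ y h -> exists q : 'I_n -> V -> C,
  [/\ forall i, holo_germ y (q i), forall i, i \notin s -> q i = fun=> 0 &
      forall x, h x = h (upds s x) + \sum_i (x 0 i - y 0 i) * q i x].
Proof.
elim: s h => [|i s IH] h hh.
  exists (fun _ _ => 0); split=> [i||x]; [exact: hg_cst | by [] | ].
  by rewrite big1 ?addr0 // => i _; rewrite mulr0.
have uy : upd y i y = y by apply/rowP => j; rewrite updE; case: eqP => // ->.
have h1 : holo_germ y (fun x => h (upd y i x)).
  by apply: hg_comp; [apply: near_all => x; exact: df_upd | rewrite uy].
have h2 : holo_germ y (Dop y i h).
  by have /hgP[r r0 hr] := hh; apply/hgP; exists r => //; exact: Dop_hol.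
have [q [q1 q2 q3]] := IH _ h1.
exists (fun j x => q j x + (j == i)%:R * Dop y i h x); split=> [j|j|x].
- by apply: hgD; [exact: q1 | apply: hgM; [exact: hg_cst | exact: h2]].
- rewrite inE negb_or => /andP[/negbTE ji js]; apply/funext => x.
  by rewrite (q2 _ js) ji mul0r addr0.
rewrite (DopE y i h x) q3 -addrA; congr (_ + _).
under [RHS]eq_bigr do rewrite mulrDr.
rewrite big_split /=; congr (_ + _).
rewrite (bigD1 i) //= eqxx mul1r big1 ?addr0 // => j /negbTE ->.
by rewrite mul0r mulr0.
Qed.

Lemma hadamard h : holo_germ y h -> exists q : 'I_n -> V -> C,
  (forall i, holo_germ y (q i)) /\
  forall x, h x = h y + \sum_i (x 0 i - y 0 i) * q i x.
Proof.
move=> /(hadamard_part (enum 'I_n))[q [q1 _ q3]]; exists q; split=> // x.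
have e : upds (enum 'I_n) x = y; last by rewrite {1}q3 e.
by apply/rowP => j; rewrite updsE mem_enum.
Qed.

(** Membership in the ideal generated by the [g j] in the ring of germs restricted to [A]. *)
Definition inI (J : finType) (g : J -> V -> C) f := exists q : J -> V -> C,
  (forall j, holo_germ y (q j)) /\ \forall x \near y, A x -> f x = \sum_j q j x * g j x.

Section OneIdeal.
Variables (J : finType) (g : J -> V -> C).

Lemma inI_eq f h : (\forall x \near y, A x -> f x = h x) -> inI g f -> inI g h.
Proof.
move=> e [q [q1 q2]]; exists q; split=> //.
by move: e q2; apply: filterS2 => x e1 e2 Ax; rewrite -e1 // e2.
Qed.

Lemma inI0 : inI g (fun=> 0).
Proof.
exists (fun _ _ => 0); split=> [j|]; first exact: hg_cst.
by apply: near_all => x _; rewrite big1 // => j _; rewrite mul0r.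
Qed.

Lemma inID f h : inI g f -> inI g h -> inI g (fun x => f x + h x).
Proof.
move=> [q [q1 q2]] [p [p1 p2]]; exists (fun j x => q j x + p j x).
split=> [j|]; first by apply: hgD; [exact: q1 | exact: p1].
move: q2 p2; apply: filterS2 => x e1 e2 Ax; rewrite e1 // e2 // -big_split.
by apply: eq_bigr => j _; rewrite mulrDl.
Qed.

Lemma inIM k f : holo_germ y k -> inI g f -> inI g (fun x => k x * f x).
Proof.
move=> hk [q [q1 q2]]; exists (fun j x => k x * q j x).
split=> [j|]; first by apply: hgM; [exact: hk | exact: q1].
apply: filterS q2 => x e Ax; rewrite e // mulr_sumr.
by apply: eq_bigr => j _; rewrite mulrA.
Qed.

Lemma inIN f : inI g f -> inI g (fun x => - f x).
Proof. by move=> /(inIM (hg_cst y (-1))); under eq_fun do rewrite mulN1r. Qed.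

Lemma inIB f h : inI g f -> inI g h -> inI g (fun x => f x - h x).
Proof. by move=> If /inIN; exact: inID. Qed.

Lemma inI_gen j : inI g (g j).
Proof.
exists (fun i _ => (i == j)%:R); split=> [i|]; first exact: hg_cst.
apply: near_all => x _; rewrite (bigD1 j) //= eqxx mul1r big1 ?addr0 // => i /negbTE ->.
by rewrite mul0r.
Qed.

Lemma inI_sum I (r : seq I) (P : pred I) (f : I -> V -> C) : (forall i, P i -> inI g (f i)) ->
  inI g (fun x => \sum_(i <- r | P i) f i x).
Proof.
move=> If; elim: r => [|i r IH].
  by under eq_fun do rewrite big_nil; exact: inI0.
under eq_fun do rewrite big_cons.
case Pi: (P i) => //; apply: inID => //; exact: If.
Qed.

Definition radI f := exists N, inI g (fun x => f x ^+ N).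

Lemma radI_inI f : inI g f -> radI f.
Proof. by move=> If; exists 1%N; under eq_fun do rewrite expr1. Qed.

Lemma inI_pow_le f N M : holo_germ y f -> (N <= M)%N ->
  inI g (fun x => f x ^+ N) -> inI g (fun x => f x ^+ M).
Proof.
move=> hf NM /(inIM (hgX (M - N) hf)).
by under eq_fun do rewrite -exprD subnK //.
Qed.

Lemma radID f h : holo_germ y f -> holo_germ y h -> radI f -> radI h ->
  radI (fun x => f x + h x).
Proof.
move=> hf hh [N IN] [M IM]; exists (N + M)%N.
under eq_fun do rewrite exprDn.
apply: inI_sum => i _.
have [iM|iM] := leqP M i.
  have := inIM (hg_cst y ('C(N + M, i)%:R)) (inIM (hgX (N + M - i) hf) (inI_pow_le hh iM IM)).
  by under eq_fun do rewrite mulr_natl.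
have Ni : (N <= N + M - i)%N by lia.
have := inIM (hg_cst y ('C(N + M, i)%:R)) (inIM (hgX i hh) (inI_pow_le hf Ni IN)).
by under eq_fun do rewrite mulr_natl [X in X *+ _]mulrC.
Qed.

Lemma radIM k f : holo_germ y k -> radI f -> radI (fun x => k x * f x).
Proof.
move=> hk [N IN]; exists N; under eq_fun do rewrite exprMn.
by apply: inIM => //; exact: hgX.
Qed.

Lemma radI_sum I (r : seq I) (f : I -> V -> C) : (forall i, holo_germ y (f i)) ->
  (forall i, radI (f i)) -> radI (fun x => \sum_(i <- r) f i x).
Proof.
move=> hf If; elim: r => [|i r IH].
  by under eq_fun do rewrite big_nil; apply/radI_inI/inI0.
under eq_fun do rewrite big_cons.
by apply: radID => //; exact: hg_sum.
Qed.

Lemma radI_eq f h : (\forall x \near y, A x -> f x = h x) -> radI f -> radI h.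
Proof.
by move=> e [N IN]; exists N; apply: inI_eq IN; apply: filterS e => x H Ax; rewrite H.
Qed.

Lemma radI_pow f N : radI (fun x => f x ^+ N.+1) -> radI f.
Proof. by move=> [M IM]; exists (N.+1 * M)%N; under eq_fun do rewrite exprM. Qed.

End OneIdeal.

Lemma inI_trans (J K : finType) (g : J -> V -> C) (k : K -> V -> C) f :
  (forall j, inI k (g j)) -> inI g f -> inI k f.
Proof.
move=> gk [q [q1 q2]].
have : inI k (fun x => \sum_j q j x * g j x) by apply: inI_sum => j _; exact: inIM.
by apply: inI_eq; apply: filterS q2 => x H Ax; rewrite H.
Qed.

End Ideals.

(** * Polynomials with holomorphic coefficients *)

Section PolyFamilies.
Variables (V : normedModType (complex R)).
Implicit Types (b : V) (p q : V -> {poly C}).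

Definition phol b (s : nat) p :=
  (forall t, (size (p t) <= s)%N) /\ forall i, holo_germ b (fun t => (p t)`_i : C).

Lemma phol_le b s s' p : (s <= s')%N -> phol b s p -> phol b s' p.
Proof. by move=> ss [p1 p2]; split=> // t; apply: leq_trans ss. Qed.

Lemma pholD b s p q : phol b s p -> phol b s q -> phol b s (fun t => p t + q t).
Proof.
move=> [p1 p2] [q1 q2]; split=> [t|i].
  by apply: leq_trans (size_polyD _ _) _; rewrite geq_max p1 q1.
by under eq_fun do rewrite coefD; apply: hgD; [exact: p2 | exact: q2].
Qed.

Lemma pholN b s p : phol b s p -> phol b s (fun t => - p t).
Proof.
move=> [p1 p2]; split=> [t|i]; first by rewrite size_polyN.
by under eq_fun do rewrite coefN; apply: hgN; exact: p2.
Qed.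

Lemma phol_cst b s (p : {poly C}) : (size p <= s)%N -> phol b s (fun=> p).
Proof. by move=> ps; split=> // i; exact: hg_cst. Qed.

Lemma phol_polyC b (f : V -> C) : holo_germ b f -> phol b 1 (fun t => (f t)%:P).
Proof.
move=> hf; split=> [t|i]; first exact: size_polyC_leq1.
under eq_fun do rewrite coefC; case: eqP => _ //; exact: hg_cst.
Qed.

Lemma pholM b s s' p q : phol b s p -> phol b s' q -> phol b (s + s') (fun t => p t * q t).
Proof.
move=> [p1 p2] [q1 q2]; split=> [t|i].
  apply: leq_trans (size_polyMleq _ _) _.
  by apply: leq_trans (leq_pred _) _; apply: leq_add.
under eq_fun do rewrite coefM.
by apply: hg_sum => j; apply: hgM; [exact: p2 | exact: q2].
Qed.

Lemma phol_sum I (r : seq I) b s (p : I -> V -> {poly C}) : (forall i, phol b s (p i)) ->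
  phol b s (fun t => \sum_(i <- r) p i t).
Proof.
move=> hp; elim: r => [|i r IH].
  by under eq_fun do rewrite big_nil; apply: phol_cst; rewrite size_poly0.
by under eq_fun do rewrite big_cons; exact: pholD.
Qed.

Lemma phol_prod I (r : seq I) b s (p : I -> V -> {poly C}) : (forall i, phol b s (p i)) ->
  phol b (size r * s).+1 (fun t => \prod_(i <- r) p i t).
Proof.
move=> hp; elim: r => [|i r IH].
  by under eq_fun do rewrite big_nil; apply: phol_cst; rewrite size_poly1.
under eq_fun do rewrite big_cons.
by rewrite /= mulSn -addnS; exact: pholM.
Qed.

Lemma phol_deriv b s p : phol b s p -> phol b s (fun t => (p t)^`()).
Proof.
move=> [p1 p2]; split=> [t|i]; first exact: leq_trans (size_poly _ _) (leq_trans (leq_pred _) (p1 t)).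
by under eq_fun do rewrite coef_deriv -mulr_natl; apply: hgM; [exact: hg_cst | exact: p2].
Qed.

Lemma phol_horner b s p (f : V -> C) : phol b s p -> holo_germ b f ->
  holo_germ b (fun t => (p t).[f t]).
Proof.
move=> [p1 p2] hf; under eq_fun do rewrite (horner_coef_wide _ (p1 _)).
by apply: hg_sum => i; apply: hgM; [exact: p2 | exact: hgX].
Qed.

Lemma phol_near b s p : phol b s p -> \forall t \near b, phol t s p.
Proof.
move=> [p1 p2].
have : \forall t \near b, forall i : 'I_s, holo_germ t (fun t => (p t)`_i : C).
  by apply: filter_forall => i; exact/hg_near/p2.
apply: filterS => t H; split=> // i; have [si|si] := ltnP i s; first exact: (H (Ordinal si)).
by under eq_fun do rewrite nth_default ?(leq_trans (p1 _)) //; exact: hg_cst.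
Qed.

End PolyFamilies.

Lemma phol_comp (V W : normedModType (complex R)) (g : V -> W) y s (p : W -> {poly C}) :
  (\forall x \near y, differentiable g x) -> phol (g y) s p -> phol y s (fun x => p (g x)).
Proof. by move=> dg [p1 p2]; split=> // i; apply: (hg_comp dg (p2 i)). Qed.

(** By Hadamard's lemma each coefficient of p (g x) differs from that of p (g y) by a combination of
    the g_j - g_j(y). *)
Lemma phol_horner_inI n m (A : set 'rV[C]_n) y (g : 'rV[C]_n -> 'rV[C]_m) s
    (p : 'rV[C]_m -> {poly C}) (f : 'rV[C]_n -> C) :
  rhol y g -> phol (g y) s p -> holo_germ y f ->
  inI A y (fun j x => g x 0 j - g y 0 j) (fun x => (p (g x)).[f x] - (p (g y)).[f x]).
Proof.
move=> hg [p1 p2] hf.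
have : inI A y (fun j x => g x 0 j - g y 0 j)
    (fun x => \sum_(i < s) f x ^+ i * ((p (g x))`_i - (p (g y))`_i)).
  apply: inI_sum => i _; apply: inIM; first exact: hgX.
  have [q [q1 q2]] := hadamard (p2 i).
  exists (fun j x => q j (g x)); split=> [j|]; first exact: rhol_comp.
  apply: near_all => x _; rewrite (q2 (g x)) addrAC subrr add0r.
  by apply: eq_bigr => j _; rewrite mulrC.
apply: inI_eq; apply: near_all => x _.
rewrite !(horner_coef_wide _ (p1 _)) -sumrB; apply: eq_bigr => i _; ring.
Qed.

End GermAlgebra.

(** * Resultants *)

Section Elimination.
Variable F : numClosedFieldType.
Implicit Types (W f g : {poly F}) (s : nat).

(** The remainder of X^i f modulo a monic W of degree s + 1, the top coefficient being cleared at
    each step; [wquo] is the quotient. Thus [elim_mx] is the matrix of multiplication by f modulo W,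
    and [elim] is the resultant of W and f. *)
Fixpoint wrow W f s i : {poly F} :=
  if i is i'.+1 then 'X * wrow W f s i' - (wrow W f s i')`_s *: W else f.

Fixpoint wquo W f s i : {poly F} :=
  if i is i'.+1 then 'X * wquo W f s i' + ((wrow W f s i')`_s)%:P else 0.

Definition elim_mx W f s : 'M[F]_s.+1 := \matrix_(i, l) (wrow W f s i)`_l.
Definition elim W f s := \det (elim_mx W f s).

Lemma wrowE W f s i : wrow W f s i = 'X^i * f - W * wquo W f s i.
Proof.
elim: i => [|i IH] /=; first by rewrite mul1r mulr0 subr0.
by rewrite {1}IH exprS -mul_polyC; ring.
Qed.

Lemma size_wrow W f s i : W \is monic -> size W = s.+2 -> (size f <= s.+1)%N ->
  (size (wrow W f s i) <= s.+1)%N.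
Proof.
move=> Wm sW sf; elim: i => [|i IH] //=; apply/leq_sizeP => j.
rewrite leq_eqVlt => /orP[/eqP <-|sj].
  by rewrite coefB coefXM coefZ /= (_ : W`_s.+1 = 1) ?mulr1 ?subrr // -[RHS](monicP Wm) /lead_coef sW.
rewrite coefB coefXM coefZ; case: j sj => // j sj /=.
by rewrite (leq_sizeP _ _ IH) // [W`__]nth_default ?mulr0 ?subr0 // sW.
Qed.

(** A vector in the kernel is a nonzero polynomial U of degree at most s with W dividing U f. As W
    and f have no common root, W divides U, which is impossible for reasons of degree. *)
Lemma elim_neq0 W f s : W \is monic -> size W = s.+2 -> (size f <= s.+1)%N ->
  (forall x, root W x -> f.[x] != 0) -> elim W f s != 0.
Proof.
move=> Wm sW sf H; apply/negP => /det0P[u u0 uM].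
pose U := \poly_(i < s.+1) u 0 (inord i).
have sU : (size U <= s.+1)%N by exact: size_poly.
have UE : \sum_(i < s.+1) u 0 i *: wrow W f s i = 0.
  apply/polyP => l; rewrite coef0 coef_sum; have [ls|ls] := ltnP l s.+1; last first.
    by rewrite big1 // => i _; rewrite coefZ nth_default ?mulr0 // (leq_trans (size_wrow i Wm sW sf)).
  have := congr1 (fun v : 'rV_s.+1 => v 0 (Ordinal ls)) uM.
  rewrite mxE [RHS]mxE => e; rewrite -[RHS]e; apply: eq_bigr => i _.
  by rewrite coefZ mxE.
have UfW : U * f = W * \sum_(i < s.+1) u 0 i *: wquo W f s i.
  apply/eqP; rewrite -subr_eq0 -[X in _ == X]UE; apply/eqP.
  rewrite /U poly_def mulr_suml mulr_sumr -sumrB; apply: eq_bigr => i _.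
  by rewrite inord_val wrowE -!mul_polyC; ring.
have WU : W %| U.
  rewrite -(Gauss_dvdpl U (q := f)); first by rewrite UfW dvdp_mulr.
  exact/Pdiv.ClosedField.coprimepP.
have U0 : U != 0.
  have /rV0Pn[i ui] := u0; apply: contraNneq ui => U0.
  by have := coef_poly s.+1 (fun i => u 0 (inord i)) i; rewrite -/U U0 coef0 ltn_ord inord_val => <-.
by have := dvdp_leq U0 WU; rewrite sW; lia.
Qed.

(** The adjugate is applied to the product of the matrix with the column of powers of x, whose first
    entry is 1. This puts the resultant into the ideal of W and f. *)
Lemma elim_ideal W f s x : W \is monic -> size W = s.+2 -> (size f <= s.+1)%N ->
  elim W f s = \sum_(i < s.+1)
    \adj (elim_mx W f s) 0 i * (x ^+ i * f.[x] - W.[x] * (wquo W f s i).[x]).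
Proof.
move=> Wm sW sf.
pose v : 'cV[F]_s.+1 := \col_l x ^+ l.
have Mv i : (elim_mx W f s *m v) i 0 = x ^+ i * f.[x] - W.[x] * (wquo W f s i).[x].
  rewrite mxE -[RHS](_ : (wrow W f s i).[x] = _); last first.
    by rewrite wrowE !hornerE.
  rewrite (horner_coef_wide _ (size_wrow i Wm sW sf)).
  by apply: eq_bigr => l _; rewrite !mxE.
have := congr1 (fun M => (M *m v) 0 0) (mul_adj_mx (elim_mx W f s)).
rewrite /= -mulmxA mxE mul_scalar_mx [RHS]mxE [v _ _]mxE expr0 mulr1 => e.
rewrite /elim -e; by apply: eq_bigr => i _; rewrite Mv.
Qed.

(** Otherwise, for each root x of W, the polynomial with coefficients f_j(x) is nonzero. The product
    of these over all roots has too small a degree to vanish at all the integers l; where it does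
    not vanish, the combination of the f_j with weights l^j has no root in common with W, so its
    resultant is nonzero. *)
Lemma common_root (J : finType) W (f : J -> {poly F}) s : W \is monic -> size W = s.+2 ->
  (forall j, size (f j) <= s.+1)%N ->
  (forall l : 'I_(s.+2 * #|J|).+1,
     elim W (\sum_j (l%:R ^+ enum_rank j) *: f j) s = 0) ->
  exists2 x, root W x & forall j, root (f j) x.
Proof.
move=> Wm sW sf H; apply: contrapT => nE.
have [r Wr] := closed_field_poly_normal W.
rewrite (monicP Wm) scale1r in Wr.
pose P x : {poly F} := \sum_j (f j).[x] *: 'X^(enum_rank j).
have P0 x : x \in r -> P x != 0.
  move=> xr; apply: contra_notN nE => /eqP Px; exists x.
    by rewrite Wr root_prod_XsubC.
  move=> j; apply/eqP; have := congr1 (fun p : {poly F} => p`_(enum_rank j)) Px.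
  rewrite coef0 coef_sum (bigD1 j) //= coefZ coefXn eqxx mulr1 big1 ?addr0 // => i ij.
  rewrite coefZ coefXn; case: eqP => [/val_inj/enum_rank_inj e|]; last by rewrite mulr0.
  by rewrite e eqxx in ij.
have sP x : (size (P x) <= #|J|)%N.
  apply/leq_sizeP => i Ji; rewrite coef_sum big1 // => j _; rewrite coefZ coefXn.
  by case: eqP => [e|]; rewrite ?mulr0 //; rewrite e leqNgt ltn_ord in Ji.
pose Q := \prod_(x <- r) P x.
have Q0 : Q != 0 by rewrite prodf_seq_neq0; apply/allP => x xr; exact: P0.
have sr : size r = s.+1 by have := size_prod_XsubC r idfun; rewrite /= -Wr sW => -[].
have sQ : (size Q <= (s.+2 * #|J|).+1)%N.
  apply: (@leq_trans (size r * #|J|).+1); last by rewrite sr; lia.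
  rewrite /Q; elim: (r) => [|x t IH]; first by rewrite big_nil size_poly1.
  rewrite big_cons; apply: leq_trans (size_polyMleq _ _) _.
  by apply: leq_trans (leq_pred _) _; rewrite /= mulSn -addnS; exact: leq_add.
have [l Ql] : exists l : 'I_(s.+2 * #|J|).+1, Q.[l%:R] != 0.
  apply: contrapT => nl.
  pose rs := [seq (l%:R : F) | l <- iota 0 (s.+2 * #|J|).+1].
  have := @max_poly_roots _ Q rs Q0; rewrite size_map size_iota => /(_ _ _)/wrap[].
  - apply/allP => _ /mapP[l + ->]; rewrite mem_iota add0n => /andP[_ ll].
    by apply/negPn/negP => Ql; apply: nl; exists (Ordinal ll).
  - by rewrite map_inj_uniq ?iota_uniq // => a b /eqP; rewrite eqr_nat => /eqP.
  - by move=> H1; have := leq_trans H1 sQ; rewrite ltnn.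
have := H l; apply/eqP; apply: elim_neq0 => //.
  by apply/leq_sizeP => i si; rewrite coef_sum big1 // => j _; rewrite coefZ (leq_sizeP _ _ (sf j)) ?mulr0.
move=> x; rewrite Wr root_prod_XsubC => xr.
have : (P x).[l%:R] != 0.
  by move: Ql; rewrite /Q horner_prod prodf_seq_neq0 => /allP/(_ x xr).
rewrite /P !horner_sum; congr (_ != 0); apply: eq_bigr => j _.
by rewrite !hornerZ hornerXn mulrC.
Qed.

End Elimination.

(** * Weierstrass preparation and the Nullstellensatz for isolated zeros *)

Section Nullstellensatz.
Variable R : realType.
Local Notation C := (CC R).
Local Notation rowT k := 'rV[C]_(1 + k).

Lemma near_forall (V : normedModType (complex R)) (x : V) (I : finType) (P : I -> V -> Prop) :
  (forall i, \forall t \near x, P i t) -> \forall t \near x, forall i, P i t.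
Proof. exact: filter_forall. Qed.

Lemma sum_unit (f : unit -> C) : \sum_j f j = f tt.
Proof. by rewrite (bigD1 tt) //= big1 ?addr0 // => -[]. Qed.

Lemma phol_wrow (V : normedModType (complex R)) (b : V) s (W f : V -> {poly C}) i :
  (forall t, W t \is monic /\ size (W t) = s.+2) -> phol b s.+2 W -> phol b s.+1 f ->
  phol b s.+1 (fun t => wrow (W t) (f t) s i).
Proof.
move=> Wm hW hf; split=> [t|].
  by apply: size_wrow; [exact: (Wm t).1 | exact: (Wm t).2 | exact: hf.1].
elim: i => [|i IH] l /=; first exact: hf.2.
under eq_fun do rewrite coefB coefXM coefZ.
apply: hgB; last by apply: hgM; [exact: IH | exact: hW.2].
by case: (l == 0%N); [exact: hg_cst | exact: IH].
Qed.

Lemma phol_wquo (V : normedModType (complex R)) (b : V) s (W f : V -> {poly C}) i :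
  (forall t, W t \is monic /\ size (W t) = s.+2) -> phol b s.+2 W -> phol b s.+1 f ->
  phol b i.+1 (fun t => wquo (W t) (f t) s i).
Proof.
move=> Wm hW hf; elim: i => [|i IH] /=; first by apply: phol_cst; rewrite size_poly0.
apply: pholD.
  split=> [t|l].
    by apply: leq_trans (size_polyMleq _ _) _; rewrite size_polyX; exact: IH.1.
  under eq_fun do rewrite coefXM.
  by case: (l == 0%N); [exact: hg_cst | exact: IH.2].
by apply: phol_le (phol_polyC ((phol_wrow i Wm hW hf).2 s)).
Qed.

Lemma hg_det (V : normedModType (complex R)) (b : V) s (M : V -> 'M[C]_s) :
  (forall i j, holo_germ b (fun t => M t i j : C)) -> holo_germ b (fun t => \det (M t) : C).
Proof.
move=> hM; apply: hg_sum => p; apply: hgM; first exact: hg_cst.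
by apply: hg_prod => i; exact: hM.
Qed.

Lemma hg_adj (V : normedModType (complex R)) (b : V) s (M : V -> 'M[C]_s) i j :
  (forall i j, holo_germ b (fun t => M t i j : C)) ->
  holo_germ b (fun t => (\adj (M t)) i j : C).
Proof.
move=> hM; under eq_fun do rewrite mxE /cofactor.
apply: hgM; first exact: hg_cst.
by apply: hg_det => a c; under eq_fun do rewrite !mxE; exact: hM.
Qed.

Lemma hg_elim_mx (V : normedModType (complex R)) (b : V) s (W f : V -> {poly C}) i l :
  (forall t, W t \is monic /\ size (W t) = s.+2) -> phol b s.+2 W -> phol b s.+1 f ->
  holo_germ b (fun t => elim_mx (W t) (f t) s i l : C).
Proof.
by move=> Wm hW hf; under eq_fun do rewrite mxE; exact: (phol_wrow i Wm hW hf).2.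
Qed.

Lemma inI_comp n m (y : 'rV[C]_n) (g : 'rV[C]_n -> 'rV[C]_m) (J : finType)
    (F : J -> 'rV[C]_m -> C) f : rhol y g -> inI setT (g y) F f ->
  inI setT y (fun j x => F j (g x)) (fun x => f (g x)).
Proof.
move=> hg [q [q1 q2]]; exists (fun j x => q j (g x)); split=> [j|]; first exact: rhol_comp.
have := cont_near (rhol_cont hg) q2.
by apply: filterS => x H _; exact: H.
Qed.

(** Rueckert's Nullstellensatz in the case where the common zero set is a point: the ideal contains
    a power of the maximal ideal. *)
Definition nullst n : Prop := forall (J : finType) (F : J -> 'rV[C]_n -> C),
  (forall j, holo_germ 0 (F j)) ->
  (\forall x \near (0 : 'rV[C]_n), (forall j, F j x = 0) -> x = 0) ->
  forall i, radI setT 0 F (fun x => x 0 i).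

Variable k : nat.
Local Notation V := (rowT k).
Implicit Types (x : V) (z : 'rV[C]_k).
Definition ord_fst : 'I_(1 + k) := lshift k ord0.
Definition row_tl x : 'rV[C]_k := rsubmx x.
Definition row_cons (t : C) z : V := row_mx (t%:M) z.

Lemma inj_i0 t z : row_cons t z 0 ord_fst = t.
Proof. by rewrite /row_cons row_mxEl mxE. Qed.

Lemma inj_r t z j : row_cons t z 0 (rshift 1 j) = z 0 j.
Proof. by rewrite /row_cons row_mxEr. Qed.

Lemma pr_inj t z : row_tl (row_cons t z) = z.
Proof. exact: row_mxKr. Qed.

Lemma prE x j : row_tl x 0 j = x 0 (rshift 1 j).
Proof. by rewrite mxE. Qed.

Lemma rhol_pr x : rhol x row_tl.
Proof. by move=> j; under eq_fun do rewrite prE; exact: hg_coord. Qed.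

Lemma rhol_inj (U : normedModType (complex R)) (u : U) (a : U -> C) (b : U -> 'rV[C]_k) :
  holo_germ u a -> rhol u b -> rhol u (fun w => row_cons (a w) (b w)).
Proof.
move=> ha hb j; case: (split_ordP j) => l ->.
  by rewrite (ord1 l); under eq_fun do rewrite inj_i0.
by under eq_fun do rewrite inj_r; exact: hb.
Qed.

Lemma inj0 : row_cons 0 0 = 0.
Proof. by rewrite /row_cons raddf0 row_mx0. Qed.

Section Weierstrass.
Variables (F : V -> C) (s : nat) (v : C -> C).
Hypotheses (hF : holo_germ 0 F) (hv : holo_germ 0 v) (v0 : v 0 != 0).
Hypothesis F0 : \forall t \near (0 : C), F (row_cons t 0) = t ^+ s.+1 * v t.

Definition G x := row_cons (F x) (row_tl x).

Lemma F00 : F 0 = 0.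
Proof. by have := nbhs_singleton F0; rewrite inj0 exprS !mul0r. Qed.

Lemma G0 : G 0 = 0.
Proof. by rewrite /G F00 /row_tl raddf0 inj0. Qed.

Lemma rhol_G : rhol 0 G.
Proof. by apply: rhol_inj => //; exact: rhol_pr. Qed.

(** Weierstrass division by F, which has order s + 1 along the first axis. [finite_division] is
    applied to [G], with exponent s + 1 for the first coordinate and 1 for the others, so that the
    monomials are powers of x_0 up to s. *)
Lemma division h : holo_germ 0 h -> exists p : 'rV[C]_k -> {poly C}, phol 0 s.+1 p /\
  inI setT 0 (fun _ : unit => F) (fun x => h x - (p (row_tl x)).[x 0 ord_fst]).
Proof.
move=> hh.
pose N (i : 'I_(1 + k)) := if i == ord_fst then s.+1 else 1%N.
have x00 i : (0 : V) 0 i = 0 by rewrite mxE.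
have [r [r1 r2 r3]] := hadamard_part [seq rshift 1 j | j <- enum 'I_k] hF.
have ri0 : r ord_fst = fun=> 0.
  by apply: r2; apply/mapP => -[j _ /eqP]; rewrite eq_lrshift.
have hvx : holo_germ 0 (fun x : V => v (x 0 ord_fst)).
  by apply: hg_comp; [exact: hg_coord | rewrite x00].
have ivx : holo_germ 0 (fun x : V => (v (x 0 ord_fst))^-1) by apply: hgV => //; rewrite x00.
(* For the first coordinate: F (x) minus terms in the other coordinates is F (x_0, 0) = x_0^(s + 1)
   v (x_0). The other coordinates are entries of [G]. *)
pose q (i j : 'I_(1 + k)) x : C := if i == ord_fst then
  if j == ord_fst then (v (x 0 ord_fst))^-1 else - ((v (x 0 ord_fst))^-1 * r j x) else (i == j)%:R.
have hq i j : holo_germ 0 (q i j).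
  rewrite /q; case: (i == ord_fst); last exact: hg_cst.
  by case: (j == ord_fst); [exact: ivx | apply: hgN; apply: hgM].
have GE x j : j != ord_fst -> G x 0 j = x 0 j.
  case: (split_ordP j) => l ->; first by rewrite (ord1 l) eqxx.
  by move=> _; rewrite inj_r prE.
have cx : {for (0 : V), continuous (fun x : V => x 0 ord_fst : C)}.
  exact/hgcont/hg_coord.
have near0 : \forall x \near (0 : V), F (row_cons ((x : V) 0 ord_fst) 0) = x 0 ord_fst ^+ s.+1 * v (x 0 ord_fst).
  by apply: (cont_near (P := fun t : C => F (row_cons t 0) = t ^+ s.+1 * v t) cx); rewrite x00.
have nearv : \forall x \near (0 : V), v ((x : V) 0 ord_fst) != 0.
  by apply: cont_neq0 (hgcont hvx) _; rewrite x00.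
have Hx : \forall x \near (0 : V), setT x -> forall i,
    ((x : V) 0 i - (0 : V) 0 i) ^+ N i = \sum_j q i j x * (G x 0 j - G 0 0 j).
  move: near0 nearv; apply: filterS2 => x e1 e2 _ i; rewrite G0 x00 subr0.
  rewrite /q /N; case: eqVneq => [->|ii0]; last first.
    rewrite expr1 (bigD1 i) //= eqxx mul1r x00 subr0 GE // big1 ?addr0 // => j ji.
    by rewrite eq_sym (negbTE ji) mul0r.
  rewrite (bigD1 ord_fst) //= ?eqxx x00 subr0 {1}/G inj_i0 {1}r3.
  have -> : upds 0 [seq rshift 1 j | j <- enum 'I_k] x = row_cons (x 0 ord_fst) 0.
    apply/rowP => j; rewrite updsE; case: (split_ordP j) => l ->.
      rewrite (ord1 l) inj_i0; case: ifP => // /mapP[j' _ /eqP].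
      by rewrite eq_lrshift.
    by rewrite inj_r mem_map ?mem_enum ?mxE //; exact: rshift_inj.
  rewrite e1 mulrDr mulrCA mulVf // mulr1 -addrA mulr_sumr (bigD1 ord_fst) //= ri0 !mulr0 add0r.
  rewrite -[LHS]addr0 -big_split /= big1 // => j ji0.
  by rewrite (negbTE ji0) !x00 !subr0 GE //; ring.
have N0 i : (0 < N i)%N by rewrite /N; case: ifP.
have [J [e [_ em _ H]]] := finite_division N0 rhol_G hq Hx.
have [c [hc hE]] := H h hh.
have /choice[m Hm] a : exists m, (m < s.+1)%N /\ forall x, e a x = x 0 ord_fst ^+ m.
  have [m [mN mE]] := em a; exists (m ord_fst); split; first by have := mN ord_fst; rewrite /N eqxx.
  move=> x; rewrite mE (bigD1 ord_fst) //= x00 subr0 big1 ?mulr1 // => j ji.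
  have := mN j; rewrite /N (negbTE ji); by case: (m j).
have hinj : rhol (0 : 'rV[C]_k) (row_cons 0) by apply: rhol_inj; [exact: hg_cst | exact: rhol_id].
exists (fun z => \sum_a (c a (row_cons 0 z))%:P * 'X^(m a)); split.
  apply: phol_sum => a; apply: (@phol_le _ _ _ (1 + (m a))); first by have := (Hm a).1.
  split=> [t|i].
    apply: leq_trans (size_polyMleq _ _) _; rewrite size_polyXn addnS /=.
    by rewrite leq_add2r size_polyC_leq1.
  under eq_fun do rewrite coefCM coefXn.
  apply: hgM; last exact: hg_cst.
  by apply: rhol_comp => //; rewrite inj0 -G0; exact: hc.
(* Modulo F, the coefficient c_a (F, z) may be replaced by c_a (0, z), which makes it a function of
   z alone. *)
have key : inI setT 0 (fun _ : unit => F)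
    (fun x => \sum_a (c a (G x) - c a (row_cons 0 (row_tl x))) * x 0 ord_fst ^+ m a).
  apply: inI_sum => a _.
  have [u [u1 u2 u3]] := hadamard_part [:: ord_fst] (hc a).
  rewrite G0 in u1 u3.
  exists (fun _ x => u ord_fst (G x) * x 0 ord_fst ^+ m a); split=> [_|].
    apply: hgM; last exact/hgX/hg_coord.
    by apply: rhol_comp; [exact: rhol_G | rewrite G0; exact: u1].
  apply: near_all => x _; rewrite big_const card_unit /= addr0 {1}u3.
  have -> : upds 0 [:: ord_fst] (G x) = row_cons 0 (row_tl x).
    apply/rowP => j; rewrite updsE inE; case: eqVneq => [->|ji]; first by rewrite inj_i0 mxE.
    move: ji; case: (split_ordP j) => l ->; first by rewrite (ord1 l) eqxx.
    by rewrite !inj_r.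
  rewrite (bigD1 ord_fst) //= big1 ?addr0 => [|j ji].
    have GE0 : G x 0 ord_fst = F x by exact: inj_i0.
    by rewrite x00 GE0; ring.
  by rewrite u2 ?inE // mulr0.
apply: inI_eq key; apply: filterS hE => x hx _; rewrite hx //.
rewrite horner_sum -sumrB; apply: eq_bigr => a _.
by rewrite (Hm a).2 hornerCM hornerXn mulrBl.
Qed.

Lemma hg_poly (p : {poly C}) (b : C) : holo_germ b (fun t : C => p.[t]).
Proof. exact: (phol_horner (phol_cst b (leqnn (size p))) (df_near_id b)). Qed.

Lemma preparation : exists (W : 'rV[C]_k -> {poly C}) (T : V -> C),
  [/\ phol 0 s.+2 W, forall z, W z \is monic /\ size (W z) = s.+2, W 0 = 'X^(s.+1),
      holo_germ 0 T /\ T 0 != 0 &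
      \forall x \near (0 : V), (W (row_tl x)).[(x : V) 0 ord_fst] = T x * F x].
Proof.
have [p [hp [q [hq E]]]] := division (hgX s.+1 (hg_coord 0 ord_fst)).
have sp z : (size (- p z) < size ('X^(s.+1) : {poly C}))%N.
  by rewrite size_polyN size_polyXn ltnS hp.1.
have hT : holo_germ 0 (q tt) by exact: hq.
have hline : rhol (0 : C) (fun t => row_cons t 0).
  by apply: rhol_inj; [exact: df_near_id | move=> j; exact: hg_cst].
have E1 : \forall t \near (0 : C), t ^+ s.+1 - (p 0).[t] = q tt (row_cons t 0) * (t ^+ s.+1 * v t).
  have : \forall t \near (0 : C), setT (row_cons t 0) -> row_cons t 0 0 ord_fst ^+ s.+1 - (p (row_tl (row_cons t 0))).[row_cons t 0 0 ord_fst] =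
      \sum_(j : unit) q j (row_cons t 0) * F (row_cons t 0).
    apply: (cont_near (P := fun x : V => setT x -> x 0 ord_fst ^+ s.+1 - (p (row_tl x)).[x 0 ord_fst] =
        \sum_j q j x * F x) (rhol_cont hline)); by rewrite inj0.
  move: F0; apply: filterS2 => t e1 /(_ I).
  by rewrite inj_i0 pr_inj sum_unit e1.
have hTl : holo_germ (0 : C) (fun t => q tt (row_cons t 0)).
  by apply: (rhol_comp (c := q tt) hline); rewrite inj0; exact: hT.
have hdef : holo_germ (0 : C) (fun t => 1 - q tt (row_cons t 0) * v t).
  by apply: hgB; [exact: hg_cst | exact: hgM].
(* A nonzero p 0 has degree at most s, so its order at 0 is at most s, while by [E1] it is divisible
   by t^(s + 1). *)
have p0 : p 0 = 0.
  apply/eqP/negP => /negP p0; have [a [u + pu]] := multiplicity_XsubC (p 0) 0.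
  rewrite p0 /= => u0.
  have as_ : (a < s.+1)%N.
    have := hp.1 0; rewrite pu; have u0' : u != 0 by apply: contraNneq p0 => u0'; rewrite pu u0' mul0r.
    rewrite size_Mmonic ?monicXn ?monic_exp ?monicXsubC //.
    rewrite size_exp_XsubC addnS /=; move: u0'; rewrite -size_poly_gt0; case: (size _) => // m' _; rewrite addSn ltnS.
    by move=> h; rewrite ltnS; apply: leq_trans h; exact: leq_addl.
  apply: (@order_lt _ (fun t => u.[t]) (fun t => 1 - q tt (row_cons t 0) * v t) 0 a s.+1).
  - exact/hgcont/hg_poly.
  - exact/hgcont/hdef.
  - exact: u0.
  - exact: as_.
  apply: filterS E1 => t e; rewrite subr0.
  have e2 : (p 0).[t] = u.[t] * t ^+ a by rewrite pu hornerM horner_exp hornerXsubC subr0.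
  rewrite mulrC -e2.
  have -> : (p 0).[t] = t ^+ s.+1 - q tt (row_cons t 0) * (t ^+ s.+1 * v t) by rewrite -e subKr.
  by rewrite mulrBr mulr1 mulrCA.
exists (fun z => 'X^(s.+1) - p z), (q tt); split.
- by apply: pholD; [apply: phol_cst; rewrite size_polyXn | apply/pholN/phol_le/hp].
- move=> z; split; first by rewrite monicE lead_coefDl // lead_coefXn.
  by rewrite size_polyDl // size_polyXn.
- by rewrite p0 subr0.
- split=> //.
  apply/negP => /eqP T0.
  apply: (@order_not0 _ (fun t => 1 - q tt (row_cons t 0) * v t) 0 s.+1).
  + exact/hgcont/hdef.
  + by rewrite inj0 T0 mul0r subr0 oner_neq0.
  apply: filterS E1 => t; rewrite p0 horner0 !subr0 => e.
  by rewrite mulrBr mulr1 {1}e; ring.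
apply: filterS E => x /(_ I); rewrite sum_unit => <-.
by rewrite hornerD hornerXn hornerN.
Qed.

End Weierstrass.

(** |t|^m is at most eta times the sum of the lower powers of |t|; the cases |t| <= 1 and |t| > 1
    are compared separately. *)
Lemma root_small (W : {poly C}) m (eta del : R) t : (0 < m)%N -> W \is monic -> size W = m.+1 ->
  0 < del <= 1 -> (forall i, (i < m)%N -> nm (W`_i : C) <= eta) -> eta * m%:R < del ^+ m ->
  root W t -> nm (t : C) < del.
Proof.
move=> m0 Wm sW /andP[d0 d1] We em /eqP Wt; rewrite ltNge; apply/negP => dt.
have e0 : 0 <= eta by apply: le_trans (We 0%N m0); exact: nm_ge0.
have : nm t ^+ m <= \sum_(i < m) eta * nm t ^+ i.
  have -> : nm t ^+ m = nm (\sum_(i < m) W`_i * t ^+ i : C).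
    rewrite -nmX -[in RHS]nmN; congr nm; apply/eqP; rewrite -subr_eq0 opprK; apply/eqP.
    rewrite -[RHS]Wt horner_coef sW big_ord_recr /= addrC; congr (_ + _).
    by rewrite -[X in X * _](_ : 1 = _) ?mul1r // -(monicP Wm) /lead_coef sW.
  apply: le_trans (nm_sum _ _ _) _; apply: ler_sum => i _.
  by rewrite nmM nmX ler_wpM2r ?exprn_ge0 ?nm_ge0 // We.
have t0 : 0 <= nm t := nm_ge0 t.
have dm : del ^+ m <= nm t ^+ m by rewrite lerXn2r ?nnegrE //; exact: ltW.
have [t1|t1] := leP (nm t) 1.
  have : \sum_(i < m) eta * nm t ^+ i <= eta * m%:R.
    rewrite mulr_natr -[X in _ *+ X](card_ord m) -sumr_const; apply: ler_sum => i _.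
    by rewrite ler_piMr // exprn_ile1.
  by lra.
have : \sum_(i < m) eta * nm t ^+ i <= eta * m%:R * nm t ^+ m.-1.
  rewrite -mulrA mulrCA mulr_natl -[X in _ *+ X](card_ord m) -sumr_const; apply: ler_sum => i _.
  by rewrite ler_wpM2l // ler_weXn2l ?(ltW t1) // -ltnS prednK.
have d1m : del ^+ m <= 1 by rewrite exprn_ile1 // ltW.
have -> : nm t ^+ m = nm t * nm t ^+ m.-1 by rewrite -exprS prednK.
have : 1 <= nm t ^+ m.-1 by rewrite exprn_ege1 // ltW.
by move: (nm t ^+ _) => T; move: (eta * _) em => E em; nra.
Qed.

(** Modulo the F_j0 prepared as W, the other F_j become polynomials f_j in x_0. The resultants of W
    with combinations of the f_j lie in the ideal and depend on k variables only; their sole common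
    zero is 0, so the induction hypothesis applies to them. *)
Lemma nullst_regular (J : finType) (F : J -> V -> C) j0 s (v : C -> C) : nullst k ->
  (forall j, holo_germ 0 (F j)) -> holo_germ 0 v -> v 0 != 0 ->
  (\forall t \near (0 : C), F j0 (row_cons t 0) = t ^+ s.+1 * v t) ->
  (\forall x \near (0 : V), (forall j, F j x = 0) -> x = 0) ->
  forall i, radI setT 0 F (fun x => x 0 i).
Proof.
move=> IH hF hv v0 F0 iso.
have [W [T [hW Wm W0 [hT T0] WT]]] := preparation (hF j0) hv v0 F0.
have /choice[f Hf] j := division (hF j0) hv v0 F0 (hF j).
pose L := (s.+2 * #|J|).+1.
pose fl (l : 'I_L) z := \sum_j (l%:R ^+ enum_rank j) *: f j z.
have hfl l : phol 0 s.+1 (fl l).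
  apply: phol_sum => j; split=> [t|i].
    by apply: leq_trans (size_scale_leq _ _) _; exact: (Hf j).1.1.
  by under eq_fun do rewrite coefZ; apply: hgM; [exact: hg_cst | exact: (Hf j).1.2].
pose D (l : 'I_L) z : C := elim (W z) (fl l z) s.
have hM l i j : holo_germ 0 (fun z => elim_mx (W z) (fl l z) s i j : C).
  by apply: hg_elim_mx.
have hD l : holo_germ 0 (D l) by exact: hg_det.
have pr0 : row_tl 0 = 0 by rewrite /row_tl raddf0.
have hpr : rhol (0 : V) row_tl by exact: rhol_pr.
have hi0 := @hg_coord R _ (0 : V) ord_fst.
have IW : inI setT 0 F (fun x => (W (row_tl x)).[x 0 ord_fst]).
  apply: (inI_eq (f := fun x => T x * F j0 x)); first by apply: filterS WT => x -> _.
  by apply: inIM => //; exact: inI_gen.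
have If j : inI setT 0 F (fun x => (f j (row_tl x)).[x 0 ord_fst]).
  apply: (inI_eq (f := fun x => F j x - (F j x - (f j (row_tl x)).[x 0 ord_fst]))).
    by apply: near_all => x _; rewrite subKr.
  apply: inIB; first exact: inI_gen.
  apply: inI_trans (Hf j).2 => -[]; exact: inI_gen.
have phol_pr p q : phol 0 p q -> phol (0 : V) p (fun x => q (row_tl x)).
  by move=> hq; apply: phol_comp; [exact: holo_row | rewrite pr0].
have ID l : inI setT 0 F (fun x => D l (row_tl x)).
  have : inI setT 0 F (fun x => \sum_(i < s.+1) (\adj (elim_mx (W (row_tl x)) (fl l (row_tl x)) s)) 0 i *
      (x 0 ord_fst ^+ i * (fl l (row_tl x)).[x 0 ord_fst] -
       (wquo (W (row_tl x)) (fl l (row_tl x)) s i).[x 0 ord_fst] * (W (row_tl x)).[x 0 ord_fst])).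
    apply: inI_sum => i _; apply: inIM.
      apply: (rhol_comp (c := fun z => (\adj (elim_mx (W z) (fl l z) s)) 0 i) hpr).
      by rewrite pr0; exact: hg_adj.
    apply: inIB.
      apply: inIM; first exact: hgX.
      apply: (inI_eq (f := fun x => \sum_j (l%:R ^+ enum_rank j) * (f j (row_tl x)).[x 0 ord_fst])).
        by apply: near_all => x _; rewrite horner_sum; apply: eq_bigr => j _; rewrite hornerZ.
      by apply: inI_sum => j _; apply: inIM => //; exact: hg_cst.
    apply: inIM => //; apply: (phol_horner (phol_pr _ _ (phol_wquo i Wm hW (hfl l)))).
    exact: hi0.
  apply: inI_eq; apply: near_all => x _.
  rewrite /D (elim_ideal (x 0 ord_fst) (Wm _).1 (Wm _).2 ((hfl l).1 _)).
  by apply: eq_bigr => i _; rewrite [X in _ - X]mulrC.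
(* A common zero z of the resultants yields a common root t of W z and the f_j z. For small z the
   root is small, so (t, z) is a common zero of the F_j in the neighbourhood where only 0 is one. *)
have zero : \forall z \near (0 : 'rV[C]_k), (forall l, D l z = 0) -> z = 0.
  have near_x : \forall x \near (0 : V), [/\ (forall j, F j x = 0) -> x = 0,
      (W (row_tl x)).[x 0 ord_fst] = T x * F j0 x, T x != 0 &
      forall j, exists q, F j x - (f j (row_tl x)).[x 0 ord_fst] = q * F j0 x].
    have H1 : \forall x \near (0 : V), forall j, exists q, F j x - (f j (row_tl x)).[x 0 ord_fst] = q * F j0 x.
      apply: near_forall => j; have [q [_ E]] := (Hf j).2.
      by apply: filterS E => x E; exists (q tt x); rewrite E // sum_unit.
    have H2 := cont_neq0 (hgcont hT) T0.
    by near=> x; split; near: x.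
  have /nm_nearP[r r0 Hr] := near_x.
  pose del := Num.min r 1.
  have d01 : 0 < del <= 1 by rewrite lt_min r0 ltr01 ge_min lexx orbT.
  pose eta := del ^+ s.+1 / (s.+1%:R + 1).
  have dd : 0 < del by case/andP: d01.
  have s0 : (0 : R) < s.+1%:R by rewrite ltr0n.
  have eta0 : 0 < eta by rewrite divr_gt0 ?exprn_gt0 ?addr_gt0.
  have eta1 : eta * s.+1%:R < del ^+ s.+1.
    rewrite /eta -mulrA gtr_pMr ?exprn_gt0 // mulrC ltr_pdivrMr ?addr_gt0 //.
    by rewrite mul1r ltrDl.
  have Wsmall : \forall z \near (0 : 'rV[C]_k), forall i : 'I_s.+1, nm ((W z)`_i : C) < eta.
    apply: near_forall => i.
    have /cont_nm/(_ eta eta0)[d d0 Hd] := hgcont (hW.2 i).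
    have := near_nm (0 : 'rV[C]_k) d0; apply: filterS => z /Hd.
    by rewrite W0 coefXn; case: eqP => [e|_]; [have := ltn_ord i; rewrite e ltnn | rewrite subr0].
  have := near_nm (0 : 'rV[C]_k) dd; move: Wsmall; apply: filterS2 => z Wz; rewrite subr0 => zd Dz.
  have [t Wt ft] := common_root (Wm z).1 (Wm z).2 (fun j => (Hf j).1.1 z) Dz.
  have td : nm t < del.
    apply: (root_small (ltn0Sn s) (Wm z).1 (Wm z).2 d01 _ eta1 Wt) => i si.
    exact/ltW/(Wz (Ordinal si)).
  have xr : nm (row_cons t z - 0) < r.
    rewrite subr0; apply: nm_row_lt => // i; case: (split_ordP i) => l ->.
      by rewrite (ord1 l) inj_i0; apply: lt_le_trans td _; rewrite ge_min lexx.
    rewrite inj_r; apply: le_lt_trans (nm_coord z l) _.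
    by apply: lt_le_trans zd _; rewrite ge_min lexx.
  have [x0 Wx Tx Fx] := Hr _ xr.
  rewrite inj_i0 pr_inj in Wx Fx.
  have Fj0 : F j0 (row_cons t z) = 0.
    by apply/eqP; move: Wx; rewrite (eqP Wt) => /esym/eqP; rewrite mulf_eq0 (negbTE Tx).
  have /(congr1 row_tl) : row_cons t z = 0.
    apply: x0 => j; have [q] := Fx j.
    by rewrite Fj0 mulr0 (eqP (ft j)) subr0.
  by rewrite pr_inj pr0.
have Rz j : radI setT 0 F (fun x => row_tl x 0 j).
  have [N IN] := IH _ D hD zero j; exists N.
  rewrite -pr0 in IN.
  by have := inI_comp hpr IN; apply: inI_trans => l.
move=> i; case: (split_ordP i) => l ->; last first.
  by apply: radI_eq (Rz l); apply: near_all => x _; rewrite prE.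
(* Modulo the remaining coordinates, W is x_0^(s + 1). *)
rewrite (ord1 l) -/ord_fst; apply: (@radI_pow _ _ _ _ _ _ _ s).
have hW' : phol (row_tl 0) s.+2 W by rewrite pr0.
have [q [q1 q2]] := phol_horner_inI setT hpr hW' hi0.
apply: (@radI_eq _ _ _ _ _ _ (fun x => (W (row_tl x)).[x 0 ord_fst] + - 1 * \sum_j q j x * row_tl x 0 j)).
  apply: filterS q2 => x /(_ I); rewrite pr0 W0 hornerXn => e _.
  have <- : \sum_j q j x * (row_tl x 0 j - (0 : 'rV[C]_k) 0 j) = \sum_j q j x * row_tl x 0 j.
    by apply: eq_bigr => j _; rewrite [X in _ - X]mxE subr0.
  by rewrite mulN1r -[X in _ - X]e subKr.
have hq : holo_germ 0 (fun x => \sum_j q j x * row_tl x 0 j).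
  by apply: hg_sum => j; apply: hgM => //; exact: hpr.
apply: radID.
- exact: (phol_horner (phol_pr _ _ hW) hi0).
- by apply: hgM => //; exact: hg_cst.
- exact: radI_inI.
apply: radIM; first exact: hg_cst.
apply: radI_sum => j; first by apply: hgM => //; exact: hpr.
exact: radIM.
Unshelve. all: by end_near. Qed.

(** Some F_j0 is not zero near 0, as the zero is isolated in positive dimension. A shear moves a
    line on which F_j0 does not vanish identically to the first axis, where it has finite order. If
    the order is 0, F_j0 is a unit. *)
Lemma nullst_step : nullst k -> nullst (1 + k).
Proof.
move=> IH J F hF iso.
have [j0 Fj0] : exists j, ~ \forall x \near (0 : V), F j x = 0.
  apply: contrapT => nE.
  have all0 : \forall x \near (0 : V), forall j, F j x = 0.
    by apply: near_forall => j; apply: contrapT => H; apply: nE; exists j.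
  have z0 : \forall x \near (0 : V), x = 0 by move: all0 iso; apply: filterS2 => x H; apply.
  have hl : rhol (0 : C) (fun t => row_cons t 0).
    by apply: rhol_inj; [exact: df_near_id | move=> j; exact: hg_cst].
  rewrite -inj0 in z0; have := cont_near (rhol_cont hl) z0.
  move=> /near_punctured[t /eqP t0 it]; apply: t0.
  by rewrite -(inj_i0 t 0) it inj0 mxE.
have [r [M [r0 hr hM]]] := hg_bounded (hF j0).
have [a [ar Fa a0]] : exists a : V, [/\ nm a < r, F j0 a != 0 & a 0 ord_fst != 0].
  have [b [br Fb]] : exists b : V, nm b < r /\ F j0 b != 0.
    apply: contrapT => nE; apply: Fj0; apply: filterS (near_nm (0 : V) r0) => x.
    rewrite subr0 => xr; apply/eqP/negPn/negP => Fx; apply: nE; by exists x.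
  have [b0|b0] := eqVneq (b 0 ord_fst) 0; last by exists b.
  have hl : \forall t \near (0 : C), differentiable (fun t : C => b + t *: (row_cons 1 0 : V)) t.
    by apply: near_all => t; exact: df_line.
  have cl := differentiable_continuous (nbhs_singleton hl).
  have bE : b + 0 *: row_cons 1 0 = b by rewrite scale0r addr0.
  have hb : holo_germ b (F j0) by apply: (hol_germ hr); rewrite subr0.
  have d0 : 0 < r - nm b by rewrite subr_gt0.
  have : \forall x \near (b + 0 *: row_cons 1 0 : V), F j0 x != 0 /\ nm (x - b) < r - nm b.
    rewrite bE; have := near_nm b d0; have := cont_neq0 (hgcont hb) Fb.
    by apply: filterS2 => x; split.
  move=> /(cont_near cl)/near_punctured[t t0 [Ft tb]].
  exists (b + t *: row_cons 1 0); split=> //.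
    by have := nmD (b + t *: row_cons 1 0 - b) b; rewrite subrK; lra.
  by rewrite mxE b0 add0r mxE inj_i0 mulr1.
(* [sh 1] maps the first unit vector to a / a_0. *)
pose u : V := (a 0 ord_fst)^-1 *: a - row_cons 1 0.
have u0 : u 0 ord_fst = 0 by rewrite mxE [X in _ + X]mxE inj_i0 mxE mulVf // subrr.
pose sh (c : C) x : V := x + (c * x 0 ord_fst) *: u.
have sh_i0 c x : sh c x 0 ord_fst = x 0 ord_fst by rewrite mxE [X in _ + X]mxE u0 mulr0 addr0.
have shK x : sh 1 (sh (- 1) x) = x.
  by rewrite {1}/sh sh_i0 /sh -addrA -scalerDl -mulrDl addNr mul0r scale0r addr0.
have shK' x : sh (- 1) (sh 1 x) = x.
  by rewrite {1}/sh sh_i0 /sh -addrA -scalerDl -mulrDl subrr mul0r scale0r addr0.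
have sh0 c : sh c 0 = 0 by rewrite /sh mxE mulr0 scale0r addr0.
have hsh c : rhol (0 : V) (sh c).
  move=> j; under eq_fun do rewrite mxE [X in _ + X]mxE.
  apply: hgD; first exact: hg_coord.
  apply: hgM; last exact: hg_cst.
  by apply: hgM; [exact: hg_cst | exact: hg_coord].
pose F' j x := F j (sh 1 x).
have hF' j : holo_germ 0 (F' j) by apply: (rhol_comp (c := F j) (hsh 1)); rewrite sh0.
have iso' : \forall x \near (0 : V), (forall j, F' j x = 0) -> x = 0.
  rewrite -(sh0 1) in iso; have := cont_near (rhol_cont (hsh 1)) iso.
  by apply: filterS => x H /H e; rewrite -(shK' x) e sh0.
suff R' i : radI setT 0 F' (fun x => x 0 i).
  move=> i; have : radI setT 0 F' (fun x => x 0 i + u 0 i * x 0 ord_fst).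
    apply: radID => //; try exact: hg_coord.
      by apply: hgM; [exact: hg_cst | exact: hg_coord].
    by apply: radIM => //; exact: hg_cst.
  move=> [N IN]; exists N; rewrite -(sh0 (- 1)) in IN.
  have [q [q1 q2]] := inI_comp (hsh (- 1)) IN.
  exists q; split=> //; apply: filterS q2 => x /[apply].
  rewrite /F'; under eq_bigr do rewrite shK.
  move=> <-; congr (_ ^+ _); rewrite -{1}(shK x) {1}/sh mxE [X in _ + X]mxE sh_i0.
  by rewrite mul1r [X in _ + X]mulrC.
pose phi (t : C) : C := F j0 (t *: ((a 0 ord_fst)^-1 *: a)).
have phiE t : F' j0 (row_cons t 0) = phi t.
  rewrite /F' /sh inj_i0 mul1r /phi /u scalerBr addrCA; congr (F j0 _).
  rewrite -[RHS]addr0; congr (_ + _); apply/eqP; rewrite subr_eq0; apply/eqP.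
  apply/rowP => j; rewrite [RHS]mxE; case: (split_ordP j) => l ->.
    by rewrite (ord1 l) !inj_i0 mulr1.
  by rewrite !inj_r [X in _ * X]mxE mulr0 mxE.
have na0 : 0 < nm (a 0 ord_fst : C) by rewrite nm_gt0.
have na : 0 < nm a.
  by apply: lt_le_trans na0 _; exact: nm_coord.
(* On the line t -> t a / a_0 the point a has parameter a_0, of modulus less than [rho], and
   parameters below [rho] stay in the ball of radius r. Vanishing near 0 would thus propagate to
   a. *)
pose rho := r * (nm (a 0 ord_fst : C) / nm a).
have rhoa : nm (a 0 ord_fst : C) < rho.
  by rewrite /rho mulrCA ltr_pMr // ltr_pdivlMr // mul1r.
have rho0 : 0 < rho by apply: lt_trans rhoa.
have in_r (t : C) : nm t < rho -> nm (t *: ((a 0 ord_fst)^-1 *: a)) < r.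
  move=> tr; rewrite !nmZ nmV.
  have e : rho * ((nm (a 0 ord_fst : C))^-1 * nm a) = r by rewrite /rho; field; rewrite !gt_eqF.
  by rewrite -[X in _ < X]e ltr_pM2r // mulr_gt0 // invr_gt0.
have hphi : hol (0 : C) rho phi.
  move=> t; rewrite subr0 => tr.
  have := @df_comp R _ _ (fun t : C => 0 + t *: ((a 0 ord_fst)^-1 *: a)) (F j0) t (df_line _ _ _).
  rewrite add0r => /(_ (hr _ _)); under eq_fun do rewrite add0r; apply.
  by rewrite subr0; exact: in_r.
have phiM (t : C) : nm (t - 0) < rho -> nm (phi t) <= M.
  by rewrite subr0 => tr; apply: hM; rewrite subr0; exact: in_r.
have [[m [g [hg g0 pg]]]|Z] := order_dich rho0 hphi phiM; last first.
  have Z0 : \forall t \near (0 : C), phi t = 0.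
    have r6 : 0 < rho / 6 by lra.
    by apply: filterS (near_nm (0 : C) r6) => t /ltW; exact: Z.
  have := identity_disc hphi phiM Z0; move=> /(_ (a 0 ord_fst)); rewrite subr0 => /(_ rhoa).
  by rewrite /phi scalerA mulfV // scale1r => e; rewrite e eqxx in Fa.
have hg0 : holo_germ 0 g by apply: (hol_germ hg); rewrite subrr nm0.
case: m pg => [|m] pg.
  apply: radI_inI.
  have F0 : F' j0 0 != 0 by rewrite -inj0 phiE pg expr0 mul1r.
  apply: (@inI_eq _ _ _ _ _ _ (fun x => x 0 i / F' j0 x * F' j0 x)).
    have := cont_neq0 (hgcont (hF' j0)) F0; apply: filterS => x Fx _.
    by rewrite divfK.
  apply: inIM; last exact: inI_gen.
  by apply: hgM; [exact: hg_coord | exact: hgV].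
have reg : \forall t \near (0 : C), F' j0 (row_cons t 0) = t ^+ m.+1 * g t.
  by apply: near_all => t; rewrite phiE pg subr0.
exact: (nullst_regular IH hF' hg0 g0 reg iso').
Qed.

End Nullstellensatz.

Lemma nullstellensatz (R : realType) n : nullst R n.
Proof.
elim: n => [|n IH]; first by move=> J F _ _ [].
exact: nullst_step IH.
Qed.

(** * Principal points of hypersurfaces *)

Section Etale.
Variable R : realType.
Local Notation C := (CC R).

Lemma near_near (V : normedModType (complex R)) (y : V) (P : V -> Prop) :
  (\forall x \near y, P x) -> \forall z \near y, \forall x \near z, P x.
Proof. by move/nbhs_interior. Qed.

Lemma near_at (V : normedModType (complex R)) (y : V) (P : V -> Prop) :
  (\forall x \near y, P x) -> P y.
Proof. exact: nbhs_singleton. Qed.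

Lemma not_near (V : normedModType (complex R)) (y : V) (P Q : V -> Prop) :
  ~ (\forall x \near y, P x) -> (\forall x \near y, Q x) -> exists2 x, Q x & ~ P x.
Proof.
move=> nP nQ; apply: contrapT => H; apply: nP; apply: filterS nQ => x Qx.
by apply: contrapT => nPx; apply: H; exists x.
Qed.

(** The expansion of the determinant makes the coefficients holomorphic; its rough degree bound is
    replaced by the exact size of [char_poly]. *)
Lemma phol_char_poly (V : normedModType (complex R)) (b : V) s (M : V -> 'M[C]_s) :
  (forall i j, holo_germ b (fun t => M t i j : C)) -> phol b s.+1 (fun t => char_poly (M t)).
Proof.
move=> hM; split=> [t|]; first by rewrite size_char_poly.
have : exists m, phol b m (fun t => char_poly (M t)).
  exists (1 + (size (index_enum 'I_s) * 2).+1)%N; rewrite /char_poly /determinant.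
  apply: phol_sum => p; apply: pholM; first by apply: phol_cst; rewrite -polyC1 -polyCN -rmorphXn /= size_polyC_leq1.
  apply: phol_prod => i; under eq_fun do rewrite !mxE.
  apply: pholD.
    by apply: phol_cst; case: (_ == _); rewrite ?mulr0n ?size_poly0 // mulr1n size_polyX.
  by apply/pholN/phol_le/phol_polyC/hM.
by move=> [m []].
Qed.

Variable n : nat.
Local Notation V := 'rV[C]_n.
Variable A : set V.
Implicit Types (x y : V) (h : V -> C).

Definition shifted y d (w : V -> 'rV[C]_d) (j : 'I_d) x : C := w x 0 j - w y 0 j.
Definition isolates d (w : V -> 'rV[C]_d) y :=
  \forall x \near y, A x -> w x = w y -> x = y.
Definition pow_cond d (w : V -> 'rV[C]_d) y := exists2 N, (0 < N)%N &
  forall i, inI A y (shifted y w) (fun x => (x 0 i - y 0 i) ^+ N).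

(** The Nullstellensatz for the equations of [A] together with w - w(y), translated to 0. On [A] the
    terms with the equations of [A] vanish. *)
Lemma isolates_pow d (w : V -> 'rV[C]_d) y : analytic_at (@holo_germ R V) A y ->
  rhol y w -> isolates w y -> pow_cond w y.
Proof.
move=> [k [F [hF AF]]] hw iso.
pose tr x := x + y.
have htr : rhol 0 tr.
  by move=> j; under eq_fun do rewrite mxE; apply: hgD; [exact: hg_coord | exact: hg_cst].
have tr0 : tr 0 = y by rewrite /tr add0r.
pose G (o : 'I_k + 'I_d) x : C := match o with inl j => F j (tr x) | inr j => shifted y w j (tr x) end.
have hG o : holo_germ 0 (G o).
  case: o => j /=; first by apply: (rhol_comp (c := F j) htr); rewrite tr0.
  apply: (rhol_comp (c := shifted y w j) htr); rewrite tr0.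
  by apply: hgB; [exact: hw | exact: hg_cst].
have isoG : \forall x \near (0 : V), (forall o, G o x = 0) -> x = 0.
  have H : \forall x \near tr 0, (forall j, F j x = 0) -> w x = w y -> x = y.
    rewrite tr0; move: AF iso; apply: filterS2 => x AFx isx Fx wx.
    by apply: isx => //; apply/AFx.
  have := cont_near (rhol_cont htr) H; apply: filterS => x Hx Gx.
  have e : tr x = y.
    apply: Hx => [j|]; first exact: (Gx (inl j)).
    by apply/rowP => j; apply/eqP; rewrite -subr_eq0; apply/eqP; exact: (Gx (inr j)).
  by rewrite -[x](addrK y) -/(tr x) e subrr.
pose bt x := x - y.
have hbt : rhol y bt.
  move=> j; under eq_fun do rewrite mxE [X in _ + X]mxE.
  by apply: hgB; [exact: hg_coord | exact: hg_cst].
have bty : bt y = 0 by rewrite /bt subrr.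
have trbt x : tr (bt x) = x by rewrite /tr /bt subrK.
have /choice[N HN] i : exists N, inI A y (shifted y w) (fun x => (x 0 i - y 0 i) ^+ N).
  have [N IN] := @nullstellensatz R n _ G hG isoG i; exists N.
  rewrite -bty in IN.
  have [q [q1 q2]] := inI_comp hbt IN.
  exists (fun j => q (inr j)); split=> //.
  move: AF q2; apply: filterS2 => x AFx /(_ I) e Ax.
  have -> : x 0 i - y 0 i = bt x 0 i by rewrite [RHS]mxE [X in _ = _ + X]mxE.
  rewrite e big_sumType /= big1 ?add0r => [|j _].
    by apply: eq_bigr => j _; rewrite trbt.
  by rewrite trbt ((AFx.1 Ax) j) mulr0.
exists (\sum_i N i).+1 => // i; apply: inI_pow_le (HN i).
  by apply: hgB; [exact: hg_coord | exact: hg_cst].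
by rewrite (bigD1 i) //= -addnS leq_addr.
Qed.

Definition monic_root d (w : V -> 'rV[C]_d) h y := exists s (p : 'rV[C]_d -> {poly C}),
  [/\ phol (w y) s.+1 p, forall t, p t \is monic /\ size (p t) = s.+1 &
      \forall x \near y, A x -> (p (w x)).[h x] = 0].

(** Multiplication by h acts on the finitely many monomials e_a by a matrix in w. At x in [A] the
    vector of the e_a(x) is an eigenvector for h(x), nonzero because one of the monomials is 1. *)
Lemma integral_dep d (w : V -> 'rV[C]_d) y h : rhol y w -> pow_cond w y ->
  holo_germ y h -> monic_root w h y.
Proof.
move=> hw [N N0 HN] hh.
have /choice[q Hq] i : exists q : 'I_d -> V -> C, (forall j, holo_germ y (q j)) /\
    \forall x \near y, A x -> (x 0 i - y 0 i) ^+ N = \sum_j q j x * shifted y w j x := HN i.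
have E : \forall x \near y, A x -> forall i,
    (x 0 i - y 0 i) ^+ N = \sum_j q i j x * (w x 0 j - w y 0 j).
  have := near_forall (fun i => (Hq i).2); apply: filterS => x H Ax i; exact: H.
have [J [e [[a0 ea0] _ he H]]] := finite_division (fun=> N0) hw (fun i => (Hq i).1) E.
have /choice[c Hc] a := H _ (hgM hh (he a)).
pose M (t : 'rV[C]_d) : 'M[C]_#|J| := \matrix_(b, a) c (enum_val a) (enum_val b) t.
exists #|J|, (fun t => char_poly (M t)); split.
- apply: phol_char_poly => b a; under eq_fun do rewrite mxE.
  exact: (Hc _).1.
- by move=> t; rewrite char_poly_monic size_char_poly.
have := near_forall (fun a => (Hc a).2); apply: filterS => x Hx Ax.
apply/eqP; rewrite -[_ == 0]/(root _ _) -eigenvalue_root_char; apply/eigenvalueP.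
exists (\row_b e (enum_val b) x); last first.
  apply/eqP => /rowP/(_ (enum_rank a0)); rewrite !mxE enum_rankK ea0.
  by apply/eqP; exact: oner_neq0.
apply/rowP => a; rewrite !mxE (Hx _ Ax) [in RHS](reindex_onto enum_val enum_rank) => [|b _]; last exact: enum_rankK.
by apply: eq_big => [b|b _]; rewrite ?enum_valK ?eqxx // !mxE mulrC.
Qed.

(** Each coordinate is a root of a monic polynomial over w. At z this polynomial is (X - z_i)^m q
    with q(z_i) nonzero, so in the fibre of w the coordinate x_i near z_i can only be z_i. *)
Lemma isolates_near d (w : V -> 'rV[C]_d) y : rhol y w -> pow_cond w y ->
  \forall z \near y, isolates w z.
Proof.
move=> hw pc.
have /near_forall : forall i : 'I_n, \forall z \near y,
    \forall x \near z, A x -> w x = w z -> x 0 i = z 0 i.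
  move=> i; have [s [p [_ pm E]]] := integral_dep hw pc (hg_coord y i).
  apply: filterS (near_near E) => z Ez.
  have [m [q + pq]] := multiplicity_XsubC (p (w z)) (z 0 i).
  rewrite -size_poly_gt0 (pm _).2 /= => q0.
  have qn : \forall x \near z, q.[(x : V) 0 i] != 0.
    apply: cont_neq0; last by rewrite -rootE.
    by apply/hgcont/(hg_comp (c := fun t => q.[t])); [exact/hg_coord | exact: hg_poly].
  move: Ez qn; apply: filterS2 => x e qx Ax wx; have := e Ax.
  rewrite wx pq hornerM horner_exp hornerXsubC => /eqP.
  by rewrite mulf_eq0 (negbTE qx) /= expf_eq0 subr_eq0 => /andP[_ /eqP].
apply: filterS => z /near_forall; apply: filterS => x H Ax wx.
by apply/rowP => i; exact: H.
Qed.

(* [w] is an immersion of the germ of [A] at [y]. *)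
Definition etale d (w : V -> 'rV[C]_d) y := rhol y w /\ forall h, holo_germ y h ->
  exists c, holo_germ (w y) c /\ \forall x \near y, A x -> h x = c (w x).

(** With all exponents equal to 1, the only monomial in [finite_division] is 1. *)
Lemma etale_crit d (w : V -> 'rV[C]_d) y : rhol y w ->
  (forall i, inI A y (shifted y w) (fun x => x 0 i - y 0 i)) -> etale w y.
Proof.
move=> hw /choice[q Hq]; split=> // h hh.
have E : \forall x \near y, A x -> forall i,
    (x 0 i - y 0 i) ^+ 1 = \sum_j q i j x * (w x 0 j - w y 0 j).
  have := near_forall (fun i => (Hq i).2); apply: filterS => x H Ax i; exact: H.
have [J [e [_ em _ H]]] := finite_division (fun=> ltn0Sn 0) hw (fun i => (Hq i).1) E.
have [c [hc Hc]] := H h hh.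
exists (fun t => \sum_a c a t); split; first exact: hg_sum.
apply: filterS Hc => x e1 Ax; rewrite e1 //; apply: eq_bigr => a _.
have [m [m1 ->]] := em a; rewrite big1 ?mulr1 // => i _.
by have := m1 i; case: (m i).
Qed.

Lemma etale_row d (w : V -> 'rV[C]_d) y m (g : V -> 'rV[C]_m) : etale w y -> rhol y g ->
  exists c : 'rV[C]_d -> 'rV[C]_m, rhol (w y) c /\ \forall x \near y, A x -> g x = c (w x).
Proof.
move=> [hw H] hg; have /choice[c Hc] j := H _ (hg j).
exists (fun t => \row_j c j t); split=> [j|].
  by under eq_fun do rewrite mxE; exact: (Hc j).1.
have := near_forall (fun j => (Hc j).2); apply: filterS => x Hx Ax.
by apply/rowP => j; rewrite mxE Hx.
Qed.

Lemma etale_near d (w : V -> 'rV[C]_d) y : etale w y ->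
  \forall z \near y, A z -> etale w z.
Proof.
move=> et; have [hw _] := et.
have [c [hc E]] := etale_row et (rhol_id y).
have hcw := cont_near (rhol_cont hw) (rhol_near hc).
have hwn := rhol_near hw; have En := near_near E.
near=> z => Az; apply: etale_crit; first by near: z.
move=> i.
have hcz : rhol (w z) c by near: z.
have hwz : rhol z w by near: z.
have Ez : \forall x \near z, A x -> x = c (w x) by near: z.
have [q [q1 q2]] := hadamard (hcz i).
exists (fun j x => q j (w x)); split=> [j|]; first exact: rhol_comp.
have zz := near_at Ez Az.
apply: filterS Ez => x e Ax; rewrite {1}(e Ax) {1}zz {1}q2 addrAC subrr add0r.
by apply: eq_bigr => j _; rewrite mulrC.
Unshelve. all: by end_near. Qed.

Lemma monic_root_near d (w : V -> 'rV[C]_d) y h : rhol y w -> monic_root w h y ->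
  \forall z \near y, monic_root w h z.
Proof.
move=> hw [s [p [hp pm E]]].
have hpz := cont_near (rhol_cont hw) (phol_near hp).
by move: hpz (near_near E); apply: filterS2 => z h1 h2; exists s, p; split.
Qed.

Definition simple_root d (w : V -> 'rV[C]_d) h y := exists s (p : 'rV[C]_d -> {poly C}),
  [/\ phol (w y) s p, \forall x \near y, A x -> (p (w x)).[h x] = 0 &
      (p (w y))^`().[h y] != 0].

Lemma simple_root_near d (w : V -> 'rV[C]_d) y h : rhol y w -> holo_germ y h ->
  simple_root w h y -> \forall z \near y, simple_root w h z.
Proof.
move=> hw hh [s [p [hp E ne]]].
have hpz := cont_near (rhol_cont hw) (phol_near hp).
have hd : holo_germ y (fun z => (p (w z))^`().[h z]).
  apply: (phol_horner (p := fun z => (p (w z))^`())) hh.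
  by apply/phol_deriv/phol_comp; [exact: holo_row | exact: hp].
have hne := cont_neq0 (hgcont hd) ne.
have En := near_near E.
near=> z; exists s, p; split; by near: z.
Unshelve. all: by end_near. Qed.

(** p (w y) = (X - y_i) q, where q(y_i) is nonzero because the root is simple. Since p (w x)
    vanishes at x_i, (x_i - y_i) q(x_i) lies in the ideal of the w_j - w_j(y), and q(x_i) is a
    unit. *)
Lemma simple_root_inI d (w : V -> 'rV[C]_d) y i : rhol y w -> A y ->
  simple_root w (fun x => x 0 i) y -> inI A y (shifted y w) (fun x => x 0 i - y 0 i).
Proof.
move=> hw Ay [s [p [hp E ne]]].
have Ey := near_at E Ay.
have /factor_theorem[q pq] : root (p (w y)) (y 0 i) by exact/eqP.
have qy : q.[y 0 i] != 0.
  by move: ne; rewrite pq derivM hornerD !hornerM derivXsubC hornerXsubC subrr mulr0 add0r hornerC mulr1.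
have hq : holo_germ y (fun x => q.[x 0 i]).
  by apply: (hg_comp (c := fun t => q.[t])); [exact/hg_coord | exact: hg_poly].
have I1 := inIM (hgV hq qy) (inIN (phol_horner_inI A hw hp (hg_coord y i))).
apply: inI_eq I1; have qn := cont_neq0 (hgcont hq) qy.
move: E qn; apply: filterS2 => x e qx Ax.
by rewrite e // pq hornerM hornerXsubC sub0r opprK mulrA mulVf // mul1r.
Qed.

(** The s-th derivative of a monic polynomial of degree s is the constant s!. So there is a last
    derivative that vanishes at h on [A] near y, and close to y there are points of [A] where the
    next one does not. *)
Lemma simple_root_exists d (w : V -> 'rV[C]_d) y h (P : V -> Prop) : rhol y w -> A y ->
  monic_root w h y -> (\forall x \near y, P x) ->
  exists z, [/\ A z, P z & simple_root w h z].
Proof.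
move=> hw Ay [s [p [hp pm E]]] nP.
pose Q l := \forall x \near y, A x -> ((p (w x))^`(l)).[h x] = 0.
have Qs : ~ Q s.
  move=> /near_at/(_ Ay) /eqP; have [m1 sz] := pm (w y).
  have -> : (p (w y))^`(s) = (s`!%:R)%:P.
    apply/polyP => i; rewrite coef_derivn coefC; case: eqVneq => [->|i0].
      rewrite addn0 ffactnn -[X in X *+ _](_ : 1 = _) // -(monicP m1) /lead_coef sz //.
    rewrite nth_default ?mul0rn // sz; lia.
  by rewrite hornerC pnatr_eq0 eqn0Ngt fact_gt0.
have [l Ql nQl] : exists2 l, Q l & ~ Q l.+1.
  apply: contrapT => nE; apply: Qs; elim: (s) => [|l IH]; first exact: E.
  by apply: contrapT => nQ; apply: nE; exists l.
have hpz := cont_near (rhol_cont hw) (phol_near hp).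
have hdz : forall z, phol z s.+1 p -> phol z s.+1 (fun t => (p t)^`(l)).
  move=> z hz; elim: (l) => [|m IH]; first exact: hz.
  by under eq_fun do rewrite derivnS; exact: phol_deriv.
have Qn := near_near Ql.
have : \forall x \near y, [/\ P x, phol (w x) s.+1 p &
   \forall z \near x, A z -> ((p (w z))^`(l)).[h z] = 0].
  by near=> x; split; near: x.
move=> /(not_near nQl)[z [Pz pz Qz] /not_implyP[Az ne]].
exists z; split=> //; exists s.+1, (fun t => (p t)^`(l)); split=> //; first exact: hdz.
by rewrite -derivnS; apply/eqP.
Unshelve. all: by end_near. Qed.

(** Simple roots are found for one coordinate after another, moving to a nearby point each time; the
    monic equations and the simple roots found before persist near their points. *)
Lemma etale_exists d (w : V -> 'rV[C]_d) y (P : V -> Prop) : rhol y w -> A y ->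
  pow_cond w y -> (\forall x \near y, P x) -> exists z, [/\ A z, P z & etale w z].
Proof.
move=> hw Ay pc nP.
have mr : forall i, monic_root w (fun x => x 0 i) y.
  by move=> i; apply: integral_dep => //; exact: hg_coord.
have H (r : seq 'I_n) : forall y (P : V -> Prop), rhol y w -> A y ->
    (forall i, monic_root w (fun x => x 0 i) y) -> (\forall x \near y, P x) ->
    exists z, [/\ A z, P z, rhol z w & forall i, i \in r -> simple_root w (fun x => x 0 i) z].
  elim: r => [|i r IH] {hw Ay mr nP P pc}y P hw Ay mr nP.
    by exists y; split=> //; exact: near_at nP.
  have mrn := near_forall (fun i => monic_root_near hw (mr i)).
  have hwn := rhol_near hw; have nPn := near_near nP.
  have nP' : \forall x \near y, [/\ \forall z \near x, P z, rhol x w &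
      forall i, monic_root w (fun x => x 0 i) x].
    by near=> x; split; near: x.
  have [z [Az [Pz hz mz] sz]] := simple_root_exists hw Ay (mr i) nP'.
  have szn := simple_root_near hz (hg_coord z i) sz.
  have nP'' : \forall x \near z, P x /\ simple_root w (fun x => x 0 i) x.
    by move: Pz szn; apply: filterS2.
  have [z' [Az' [Pz' si] hz' H]] := IH z _ hz Az mz nP''.
  by exists z'; split=> // k; rewrite inE => /orP[/eqP->|/H].
have [z [Az Pz hz sz]] := H (enum 'I_n) y P hw Ay mr nP.
exists z; split=> //; apply: etale_crit => // i.
by apply: simple_root_inI => //; apply: sz; rewrite mem_enum.
Unshelve. all: by end_near. Qed.

End Etale.

(** * Removing a function from a projection *)

Section Reduction.
Variable R : realType.
Local Notation C := (CC R).

(** The line joins b to a nearby point where beta does not vanish; by the identity theorem beta has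
    finite order along it. *)
Lemma line_order (V : normedModType (complex R)) (b : V) (beta : V -> C) : holo_germ b beta ->
  ~ (\forall t \near b, beta t = 0) -> exists v s g,
  [/\ beta (b + v) != 0, holo_germ (0 : C) g, g 0 != 0 &
      forall t : C, beta (b + t *: v) = t ^+ s * g t].
Proof.
move=> hb nb; have [r [M [r0 hr hM]]] := hg_bounded hb.
have [a ar ba] := not_near nb (near_nm b r0).
pose v := a - b; have [v0|v0] := eqVneq v 0.
  have ab : a = b by apply/eqP; rewrite -subr_eq0 -/v v0.
  have bb : beta b != 0 by apply/eqP; rewrite -ab.
  exists v, 0%N, (fun=> beta b); rewrite v0 addr0; split=> // [|t].
  - exact: hg_cst.
  - by rewrite scaler0 addr0 expr0 mul1r.
have nv : 0 < nm v by rewrite nm_gt0.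
pose rho := r / nm v.
have rho0 : 0 < rho by exact: divr_gt0.
have in_r (t : C) : nm (t - 0) < rho -> nm (b + t *: v - b) < r.
  by rewrite subr0 addrAC subrr add0r nmZ /rho ltr_pdivlMr.
have hphi : hol (0 : C) rho (fun t => beta (b + t *: v)).
  move=> t tr; apply: (df_comp (f := fun t : C => b + t *: v)); first exact: df_line.
  exact/hr/in_r.
have phiM (t : C) : nm (t - 0) < rho -> nm (beta (b + t *: v)) <= M.
  by move=> tr; exact/hM/in_r.
have b1 : beta (b + v) != 0 by rewrite /v addrC subrK; exact/eqP.
have [[m [g [hg g0 pg]]]|Z] := order_dich rho0 hphi phiM.
  exists v, m, g; split; [exact: b1 | | exact: g0 | by move=> t; rewrite pg subr0].
  by apply: (hol_germ hg); rewrite subrr nm0.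
have Z0 : \forall t \near (0 : C), beta (b + t *: v) = 0.
  have r6 : 0 < rho / 6 by lra.
  by apply: filterS (near_nm (0 : C) r6) => t /ltW; exact: Z.
have := identity_disc hphi phiM Z0; move=> /(_ 1); rewrite scale1r subr0 nm1 ltr_pdivlMr //.
by rewrite mul1r => /(_ ar) e; rewrite e eqxx in b1.
Qed.

(** The first order parts of f and g would factor the identity of dimension d + 1 through dimension
    d. *)
Lemma no_section d (b : 'rV[C]_d.+1) (f : 'rV[C]_d.+1 -> 'rV[C]_d) (g : 'rV[C]_d -> 'rV[C]_d.+1) :
  rhol b f -> rhol (f b) g -> ~ \forall x \near b, g (f x) = x.
Proof.
move=> hf hg E.
have /choice[p Hp] j := hadamard (hf j).
have /choice[q Hq] i := hadamard (hg i).
pose P x : 'M[C]_(d.+1, d) := \matrix_(l, j) p j l x.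
pose Q t : 'M[C]_(d, d.+1) := \matrix_(j, i) q i j t.
have key x : g (f x) = g (f b) + (x - b) *m P x *m Q (f x).
  apply/rowP => i; rewrite (Hq i).2 mxE; congr (_ + _); rewrite mxE.
  apply: eq_bigr => j _; rewrite [Q _ _ _]mxE; congr (_ * _).
  rewrite (Hp j).2 addrAC subrr add0r mxE; apply: eq_bigr => l _.
  by rewrite [P _ _ _]mxE; congr (_ * _); rewrite [RHS]mxE [X in _ = _ + X]mxE.
suff PQ : P b *m Q (f b) = 1%:M by have := mulmx1_min PQ; rewrite ltnn.
apply/matrixP => l i.
have hl : \forall t \near (0 : C), differentiable (fun t : C => b + t *: delta_mx 0 l) t.
  by apply: near_all => t; exact: df_line.
have bE : b + 0 *: delta_mx 0 l = b by rewrite scale0r addr0.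
pose m (x : 'rV[C]_d.+1) : C := (P x *m Q (f x)) l i.
have hm : holo_germ b m.
  rewrite /m; under eq_fun do rewrite mxE.
  apply: hg_sum => j; apply: hgM; under eq_fun do rewrite mxE.
    exact: (Hp j).1.
  by apply: (rhol_comp (c := q i j) hf); exact: (Hq i).1.
have hml : holo_germ (0 : C) (fun t => m (b + t *: delta_mx 0 l) - (l == i)%:R).
  by apply: hgB; last exact: hg_cst; apply: (hg_comp (c := m) hl); rewrite bE.
have Z : \forall t \near (0 : C), (t - 0) ^+ 1 * (m (b + t *: delta_mx 0 l) - (l == i)%:R) = 0.
  have Eb := near_at E; rewrite -bE in E.
  have cl := differentiable_continuous (near_at hl).
  have := cont_near cl E; apply: filterS => t; rewrite key Eb => /rowP/(_ i).
  rewrite subr0 addrAC subrr add0r -mulmxA -scalemxAl -rowE.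
  have cE (N : 'rV[C]_d.+1) : (b + t *: N) 0 i = b 0 i + t * N 0 i.
    by rewrite mxE [X in _ + X]mxE.
  have rE (N : 'M[C]_d.+1) : row l N 0 i = N l i by rewrite mxE.
  have dE : (delta_mx 0 l : 'rV[C]_d.+1) 0 i = (l == i)%:R by rewrite mxE eqxx eq_sym.
  rewrite [LHS]cE [RHS]cE rE dE => /addrI e.
  by rewrite /m expr1 mulrBr e subrr.
have : m b - (l == i)%:R == 0.
  apply/negPn/negP => ne; apply: (order_not0 (hgcont hml) _ Z).
  by rewrite bE.
by rewrite subr_eq0 => /eqP; rewrite /m => ->; rewrite mxE.
Qed.

Variable n : nat.
Local Notation V := 'rV[C]_n.
Implicit Types (A : set V) (x y : V).

(** Hadamard's lemma in u only, with v as a holomorphic parameter: f (u + v) is regarded as a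
    function of 2 n variables. *)
Lemma hadamard2 y (f : V -> C) : holo_germ y f -> exists q : 'I_n -> 'rV[C]_(n + n) -> C,
  (forall i, holo_germ (row_mx 0 y) (q i)) /\
  forall u v : V, f (u + v) = f v + \sum_i u 0 i * q i (row_mx u v).
Proof.
move=> hf; pose F (z : 'rV[C]_(n + n)) := f (lsubmx z + rsubmx z).
have hF : holo_germ (row_mx 0 y) F.
  apply: (rhol_comp (c := f)); last by rewrite row_mxKl row_mxKr add0r.
  by move=> j; under eq_fun do rewrite !mxE; apply: hgD; exact: hg_coord.
have [q [q1 q2 q3]] := hadamard_part [seq lshift n j | j <- enum 'I_n] hF.
exists (fun i => q (lshift n i)); split=> // u v.
have := q3 (row_mx u v); rewrite {1}/F row_mxKl row_mxKr => ->.
have -> : upds (row_mx 0 y) [seq lshift n j | j <- enum 'I_n] (row_mx u v) = row_mx 0 v.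
  apply/rowP => j; rewrite updsE; case: (split_ordP j) => l ->.
    by rewrite mem_map ?mem_enum ?row_mxEl //; exact: lshift_inj.
  by case: ifP => [/mapP[l' _ /eqP]|_]; rewrite ?row_mxEr // eq_sym eq_lrshift.
rewrite /F row_mxKl row_mxKr add0r big_split_ord /=; congr (_ + _).
rewrite [X in _ + X]big1 ?addr0 => [|j _].
  by apply: eq_bigr => j _; rewrite !row_mxEl mxE subr0.
rewrite q2 ?mulr0 //; apply/mapP => -[l' _ /eqP].
by rewrite eq_sym eq_lrshift.
Qed.

(** The linear projection whose kernel is spanned by the vector with k-th entry 1 and the entries
    [u] elsewhere. *)
Definition project d (k : 'I_d.+1) (u : 'I_d -> C) (t : 'rV[C]_d.+1) : 'rV[C]_d :=
  \row_j (t 0 (lift k j) - t 0 k * u j).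

Lemma rhol_project d k u (w : V -> 'rV[C]_d.+1) y : rhol y w ->
  rhol y (fun x => @project d k u (w x)).
Proof.
move=> hw j; under eq_fun do rewrite mxE.
by apply: hgB; [exact: hw | apply: hgM; [exact: hw | exact: hg_cst]].
Qed.

Lemma project_inj d k u (t t' : 'rV[C]_d.+1) : @project d k u t = project k u t' ->
  t 0 k = t' 0 k -> t = t'.
Proof.
move=> pt tk; apply/rowP => j; case: (unliftP k j) => [i ->|-> //].
by move: pt => /rowP/(_ i); rewrite !mxE tk => /addIr.
Qed.

(** Project along a line through w(y) on which beta has finite order. Points of a fibre have their
    image under w on this line and satisfy beta = 0; near w(y) this leaves w(y) alone. *)
Lemma isolates_project A y d (w : V -> 'rV[C]_d.+1) (beta : 'rV[C]_d.+1 -> C) : A y ->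
  rhol y w -> isolates A w y -> holo_germ (w y) beta ->
  ~ (\forall t \near w y, beta t = 0) -> (\forall x \near y, A x -> beta (w x) = 0) ->
  exists k u, isolates A (fun x => @project d k u (w x)) y.
Proof.
move=> Ay hw iso hb nb E.
have [v [s [g [bv hg g0 bE]]]] := line_order hb nb.
have b0 := near_at E Ay.
have /rV0Pn[k vk] : v != 0 by apply: contraNneq bv => ->; rewrite addr0 b0.
exists k, (fun j => v 0 (lift k j) / v 0 k).
pose tau x : C := (w x 0 k - w y 0 k) / v 0 k.
have htau : holo_germ y tau.
  by apply: hgM; last exact: hg_cst; apply: hgB; [exact: hw | exact: hg_cst].
have gn : \forall t \near tau y, g t != 0.
  by rewrite /tau subrr mul0r; exact: cont_neq0 (hgcont hg) g0.
have gt := cont_near (hgcont htau) gn.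
near=> x => Ax px.
have wx : w x = w y + tau x *: v.
  apply: (project_inj (k := k) (u := fun j => v 0 (lift k j) / v 0 k)); last first.
    by rewrite mxE [X in _ + X]mxE /tau divfK // addrC subrK.
  rewrite px; apply/rowP => j; rewrite !mxE /tau; field; exact: vk.
have : beta (w x) = 0 by move: Ax; near: x.
rewrite wx bE => /eqP; rewrite mulf_eq0 expf_eq0 => /orP[/andP[_ /eqP t0]|]; last first.
  by apply: contraTeq => _; near: x.
have Wx : w x = w y by rewrite wx t0 scale0r addr0.
by move: Ax Wx; near: x.
Unshelve. all: by end_near. Qed.

End Reduction.

(** * A hypersurface T in a normal analytic set S *)

Section Pairs.
Variables (R : realType) (n : nat).
Local Notation C := (CC R).
Local Notation V := 'rV[C]_n.
Implicit Types (A : set V) (x y z : V).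

Definition isoby A d y := exists w : V -> 'rV[C]_d, rhol y w /\ isolates A w y.

Definition regular_germ (S : set V) y (b : V -> C) := forall h, holo_germ y h ->
  (\forall x \near y, S x -> b x * h x = 0) -> \forall x \near y, S x -> h x = 0.

(** A family with one member, to express principal ideals by [inI]. *)
Definition one (f : V -> C) : unit -> V -> C := fun=> f.

Definition normal_germs (S : set V) y := forall (a b : V -> C) m (c : 'I_m -> V -> C),
  holo_germ y a -> holo_germ y b -> (forall i, holo_germ y (c i)) -> regular_germ S y b ->
  (\forall x \near y, S x ->
     a x ^+ m + \sum_(i < m) c i x * a x ^+ i * b x ^+ (m - i) = 0) ->
  inI S y (one b) a.

(** The homogenised characteristic polynomial: it gives the integral equation of a / c without
    denominators, also where c = 0. *)
Lemma det_homog (F : fieldType) m (M : 'M[F]_m) (a c : F) :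
  \det (a%:M - c *: M) = a ^+ m + \sum_(i < m) (char_poly M)`_i * a ^+ i * c ^+ (m - i).
Proof.
have hc t : \det (t%:M - M) = (char_poly M).[t].
  rewrite /char_poly -horner_evalE -det_map_mx; congr (\det _); apply/matrixP => i j.
  rewrite !mxE /= /horner_eval !hornerE; by case: (_ == _); rewrite ?mulr1n ?mulr0n !hornerE.
have [->|c0] := eqVneq c 0.
  rewrite scale0r subr0 det_scalar big1 ?addr0 // => i _.
  by rewrite expr0n subn_eq0 leqNgt ltn_ord mulr0.
have -> : a%:M - c *: M = c *: ((a / c)%:M - M).
  by rewrite scalerBr scale_scalar_mx mulrCA mulfV // mulr1.
rewrite detZ hc horner_coef size_char_poly big_ord_recr /= mulrDr addrC; congr (_ + _).
  have := char_poly_monic M; rewrite monicE /lead_coef size_char_poly /= => /eqP ->.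
  by rewrite mul1r expr_div_n mulrCA mulfV ?mulr1 // expf_neq0.
rewrite mulr_sumr; apply: eq_bigr => i _; rewrite expr_div_n.
have -> : c ^+ m = c ^+ (m - i) * c ^+ i by rewrite -exprD subnK // ltnW.
by field; rewrite expf_neq0.
Qed.

Lemma one_inI A y f g : inI A y (one g) f <->
  exists2 q, holo_germ y q & \forall x \near y, A x -> f x = q x * g x.
Proof.
split=> [[q [q1 q2]]|[q q1 q2]].
  by exists (q tt) => //; apply: filterS q2 => x H Ax; rewrite H // sum_unit.
by exists (fun=> q); split=> //; apply: filterS q2 => x H Ax; rewrite H // sum_unit.
Qed.

Lemma inI_near A y (J : finType) (g : J -> V -> C) f : inI A y g f ->
  \forall z \near y, inI A z g f.
Proof.
move=> [q [q1 q2]].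
have hq := near_forall (fun j => hg_near (q1 j)).
by move: hq (near_near q2); apply: filterS2 => z h1 h2; exists q.
Qed.

Lemma etale_isolates A d (w : V -> 'rV[C]_d) y : etale A w y -> A y -> isolates A w y.
Proof.
move=> et Ay; have [c [_ E]] := etale_row et (rhol_id y).
have Ey := near_at E Ay.
by apply: filterS E => x e Ax wx; rewrite (e Ax) wx -Ey.
Qed.

Variables (S T O : set V).
Hypothesis TS : T `<=` S.
Hypothesis O_open : forall y, O y -> \forall x \near y, O x.
Hypothesis T_an : forall y, T y -> O y -> analytic_at (@holo_germ R V) T y.
Hypothesis S_an : forall y, T y -> O y -> analytic_at (@holo_germ R V) S y.
Hypothesis dims : forall y, T y -> O y -> exists d,
  [/\ isoby T d y, forall e, isoby T e y -> (d <= e)%N, isoby S d.+1 y &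
      forall e, isoby S e y -> (d.+1 <= e)%N].
Hypothesis nrm : forall y, T y -> O y -> normal_germs S y.
Hypothesis TO : exists y, T y /\ O y.

Definition etale_dim d := exists y (w : V -> 'rV[C]_d), [/\ T y, O y & etale T w y].

Lemma min_etale_dim : exists d, etale_dim d /\ forall e, etale_dim e -> (d <= e)%N.
Proof.
have exP : exists d, `[< etale_dim d >].
  have [y [Ty Oy]] := TO; exists n; apply/asboolP; exists y, id; split=> //.
  split=> [|h hh]; first exact: rhol_id.
  by exists h; split=> //; apply: near_all.
have [d /asboolP Pd min] := ex_minnP exP.
by exists d; split=> // e Pe; apply: min; exact/asboolP.
Qed.

Section MinimalDim.
Variable d : nat.
Hypothesis min : forall e, etale_dim e -> (d <= e)%N.

Lemma isolates_etale e (w : V -> 'rV[C]_e) y (P : V -> Prop) : T y -> O y -> rhol y w ->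
  isolates T w y -> (\forall x \near y, P x) ->
  exists z, [/\ T z, O z, P z & etale T w z].
Proof.
move=> Ty Oy hw iso nP; have pc := isolates_pow (T_an Ty Oy) hw iso.
have nOP : \forall x \near y, O x /\ P x by move: (O_open Oy) nP; apply: filterS2.
by have [z [Tz [Oz Pz] ez]] := etale_exists hw Ty pc nOP; exists z.
Qed.

Lemma isoby_min e y : T y -> O y -> isoby T e y -> (d <= e)%N.
Proof.
move=> Ty Oy [w [hw iso]]; apply: min.
have nT : \forall x \near y, True by apply: near_all.
by have [z [Tz Oz _ ez]] := isolates_etale Ty Oy hw iso nT; exists z, w.
Qed.

(** A nonzero relation between the w_j on T would allow a projection to fewer functions, which
    immerse T at a nearby point, against the minimality of d. *)
Lemma dominant (w : V -> 'rV[C]_d) y (beta : 'rV[C]_d -> C) : T y -> O y -> etale T w y ->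
  holo_germ (w y) beta -> (\forall x \near y, T x -> beta (w x) = 0) ->
  \forall t \near w y, beta t = 0.
Proof.
move=> Ty Oy; case: d min w beta => [|e] mn w beta et hb E.
  have b0 := near_at E Ty.
  by apply: near_all => t; rewrite -[RHS]b0; congr beta; rewrite (thinmx0 t) (thinmx0 (w y)).
apply: contrapT => nb.
have [k [u iso]] := isolates_project Ty et.1 (etale_isolates et Ty) hb nb E.
have hp := rhol_project k u et.1.
have nT : \forall x \near y, True by apply: near_all.
have [z [Tz Oz _ ez]] := isolates_etale Ty Oy hp iso nT.
by have := mn e; rewrite ltnn => H; apply/notF/H; exists z, (fun x => project k u (w x)).
Qed.

(** The minimal d is the local dimension of T at such a point: an immersion isolates, and functions
    that isolate are an immersion at points nearby. The dimension of S is then d + 1. *)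
Lemma local_dims y (w : V -> 'rV[C]_d) : T y -> O y -> etale T w y ->
  isoby S d.+1 y /\ forall e, isoby S e y -> (d.+1 <= e)%N.
Proof.
move=> Ty Oy et; have [d' [T1 T2 S1 S2]] := dims Ty Oy.
have -> // : d = d'; apply/eqP; rewrite eqn_leq (isoby_min Ty Oy T1) T2 //.
by exists w; split; [exact: et.1 | exact: etale_isolates].
Qed.

(** Take d + 1 functions G that isolate a point on S, and move to where they immerse T. There G and
    the d functions w0 are functions of each other on T, so by [no_section] the image of T satisfies
    a nontrivial equation. Hence a projection w of G to d functions isolates on T, and immerses T
    nearby. The dropped function G_l equals some g(w) on T, and c = G_l - g(w) vanishes on T, while
    (c, w) determines G. *)
Lemma adapted_chart : etale_dim d -> exists y (w : V -> 'rV[C]_d) (c : V -> C),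
  [/\ T y, O y, etale T w y, holo_germ y c /\ (\forall x \near y, T x -> c x = 0) &
      isolates S (fun x => row_cons (c x) (w x)) y].
Proof.
move=> [y0 [w0 [Ty0 Oy0 et0]]].
have [[G [hG isoG]] _] := local_dims Ty0 Oy0 et0.
have isoT : isolates T G y0 by apply: filterS isoG => x H /TS; exact: H.
have pcS := isolates_pow (S_an Ty0 Oy0) hG isoG.
have nP : \forall x \near y0, isolates S G x /\ (T x -> etale T w0 x).
  by move: (isolates_near hG pcS) (etale_near et0); apply: filterS2.
have [y1 [Ty1 Oy1 [isoG1 /(_ Ty1) et1] etG]] := isolates_etale Ty0 Oy0 hG isoT nP.
have hG1 := etG.1.
have [e [he Ge]] := etale_row et1 hG1.
have [f [hf wf]] := etale_row etG et1.1.
pose beta k (t : 'rV[C]_d.+1) : C := t 0 k - e (f t) 0 k.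
have [k nb] : exists k, ~ \forall t \near G y1, beta k t = 0.
  apply: contrapT => nE.
  have he1 : rhol (f (G y1)) e by rewrite -(near_at wf Ty1).
  apply: (no_section hf he1).
  have /near_forall : forall k, \forall t \near G y1, beta k t = 0.
    by move=> k; apply: contrapT => nk; apply: nE; exists k.
  apply: filterS => t H; apply/rowP => k; apply/esym/eqP; rewrite -subr_eq0; apply/eqP; exact: H.
have hb : holo_germ (G y1) (beta k).
  apply: hgB; first exact: hg_coord.
  by apply: (rhol_comp (c := fun s => e s 0 k) hf); rewrite -(near_at wf Ty1); exact: he.
have Eb : \forall x \near y1, T x -> beta k (G x) = 0.
  by move: Ge wf; apply: filterS2 => x e1 e2 Tx; rewrite /beta -(e2 Tx) -(e1 Tx) subrr.
have isoG1T : isolates T G y1 by apply: filterS isoG1 => x H /TS; exact: H.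
have [l [u iso]] := isolates_project Ty1 hG1 isoG1T hb nb Eb.
pose w x := project l u (G x).
have hw : rhol y1 w by exact: rhol_project.
have pcS1 := isolates_pow (S_an Ty1 Oy1) hG1 isoG1.
have nP1 : \forall x \near y1, isolates S G x /\ rhol x G.
  by move: (isolates_near hG1 pcS1) (rhol_near hG1); apply: filterS2.
have [y2 [Ty2 Oy2 [isoG2 hG2] et2]] := isolates_etale Ty1 Oy1 hw iso nP1.
have [g [hg Eg]] := et2.2 _ (hG2 l).
have Ey := near_at Eg Ty2.
exists y2, w, (fun x => G x 0 l - g (w x)); split=> //.
  split; first by apply: hgB; [exact: hG2 | exact: rhol_comp et2.1 hg].
  by apply: filterS Eg => x H Tx; rewrite H // subrr.
apply: filterS isoG2 => x H Sx E; apply: H => //.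
have wx : w x = w y2 by apply/rowP => j; have := congr1 (fun v : 'rV_(1 + d) => v 0 (rshift 1 j)) E; rewrite !inj_r.
apply: (project_inj wx); have := congr1 (fun v : 'rV_(1 + d) => v 0 (@ord_fst d)) E.
by rewrite !inj_i0 wx => /addIr.
Qed.

Section Chart.
Variables (w : V -> 'rV[C]_d) (c : V -> C) (xi : 'rV[C]_d -> V).

(** [xi] inverts [w] on T, so that T is a graph over [w], with the [zc i] as its equations. *)
Definition chart y := [/\ T y /\ O y, etale T w y,
  holo_germ y c /\ (\forall x \near y, T x -> c x = 0),
  isolates S (fun x => row_cons (c x) (w x)) y &
  rhol (w y) xi /\ (\forall x \near y, T x -> x = xi (w x))].

Definition zc (i : 'I_n) x : C := x 0 i - xi (w x) 0 i.

Lemma chart_rhol y : chart y -> rhol y (fun x => row_cons (c x) (w x)).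
Proof. by move=> [_ [hw _] [hc _] _ _]; exact: rhol_inj. Qed.

Lemma chart_near y : chart y -> \forall z \near y, T z -> chart z.
Proof.
move=> ch; have [[Ty Oy] et [hc cT] iso [hx xE]] := ch.
have n1 := O_open Oy; have n2 := etale_near et; have n3 := hg_near hc; have n4 := near_near cT.
have n5 := isolates_near (chart_rhol ch) (isolates_pow (S_an Ty Oy) (chart_rhol ch) iso).
have n6 := cont_near (rhol_cont et.1) (rhol_near hx); have n7 := near_near xE.
near=> z => Tz; split.
- by split=> //; near: z.
- by move: Tz; near: z.
- by split; near: z.
- by near: z.
- by split; near: z.
Unshelve. all: by end_near. Qed.

Lemma chart_zc y i : chart y -> holo_germ y (zc i) /\ \forall x \near y, T x -> zc i x = 0.
Proof.
move=> [_ [hw _] _ _ [hx xE]]; split.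
  by apply: hgB; [exact: hg_coord | exact: (rhol_comp (c := fun t => xi t 0 i) hw (hx i))].
by apply: filterS xE => x H Tx; rewrite /zc -(H Tx) subrr.
Qed.

(** Expand f around the point xi(w) of the graph. The constant term f(xi(w)) is a function of w that
    vanishes on T, so it is zero by [dominant]; the rest is a combination of the [zc i]. *)
Lemma chart_ideal y f : chart y -> holo_germ y f -> (\forall x \near y, T x -> f x = 0) ->
  inI setT y zc f.
Proof.
move=> ch hf fT; have [[Ty Oy] et _ _ [hx xE]] := ch.
have yE := near_at xE Ty.
have [q [q1 q2]] := hadamard2 hf.
have hfx : holo_germ (w y) (fun t => f (xi t)) by apply: (rhol_comp hx); rewrite -yE.
have b0 : \forall t \near w y, f (xi t) = 0.
  apply: (dominant Ty Oy et hfx); move: fT xE; apply: filterS2 => x e1 e2 Tx.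
  by rewrite -(e2 Tx) e1.
have fx := cont_near (rhol_cont et.1) b0.
have hr : rhol y (fun x => row_mx (x - xi (w x)) (xi (w x)) : 'rV[C]_(n + n)).
  have hxw j : holo_germ y (fun x => xi (w x) 0 j : C).
    exact: (rhol_comp (c := fun t => xi t 0 j) et.1 (hx j)).
  move=> j; case: (split_ordP j) => l ->; last by under eq_fun do rewrite row_mxEr.
  under eq_fun do rewrite row_mxEl mxE [X in _ + X]mxE.
  by apply: hgB; [exact: hg_coord | exact: hxw].
exists (fun i x => q i (row_mx (x - xi (w x)) (xi (w x)))); split=> [i|].
  by apply: (rhol_comp (c := q i) hr); rewrite -yE subrr; exact: q1.
apply: filterS fx => x fx0 _.
rewrite -{1}[x](subrK (xi (w x))) q2 fx0 add0r; apply: eq_bigr => i _.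
by rewrite mulrC; congr (_ * _); rewrite [LHS]mxE [X in _ + X = _]mxE.
Qed.

Lemma chart_zero y : chart y -> \forall x \near y, (forall i, zc i x = 0) -> T x.
Proof.
move=> ch; have [[Ty Oy] _ _ _ _] := ch; have [k [F [hF TF]]] := T_an Ty Oy.
have FI j : inI setT y zc (F j).
  by apply: chart_ideal => //; apply: filterS TF => x H /H.
have /choice[q Hq] := FI.
have := near_forall (fun j => (Hq j).2); move: TF; apply: filterS2 => x TFx H z0.
apply/TFx => j; rewrite (H j) // big1 // => i _; by rewrite z0 mulr0.
Qed.

(** Otherwise the d functions w would isolate the point on S, which has dimension d + 1. *)
Lemma chart_dense y : chart y -> ~ \forall x \near y, S x -> T x.
Proof.
move=> [[Ty Oy] et _ _ _] E; have [_ Smin] := local_dims Ty Oy et.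
suff /Smin : isoby S d y by rewrite ltnn.
exists w; split; first exact: et.1.
by move: E (etale_isolates et Ty); apply: filterS2 => x ST H /ST.
Qed.

(** h satisfies a monic equation over (c, w). Modulo c its coefficients are functions g_i(w); let
    g_k be the first that is not identically zero. By [dominant] it is a unit at some point of T
    nearby, where the equation reads h^k times a unit = 0 modulo c, as h vanishes on T. *)
Lemma chart_nilpotent1 y h (P : V -> Prop) : chart y -> holo_germ y h ->
  (\forall x \near y, T x -> h x = 0) -> (\forall x \near y, P x) ->
  exists z, [/\ chart z, P z & radI S z (one c) h].
Proof.
move=> ch hh hT nP; have [[Ty Oy] et [hc cT] iso _] := ch.
pose f x := row_cons (c x) (w x).
have hf : rhol y f := chart_rhol ch.
have [s [p [hp pm E]]] := integral_dep hf (isolates_pow (S_an Ty Oy) hf iso) hh.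
pose g i (t : 'rV[C]_d) : C := (p (row_cons 0 t))`_i.
have fy : f y = row_cons 0 (w y) by rewrite /f (near_at cT Ty).
have hcons : rhol (w y) (fun t => row_cons 0 t) by apply: rhol_inj; [exact: hg_cst | exact: rhol_id].
have hg i : holo_germ (w y) (g i).
  by apply: (rhol_comp (c := fun t => (p t)`_i) hcons); rewrite -fy; exact: hp.2.
have [k [gk gi]] : exists k, ~ (\forall t \near w y, g k t = 0) /\
    forall i, (i < k)%N -> \forall t \near w y, g i t = 0.
  have exk : exists k, `[< ~ (\forall t \near w y, g k t = 0) >].
    exists s; apply/asboolP => /near_at; rewrite /g => e.
    have [m sz] := pm (row_cons 0 (w y)).
    by move: m; rewrite monicE /lead_coef sz /= e eq_sym oner_eq0.
  have [k /asboolP Hk min_k] := ex_minnP exk; exists k; split=> // i ik.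
  by apply: contrapT => /asboolP /min_k; rewrite leqNgt ik.
have sk : (k < s.+1)%N.
  rewrite ltnNge; apply/negP => sk; apply: gk; apply: near_all => t.
  by rewrite /g nth_default // (pm _).2.
have gkw : ~ \forall x \near y, T x -> g k (w x) = 0.
  by move/(dominant Ty Oy et (hg k)).
have hgw := fun i => cont_near (rhol_cont et.1) (hg_near (hg i)).
have nQ : \forall x \near y, [/\ T x -> chart x, P x, holo_germ x h /\ (\forall t \near x, T t -> h t = 0) &
    (phol (f x) s.+1 p /\ (\forall t \near x, S t -> (p (f t)).[h t] = 0)) /\
    forall i : 'I_k, \forall t \near w x, g i t = 0].
  have n1 := chart_near ch; have n2 := hg_near hh; have n3 := near_near hT.
  have n4 := cont_near (rhol_cont hf) (phol_near hp); have n5 := near_near E.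
  have n6 : \forall x \near y, forall i : 'I_k, \forall t \near w x, g i t = 0.
    apply: near_forall => i; exact: (cont_near (rhol_cont et.1) (near_near (gi i (ltn_ord i)))).
  near=> x; split; [by near: x | by near: x | by split; near: x | by do 2?split; near: x].
have [z [chz Pz [hhz hTz] [[hpz Ez] giz]] /not_implyP[Tz gkz]] := not_near gkw nQ.
exists z; split; [exact: chz | exact: Pz | ].
have {}chz := chz Tz; have [_ etz [hcz cTz] _ _] := chz.
have cz := near_at cTz Tz; have hz := near_at hTz Tz.
have hfz : rhol z f := chart_rhol chz.
have fz : f z = row_cons 0 (w z) by rewrite /f cz.
exists k; have inc i : exists r, holo_germ z r /\ \forall x \near z, (p (f x))`_i = g i (w x) + r x * c x.
  have [r [r1 r2 r3]] := hadamard_part [:: @ord_fst d] (hpz.2 i).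
  exists (fun x => r (@ord_fst d) (f x)); split; first exact: (rhol_comp (c := r (@ord_fst d)) hfz (r1 _)).
  apply: near_all => x; rewrite r3; congr (_ + _).
    rewrite /g; congr ((p _)`_i); apply/rowP => j; rewrite updsE inE fz.
    by case: (split_ordP j) => l ->; rewrite ?(ord1 l) ?eqxx ?inj_i0 // eq_sym eq_lrshift !inj_r.
  rewrite (bigD1 (@ord_fst d)) //= big1 ?addr0 => [|j jf]; last by rewrite r2 ?inE // mulr0.
  by rewrite fz !inj_i0 subr0 mulrC.
have /choice[r Hr] := inc.
(* The equation is split at k: the upper terms are [u] h^k with [u] a unit, the lower ones are [v]
   c. *)
pose u x := \sum_(k <= i < s.+1) (p (f x))`_i * h x ^+ (i - k).
pose v x := \sum_(i < k) r i x * h x ^+ i.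
have hpf i : holo_germ z (fun x => (p (f x))`_i : C).
  exact: (rhol_comp (c := fun t => (p t)`_i) hfz (hpz.2 i)).
have hu : holo_germ z u by apply: hg_sum => i; apply: hgM; [exact: hpf | exact: hgX].
have hv : holo_germ z v by apply: hg_sum => i; apply: hgM; [exact: (Hr i).1 | exact: hgX].
have uz : u z != 0.
  rewrite /u big_ltn // subnn expr0 mulr1 big_nat_cond big1 ?addr0 => [|i /andP[/andP[ki _] _]].
    by rewrite fz; apply/eqP; exact: gkz.
  by rewrite hz expr0n subn_eq0 leqNgt ki mulr0.
apply/one_inI; exists (fun x => - v x / u x); first by apply: hgM; [exact: hgN | exact: hgV].
have n1 := cont_neq0 (hgcont hu) uz.
have n2 := near_forall (fun i : 'I_k => (Hr i).2).
have n3 : \forall x \near z, forall i : 'I_k, g i (w x) = 0.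
  by apply: near_forall => i; exact: (cont_near (rhol_cont etz.1) (giz i)).
near=> x => Sx.
have ux : u x != 0 by near: x.
have rx i : (i < k)%N -> (p (f x))`_i = r i x * c x.
  move=> ik; have H1 : forall i : 'I_k, (p (f x))`_i = g i (w x) + r i x * c x by near: x.
  have H2 : forall i : 'I_k, g i (w x) = 0 by near: x.
  by have := H1 (Ordinal ik); rewrite (H2 (Ordinal ik)) add0r.
have : (p (f x)).[h x] = 0 by move: Sx; near: x.
rewrite (horner_coef_wide _ (hpz.1 (f x))) -(big_mkord xpredT (fun i => (p (f x))`_i * h x ^+ i)).
rewrite (big_cat_nat (n := k)) //=; last exact: ltnW.
have -> : \sum_(0 <= i < k) (p (f x))`_i * h x ^+ i = v x * c x.
  rewrite big_mkord mulr_suml; apply: eq_bigr => i _; rewrite rx //; ring.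
have -> : \sum_(k <= i < s.+1) (p (f x))`_i * h x ^+ i = u x * h x ^+ k.
  rewrite mulr_suml big_nat_cond [RHS]big_nat_cond; apply: eq_bigr => i /andP[/andP[ki _] _].
  by rewrite -mulrA -exprD subnK.
move=> /eqP; rewrite addr_eq0 => /eqP e.
by rewrite mulrAC mulNr e opprK mulrAC mulfV // mul1r.
Unshelve. all: by end_near. Qed.

Lemma radI_near y h : radI S y (one c) h -> \forall z \near y, radI S z (one c) h.
Proof. by move=> [N /inI_near]; apply: filterS => z H; exists N. Qed.

Lemma chart_nilpotent y : chart y ->
  exists z, chart z /\ forall i, radI S z (one c) (zc i).
Proof.
move=> ch.
have H (r : seq 'I_n) : forall y (P : V -> Prop), chart y -> (\forall x \near y, P x) ->
    exists z, [/\ chart z, P z & forall i, i \in r -> radI S z (one c) (zc i)].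
  elim: r => [|i r IH] {ch}y P ch nP; first by exists y; split=> //; exact: near_at nP.
  have [hz zT] := chart_zc i ch.
  have [z [chz Pz /radI_near rz]] := chart_nilpotent1 ch hz zT (near_near nP).
  have nP' : \forall x \near z, P x /\ radI S x (one c) (zc i) by move: Pz rz; apply: filterS2.
  have [z' [chz' [Pz' ri] rr]] := IH z _ chz nP'.
  by exists z'; split=> // j; rewrite inE => /orP[/eqP->|/rr].
have nT : \forall x \near y, True by apply: near_all.
have [z [chz _ rz]] := H (enum 'I_n) y _ ch nT.
by exists z; split=> // i; apply: rz; rewrite mem_enum.
Qed.

(** On S the zeros of c lie in T, because the [zc i] are nilpotent modulo c. So h vanishes on S off
    T, and T contains no neighbourhood in S of any of its points. *)
Lemma chart_regular y : chart y -> (forall i, radI S y (one c) (zc i)) -> regular_germ S y c.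
Proof.
move=> ch rz h hh E.
have /near_forall c0 i : \forall x \near y, S x -> c x = 0 -> zc i x = 0.
  have [N /one_inI[q _ H]] := rz i; apply: filterS H => x H Sx cx.
  have := H Sx; rewrite cx mulr0 => /eqP; rewrite expf_eq0 => /andP[_ /eqP //].
have off : \forall x \near y, S x -> ~ T x -> h x = 0.
  have zT := chart_zero ch; near=> x => Sx nTx; apply/eqP.
  have : c x * h x == 0 by apply/eqP; move: Sx; near: x.
  rewrite mulf_eq0 => /orP[/eqP cx|//]; exfalso; apply: nTx.
  have z0 i : zc i x = 0.
    have H : forall i, S x -> c x = 0 -> zc i x = 0 by near: x.
    exact: H.
  by move: z0; near: x.
have chn := chart_near ch; have offn := near_near off; have hhn := hg_near hh.
near=> x => Sx; have [Tx|nTx] := pselect (T x); last by move: Sx nTx; near: x.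
apply/eqP/negPn/negP => hx.
have chx : chart x by move: Tx; near: x.
have hhx : holo_germ x h by near: x.
have offx : \forall t \near x, S t -> ~ T t -> h t = 0 by near: x.
apply: (chart_dense chx); move: offx (cont_neq0 (hgcont hhx) hx).
apply: filterS2 => t H ht St; apply: contrapT => nTt.
by rewrite (H St nTt) eqxx in ht.
Unshelve. all: by end_near. Qed.

(** Start from 1, which is not a multiple of c since c vanishes at y, and multiply by the highest
    power of each [zc i] that does not lead into (c). *)
Lemma maximal_multiplier y : chart y -> (forall i, radI S y (one c) (zc i)) ->
  exists a, [/\ holo_germ y a, ~ inI S y (one c) a &
    forall i, inI S y (one c) (fun x => zc i x * a x)].
Proof.
move=> ch rz; have [[Ty Oy] _ [hc cT] _ _] := ch.
have H (r : seq 'I_n) : exists a, [/\ holo_germ y a, ~ inI S y (one c) a &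
    forall i, i \in r -> inI S y (one c) (fun x => zc i x * a x)].
  elim: r => [|i r [a [ha na ar]]].
    exists (fun=> 1); split=> //; first exact: hg_cst.
    move=> /one_inI[q _ /near_at/(_ (TS Ty))]; rewrite (near_at cT Ty) mulr0.
    by move/eqP; rewrite oner_eq0.
  have hz := (chart_zc i ch).1.
  pose Q l := inI S y (one c) (fun x => zc i x ^+ l * a x).
  have [l Ql nQl] : exists2 l, Q l.+1 & ~ Q l.
    apply: contrapT => nE; have [N IN] := rz i.
    have nQ : forall l, ~ Q l.
      elim=> [|l IH]; first by rewrite /Q; under eq_fun do rewrite expr0 mul1r.
      by move=> Ql; apply: nE; exists l.
    apply: (nQ N); rewrite /Q; under eq_fun do rewrite mulrC.
    exact: inIM.
  exists (fun x => zc i x ^+ l * a x); split=> //; first by apply: hgM => //; exact: hgX.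
  move=> j; rewrite inE => /orP[/eqP ->|/ar Ij].
    by move: Ql; rewrite /Q; under eq_fun do rewrite exprS -mulrA.
  by under eq_fun do rewrite mulrCA; apply: inIM => //; exact: hgX.
have [a [ha na ar]] := H (enum 'I_n).
by exists a; split=> // i; apply: ar; rewrite mem_enum.
Qed.

Lemma chart_principal y : chart y -> (forall i, radI S y (one c) (zc i)) ->
  exists z g, [/\ T z /\ O z, holo_germ z g, \forall x \near z, T x -> g x = 0 &
    forall f, holo_germ z f -> (\forall x \near z, T x -> f x = 0) -> inI S z (one g) f].
Proof.
move=> ch rz; have [[Ty Oy] _ [hc cT] _ _] := ch.
have [a [ha na Ia]] := maximal_multiplier ch rz.
have /choice[f Hf] i : exists f, holo_germ y f /\ \forall x \near y, S x -> zc i x * a x = f x * c x.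
  by have /one_inI[q q1 q2] := Ia i; exists q.
have [i nfi] : exists i, ~ \forall x \near y, T x -> f i x = 0.
  apply: contrapT => nE; apply: na.
  have /choice[m Hm] i : exists m : 'I_n -> V -> C, (forall l, holo_germ y (m l)) /\
      \forall x \near y, setT x -> f i x = \sum_l m l x * zc l x.
    apply: chart_ideal => //; first exact: (Hf i).1.
    by apply: contrapT => nf; apply: nE; exists i.
  have [q [q1 q2]] := chart_ideal ch hc cT.
  pose M x : 'M[C]_n := \matrix_(i, l) m i l x.
  pose D x := \det ((a x)%:M - c x *: M x).
  have hM k l : holo_germ y (fun x => M x k l : C).
    by under eq_fun do rewrite mxE; exact: (Hm k).1.
  have hD : holo_germ y D.
    apply: hg_det => k l; under eq_fun do rewrite mxE [X in _ + X]mxE [X in - X]mxE [X in X + _]mxE.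
    apply: hgB; last exact: hgM.
    case: (k == l); last by under eq_fun do rewrite mulr0n; exact: hg_cst.
    by under eq_fun do rewrite mulr1n.
  (* From f = M z and a z = c f follows (a - c M) z = 0, so the determinant [D] kills every z_l, and
     with them c, which lies in their ideal. *)
  have Dc : \forall x \near y, S x -> c x * D x = 0.
    have n1 := near_forall (fun i => (Hf i).2); have n2 := near_forall (fun i => (Hm i).2).
    near=> x => Sx.
    have qx : setT x -> c x = \sum_j q j x * zc j x by near: x.
    have e1 k : zc k x * a x = f k x * c x.
      have H1 : forall k, S x -> zc k x * a x = f k x * c x by near: x.
      exact: H1.
    have e2 k : f k x = \sum_l m k l x * zc l x.
      have H1 : forall k, setT x -> f k x = \sum_l m k l x * zc l x by near: x.
      exact: H1.
    pose v : 'cV[C]_n := \col_l zc l x.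
    have Nv : ((a x)%:M - c x *: M x) *m v = 0.
      rewrite mulmxBl mul_scalar_mx -scalemxAl; apply/colP => k.
      rewrite !mxE mulrC e1 e2 mulrC; apply/eqP; rewrite subr_eq0; apply/eqP; congr (_ * _).
      by apply: eq_bigr => l _; rewrite !mxE.
    have Dz l : D x * zc l x = 0.
      have := congr1 (fun u : 'cV[C]_n => (\adj ((a x)%:M - c x *: M x) *m u) l 0) Nv.
      by rewrite mulmx0 mulmxA mul_adj_mx mul_scalar_mx !mxE.
    rewrite (qx I) mulr_suml big1 // => l _.
    by rewrite -mulrA [X in _ * X]mulrC Dz mulr0.
  have D0 := chart_regular ch rz hD Dc.
  (* By [det_homog], D = 0 is a monic equation for a / c. *)
  apply: (nrm Ty Oy (m := n) ha hc (c := fun k x => (char_poly (M x))`_k) _ (chart_regular ch rz)).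
    by move=> k; exact: (phol_char_poly hM).2.
  by apply: filterS D0 => x H Sx; rewrite -det_homog; exact: H.
have nP : \forall x \near y, [/\ T x -> chart x, forall k, radI S x (one c) (zc k),
    forall k, holo_germ x (f k) & forall k, \forall t \near x, S t -> zc k t * a t = f k t * c t].
  have n1 := chart_near ch; have n2 := near_forall (fun k => radI_near (rz k)).
  have n3 := near_forall (fun k => hg_near (Hf k).1).
  have n4 := near_forall (fun k => near_near (Hf k).2).
  by near=> x; split; near: x.
have [z [chz rzz hfz fz] /not_implyP[Tz /eqP fiz]] := not_near nfi nP.
have {}chz := chz Tz; have [[_ Oz] _ [hcz _] _ _] := chz.
exists z, (zc i); have [hzi ziT] := chart_zc i chz; split=> // h hh hT.
apply: (@inI_trans _ _ _ _ _ _ zc); last first.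
  by have [q [q1 q2]] := chart_ideal chz hh hT; exists q; split=> //; apply: filterS q2 => x H _; exact: H.
move=> l; have hzl := (chart_zc l chz).1.
(* Multiplied by the regular germ c, both products become a z_i z_l. *)
have E : \forall x \near z, S x -> f l x * zc i x - f i x * zc l x = 0.
  apply: (chart_regular chz rzz).
    by apply: hgB; apply: hgM.
  move: (fz i) (fz l); apply: filterS2 => x ei el Sx.
  have -> : c x * (f l x * zc i x - f i x * zc l x) =
    f l x * c x * zc i x - f i x * c x * zc l x by ring.
  by rewrite -(ei Sx) -(el Sx); ring.
apply/one_inI; exists (fun x => f l x / f i x); first by apply: hgM => //; exact: hgV.
move: E (cont_neq0 (hgcont (hfz i)) fiz); apply: filterS2 => x e fx Sx.
have /eqP := e Sx; rewrite subr_eq0 => /eqP e1.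
by rewrite mulrAC e1 mulrAC mulfV // mul1r.
Unshelve. all: by end_near. Qed.

End Chart.
End MinimalDim.

Theorem principal_point : exists z g, [/\ T z /\ O z, holo_germ z g,
    \forall x \near z, T x -> g x = 0 &
    forall f, holo_germ z f -> (\forall x \near z, T x -> f x = 0) -> inI S z (one g) f].
Proof.
have [d [Pd mn]] := min_etale_dim.
have [y [w [c [Ty Oy et [hc cT] iso]]]] := adapted_chart mn Pd.
have [xi [hx xE]] := etale_row et (rhol_id y).
have ch : chart w c xi y by split.
have [z [chz rz]] := chart_nilpotent mn ch.
have [z' [g H]] := chart_principal mn chz rz; exists z', g; exact: H.
Qed.

End Pairs.

(** * From local models back to the complex space *)

Section Transport.
Variables (R : realType) (X : complex_space R) (U : set X) (n : nat).
Local Notation C := (CC R).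
Local Notation V := 'rV[C]_n.
Variables (phi : X -> V) (W : set V) (psi : V -> X).
Hypothesis U_open : open U.
Hypothesis phi_cont : forall x, U x -> forall P : set V, nbhs (phi x) P -> \forall y \near x, P (phi y).
Hypothesis psi_cont : forall x, U x -> forall P : set X, nbhs x P ->
  \forall v \near phi x, (phi @` U) v -> P (psi v).
Hypothesis phiK : forall x, U x -> psi (phi x) = x.
Hypothesis model_an : forall x, U x -> analytic_at (@holo_germ R V) (phi @` U) (phi x).
Hypothesis germs : forall x f, U x ->
  (cs_germ x f <-> exists2 F, holo_germ (phi x) F & \forall y \near x, f y = F (phi y)).
Implicit Types (x y : X) (v : V).

Definition image_of (A : set X) : set V := [set v | (phi @` U) v /\ A (psi v)].

Lemma U_near x : U x -> \forall y \near x, U y.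
Proof. by move=> Ux; exact: open_nbhs_nbhs. Qed.

(** [phi] and [psi] are continuous and inverse to each other, so statements about points of [A] near
    x can be transferred to the model. *)
Lemma near_image A x (P : V -> Prop) : U x ->
  (\forall y \near x, A y -> P (phi y)) <-> (\forall v \near phi x, image_of A v -> P v).
Proof.
move=> Ux; split=> [H|H].
  apply: filterS (psi_cont Ux H) => v Hv [Sv Av].
  by have := Hv Sv Av; have [y Uy <-] := Sv; rewrite phiK.
have := phi_cont Ux H; apply: filterS2 (U_near Ux) => y Uy Hy Ay; apply: Hy.
by split; [exists y | rewrite phiK].
Qed.

Lemma near_model x (P : V -> Prop) : U x ->
  (\forall y \near x, P (phi y)) <-> (\forall v \near phi x, image_of setT v -> P v).
Proof.
move=> Ux; rewrite -near_image //; split; apply: filterS => y; first by [].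
exact.
Qed.

Lemma germ_comp x F : U x -> holo_germ (phi x) F -> cs_germ x (fun y => F (phi y)).
Proof. by move=> Ux hF; apply/germs => //; exists F => //; apply: filterE. Qed.

Lemma image_model_an x : U x -> analytic_at (@holo_germ R V) (image_of setT) (phi x).
Proof.
move=> /model_an[k [F [hF FE]]]; exists k, F; split=> //.
apply: filterS FE => v <-; split=> [[]//|Sv]; by split.
Qed.

Lemma image_an A x : U x -> analytic_at (@cs_germ R X) A x ->
  analytic_at (@holo_germ R V) (image_of A) (phi x).
Proof.
move=> Ux [k [F [hF FE]]]; have [l [G [hG GE]]] := model_an Ux.
have /choice[F' HF'] i : exists F', holo_germ (phi x) F' /\ \forall y \near x, F i y = F' (phi y).
  by have [F' h1 h2] := (germs (F i) Ux).1 (hF i); exists F'.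
have F'h i : holo_germ (phi x) (F' i) by have [] := HF' i.
have F'E : \forall y \near x, forall i, F i y = F' i (phi y).
  by apply: filter_forall => i; have [] := HF' i.
have E : \forall y \near x, True -> (A (psi (phi y)) <-> forall i, F' i (phi y) = 0).
  move: FE F'E; apply: filterS3 (U_near Ux) => y Uy e1 e2 _; rewrite phiK // e1.
  by split=> H i; have := H i; rewrite e2.
have {}E := (near_image setT (fun v => A (psi v) <-> forall i, F' i v = 0) Ux).1 E.
pose FG (i : 'I_(k + l)) : V -> C := match fintype.split i with inl a => F' a | inr b => G b end.
exists (k + l)%N, FG; split.
  by move=> i; rewrite /FG; case: (fintype.split i) => j; [exact: F'h | exact: hG].
move: E GE; apply: filterS2 => v e1 e2; split=> [[Sv Av] i|H].
  have Sv' : image_of setT v by split.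
  by rewrite /FG; case: (fintype.split i) => j; [exact: (e1 Sv').1 | exact: e2.1].
have Sv : (phi @` U) v.
  by apply/e2 => j; have := H (rshift k j); rewrite /FG (unsplitK (inr j)).
split=> //; apply/e1; first by split.
by move=> j; have := H (lshift l j); rewrite /FG (unsplitK (inl j)).
Qed.

Lemma isoby_image A x d : U x -> isolated_by A x d <-> isoby (image_of A) d (phi x).
Proof.
move=> Ux; split=> [[g [gx iso]]|[w [hw iso]]].
  have /choice[G HG] i : exists G, holo_germ (phi x) G /\ \forall y \near x, g i y = G (phi y).
    by have [G h1 h2] := (germs (g i) Ux).1 (gx i).1; exists G.
  have Gh i : holo_germ (phi x) (G i) by have [] := HG i.
  have GE : \forall y \near x, forall i, g i y = G i (phi y).
    by apply: filter_forall => i; have [] := HG i.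
  have Gx i : G i (phi x) = 0 by rewrite -(nbhs_singleton GE i) (gx i).2.
  exists (fun v => \row_i G i v); split=> [i|].
    by under eq_fun do rewrite mxE; exact: Gh.
  apply/near_image => //; move: iso GE; apply: filterS2 => y e1 e2 Ay wy.
  congr phi; apply: e1 => // i; rewrite e2.
  by have := congr1 (fun v : 'rV_d => v 0 i) wy; rewrite !mxE Gx.
exists (fun i y => w (phi y) 0 i - w (phi x) 0 i); split=> [i|].
  split; last by rewrite subrr.
  apply: (germ_comp (F := fun v => w v 0 i - w (phi x) 0 i)) => //.
  by apply: hgB; [exact: hw | exact: hg_cst].
have := (near_image A (fun v => w v = w (phi x) -> v = phi x) Ux).2 iso.
apply: filterS2 (U_near Ux) => y Uy H Ay wy.
rewrite -(phiK Uy) (H Ay) ?phiK //; apply/rowP => i; apply/eqP; rewrite -subr_eq0.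
by apply/eqP; exact: wy.
Qed.

Lemma regular_image x (b : V -> C) : U x -> regular_germ (image_of setT) (phi x) b ->
  holo_germ (phi x) b -> germ_regular (@cs_germ R X) x (fun y => b (phi y)).
Proof.
move=> Ux rb hb; split=> [|c /germs-/(_ Ux)[F hF cF] bc]; first exact: germ_comp.
have E : \forall v \near phi x, image_of setT v -> b v * F v = 0.
  by apply/(near_model (fun v => b v * F v = 0)) => //; move: bc cF; apply: filterS2 => y + <-.
have := (near_model (fun v => F v = 0) Ux).2 (rb F hF E).
by move: cF; apply: filterS2 => y ->.
Qed.

Lemma normal_image x : U x -> normal_germs (image_of setT) (phi x).
Proof.
move=> Ux a b m c ha hb hc rb E.
have := @cs_normal R X x (fun y => a (phi y)) (fun y => b (phi y)) m (fun i y => c i (phi y))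
  (germ_comp Ux ha) (regular_image Ux rb hb) (fun i => germ_comp Ux (hc i))
  ((near_model (fun v => a v ^+ m + \sum_(i < m) c i v * a v ^+ i * b v ^+ (m - i) = 0) Ux).2 E).
move=> [q /germs-/(_ Ux)[Q hQ qQ] H]; apply/one_inI; exists Q => //.
by apply/(near_model (fun v => a v = Q v * b v)) => //; move: H qQ; apply: filterS2 => y + <-.
Qed.

Lemma generator_image Z x g : U x -> holo_germ (phi x) g ->
  (\forall v \near phi x, image_of Z v -> g v = 0) ->
  (forall f, holo_germ (phi x) f -> (\forall v \near phi x, image_of Z v -> f v = 0) ->
     inI (image_of setT) (phi x) (one g) f) ->
  ideal_generator Z x (fun y => g (phi y)).
Proof.
move=> Ux hg gZ H; split.
  by split; [exact: germ_comp | exact: (near_image Z (fun v => g v = 0) Ux).2].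
move=> f [/germs-/(_ Ux)[F hF fF] fZ].
have FZ : \forall v \near phi x, image_of Z v -> F v = 0.
  by apply/(near_image Z (fun v => F v = 0)) => //; move: fZ fF; apply: filterS2 => y + <-.
have /one_inI[q hq E] := H F hF FZ.
exists (fun y => q (phi y)); first exact: germ_comp.
have := (near_model (fun v => F v = q v * g v) Ux).2 E.
by move: fF; apply: filterS2 => y ->.
Qed.

End Transport.

Lemma local_modelP (R : realType) (X : complex_space R) U n phi W :
  @local_model R X (@cs_germ R X) U n phi W ->
  [/\ open U, forall x, U x -> forall P : set _, nbhs (phi x) P -> \forall y \near x, P (phi y),
      (exists psi : 'rV[CC R]_n -> X, (forall x, U x -> forall P : set X, nbhs x P ->
         \forall v \near phi x, (phi @` U) v -> P (psi v)) /\
         forall x, U x -> psi (phi x) = x),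
      forall x, U x -> analytic_at (@holo_germ R 'rV[CC R]_n) (phi @` U) (phi x) &
      forall x f, U x -> (cs_germ x f <-> exists2 F, holo_germ (phi x) F &
                              \forall y \near x, f y = F (phi y))].
Proof.
move=> [[Uo Wo] UW an [pc [psi [qc pK]]] gE]; split=> //.
- move=> x Ux P Px; have /subspace_continuousP/(_ x Ux) := pc.
  move=> /(_ P Px) H; have {}H : \forall y \near x, U y -> P (phi y) := H.
  have Un : \forall y \near x, U y by exact: open_nbhs_nbhs.
  by move: H Un; apply: filterS2 => y; apply.
- exists psi; split=> // x Ux P Px.
  have H : forall B : set X, nbhs (psi (phi x)) B -> \forall v \near phi x, (phi @` U) v -> B (psi v).
    have Sx : (phi @` U) (phi x) by exists x.
    by move: qc => /subspace_continuousP/(_ _ Sx).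
  by apply: H; rewrite pK.
- by move=> x Ux; apply: an; apply: UW; exists x.
Qed.

Theorem hypersurface_generator (R : realType) (X : complex_space R) (Z B : set X) (p : X) :
  irreducible_hypersurface Z -> Z p -> nbhs p B ->
  exists y g, [/\ B y, Z y & ideal_generator Z y g].
Proof.
move=> [[Zan _ _] Zdim] Zp Bp.
have [U [n [phi [W [lm Up]]]]] := cs_local p.
have [Uo pc [psi [qc pK]] an gE] := local_modelP lm.
pose T := image_of U phi psi Z; pose S := image_of U phi psi setT.
(* The neighbourhood [B] in the form of an open condition on C^n. *)
pose O (v : 'rV[CC R]_n) := \forall v' \near v, (phi @` U) v' -> B (psi v').
have inT v : T v -> exists x, [/\ U x, Z x & v = phi x].
  by move=> [[x Ux <-]]; rewrite pK // => Zx; exists x.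
have Oo v : O v -> \forall v' \near v, O v' by exact: near_near.
have [z [g [[Tz Oz] hg gT gen]]] : exists z g, [/\ T z /\ O z, holo_germ z g,
    \forall x \near z, T x -> g x = 0 &
    forall f, holo_germ z f -> (\forall x \near z, T x -> f x = 0) -> inI S z (one g) f].
  apply: (@principal_point R n S T O) => //.
  - by move=> v [].
  - by move=> v /inT[x [Ux Zx ->]] _; apply: image_an => //; exact: Zan.
  - by move=> v /inT[x [Ux Zx ->]] _; exact: image_model_an.
  - move=> v /inT[x [Ux Zx ->]] _; have [d [[Z1 Z2] [X1 X2]]] := Zdim x Zx.
    exists d; split; try by apply/isoby_image.
      by move=> e /isoby_image H; apply: Z2; exact: H.
    by move=> e /isoby_image H; apply: X2; exact: H.
  - by move=> v /inT[x [Ux Zx ->]] _; exact: normal_image.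
  - exists (phi p); split; last exact: qc.
    by split; [exists p | rewrite pK].
have [x [Ux Zx zE]] := inT z Tz; rewrite zE in Oz hg gT gen.
exists x, (fun y => g (phi y)); split=> //.
  by have := near_at Oz; rewrite pK //; apply; exists x.
exact: (generator_image Uo pc qc pK gE).
Qed.

(** * Holomorphic discs and their speed *)

Section Speed.
Variables (R : realType) (X : complex_space R).
Local Notation C := (CC R).
Local Notation rc := (real_complex R).
Implicit Types (h : C -> X) (z : C).

Definition holo_at h z := {for z, continuous h} /\
  forall g, cs_germ (h z) g -> holo_germ z (g \o h).

Lemma d1_derivable (f : C -> C) z : holo_germ z f -> derivable f z 1.
Proof. by move/near_at/derivable1_diffP. Qed.

Lemma d1D (f g : C -> C) z : holo_germ z f -> holo_germ z g ->
  derive1 (fun t => f t + g t : C) z = derive1 f z + derive1 g z.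
Proof. by move=> hf hg; rewrite !derive1E deriveD //; exact: d1_derivable. Qed.

Lemma d1M (f g : C -> C) z : holo_germ z f -> holo_germ z g ->
  derive1 (fun t => f t * g t : C) z = f z * derive1 g z + g z * derive1 f z.
Proof. by move=> hf hg; rewrite !derive1E deriveM //; exact: d1_derivable. Qed.

Lemma d1_cst (a : C) z : derive1 (fun=> a : C) z = 0.
Proof. exact: derive1_cst. Qed.

Lemma d1_comp (f g : C -> C) z : holo_germ z f -> holo_germ (f z) g ->
  derive1 (fun t => g (f t)) z = derive1 f z * derive1 g (f z).
Proof.
move=> /near_at df /near_at dg; have dgf := df_comp df dg.
rewrite (derive1_diff dgf) (derive1_diff df) (derive1_diff dg).
have := congr1 (fun F => F 1) (diff_comp df dg).
by move=> /= e; apply: etrans (diffC1 _ _ _); exact: e.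
Qed.

Lemma velocity_tangent h z : holo_at h z -> tangent_vector (h z) (velocity h z).
Proof.
move=> [ch gh]; split.
- by move=> a b _ _ ab; apply: d1_near; exact: (ch _ ab).
- by move=> a b /gh ha /gh hb; exact: d1D.
- move=> l a /gh ha; rewrite /velocity /= -[RHS]addr0 -(mulr0 (a (h z))) -(d1_cst l z).
  by rewrite addrC (d1M (hg_cst z l) ha) d1_cst mulr0 !addr0 add0r.
- by move=> a b /gh ha /gh hb; exact: d1M.
Qed.

Lemma near_holo h z (P : set X) : {for z, continuous h} -> nbhs (h z) P -> \forall t \near z, P (h t).
Proof. by move=> ch Pz; exact: ch. Qed.

Lemma holo_at_comp h (tau : C -> C) z : holo_germ z tau -> holo_at h (tau z) ->
  holo_at (fun t => h (tau t)) z.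
Proof.
move=> ht [ch gh]; split; first by apply: continuous_comp => //; exact: hgcont.
by move=> g /gh hg; exact: (hg_comp (c := g \o h) ht hg).
Qed.

Lemma herm_scale n (H : 'M[C]_n) (v : 'I_n -> C) (l : C) :
  herm_form H (fun i => l * v i) = rc (nm l ^+ 2) * herm_form H v.
Proof.
rewrite /herm_form mulr_sumr; apply: eq_bigr => i _; rewrite mulr_sumr; apply: eq_bigr => j _.
by rewrite nm_sqr rmorphM /=; ring.
Qed.

Variable N : hermitian_metric X.

Lemma speed_ge0 h z : holo_at h z -> 0 <= speed N h z.
Proof. by move=> hh; apply/hnorm_ge0/velocity_tangent. Qed.

Section Chart.
Variables (U : set X) (n : nat) (phi : X -> 'rV[C]_n) (W : set 'rV[C]_n)
  (H : 'rV[C]_n -> 'M[C]_n).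
Hypothesis lm : @local_model R X (@cs_germ R X) U n phi W.
Hypothesis normE : forall x v, U x -> tangent_vector x v ->
  rc (hnorm N x v ^+ 2) = herm_form (H (phi x)) (fun i => v (fun y => phi y 0 i)).

Lemma chart_germ x i : U x -> cs_germ x (fun y => phi y 0 i : C).
Proof.
move=> Ux; have [_ _ _ _ gE] := local_modelP lm.
by apply/gE => //; exists (fun v : 'rV_n => v 0 i); [exact: hg_coord | exact: filterE].
Qed.

Lemma chart_holo h z : U (h z) -> holo_at h z -> rhol z (fun t => phi (h t)).
Proof. by move=> Uz [_ gh] i; exact: gh (chart_germ i Uz). Qed.

Lemma speedE h z : U (h z) -> holo_at h z -> rc (speed N h z ^+ 2) =
  herm_form (H (phi (h z))) (fun i => derive1 (fun t => phi (h t) 0 i : C) z).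
Proof. by move=> Uz hh; exact: (normE Uz (velocity_tangent hh)). Qed.

Lemma speedE_Re h z : U (h z) -> holo_at h z -> speed N h z ^+ 2 =
  complex.Re (herm_form (H (phi (h z))) (fun i => derive1 (fun t => phi (h t) 0 i : C) z)).
Proof. by move=> Uz hh; rewrite -(speedE Uz hh). Qed.

Lemma speed_comp_chart h (tau : C -> C) z : U (h (tau z)) -> holo_germ z tau ->
  holo_at h (tau z) -> speed N (fun t => h (tau t)) z = nm (derive1 tau z) * speed N h (tau z).
Proof.
move=> Uz ht hh; have hht := holo_at_comp ht hh.
apply/eqP; rewrite -(@eqrXn2 _ 2) ?mulr_ge0 ?nm_ge0 ?speed_ge0 //; apply/eqP.
rewrite exprMn; apply: (@complexI R).
apply: (etrans (speedE (h := fun t => h (tau t)) Uz hht)).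
have rcM (a b : R) : rc (a * b) = rc a * rc b by rewrite rmorphM.
rewrite rcM (speedE Uz hh) -herm_scale.
congr herm_form; apply/funext => i.
exact: (d1_comp (g := fun t => phi (h t) 0 i) ht (chart_holo Uz hh i)).
Qed.

End Chart.

Lemma speed_comp h (tau : C -> C) z : holo_germ z tau -> holo_at h (tau z) ->
  speed N (fun t => h (tau t)) z = nm (derive1 tau z) * speed N h (tau z).
Proof.
move=> ht hh; have [U [n [phi [W [H [lm Up _ nE]]]]]] := @hnorm_local R X N (h (tau z)).
exact: (speed_comp_chart lm nE).
Qed.

End Speed.

(** * Lower bounds for hermitian metrics *)

Section HermitianBounds.
Variables (R : realType) (n : nat).
Local Notation C := (CC R).
Local Notation V := 'rV[C]_n.
Variables (W : set V) (H : V -> 'M[C]_n).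
Hypothesis hm : hermitian_metric_on W H.

Lemma metric_cont w0 i j : W w0 -> forall e : R, 0 < e ->
  \forall w \near w0, nm (H w i j - H w0 i j : C) < e.
Proof.
move=> Ww e e0; have [sm _ _] := hm; have [[cR _] [cI _]] := sm i j 0%N.
have e2 : 0 < e / 2 by lra.
have /cvgrPdist_lt/(_ _ e2) HR := cR w0 Ww.
have /cvgrPdist_lt/(_ _ e2) HI := cI w0 Ww.
move: HR HI; apply: filterS2 => w hR hI.
rewrite nm_sub; apply: le_lt_trans (nm_ReIm _) _; rewrite !raddfB /=.
by move: hR hI; lra.
Qed.

Lemma tends_conj I (Fl : set_system I) {PF : ProperFilter Fl} (u : I -> C) (l : C) :
  tends Fl u l -> tends Fl (fun i => conjc (u i) : C) (conjc l).
Proof.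
move=> ul e e0; apply: filterS (ul e e0) => i; rewrite -(nm_conj (u i - l)) rmorphB //.
Qed.

Lemma tends_herm I (Fl : set_system I) {PF : ProperFilter Fl} (w : I -> V) w0
    (v : I -> 'I_n -> C) (v0 : 'I_n -> C) : W w0 -> tends Fl w w0 ->
  (forall i, tends Fl (v^~ i) (v0 i)) ->
  tends Fl (fun k => herm_form (H (w k)) (v k) : C) (herm_form (H w0) v0).
Proof.
move=> Ww ww vv; apply: tends_sum => i; apply: tends_sum => j.
apply: tendsM; last by apply: tends_conj.
apply: tendsM => // e e0; have /nm_nearP[d d0 Hd] := metric_cont i j Ww e0.
by apply: filterS (ww d d0) => k; exact: Hd.
Qed.

(** By contradiction: vectors violating the bound with K = k + 1, scaled to maximal entry 1, have
    along an ultrafilter a nonzero limit on which the form at w0 is not positive. *)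
Lemma herm_lower w0 : W w0 -> exists r K : R, [/\ 0 < r, 0 < K &
  forall w, W w -> nm (w - w0) < r -> forall (v : 'I_n -> C) i,
    nm (v i) <= K * Num.sqrt (complex.Re (herm_form (H w) v))].
Proof.
move=> Ww; apply: contrapT => nE.
have /choice[p Hp] (k : nat) : exists p : V * ('I_n -> C), [/\ W p.1, nm (p.1 - w0) < k.+1%:R^-1,
    (forall i, nm (p.2 i) <= 1), (exists i, nm (p.2 i) = 1) &
    Num.sqrt (complex.Re (herm_form (H p.1) p.2)) <= k.+1%:R^-1].
  have k0 : (0 : R) < k.+1%:R by rewrite ltr0n.
  apply: contrapT => nk; apply: nE; exists k.+1%:R^-1, k.+1%:R; split; rewrite ?invr_gt0 //.
  move=> w Www wr v; have [/forallP v0|] := boolP [forall i, v i == 0].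
    by move=> i; rewrite (eqP (v0 i)) nm0 mulr_ge0 ?sqrtr_ge0 // ltW.
  rewrite negb_forall => /existsP[i0 vi0].
  pose m := [arg max_(i > i0) nm (v i)]%O.
  have mP i : nm (v i) <= nm (v m).
    by rewrite /m; case: arg_maxP => // j _; exact.
  have m0 : 0 < nm (v m) by apply: lt_le_trans (mP i0); rewrite nm_gt0.
  move=> i; apply: le_trans (mP i) _; rewrite leNgt; apply/negP => lt; apply: nk.
  pose l : C := real_complex R (nm (v m))^-1.
  have nl : nm l = (nm (v m))^-1 by rewrite nm_real ger0_norm // invr_ge0 ltW.
  exists (w, fun i => l * v i); split=> //=.
  - by move=> j; rewrite nmM nl mulrC ler_pdivrMr // mul1r.
  - by exists m; rewrite nmM nl mulVf // gt_eqF.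
  rewrite herm_scale nl -[X in Num.sqrt X](_ : (nm (v m))^-1 ^+ 2 * complex.Re (herm_form (H w) v) = _); last first.
    by case: (herm_form _ _) => a b /=; rewrite mul0r subr0.
  rewrite sqrtrM ?exprn_ge0 ?invr_ge0 ?(ltW m0) // sqrtr_sqr ger0_norm ?invr_ge0 ?(ltW m0) //.
  by rewrite mulrC ler_pdivrMr // ler_pdivlMl // ltW.
have [U [UU Uoo]] := ultraFilterLemma (F := \oo) _.
have small (e : R) : 0 < e -> \forall k \near U, k.+1%:R^-1 < e.
  by move=> e0; apply: Uoo; have := @tends_harm R e e0; apply: filterS => k; rewrite subr0 nmV nm_nat.
have /choice[v Hv] i : exists l : C, tends U (fun k => (p k).2 i) l.
  by apply: (@ultra_C R _ U UU _ 1); apply: filterE => k; have [_ _ H1 _ _] := Hp k.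
have tw : tends U (fun k => (p k).1) w0.
  by move=> e e0; apply: filterS (small e e0) => k; apply: lt_trans; have [_] := Hp k.
have th := tends_herm Ww tw Hv.
have [i vi] : exists i, v i != 0.
  apply: contrapT => nv.
  have v0 i : v i = 0 by apply/eqP/negPn/negP => vi; apply: nv; exists i.
  have : \forall k \near U, forall i, nm ((p k).2 i) < 1.
    apply: filter_forall => i; have := Hv i; rewrite v0 => /(_ 1 ltr01).
    by apply: filterS => k; rewrite subr0.
  move=> /filter_ex[k Hk]; have [_ _ _ [i e] _] := Hp k.
  by have := Hk i; rewrite e ltxx.
have [_ _ pos] := hm; have := pos w0 v Ww (ex_intro _ i vi).
rewrite ltcE /= => /andP[_ h0].
have h4 : 0 < complex.Re (herm_form (H w0) v) / 4 by lra.
have [k [k1 k2]] := near_ex2 (th _ _ h4) (small _ h4).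
have [_ _ _ _ sk] := Hp k.
have rk : complex.Re (herm_form (H (p k).1) (p k).2) <= k.+1%:R^-1.
  have [le0|gt0] := leP (complex.Re (herm_form (H (p k).1) (p k).2)) 0.
    by apply: le_trans le0 _; rewrite invr_ge0.
  have i1 : (k.+1%:R^-1 : R) <= 1 by rewrite invf_le1 ?ltr0n // ler1n.
  have i0 : (0 : R) <= k.+1%:R^-1 by rewrite invr_ge0.
  rewrite -(sqr_sqrtr (ltW gt0)); have := sqrtr_ge0 (complex.Re (herm_form (H (p k).1) (p k).2)).
  by move: sk; move: (Num.sqrt _) => t; move: (_^-1) i0 i1 => q; nra.
have := nm_Re (herm_form (H (p k).1) (p k).2 - herm_form (H w0) v).
rewrite raddfB /= => hk; have := le_lt_trans hk k1.
by move: rk k2 h0; move: (complex.Re _) (complex.Re _) (_^-1) => A B q; rewrite ltr_norml => *; lra.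
Qed.

End HermitianBounds.

(** * Truncated distance to a point *)

Section LocalMetric.
Variables (R : realType) (X : complex_space R).
Local Notation C := (CC R).
Local Notation rc := (real_complex R).
Variable N : hermitian_metric X.
Hypothesis Xc : compact [set: X].

Lemma closed_nbhd (p : X) (B : set X) : nbhs p B -> exists2 V, nbhs p V & closure V `<=` B.
Proof.
move=> Bp; have rg := compact_regular (cs_hausdorff (c := X)) Xc (filterT : nbhs p setT).
by have [V Vp VB] := rg _ B Bp; exists V.
Qed.

Lemma min_lip (e a b : R) : `|Num.min e a - Num.min e b| <= `|a - b|.
Proof.
by case: (leP e a) => ?; case: (leP e b) => ?; case: (ler0P (_ - _)) => ?; case: (ler0P (a - b)) => ?; lra.
Qed.

(** [rho] stands for a distance to [p] on the whole of X: its sublevel sets form a basis at [p], and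
    along a holomorphic curve it changes at a rate below any s that exceeds K times the speed. *)
Definition local_metric (p : X) (rho : X -> R) (K : R) :=
  [/\ 0 < K, rho p = 0 /\ (forall q, 0 <= rho q), forall q, q <> p -> 0 < rho q,
    (forall B, nbhs p B -> exists2 e, 0 < e & forall x, rho x < e -> B x) /\
    (forall e, 0 < e -> \forall x \near p, rho x < e) &
    forall (h : C -> X) z s, holo_at h z -> K * speed N h z < s ->
      \forall t \near z, `|rho (h t) - rho (h z)| <= s * nm (t - z)].

(** The distance in ambient coordinates, cut off at eps so that it extends by a constant outside the
    chart. The rate of change comes from [herm_lower], applied to the derivatives of the
    coordinates. *)
Lemma local_metric_exists p : exists rho K, local_metric p rho K.
Proof.
have [U [n [phi [W [H [lm Up hm nE]]]]]] := @hnorm_local R X N p.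
have [Uo pc [psi [qc pK]] _ _] := local_modelP lm.
have UW x : U x -> W (phi x) by have [_ UW _ _ _] := lm; move=> Ux; apply: UW; exists x.
have [r [K [r0 K0 low]]] := herm_lower hm (UW p Up).
have nU x : U x -> \forall y \near x, U y by move=> Ux; exact: open_nbhs_nbhs.
have [V Vp VU] := closed_nbhd (nU p Up).
have /nm_nearP[r1 r10 HV] := qc p Up V Vp.
(* Below r, so that [herm_lower] covers all points where rho is not locally constant. Below r1, so
   that points closer than eps lie in V; since the closure of V lies in U, rho is constant near
   every point outside U. *)
pose eps := Num.min r r1 / 2.
have m0 : 0 < Num.min r r1 by rewrite lt_min r0.
have eps0 : 0 < eps by rewrite /eps; lra.
have mr : Num.min r r1 <= r by rewrite ge_min lexx.
have mr1 : Num.min r r1 <= r1 by rewrite ge_min lexx orbT.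
have er : eps < r by rewrite /eps; lra.
have er1 : eps < r1 by rewrite /eps; lra.
pose dist x := nm (phi x - phi p).
pose rho x := if `[< U x >] then Num.min eps (dist x) else eps.
have rhoU x : U x -> rho x = Num.min eps (dist x) by move=> Ux; rewrite /rho asboolT.
have rhoN x : ~ U x -> rho x = eps by move=> Ux; rewrite /rho asboolF.
have Vin x : U x -> dist x < eps -> V x.
  by move=> Ux dx; have := HV (phi x) (lt_trans dx er1); rewrite pK //; apply; exists x.
exists rho, K; split=> //.
- split; first by rewrite rhoU // /dist subrr nm0; apply/min_idPr/ltW.
  move=> q; have [Uq|Uq] := pselect (U q); last by rewrite rhoN // ltW.
  by rewrite rhoU // le_min (ltW eps0) nm_ge0.
- move=> q qp; have [Uq|Uq] := pselect (U q); last by rewrite rhoN.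
  rewrite rhoU // lt_min eps0 nm_gt0 subr_eq0; apply/eqP => e.
  by apply: qp; rewrite -(pK q Uq) e pK.
- split=> [B Bp|e e0].
    have /nm_nearP[r2 r20 HB] := qc p Up B Bp.
    exists (Num.min eps r2); first by rewrite lt_min eps0.
    move=> x; have [Ux|Ux] := pselect (U x); last first.
      by rewrite rhoN // lt_min ltxx.
    rewrite rhoU // => lt; have [dx|dx] := ltP (dist x) r2.
      by have := HB (phi x) dx; rewrite pK //; apply; exists x.
    have : Num.min eps r2 <= Num.min eps (dist x) by rewrite le_min !ge_min lexx /= dx orbT.
    by lra.
  have := pc p Up _ (near_nm (phi p) e0); move: (nU p Up); apply: filterS2 => x Ux dx.
  by rewrite rhoU // gt_min dx orbT.
move=> h z s hh sp; have s0 : 0 <= speed N h z by exact: speed_ge0.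
have hc := hh.1.
have const : (\forall y \near h z, rho y = eps) ->
    \forall t \near z, `|rho (h t) - rho (h z)| <= s * nm (t - z).
  move=> E; have := near_holo hc E; apply: filterS => t ->.
  rewrite (nbhs_singleton E) subrr normr0 mulr_ge0 ?nm_ge0 //.
  by apply: ltW; apply: le_lt_trans sp; rewrite mulr_ge0 // ltW.
have [Uz|Uz] := pselect (U (h z)); last first.
  apply: const; have : \forall y \near h z, (~` closure V) y.
    apply: open_nbhs_nbhs; split; first exact/closed_openC/closed_closure.
    by move=> /VU.
  apply: filterS => y nVy; have [Uy|Uy] := pselect (U y); last exact: rhoN.
  rewrite rhoU //; apply/min_idPl; rewrite leNgt; apply/negP => /(Vin y Uy) Vy.
  by apply: nVy; exact: subset_closure.
have [dz|dz] := leP r (dist (h z)).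
  apply: const.
  have d0 : 0 < r - eps by lra.
  have := pc _ Uz _ (near_nm (phi (h z)) d0); move: (nU _ Uz); apply: filterS2 => y Uy dy.
  rewrite rhoU //; apply/min_idPl; have := nm_tri (phi y) (phi (h z)) (phi p).
  by rewrite [nm (phi (h z) - phi y)]nm_sub; move: dz; rewrite /dist; clear - dy; lra.
have hol := chart_holo lm Uz hh.
pose a i := derive1 (fun t => phi (h t) 0 i : C) z.
have ai i : nm (a i) <= K * speed N h z.
  apply: le_trans (low (phi (h z)) (UW _ Uz) dz a i) _.
  rewrite -(speedE_Re nE Uz hh) sqrtr_sqr ger0_norm //.
have e0 : 0 < s - K * speed N h z by lra.
have E : \forall t \near z, forall i,
    nm (phi (h t) 0 i - phi (h z) 0 i - (t - z) * a i : C) <= (s - K * speed N h z) * nm (t - z).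
  apply: near_forall => i; have [d d0 Hd] := C_eps (near_at (hol i)) e0.
  by apply: filterS (near_nm z d0) => t; exact: Hd.
have := near_holo hc (nU _ Uz); move: E; apply: filterS2 => t Et Ut.
rewrite !rhoU //; apply: le_trans (min_lip _ _ _) _.
have d1 : nm (phi (h t) - phi (h z)) <= s * nm (t - z).
  apply: nm_row_le => [|i].
    by rewrite mulr_ge0 ?nm_ge0 //; apply: ltW; apply: le_lt_trans sp; rewrite mulr_ge0 // ltW.
  have -> : (phi (h t) - phi (h z)) 0 i = phi (h t) 0 i - phi (h z) 0 i - (t - z) * a i + (t - z) * a i.
    by rewrite subrK mxE [X in _ + X]mxE.
  apply: le_trans (nmD _ _) _; have := Et i; rewrite nmM.
  have := ler_wpM2l (nm_ge0 (t - z)) (ai i).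
  by move: (nm (t - z)) (nm (a i)) (K * _) => u v w0; clear; lra.
apply: le_trans d1; rewrite /dist; have := nm_tri (phi (h z)) (phi (h t)) (phi p).
have := nm_tri (phi (h t)) (phi (h z)) (phi p); rewrite [nm (phi (h z) - phi (h t))]nm_sub ler_norml.
move: (nm (phi (h t) - phi (h z))) (nm (phi (h z) - phi p)) (nm (phi (h t) - phi p)) => a1 a2 a3.
by clear; lra.
Qed.

End LocalMetric.

(** * A mean value inequality *)

Section Comparison.
Variable R : realType.

(** The supremum of the t up to which the inequality holds satisfies it, and cannot be less than 1.
    This replaces the integration of speeds along a path. *)
Lemma comparison (u b : R -> R) :
  (forall s t, 0 <= s -> s <= t -> t <= 1 -> b s <= b t) ->
  (forall t, 0 <= t <= 1 -> exists2 d, 0 < d & forall s, 0 <= s <= 1 -> `|s - t| < d ->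
     `|u s - u t| <= `|b s - b t|) ->
  `|u 1 - u 0| <= b 1 - b 0.
Proof.
move=> bm ub; pose S := [set t | 0 <= t <= 1 /\ `|u t - u 0| <= b t - b 0].
have S0 : S 0 by split; rewrite ?lexx ?ler01 // !subrr normr0.
have hS : has_sup S by split; [exists 0 | exists 1 => t [/andP[]]].
have le_sup t : S t -> t <= sup S by move=> St; exact: sup_ubound hS.2 _ St.
have s0 := le_sup 0 S0.
have s1 : sup S <= 1 by apply: (sup_le_ub hS.1) => t [/andP[]].
have [d d0 Hd] := ub (sup S) ltac:(by rewrite s0).
have [t [/andP[t0 t1] St] ts] := sup_adherent d0 hS.
have tS : t <= sup S by apply: le_sup; split=> //; rewrite t0.
have SS : S (sup S).
  split; first by rewrite s0.
  have := Hd t; rewrite t0 t1 ltr_norml => /(_ isT ltac:(by lra)).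
  have := bm t (sup S) t0 tS s1; move=> bts; rewrite [X in _ <= X -> _]ler0_norm ?subr_le0 // opprB => H.
  have := ler_normD (u (sup S) - u t) (u t - u 0).
  by rewrite subrKA [X in _ <= X + _]distrC; lra.
have [s1'|s1'] := ltP (sup S) 1; last first.
  have e : sup S = 1 by apply/eqP; rewrite eq_le s1.
  by rewrite -e; have [] := SS.
pose t' := Num.min (sup S + d / 2) 1.
have t'1 : t' <= 1 by rewrite ge_min lexx orbT.
have t'd : t' <= sup S + d / 2 by rewrite ge_min lexx.
have t's : sup S < t' by rewrite lt_min s1' andbT; lra.
have : S t'.
  split; first by rewrite t'1 andbT; lra.
  have := Hd t'; rewrite t'1 andbT ltr_norml => /(_ ltac:(by lra) ltac:(by lra)).
  have := bm (sup S) t' s0 (ltW t's) t'1; move=> bts; rewrite [X in _ <= X -> _]ger0_norm ?subr_ge0 // => H.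
  have := ler_normD (u t' - u (sup S)) (u (sup S) - u 0); rewrite subrKA.
  by have [_ ?] := SS; lra.
by move=> /le_sup; lra.
Qed.

End Comparison.

(** * Automorphisms of the disc *)

Section DiscAutomorphisms.
Variable R : realType.
Local Notation C := (CC R).
Local Notation rc := (real_complex R).
Implicit Types (a z w : C).

Lemma d1_affine (k b z : C) : derive1 (fun w : C => k * w + b) z = k.
Proof.
have H (e : R) : 0 < e -> exists2 d : R, 0 < d & forall w, nm (w - z) < d ->
    nm (k * w + b - (k * z + b) - (w - z) * k) <= e * nm (w - z).
  move=> e0; exists 1; first exact: ltr01.
  move=> w _; have -> : k * w + b - (k * z + b) - (w - z) * k = 0 by ring.
  by rewrite nm0 mulr_ge0 ?nm_ge0 // ltW.
exact: (eps_C H).2.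
Qed.

Definition cj a : C := conjc a.
Definition mob a z : C := (z + a) / (1 + cj a * z).

Lemma nm_cj a : nm (cj a) = nm a.
Proof. exact: nm_conj. Qed.

Lemma cjN a : cj (- a) = - cj a.
Proof. by rewrite /cj rmorphN. Qed.

Lemma mob_den a z : nm a < 1 -> nm z < 1 -> 1 + cj a * z != 0.
Proof.
move=> a1 z1; apply: contraTneq (ltr01 : (0 : R) < 1) => e; rewrite -leNgt.
have : nm (cj a * z) = 1 by rewrite -(addKr 1 (cj a * z)) e addr0 nmN nm1.
by rewrite nmM nm_cj; have := nm_ge0 a; have := nm_ge0 z; nra.
Qed.

Lemma nm_mob a z : nm a < 1 -> nm z < 1 ->
  (1 - nm (mob a z) ^+ 2) * nm (1 + cj a * z) ^+ 2 = (1 - nm a ^+ 2) * (1 - nm z ^+ 2).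
Proof.
move=> a1 z1; have d0 := mob_den a1 z1.
have nd : nm (1 + cj a * z) != 0 by rewrite nm_eq0.
have -> : (1 - nm (mob a z) ^+ 2) * nm (1 + cj a * z) ^+ 2 =
    nm (1 + cj a * z) ^+ 2 - nm (z + a) ^+ 2.
  by rewrite /mob nmM nmV; field.
apply: (@complexI R).
have rB (x y : R) : rc (x - y) = rc x - rc y by rewrite rmorphB.
have rM (x y : R) : rc (x * y) = rc x * rc y by rewrite rmorphM.
have r1 : rc 1 = 1 by rewrite rmorph1.
have sq (u : C) : rc (nm u ^+ 2) = u * cj u by exact: nm_sqr.
have cD (u v : C) : cj (u + v) = cj u + cj v by exact: rmorphD.
have cM (u v : C) : cj (u * v) = cj u * cj v by exact: rmorphM.
have c1 : cj 1 = 1 by exact: rmorph1.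
have cK (u : C) : cj (cj u) = u by exact: conjcK.
rewrite rM !rB !sq r1 !cD cM c1 cK.
ring.
Qed.

Lemma mob_disc a z : nm a < 1 -> nm z < 1 -> nm (mob a z) < 1.
Proof.
move=> a1 z1; have := nm_mob a1 z1.
have nd : 0 < nm (1 + cj a * z) by rewrite nm_gt0 mob_den.
have := nm_ge0 a; have := nm_ge0 z; have := nm_ge0 (mob a z).
move: (nm (mob a z)) (nm a) (nm z) (nm _) nd a1 z1 => m p q d d0 p1 q1 m0 q0 p0 e.
have : 0 < (1 - m ^+ 2) * d ^+ 2 by rewrite e; apply: mulr_gt0; nra.
rewrite pmulr_lgt0 ?exprn_gt0 //; nra.
Qed.

Lemma mob_inj a z w : nm a < 1 -> nm z < 1 -> nm w < 1 ->
  mob a z - mob a w = (z - w) * ((1 - cj a * a) / ((1 + cj a * z) * (1 + cj a * w))).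
Proof.
move=> a1 z1 w1; have dz := mob_den a1 z1; have dw := mob_den a1 w1.
by rewrite /mob; field; rewrite dz dw.
Qed.

Lemma mob_unit a : nm a < 1 -> 1 - cj a * a != 0.
Proof. by move=> a1; have := @mob_den (- a) a; rewrite nmN cjN mulNr; exact. Qed.

Lemma mobK a z : nm a < 1 -> nm z < 1 -> mob (- a) (mob a z) = z.
Proof.
move=> a1 z1; have d0 := mob_den a1 z1; have e0 : 1 + cj (- a) * mob a z != 0.
  by apply: mob_den; rewrite ?nmN // mob_disc.
apply: (mulIf e0); rewrite {1}/mob divfK // cjN /mob; field; exact: d0.
Qed.

Lemma mobK' a z : nm a < 1 -> nm z < 1 -> mob a (mob (- a) z) = z.
Proof. by move=> a1 z1; rewrite -{1}(opprK a) mobK // nmN. Qed.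

Lemma mob_holo a z : nm a < 1 -> nm z < 1 -> holo_germ z (mob a).
Proof.
move=> a1 z1; apply: hgM; first by apply: hgD; [exact: df_near_id | exact: hg_cst].
apply: hgV; last exact: mob_den.
by apply: hgD; [exact: hg_cst | apply: hgM; [exact: hg_cst | exact: df_near_id]].
Qed.

Lemma mob_derive a z : nm a < 1 -> nm z < 1 ->
  derive1 (mob a) z = (1 - cj a * a) / (1 + cj a * z) ^+ 2.
Proof.
move=> a1 z1; have d0 := mob_den a1 z1.
have H : \forall w \near z, mob a w = mob a z + (w - z) * ((1 - cj a * a) / ((1 + cj a * w) * (1 + cj a * z))).
  have d1 : 0 < 1 - nm z by rewrite subr_gt0.
  apply: filterS (near_nm z d1) => w wz.
  have w1 : nm w < 1 by have := nmD (w - z) z; rewrite subrK; lra.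
  by rewrite -(mob_inj a1 w1 z1) addrC subrK.
have hu : holo_germ z (fun w => (1 - cj a * a) / ((1 + cj a * w) * (1 + cj a * z))).
  apply: hgM; first exact: hg_cst; apply: hgV; last by rewrite mulf_neq0.
  apply: hgM; last exact: hg_cst.
  by apply: hgD; [exact: hg_cst | apply: hgM; [exact: hg_cst | exact: df_near_id]].
have hz : holo_germ z (fun w => w - z) by apply: hgB; [exact: df_near_id | exact: hg_cst].
rewrite (d1_near H) (d1D (hg_cst z _) (hgM hz hu)) d1_cst add0r (d1M hz hu) subrr mul0r add0r.
have -> : derive1 (fun w : C => w - z) z = 1.
  have <- : (fun w : C => 1 * w + (- z)) = (fun w => w - z) by apply/funext => w; rewrite mul1r.
  exact: d1_affine.
by rewrite mulr1 expr2.
Qed.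

(** Equality in the Schwarz-Pick lemma: [mob a] preserves the Poincare metric. *)
Lemma nm_mob_derive a z : nm a < 1 -> nm z < 1 ->
  nm (derive1 (mob a) z) * (1 - nm z ^+ 2) = 1 - nm (mob a z) ^+ 2.
Proof.
move=> a1 z1; have d0 := mob_den a1 z1.
have nd : nm (1 + cj a * z) != 0 by rewrite nm_eq0.
have na : nm (1 - cj a * a) = 1 - nm a ^+ 2.
  have -> : 1 - cj a * a = rc (1 - nm a ^+ 2).
    have rB (x y : R) : rc (x - y) = rc x - rc y by rewrite rmorphB.
    by rewrite rB nm_sqr rmorph1 mulrC.
  by rewrite nm_real ger0_norm // subr_ge0 exprn_ile1 ?nm_ge0 // ltW.
rewrite mob_derive // nmM nmV nmX na.
have d2 : nm (1 + cj a * z) ^+ 2 != 0 by rewrite expf_neq0.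
by rewrite mulrAC -(nm_mob a1 z1) mulfK.
Qed.

Lemma mob0 a : mob a 0 = a.
Proof. by rewrite /mob add0r mulr0 addr0 divr1. Qed.

End DiscAutomorphisms.

(** * Orders of zeros under reparametrisation *)

Section Orders.
Variable R : realType.
Local Notation C := (CC R).
Implicit Types (F tau : C -> C) (x y : C).

(** [sigma] is a right inverse of [tau] near tau x, and the unit [v] says that sigma s - x has order
    exactly 1 in s - tau x. That is all the order of a zero depends on. *)
Definition inverse_at tau (sigma : C -> C) x := exists v : C -> C,
  [/\ \forall s \near tau x, tau (sigma s) = s, holo_germ (tau x) sigma /\ sigma (tau x) = x,
      holo_germ (tau x) v, v (tau x) != 0 &
      \forall s \near tau x, sigma s - x = (s - tau x) * v s].

Lemma order_inverse F tau sigma x n : inverse_at tau sigma x ->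
  vanishing_order (fun t => F (tau t)) x n -> vanishing_order F (tau x) n.
Proof.
move=> [v [ts [hs sx] hv v0 vE]] [u [hu u0 uE]].
exists (fun s => v s ^+ n * u (sigma s)); split.
- apply: hgM; first exact: hgX.
  by apply: (hg_comp (c := u) hs); rewrite sx.
- by rewrite sx mulf_neq0 // expf_neq0.
have uE' : \forall s \near tau x, F (tau (sigma s)) = (sigma s - x) ^+ n * u (sigma s).
  apply: (cont_near (P := fun t : C => F (tau t) = (t - x) ^+ n * u t) (hgcont hs)).
  by rewrite sx; exact: uE.
near=> s.
have e1 : tau (sigma s) = s by near: s.
have e2 : sigma s - x = (s - tau x) * v s by near: s.
have e3 : F (tau (sigma s)) = (sigma s - x) ^+ n * u (sigma s) by near: s.
by rewrite -{1}e1 e3 e2 exprMn mulrA.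
Unshelve. all: by end_near. Qed.

Lemma inverse_affine (k b x : C) : k != 0 -> inverse_at (fun t => k * t + b) (fun s => (s - b) / k) x.
Proof.
move=> k0; exists (fun=> k^-1); split.
- by apply: near_all => s; rewrite mulrC divfK // subrK.
- split; last by rewrite addrK mulrAC divff // mul1r.
  by apply: hgM; [apply: hgB; [exact: df_near_id | exact: hg_cst] | exact: hg_cst].
- exact: hg_cst.
- by rewrite invr_eq0.
- by apply: near_all => s; field.
Qed.

Lemma inverse_mob (a x : C) : nm a < 1 -> nm x < 1 -> inverse_at (mob a) (mob (- a)) x.
Proof.
move=> a1 x1; have a1' : nm (- a) < 1 by rewrite nmN.
have t1 := mob_disc a1 x1.
have nd : \forall s \near mob a x, nm s < 1.
  have d1 : 0 < 1 - nm (mob a x) by rewrite subr_gt0.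
  apply: filterS (near_nm _ d1) => w wz.
  by have := nmD (w - mob a x) (mob a x); rewrite subrK; lra.
exists (fun s => (1 - cj (- a) * - a) / ((1 + cj (- a) * s) * (1 + cj (- a) * mob a x))); split.
- by apply: filterS nd => s s1; exact: mobK'.
- by split; [exact: mob_holo | exact: mobK].
- apply: hgM; first exact: hg_cst; apply: hgV; last by rewrite mulf_neq0 // mob_den.
  apply: hgM; last exact: hg_cst.
  by apply: hgD; [exact: hg_cst | apply: hgM; [exact: hg_cst | exact: df_near_id]].
- by rewrite mulf_neq0 ?mob_unit // invr_eq0 mulf_neq0 // mob_den.
- by apply: filterS nd => s s1; rewrite -mob_inj // mobK.
Qed.

(** F has finite order a at g x, otherwise F \o g would vanish near x; if a > 0, the expansion of g
    - g x, of order e, is then substituted. *)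
Lemma order_compose F g x n : holo_germ x g -> holo_germ (g x) F ->
  vanishing_order (fun t => F (g t)) x n -> exists a e, vanishing_order F (g x) a /\ n = (a * e)%N.
Proof.
move=> hg hF [u [hu u0 uE]].
have cg := hgcont hg.
have nz : ~ \forall t \near x, F (g t) = 0.
  move=> Z; apply: (order_not0 (hgcont hu) u0 (n := n)).
  by move: Z uE; apply: filterS2 => t -> <-.
have [[a [w [hw w0 wE]]]|Z] := order_dich_germ hF; last first.
  by exfalso; apply: nz; exact: (cont_near cg Z).
have Fo : vanishing_order F (g x) a by exists w; split=> //; exact: near_all.
have hwg : holo_germ x (fun t => w (g t)) by exact: (hg_comp (c := w) hg hw).
case: a wE Fo => [|a] wE Fo.
  (* For a = 0 the map g may be constant near x, and then it has no order e of its own. *)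
  exists 0%N, 0%N; split=> //.
  apply: (order_unique (hgcont hu) (hgcont hwg) u0 w0).
  by apply: filterS uE => t <-; rewrite wE !expr0 !mul1r.
have hgx : holo_germ x (fun t => g t - g x) by apply: hgB; [exact: hg | exact: hg_cst].
have [[e [v [hv v0 vE]]]|Z] := order_dich_germ hgx; last first.
  by exfalso; apply: nz; apply: filterS Z => t gt; rewrite wE gt exprS !mul0r.
exists a.+1, e; split=> //.
have hvw : holo_germ x (fun t => v t ^+ a.+1 * w (g t)) by apply: hgM => //; exact: hgX.
apply: (order_unique (hgcont hu) (hgcont hvw) u0); first by rewrite mulf_neq0 // expf_neq0.
apply: filterS uE => t <-; rewrite wE vE exprMn -exprM mulnC.
by rewrite mulrA.
Qed.

End Orders.

(** * Local equations and multiplicity conditions *)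

Section Multiplicities.
Variables (R : realType) (X : complex_space R).
Local Notation C := (CC R).
Implicit Types (h f : C -> X) (Z U : set X).

Lemma germ_cont (x : X) (f : X -> C) : cs_germ x f -> {for x, continuous f}.
Proof.
have [U [n [phi [W [lm Ux]]]]] := cs_local x.
have [_ pc _ _ gE] := local_modelP lm.
move=> /(gE _ _ Ux)[F hF fF]; have fx := nbhs_singleton fF => P.
rewrite /= fx => FP.
have PF : \forall v \near phi x, P (F v) by exact: (cont_near (hgcont hF) FP).
by have := pc x Ux _ PF; move: fF; apply: filterS2 => y /= ->.
Qed.

Lemma germ_cst (x : X) (a : C) : cs_germ x (fun=> a).
Proof.
have [U [n [phi [W [lm Ux]]]]] := cs_local x.
have [_ pc _ _ gE] := local_modelP lm.
by apply/gE => //; exists (fun=> a); [exact: hg_cst | exact: filterE].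
Qed.

Lemma germ_near (x : X) (f : X -> C) : cs_germ x f -> \forall y \near x, cs_germ y f.
Proof.
have [U [n [phi [W [lm Ux]]]]] := cs_local x.
have [Uo pc _ _ gE] := local_modelP lm.
move=> /(gE _ _ Ux)[F hF fF].
have h1 := pc x Ux _ (hg_near hF).
have h2 : \forall y \near x, U y by exact: open_nbhs_nbhs.
have h3 := nbhs_interior fF.
by move: h1 h2 h3; apply: filterS3 => y hFy Uy fFy; apply/gE => //; exists F.
Qed.

Lemma germ_neq0 (x : X) (f : X -> C) : cs_germ x f -> f x != 0 -> \forall y \near x, f y != 0.
Proof.
move=> gf fx; have d0 : 0 < nm (f x) by rewrite nm_gt0.
have cf : \forall y \near x, nm (f y - f x) < nm (f x) := germ_cont gf (near_nm (f x) d0).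
apply: filterS cf => y H.
by apply: contraTneq H => ->; rewrite sub0r nmN ltxx.
Qed.

Lemma off_hypersurface Z (x : X) : analytic_subset (@cs_germ R X) Z -> ~ Z x ->
  \forall y \near x, ~ Z y.
Proof.
move=> /(_ x)[k [F [gF FE]]] nZ.
have [i Fi] : exists i, F i x != 0.
  apply: contrapT => nE; apply: nZ; apply/(nbhs_singleton FE) => i.
  by apply/eqP/negPn/negP => Fi; apply: nE; exists i.
move: FE (germ_neq0 (gF i) Fi); apply: filterS2 => y e Fy /e /(_ i) Fy0.
by rewrite Fy0 eqxx in Fy.
Qed.

(** Off [Z] the constant 1 generates the ideal, so phi is a unit there. *)
Lemma local_equation_off Z k U phi y : irreducible_hypersurface Z ->
  local_equation Z k U phi -> U y -> ~ Z y -> phi y != 0.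
Proof.
move=> [[Zan _ _] _] [_ _ le] Uy nZ.
have gen : ideal_generator Z y (fun=> 1).
  split; first by split; [exact: germ_cst | apply: filterS (off_hypersurface Zan nZ) => t].
  by move=> f [gf _]; exists f => //; apply: filterE => t; rewrite mulr1.
have [u [_ u0 /nbhs_singleton ->]] := le y _ Uy gen.
by rewrite expr1n mulr1.
Qed.

(** If phi were nonzero at a point of [Z], it would be so nearby, in particular at a point of [Z]
    with a generator g of the ideal. There phi = u g^k with k > 0, and g vanishes. *)
Lemma local_equation_on Z k U phi y : irreducible_hypersurface Z -> (0 < k)%N ->
  local_equation Z k U phi -> U y -> Z y -> phi y = 0.
Proof.
move=> Zh k0 [Uo gphi le] Uy Zy; apply/eqP/negPn/negP => py.
have nB : \forall t \near y, U t /\ phi t != 0.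
  have h2 : \forall t \near y, U t by exact: open_nbhs_nbhs.
  by move: h2 (germ_neq0 (gphi y Uy) py); apply: filterS2.
have [t [g [[Ut pt] Zt gen]]] := hypersurface_generator Zh Zy nB.
have [u [_ _ /nbhs_singleton pE]] := le t g Ut gen.
have [[_ /nbhs_singleton/(_ Zt) g0] _] := gen.
by rewrite pE g0 expr0n eqn0Ngt k0 mulr0 eqxx in pt.
Qed.

Lemma pullback_inverse h (tau sigma : C -> C) x Z q : inverse_at tau sigma x ->
  pullback_mult (fun t => h (tau t)) x Z q -> pullback_mult h (tau x) Z q.
Proof.
move=> inv [k [U [phi [n [k0 le Ux vo qE]]]]]; exists k, U, phi, n.
split; [exact: k0 | exact: le | exact: Ux | exact: (order_inverse (F := phi \o h) inv vo) | exact: qE].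
Qed.

Definition adm (c : morphism_kind) m k n := match c with
  | Nonclassical => (m * k <= n)%N | Classical => (m * k %| n)%N end.

Lemma admE c m k n : (0 < k)%N -> admissible_mult c m (n%:R / k%:R) <-> adm c m k n.
Proof.
move=> k0; have k0' : (0 : rat) < k%:R by rewrite ltr0n.
case: c => /=; first by rewrite ler_pdivlMr // -natrM ler_nat.
split=> [[j e]|/dvdnP[j ->]].
  have /eqP : (n%:R : rat) = (j * m * k)%:R by rewrite natrM -e divfK ?gt_eqF.
  by rewrite eqr_nat => /eqP ->; rewrite -mulnA dvdn_mull.
exists j; rewrite mulnA natrM mulfK ?gt_eqF //.
Qed.

Variables (Delta : orbifold X) (c : morphism_kind).

Definition mult_ok f (E : set C) := forall i m x q, orb_mult (o := Delta) i = Some m -> E x ->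
  hyp i (f x) -> pullback_mult f x (hyp i) q -> admissible_mult c m q.

Lemma mult_ok_inverse h (tau : C -> C) (E E' : set C) :
  (forall x, E' x -> E (tau x) /\ exists sigma, inverse_at tau sigma x) ->
  mult_ok h E -> mult_ok (fun t => h (tau t)) E'.
Proof.
move=> H ok i m x q im E'x hx pq; have [Ex [sigma inv]] := H x E'x.
exact: (ok i m (tau x) q im Ex hx (pullback_inverse inv pq)).
Qed.

(** The order of phi \o f is multiplied by some e, and e > 0 because phi vanishes at the point. *)
Lemma mult_ok_compose f (g : C -> C) (E : set C) : (forall x, holo_at f x) ->
  (forall z, E z -> holo_germ z g) -> mult_ok f setT -> mult_ok (fun t => f (g t)) E.
Proof.
move=> hf hg ok i m x q im Ex hx [k [U [phi [n [k0 le Ux vo qE]]]]].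
have Zh := hyp_hypersurface (o := Delta) i.
have phi0 := local_equation_on Zh k0 le Ux hx.
have [_ gphi _] := le.
have hF : holo_germ (g x) (phi \o f) by exact: (hf (g x)).2 _ (gphi _ Ux).
have [a [e [Fo nE]]] := order_compose (hg x Ex) hF vo.
have n0 : (0 < n)%N.
  case: n nE vo qE => // _ [u [_ u0 /nbhs_singleton /= uE]] _.
  by move: uE; rewrite phi0 expr0 mul1r => uE; rewrite -uE eqxx in u0.
have : admissible_mult c m (a%:R / k%:R).
  by apply: (ok i m (g x)) => //; exists k, U, phi, a; split.
rewrite qE => /(admE _ _ _ k0) ad; apply/admE => //; rewrite nE.
move: n0; rewrite nE muln_gt0 => /andP[_ e0].
case: c ad => /= ad; first by apply: leq_trans ad _; rewrite leq_pmulr.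
by apply: dvdn_trans ad _; rewrite dvdn_mulr.
Qed.

Definition disc (r : R) := [set z : C | nm z < r].

Lemma unit_discE : @unit_disc R = disc 1.
Proof.
apply/seteqP; split=> z; rewrite /unit_disc /disc /= nmE.
  by rewrite -[X in _ < X](rmorph1 (real_complex R)) ltcR.
by move=> z1; rewrite -[1](rmorph1 (real_complex R)) ltcR.
Qed.

Hypothesis D_compact : compact_orbifold Delta.

(** Compactness excludes weight 1, so every multiplicity is finite. *)
Lemma disc_morphismE h : disc_morphism Delta c h <->
  [/\ forall z, nm z < 1 -> holo_at h z, exists2 z, nm z < 1 & ~ orb_support Delta (h z) &
      mult_ok h (disc 1)].
Proof.
have noN i : orb_mult (o := Delta) i <> None.
  by have [_ /(_ i) w1] := D_compact; move=> iN; apply: w1; rewrite /weight iN.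
rewrite /disc_morphism unit_discE; split=> [[h1 h2 h3 _]|[h1 h2 h3]].
  split=> //; apply: contrapT => nE; apply: h2 => _ [z z1 <-].
  by apply: contrapT => nS; apply: nE; exists z.
split=> //.
- have [z z1 nz] := h2 => H; apply: nz; apply: H; by exists z.
- by move=> i /noN.
Qed.

Lemma disc_auto h a : nm a < 1 -> disc_morphism Delta c h ->
  disc_morphism Delta c (fun z => h (mob a z)).
Proof.
move=> a1 /disc_morphismE[h1 [z z1 nz] h3]; apply/disc_morphismE; split.
- by move=> w w1; apply: holo_at_comp; [exact: mob_holo | apply: h1; exact: mob_disc].
- by exists (mob (- a) z); [apply: mob_disc => //; rewrite nmN | rewrite mobK'].
- apply: mult_ok_inverse h3 => x x1; split; first exact: mob_disc.
  by exists (mob (- a)); exact: inverse_mob.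
Qed.

End Multiplicities.

(** * Bounded speeds give a distance *)

Section BoundedSpeed.
Variables (R : realType) (X : complex_space R) (Delta : orbifold X).
Variables (N : hermitian_metric X) (c : morphism_kind).
Local Notation C := (CC R).
Hypothesis D_compact : compact_orbifold Delta.

Lemma speed_disc_bound (B : R) h z : (forall h, disc_morphism Delta c h -> speed N h 0 <= B) ->
  disc_morphism Delta c h -> nm z < 1 -> (1 - nm z ^+ 2) * speed N h z <= B.
Proof.
move=> HB dh z1; have dm := disc_auto D_compact z1 dh.
have hh : holo_at h (mob z 0) by rewrite mob0; have [H _ _] := (disc_morphismE c D_compact h).1 dh; exact: H.
have n0 : nm (0 : C) < 1 by rewrite nm0.
have := HB _ dm; rewrite (speed_comp N (mob_holo z1 n0) hh) mob0.
by have := nm_mob_derive z1 n0; rewrite nm0 expr0n subr0 mulr1 mob0 => ->.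
Qed.

(** The inequality ln q >= 1 - 1 / q, where q is the quotient of the arguments of the two
    logarithms; the left side equals 1 - 1 / q. *)
Lemma ln_ratio_mono (r s t : R) : 0 <= r -> r < 1 -> 0 <= s -> s <= t -> t <= 1 ->
  2 * (r * (t - s)) / ((1 + t * r) * (1 - s * r)) <=
  ln ((1 + t * r) / (1 - t * r)) - ln ((1 + s * r) / (1 - s * r)).
Proof.
move=> r0 r1 s0 st t1.
have tr : t * r < 1 by nra. have sr : s * r < 1 by nra.
have sr0 : 0 <= s * r by rewrite mulr_ge0. have tr0 : 0 <= t * r by rewrite mulr_ge0 // (le_trans s0).
have p1 : 0 < 1 + t * r by lra. have p2 : 0 < 1 - t * r by lra.
have p3 : 0 < 1 + s * r by lra. have p4 : 0 < 1 - s * r by lra.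
rewrite -ln_div ?posrE ?divr_gt0 //.
set q := _ / _ / _.
have q0 : 0 < q by rewrite !divr_gt0.
have -> : ln q = - ln q^-1 by rewrite lnV ?posrE // opprK.
have H : ln (1 + (q^-1 - 1)) <= q^-1 - 1.
  have q1 : 0 < q^-1 by rewrite invr_gt0.
  by apply: le_ln1Dx; lra.
rewrite addrC subrK in H.
have -> : 2 * (r * (t - s)) / ((1 + t * r) * (1 - s * r)) = 1 - q^-1.
  by rewrite /q; field; rewrite !gt_eqF.
by lra.
Qed.

(** The density of the Poincare distance is 2 / (1 - x^2). The factor 2 absorbs the change of the
    density between s and t, so that the bound holds on a whole neighbourhood of t as [comparison]
    requires. *)
Lemma ln_ratio_lip (A r s t : R) : 0 <= A -> 0 <= r -> r < 1 -> 0 <= s <= 1 -> 0 <= t <= 1 ->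
  `|s - t| <= 1 - t * r ->
  A / (1 - (t * r) ^+ 2) * (`|s - t| * r) <=
  `|A * ln ((1 + s * r) / (1 - s * r)) - A * ln ((1 + t * r) / (1 - t * r))|.
Proof.
move=> A0 r0 r1 /andP[s0 s1] /andP[t0 t1] st.
have frac (x P Q Q' : R) : 0 <= x -> 0 < P -> 0 < Q -> 0 < Q' -> Q' <= 2 * Q ->
    x / (P * Q) <= 2 * x / (P * Q').
  clear => x0 P0 Q0 Q0' QQ; rewrite ler_pdivrMr ?mulr_gt0 // mulrAC ler_pdivlMr ?mulr_gt0 //.
  have xP : 0 <= x * P by rewrite mulr_ge0 // ltW.
  have := ler_wpM2l xP QQ; lra.
have sr0 : 0 <= s * r by rewrite mulr_ge0.
have tr0 : 0 <= t * r by rewrite mulr_ge0.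
have sr1 : s * r < 1 by clear - s1 r0 r1; nra.
have tr1 : t * r < 1 by clear - t1 r0 r1; nra.
have pos x : 0 <= x -> 0 < 1 + x by move=> x0; rewrite ltr_wpDr.
have neg x : x < 1 -> 0 < 1 - x by rewrite subr_gt0.
rewrite mulrAC -mulrA -mulrBr normrM (ger0_norm A0) ler_wpM2l //.
have -> : 1 - (t * r) ^+ 2 = (1 + t * r) * (1 - t * r) by ring.
have [ts|ts] := leP t s.
  have H := ln_ratio_mono r0 r1 t0 ts s1.
  apply: le_trans (le_trans H (ler_norm _)); rewrite (ger0_norm (x := s - t)) ?subr_ge0 //.
  have rst : r * (s - t) <= s - t by rewrite ler_piMl ?subr_ge0 // ltW.
  rewrite [X in X / _]mulrC [X in _ / X <= _]mulrC [X in _ <= _ / X]mulrC.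
  rewrite ger0_norm ?subr_ge0 // in st.
  apply: frac; rewrite ?neg ?pos ?mulr_ge0 ?subr_ge0 //.
  by clear - st rst tr0; lra.
have H := ln_ratio_mono r0 r1 s0 (ltW ts) t1.
rewrite [leRHS]distrC; apply: le_trans (le_trans H (ler_norm _)).
have rst : r * (t - s) <= t - s by rewrite ler_piMl ?subr_ge0 ?ltW.
rewrite distrC ger0_norm ?subr_ge0 ?(ltW ts) // in st *.
rewrite [X in X / _]mulrC; apply: frac; rewrite ?neg ?pos ?mulr_ge0 ?subr_ge0 ?(ltW ts) //.
by clear - st rst; lra.
Qed.

Lemma distance_from_bound (B : R) :
  (forall h, disc_morphism Delta c h -> speed N h 0 <= B) -> kobayashi_is_distance Delta c.
Proof.
move=> HB p q Sp Sq k0; apply: contrapT => pq.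
have Xc := D_compact.1.
have [rho [K [K0 [rp r0] rpos _ lip]]] := local_metric_exists N Xc p.
have B0 : 0 <= Num.max B 0 by rewrite le_max lexx orbT.
(* The [+ 1] provides the strict inequality in the last clause of [local_metric]. *)
pose A := K * (Num.max B 0 + 1).
have A0 : 0 < A by rewrite mulr_gt0 // ltr_wpDl.
have key h (z : C) : disc_morphism Delta c h -> nm z < 1 ->
    `|rho (h z) - rho (h 0)| <= A * ln ((1 + nm z) / (1 - nm z)).
  move=> dh z1; have [hh _ _] := (disc_morphismE c D_compact h).1 dh.
  pose r := nm z; have r0' : 0 <= r := nm_ge0 z.
  pose b (t : R) := A * ln ((1 + t * r) / (1 - t * r)).
  have -> : A * ln ((1 + nm z) / (1 - nm z)) = b 1 - b 0.
    by rewrite /b !mul1r !mul0r addr0 subr0 divr1 ln1 mulr0 subr0.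
  have bm s t : 0 <= s -> s <= t -> t <= 1 -> b s <= b t.
    move=> s0 st t1; have := ln_ratio_mono r0' z1 s0 st t1.
    have sr : s * r < 1 by apply: le_lt_trans z1; rewrite ler_piMl // (le_trans st).
    have : 0 <= 2 * (r * (t - s)) / ((1 + t * r) * (1 - s * r)).
      have tr0 : 0 <= t * r by rewrite mulr_ge0 // (le_trans s0).
      rewrite divr_ge0 // mulr_ge0 ?subr_ge0 ?(ltW sr) ?addr_ge0 //.
      by rewrite mulr_ge0 ?subr_ge0.
    move=> /le_trans/[apply]; rewrite subr_ge0 /b => lnle; exact: ler_wpM2l (ltW A0) _ _ lnle.
  pose rc (t : R) : C := real_complex R t.
  have path := @comparison R (fun t => rho (h (rc t * z))) b bm.
  have e1 : h z = h (rc 1 * z) by rewrite /rc rmorph1 mul1r.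
  have e0 : h 0 = h (rc 0 * z) by rewrite /rc rmorph0 mul0r.
  rewrite e1 e0; apply: path => t /andP[t0 t1].
  have tr0 : 0 <= t * r by rewrite mulr_ge0.
  have tr1 : t * r < 1 by nra.
  have ny : nm (rc t * z) = t * r by rewrite nmM nm_real ger0_norm.
  have y1 : nm (rc t * z) < 1 by rewrite ny.
  have d0 : 0 < 1 - (t * r) ^+ 2 by nra.
  have sp : K * speed N h (rc t * z) < A / (1 - (t * r) ^+ 2).
    rewrite ltr_pdivlMr // /A -mulrA ltr_pM2l //.
    have := speed_disc_bound HB dh y1; rewrite ny [X in X <= _ -> _]mulrC => /le_lt_trans; apply.
    by apply: (@le_lt_trans _ _ (Num.max B 0)); [rewrite le_max lexx | rewrite ltrDl].
  have /nm_nearP[del del0 Hd] := lip h _ _ (hh _ y1) sp.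
  exists (Num.min del (1 - t * r)); first by rewrite lt_min del0 subr_gt0.
  move=> s /andP[s0 s1]; rewrite lt_min => /andP[sd sr].
  have sr0 : 0 <= s * r by rewrite mulr_ge0.
  have sr1 : s * r < 1 by apply: le_lt_trans z1; rewrite ler_piMl.
  have nd : nm (rc s * z - rc t * z) = `|s - t| * r.
    by rewrite -mulrBl nmM -rmorphB nm_real.
  have st_le : `|s - t| * r <= `|s - t| by rewrite ler_piMr // ltW.
  have := Hd (rc s * z); rewrite nd => /(_ (le_lt_trans st_le sd)) H.
  apply: le_trans H _.
  apply: ln_ratio_lip; rewrite ?t0 ?s0 ?(ltW A0) //; exact: ltW.
(* A competitor in the supremum that defines the Kobayashi pseudodistance, positive at (p, q). *)
pose d x y := `|rho x - rho y| / A.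
have dP : pseudodistance_on (~` orb_support1 Delta) d /\ disc_decreasing Delta c d.
  split; first split.
  - by move=> x _; rewrite /d subrr normr0 mul0r.
  - by move=> x y _ _; rewrite divr_ge0 // ltW.
  - by move=> x y _ _; rewrite /d distrC.
  - move=> x y w _ _ _; rewrite /d -mulrDl ler_wpM2r ?invr_ge0 ?(ltW A0) //.
    exact: ler_distD.
  move=> h dh z w; rewrite unit_discE => z1 w1.
  have w1' : nm (- w) < 1 by rewrite nmN.
  rewrite /d ler_pdivrMr // mulrC.
  (* The disc is recentred at w; the point z becomes [mob (- w) z], whose modulus is the argument in
     [poincare z w]. *)
  have := key _ _ (disc_auto D_compact w1 dh) (mob_disc w1' z1).
  rewrite mobK' // mob0 => H; apply: le_trans H _; rewrite le_eqVlt; apply/orP; left; apply/eqP.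
  congr (A * _); rewrite /poincare /mob cjN mulNr.
  by [].
have : ((d p q)%:E <= kobayashi Delta c p q)%E by apply: ereal_sup_ubound; exists d.
rewrite k0 lee_fin /d rp sub0r normrN ger0_norm // ler_pdivrMr // mul0r leNgt.
by rewrite rpos // => qp; apply: pq.
Qed.

End BoundedSpeed.

(** * Locally uniform limits of holomorphic curves *)

Section LocallyUniformLimits.
Variables (R : realType) (X : complex_space R).
Local Notation C := (CC R).
Hypothesis Xc : compact [set: X].
Context (I : Type) (U : set_system I) {UU : UltraFilter U}.
Implicit Types (F : I -> C -> X) (f : C -> X) (x z w : C).

(** Uniformity near x is tested on neighbourhoods of the single point f x, which makes sense in a
    topological space. *)
Definition loc_unif F f x := forall B, nbhs (f x) B -> exists2 d : R, 0 < d &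
  \forall i \near U, forall w, nm (w - x) < d -> B (F i w).

Definition holo_family F x (r : R) := \forall i \near U, forall w, nm (w - x) < r -> holo_at (F i) w.

Lemma loc_unif_at F f x B : loc_unif F f x -> nbhs (f x) B -> \forall i \near U, B (F i x).
Proof.
move=> lu /lu[d d0]; apply: filterS => i; apply.
by rewrite subrr nm0.
Qed.

Section AtPoint.
Variables (F : I -> C -> X) (f : C -> X) (x : C) (r : R).
Hypotheses (r0 : 0 < r) (lu : forall w, nm (w - x) < r -> loc_unif F f w).
Hypothesis hF : holo_family F x r.

Lemma lu_center : loc_unif F f x.
Proof. by apply: lu; rewrite subrr nm0. Qed.

(** A neighbourhood of f x with closure inside B: it contains the F i w for almost all i, so their
    limit f w lies in the closure. *)
Lemma limit_continuous : {for x, continuous f}.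
Proof.
move=> B /= Bx; have [V Vx VB] := closed_nbhd Xc Bx.
have [d d0 Hd] := lu_center Vx.
have m0 : 0 < Num.min d r by rewrite lt_min d0.
apply: filterS (near_nm x m0) => w; rewrite lt_min => /andP[wd wr].
apply: VB => Q Qw; have h1 := loc_unif_at (lu wr) Qw.
have [i [h2 h3]] := near_ex2 h1 Hd.
by exists (F i w); split=> //; exact: h3.
Qed.

(** Reduces the family to bounded holomorphic functions on one disc, to which [weierstrass] and
    [hurwitz] apply. *)
Lemma limit_germ g : cs_germ (f x) g -> exists rho M : R, [/\ 0 < rho <= r,
  bounded_family U x rho (fun i w => g (F i w)) M &
  forall w, nm (w - x) < rho -> tends U (fun i => g (F i w) : C) (g (f w))].
Proof.
move=> gx; have cg : \forall y \near f x, nm (g y - g (f x)) < 1 := germ_cont gx (near_nm (g (f x)) ltr01).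
have gn := germ_near gx.
have Bx : \forall y \near f x, cs_germ y g /\ nm (g y - g (f x)) < 1 by move: gn cg; apply: filterS2.
have [d d0 Hd] := lu_center Bx.
have /nm_nearP[e e0 He] := near_holo limit_continuous gn.
pose rho := Num.min (Num.min d e) r.
have rho0 : 0 < rho by rewrite !lt_min d0 e0.
have rr : rho <= r by rewrite ge_min lexx orbT.
have rd : rho <= d by rewrite !ge_min lexx.
have re : rho <= e by rewrite !ge_min lexx orbT.
exists rho, (nm (g (f x)) + 1); split; first by rewrite rho0.
  move: hF Hd; apply: filterS2 => i hi Bi; split=> w wr.
    have [gw _] := Bi w (lt_le_trans wr rd).
    exact: (near_at ((hi w (lt_le_trans wr rr)).2 g gw)).
  have [_ H] := Bi w (lt_le_trans wr rd).
  by have := nmD (g (F i w) - g (f x)) (g (f x)); rewrite subrK; lra.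
move=> w wr s s0; have gw := He w (lt_le_trans wr re).
have cw : \forall y \near f w, nm (g y - g (f w)) < s := germ_cont gw (near_nm (g (f w)) s0).
exact: loc_unif_at (lu (lt_le_trans wr rr)) cw.
Qed.

Lemma limit_holo : holo_at f x.
Proof.
split; first exact: limit_continuous.
move=> g gx; have [rho [M [/andP[rho0 _] bf tl]]] := limit_germ gx.
by have [hg _] := weierstrass bf tl; apply/hgP; exists rho.
Qed.

Lemma limit_derive g : cs_germ (f x) g ->
  tends U (fun i => derive1 (fun t => g (F i t) : C) x : C) (derive1 (fun t => g (f t) : C) x).
Proof.
move=> gx; have [rho [M [/andP[rho0 _] bf tl]]] := limit_germ gx.
have [hg td] := weierstrass bf tl.
have xx : nm (x - x) < rho by rewrite subrr nm0.
have e0 := derive1_diff (hg x xx).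
have ei : \forall i \near U, 'd (fun w => g (F i w) : C) x 1 = derive1 (fun w => g (F i w) : C) x.
  by apply: filterS bf => i [hi _]; exact: (esym (derive1_diff (hi x xx))).
rewrite e0; exact: (tends_near ei (td x xx 1)).
Qed.

Variable N : hermitian_metric X.

(** The square of the speed is the hermitian form at the derivatives of the coordinates; the
    coordinates and their derivatives converge, and the form is continuous. *)
Lemma limit_speed : tends U (fun i => real_complex R (speed N (F i) x ^+ 2) : C)
  (real_complex R (speed N f x ^+ 2)).
Proof.
have [V [n [phi [W [H [lm Vx hm nE]]]]]] := @hnorm_local R X N (f x).
have [Vo pc _ _ _] := local_modelP lm.
have VW : W (phi (f x)) by have [_ VW _ _ _] := lm; apply: VW; exists (f x).
have nV : \forall y \near f x, V y by exact: open_nbhs_nbhs.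
have tw : tends U (fun i => phi (F i x)) (phi (f x)).
  move=> e e0; have pe : \forall y \near f x, nm (phi y - phi (f x)) < e := pc _ Vx _ (near_nm (phi (f x)) e0).
  exact: loc_unif_at lu_center pe.
have td k := limit_derive (chart_germ lm k Vx).
have := tends_herm hm VW tw td _; rewrite -(speedE nE Vx limit_holo) => /(_ _).
apply: tends_near; move: (loc_unif_at lu_center nV) hF; apply: filterS2 => i Vi hi.
by rewrite (speedE nE Vi) //; apply: hi; rewrite subrr nm0.
Qed.

End AtPoint.

Section Equicontinuity.
Variables (N : hermitian_metric X) (F : I -> C -> X) (L : R).
Hypothesis bound : forall r : R, \forall i \near U, forall w, nm w < r ->
  holo_at (F i) w /\ speed N (F i) w <= L.

Lemma path_bound rho K p h x w s : local_metric N p rho K ->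
  (forall z, nm (z - x) <= nm (w - x) -> holo_at h z /\ K * speed N h z < s) ->
  `|rho (h w) - rho (h x)| <= s * nm (w - x).
Proof.
move=> [K0 _ _ _ lip] H.
have [hx sx] := H x ltac:(by rewrite subrr nm0 nm_ge0).
have s0 : 0 <= s by apply/ltW/(le_lt_trans _ sx); rewrite mulr_ge0 ?(ltW K0) ?speed_ge0.
pose l := nm (w - x); have l0 : 0 <= l := nm_ge0 _.
pose rc (t : R) : C := real_complex R t.
have rcB s' t : rc s' - rc t = rc (s' - t) by rewrite /rc rmorphB.
pose b (t : R) := s * (t * l).
have bm s' t : 0 <= s' -> s' <= t -> t <= 1 -> b s' <= b t.
  by move=> _ st _; rewrite /b ler_wpM2l // ler_wpM2r.
have := @comparison R (fun t => rho (h (x + rc t * (w - x)))) b bm.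
have -> : x + rc 1 * (w - x) = w by rewrite /rc rmorph1 mul1r addrC subrK.
have -> : x + rc 0 * (w - x) = x by rewrite /rc rmorph0 mul0r addr0.
rewrite /b mul1r mul0r mulr0 subr0; apply => t /andP[t0 t1].
have [] := H (x + rc t * (w - x)).
  by rewrite [x + _]addrC addrK nmM nm_real ger0_norm // ler_piMl.
move=> hz sz; have /nm_nearP[d d0 Hd] := lip h _ s hz sz.
exists (d / (l + 1)); first by rewrite divr_gt0 // ltr_wpDl.
move=> u _; rewrite ltr_pdivlMr ?ltr_wpDl // => ud.
have e : nm (x + rc u * (w - x) - (x + rc t * (w - x))) = `|u - t| * l.
  by rewrite opprD addrACA subrr add0r -mulrBl rcB nmM nm_real.
have := Hd (x + rc u * (w - x)); rewrite e => H1.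
have ul : `|u - t| * l < d by apply: le_lt_trans ud; rewrite ler_wpM2l // lerDl.
by apply: le_trans (H1 ul) _; rewrite -mulrBr -mulrBl !normrM (ger0_norm s0) (ger0_norm l0).
Qed.

(** Near x, a truncated distance to the limit point f x grows along F i at a rate bounded uniformly
    in i, so F i maps a fixed disc around x into B. *)
Lemma limit_exists : exists f, forall x, loc_unif F f x.
Proof.
have /choice[f Hf] x : exists p : X, forall B, nbhs p B -> \forall i \near U, B (F i x).
  have nT : \forall i \near U, [set: X] (F i x) by apply: filterE.
  have [p _ Hp] := ultra_compact (u := fun i => F i x) Xc nT.
  by exists p.
exists f => x B Bp; have [rho [K lm]] := local_metric_exists N Xc (f x).
have [K0 _ _ [basis cont] _] := lm.
have [e e0 He] := basis B Bp.
have e2 : 0 < e / 2 by lra.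
have h1 := Hf x _ (cont _ e2).
(* A rate strictly above K L, as [local_metric] demands. *)
pose s := K * (`|L| + 1); have s0 : 0 < s by rewrite mulr_gt0 // ltr_wpDl.
have q0 : 0 < e / 2 / s by rewrite divr_gt0.
exists (Num.min 1 (e / 2 / s)); first by rewrite lt_min ltr01.
move: h1 (bound (nm x + 1)); apply: filterS2 => i ri bi w; rewrite lt_min => /andP[w1 ws].
apply: He; have := @path_bound rho K (f x) (F i) x w s lm _.
have H z : nm (z - x) <= nm (w - x) -> holo_at (F i) z /\ K * speed N (F i) z < s.
  move=> zw; have [] := bi z.
    by have := nmD (z - x) x; rewrite subrK; lra.
  move=> hz sz; split; first exact: hz.
  by rewrite ltr_pM2l //; have := ler_norm L; lra.
move=> /(_ H); move: ws; rewrite ltr_pdivlMr // mulrC => ws.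
by rewrite ler_norml; lra.
Qed.

End Equicontinuity.

End LocallyUniformLimits.

(** * Boundedness of the speed on smaller discs *)

Section SpeedBound.
Variables (R : realType) (X : complex_space R) (N : hermitian_metric X).
Local Notation C := (CC R).
Hypothesis Xc : compact [set: X].

(** Points z_n with speed above n accumulate at some y. The translates h(t + z_n - y) converge to h
    locally uniformly near y, so by [limit_speed] their speeds at y, which are those of h at z_n,
    stay bounded. *)
Lemma speed_bounded (h : C -> X) (r : R) : r < 1 -> (forall z, nm z < 1 -> holo_at h z) ->
  exists B : R, forall z, nm z <= r -> speed N h z <= B.
Proof.
move=> r1 hh; apply: contrapT => nB.
have /choice[z Hz] (n : nat) : exists z : C, nm z <= r /\ n%:R < speed N h z.
  apply: contrapT => nz; apply: nB; exists n%:R => z zr; rewrite leNgt; apply/negP => lt.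
  by apply: nz; exists z.
have [U [UU Uoo]] := ultraFilterLemma (F := \oo) _.
have zr : \forall n \near U, nm (z n) <= r by apply: filterE => n; have [] := Hz n.
have [y ty] := ultra_C zr.
have yr : nm y <= r by exact: (tends_le ty zr).
pose F n (t : C) := h (1 * t + (z n - y)).
have r0 : 0 < (1 - r) / 2 by lra.
have lu w : nm (w - y) < (1 - r) / 2 -> loc_unif U F h w.
  move=> wy B Bw; have w1 : nm w < 1 by have := nmD (w - y) y; rewrite subrK; lra.
  have /nm_nearP[e e0 He] := near_holo (hh w w1).1 Bw.
  have e2 : 0 < e / 2 by lra.
  exists (e / 2) => //; apply: filterS (ty _ e2) => n zn t tw; apply: He.
  rewrite mul1r addrAC; have := nmD (t - w) (z n - y); lra.
have hF : holo_family U F y ((1 - r) / 2).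
  apply: filterS (ty _ r0) => n zn w wy; rewrite /F.
  apply: (holo_at_comp (tau := fun t => 1 * t + (z n - y))).
    by apply: hgD; [apply: hgM; [exact: hg_cst | exact: df_near_id] | exact: hg_cst].
  apply: hh; rewrite mul1r; have := nmD (w - y + (z n - y)) y.
  have := nmD (w - y) (z n - y).
  have -> : w - y + (z n - y) + y = w + (z n - y) by rewrite addrAC subrK.
  lra.
pose ls := @limit_speed R X Xc nat U UU F h y ((1 - r) / 2) r0 lu hF N.
have := ls 1 ltr01.
have [M MN] : exists M : nat, speed N h y ^+ 2 + 2 < M%:R.
  by exists (Num.bound (speed N h y ^+ 2 + 2)); apply: archi_boundP; rewrite addr_ge0 ?sqr_ge0.
have /Uoo big : \forall n \near \oo, (M <= n)%N by exact: nbhs_infty_ge.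
move=> /near_ex2 /(_ big) [n [h1 h2]].
have [zn sz] := Hz n.
have e : speed N (F n) y = speed N h (z n).
  have h1' : holo_germ y (fun t => 1 * t + (z n - y)).
    by apply: hgD; [apply: hgM; [exact: hg_cst | exact: df_near_id] | exact: hg_cst].
  have e1 : 1 * y + (z n - y) = z n by rewrite mul1r addrC subrK.
  have hz : holo_at h (1 * y + (z n - y)) by rewrite e1; apply: hh; exact: le_lt_trans zn r1.
  have := speed_comp N h1' hz; rewrite d1_affine nm1 mul1r => e2.
  rewrite e1 in e2; rewrite -e2; exact: erefl.
move: h1; rewrite e.
have rcB (u v : R) : nm (real_complex R u - real_complex R v : C) = `|u - v| by rewrite -rmorphB nm_real.
rewrite rcB ltr_norml => /andP[_ h1].
have Mn : (M%:R : R) <= n%:R by rewrite ler_nat.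
move: h1 sz MN Mn; move: (speed N h (z n)) (speed N h y) (n%:R : R) (M%:R : R) => u v p q; clear.
move=> h1 h2 h3 h4; have v2 := sqr_ge0 v; nra.
Qed.

End SpeedBound.

(** * Multiplicities in the limit *)

Section LimitMultiplicities.
Variables (R : realType) (X : complex_space R) (Delta : orbifold X) (c : morphism_kind).
Local Notation C := (CC R).
Hypothesis Xc : compact [set: X].
Context (I : Type) (U : set_system I) {UU : UltraFilter U}.

(** Induction by removing all copies of one element at a time. *)
Lemma size_count (T : eqType) (s : seq T) m :
  (forall t, t \in s -> (m %| count_mem t s)%N) -> (m %| size s)%N.
Proof.
elim: {s}(size s) {-2}s (leqnn (size s)) => [|n IH] [|t s] // sn H.
have e : size (t :: s) = (count_mem t (t :: s) + size (seq.filter (predC1 t) (t :: s)))%N.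
  by rewrite size_filter count_predC.
rewrite e dvdn_addr ?H ?mem_head //; apply: IH.
  rewrite /= eqxx /=; apply: leq_trans (_ : (size s <= n)%N) => //.
  by rewrite size_filter count_size.
move=> u; rewrite mem_filter => /andP[/= ut us].
have -> : count_mem u (seq.filter (predC1 t) (t :: s)) = count_mem u (t :: s).
  rewrite count_filter; apply: eq_count => v /=.
  by case: eqP => //= ->; rewrite ut.
exact: H.
Qed.

Lemma order_roots (F v : C -> C) (s : seq C) (t : C) : holo_germ t v -> v t != 0 ->
  (forall w, F w = (\prod_(a <- s) (w - a)) * v w) -> vanishing_order F t (count_mem t s).
Proof.
move=> hv v0 FE; exists (fun w => (\prod_(a <- s | a != t) (w - a)) * v w); split.
- apply: hgM; last exact: hv.
  by apply: hg_prod => a; apply: hgB; [exact: df_near_id | exact: hg_cst].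
- rewrite mulf_neq0 // prodf_seq_neq0; apply/allP => a _; apply/implyP => at'.
  by rewrite subr_eq0 eq_sym.
apply: filterE => w; rewrite FE (bigID (fun a => a == t)) /= -mulrA; congr (_ * _).
rewrite (eq_bigr (fun=> w - t)) => [|a /eqP -> //].
by rewrite big_const_seq iter_mulr_1.
Qed.

(* Hurwitz's theorem splits the zero of order n of the limit equation into zeros of
   the approximating ones, all lying on the component. *)
Lemma mult_limit (F : I -> C -> X) f : (forall x, loc_unif U F f x) ->
  (forall r : R, \forall i \near U, (forall w, nm w < r -> holo_at (F i) w) /\
     mult_ok Delta c (F i) (disc r)) ->
  mult_ok Delta c f setT.
Proof.
move=> lu H j m x q jm _ hx [k [V [phi [n [k0 le Vx vo qE]]]]].
have Zh := hyp_hypersurface (o := Delta) j.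
have phi0 := local_equation_on Zh k0 le Vx hx.
have [Vo gphi _] := le.
have hF : holo_family U F x 1.
  apply: filterS (H (nm x + 1)) => i [hi _] w w1; apply: hi.
  by have := nmD (w - x) x; rewrite subrK; lra.
have lux w : nm (w - x) < 1 -> loc_unif U F f w by move=> _; exact: lu.
have [rho [M [/andP[rho0 rho1] bf tl]]] := limit_germ Xc ltr01 lux hF (gphi _ Vx).
have [g [hg g0 gE]] := vo.
have n0 : (0 < n)%N.
  case: n gE {vo qE} => // /nbhs_singleton /=; rewrite phi0 expr0 mul1r => e.
  by rewrite -e eqxx in g0.
have nV : \forall y \near f x, V y by exact: open_nbhs_nbhs.
have [d d0 Hd] := lu x V nV.
have /nm_nearP[e e0 He] : \forall w \near x, phi (f w) = (w - x) ^+ n * g w /\ g w != 0.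
  by move: gE (cont_neq0 (hgcont hg) g0); apply: filterS2.
pose s := Num.min (Num.min d e) rho.
have s0 : 0 < s by rewrite !lt_min d0 e0.
have sr : s <= rho by rewrite ge_min lexx orbT.
have sd : s <= d by rewrite !ge_min lexx.
have se : s <= e by rewrite !ge_min lexx orbT.
have bf' : bounded_family U x s (fun i w => phi (F i w)) M.
  apply: filterS bf => i [h1 h2]; split=> w ws.
    exact: h1 (lt_le_trans ws sr).
  exact: h2 (lt_le_trans ws sr).
have tl' w : nm (w - x) < s -> tends U (fun i => phi (F i w) : C) (phi (f w)).
  by move=> ws; exact: tl (lt_le_trans ws sr).
have gE' w : nm (w - x) < s -> phi (f w) = (w - x) ^+ n * g w /\ g w != 0.
  by move=> ws; exact: He (lt_le_trans ws se).
have hz := hurwitz s0 bf' tl' (hgcont hg) gE'.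
have hU : \forall i \near U, mult_ok Delta c (F i) (disc (nm x + 1)) /\
    forall w, nm (w - x) < d -> V (F i w).
  by move: (H (nm x + 1)) Hd; apply: filterS2 => i [_ h1] h2.
have [i [[l [v [sl lx hv v0 vE]]] [ok Vi]]] := near_ex2 (hz _) hU.
have s2 : s / 2 < s by rewrite ltr_pdivrMr // ltr_pMr // ltr1n.
have root t : t \in l -> adm c m k (count_mem t l).
  move=> tl0; have tx := lx t tl0; have ts : nm (t - x) < s := le_lt_trans tx s2.
  have Vt : V (F i t) by apply: Vi; exact: lt_le_trans ts sd.
  have pt : phi (F i t) = 0.
    by rewrite vE (big_rem t) //= subrr !mul0r.
  (* An equation is nonzero off the component, and [phi] vanishes at [F i t]. *)
  have Zt : hyp j (F i t).
    by apply: contrapT => nZ; have := local_equation_off Zh le Vt nZ; rewrite pt eqxx.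
  apply/(admE c m _ k0); apply: (ok j m t) => //.
    by rewrite /disc /=; have := nmD (t - x) x; rewrite subrK; lra.
  exists k, V, phi, (count_mem t l); split=> //.
  exact: (order_roots (hol_germ hv ts) (v0 t tx) vE).
rewrite qE; apply/admE => //; rewrite -sl.
have l0 : (0 < size l)%N by rewrite sl.
case: (c) root => /= root.
  case: l l0 root {sl lx vE} => // t l _ /(_ t (mem_head t l)) /leq_trans; apply.
  exact: count_size.
exact: size_count.
Qed.

End LimitMultiplicities.

(** * Brody's reparametrisation and the theorem *)

Section Brody.
Variables (R : realType) (X : complex_space R) (Delta : orbifold X).
Variables (N : hermitian_metric X) (c : morphism_kind).
Local Notation C := (CC R).
Hypothesis D_compact : compact_orbifold Delta.

(** F is h (mob a (z / M) / 2), where [a] maximises, up to the factor 1 + eps, the invariant speed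
    [G] of h (z / 2), and M = G a. In particular M is at least G 0 / (1 + eps), with G 0 half the
    speed of h at 0. *)
Lemma brody_reparam h (eps : R) : 0 < eps -> disc_morphism Delta c h -> 0 < speed N h 0 ->
  exists F M, [/\ speed N h 0 / 2 / (1 + eps) <= M, forall z, nm z < M -> holo_at F z,
    forall z, nm z < M -> (1 - (nm z / M) ^+ 2) * speed N F z <= 1 + eps,
    speed N F 0 = 1 & mult_ok Delta c F (disc M)].
Proof.
move=> eps0 dh sh0; have [hh _ ok] := (disc_morphismE c D_compact h).1 dh.
have e1 : 0 < 1 + eps by lra.
have z0 : nm (0 : C) < 1 by rewrite nm0.
have half1 : (1 / 2 : R) < 1 by lra.
have [B HB] := speed_bounded N D_compact.1 half1 hh.
(* The dilation by 1 / 2 keeps the speed bounded, so that the supremum of [G] is finite. *)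
pose q : C := real_complex R (1 / 2).
have nq : nm q = 1 / 2 by rewrite nm_real ger0_norm; lra.
have q0 : q != 0 by rewrite -nm_gt0 nq; lra.
have qlt z : nm z < 1 -> nm (q * z) < 1 / 2 by rewrite nmM nq; lra.
have hq z : holo_germ z (fun t => q * t + 0).
  by apply: hgD; [apply: hgM; [exact: hg_cst | exact: df_near_id] | exact: hg_cst].
pose G z : R := (1 - nm z ^+ 2) * (1 / 2 * speed N h (q * z)).
have G0 : G 0 = speed N h 0 / 2 by rewrite /G nm0 mulr0 expr0n subr0 mul1r mulrC mulrA mulr1.
pose S := [set G z | z in [set z : C | nm z < 1]].
have hS : has_sup S.
  split; first by exists (G 0), 0.
  exists (`|B|) => _ [z z1 <-]; have qz := qlt z z1.
  have sB := HB _ (ltW qz); have s0 := speed_ge0 N (hh _ (lt_trans qz half1)).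
  have := ler_norm B; have := sqr_ge0 (nm z); have zz := nm_ge0 z; have z2 : nm z ^+ 2 <= 1 by rewrite exprn_ile1 // ltW.
  rewrite /G; move: sB s0 z2; move: (nm z ^+ 2) (speed N h _) (`|B|) => u v w; clear; nra.
have SG z : nm z < 1 -> G z <= sup S by move=> z1; apply: sup_ubound hS.2 _ _; exists z.
have sS0 : 0 < sup S by apply: lt_le_trans (SG 0 z0); rewrite G0 divr_gt0.
(* sup S - e is sup S / (1 + eps). *)
pose e := sup S - sup S / (1 + eps).
have e0 : 0 < e.
  by rewrite subr_gt0 ltr_pdivrMr ?ltr_wpDl // ?ltr_pMr // ltrDl.
have [_ [a a1 <-] Ga] := sup_adherent e0 hS.
have {}a1 : nm a < 1 := a1.
rewrite /e opprB addrC subrK in Ga.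
have GM z : nm z < 1 -> G z <= (1 + eps) * G a.
  by move=> z1; apply: le_trans (SG z z1) _; rewrite ltW // mulrC -ltr_pdivrMr.
pose M := G a; have M0 : 0 < M by apply: lt_trans Ga; rewrite divr_gt0.
pose m : C := real_complex R M^-1.
have nmm : nm m = M^-1 by rewrite nm_real ger0_norm // invr_ge0 ltW.
have m0 : m != 0 by rewrite -nm_gt0 nmm invr_gt0.
pose tau z : C := q * mob a (m * z + 0) + 0.
have mz z : nm z < M -> nm (m * z + 0) < 1.
  by rewrite addr0 nmM nmm mulrC ltr_pdivrMr // mul1r.
have hm z : holo_germ z (fun t => m * t + 0).
  by apply: hgD; [apply: hgM; [exact: hg_cst | exact: df_near_id] | exact: hg_cst].
have ht z : nm z < M -> holo_germ z (fun t => mob a (m * t + 0)).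
  move=> zM; exact: (hg_comp (c := mob a) (hm z) (mob_holo a1 (mz z zM))).
have tau1 z : nm z < M -> nm (tau z) < 1.
  by move=> zM; rewrite /tau addr0; apply: lt_trans half1; apply/qlt/mob_disc/mz.
have htau z : nm z < M -> holo_germ z tau.
  by move=> zM; exact: (hg_comp (c := fun t => q * t + 0) (ht z zM) (hq _)).
have dtau z : nm z < M -> derive1 tau z = m * derive1 (mob a) (m * z + 0) * q.
  move=> zM.
  have e2 := d1_comp (g := fun t => q * t + 0) (ht z zM) (hq _).
  have e3 := d1_comp (g := mob a) (hm z) (mob_holo a1 (mz z zM)).
  rewrite d1_affine in e2; rewrite d1_affine in e3; rewrite -e3; exact: e2.
(* By [nm_mob_derive], the invariant speed at z / M is that of h (z / 2) at the image point. *)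
have sF z : nm z < M -> (1 - (nm z / M) ^+ 2) * speed N (fun t => h (tau t)) z = G (mob a (m * z + 0)) / M.
  move=> zM; rewrite (speed_comp N (htau z zM) (hh _ (tau1 z zM))) (dtau z zM) !nmM nmm nq.
  have := nm_mob_derive a1 (mz z zM).
  have -> : nm (m * z + 0) = nm z / M by rewrite addr0 nmM nmm mulrC.
  have -> : tau z = q * mob a (m * z + 0) by exact: addr0.
  rewrite /G => <-.
  move: (nm (derive1 _ _)) (speed N h _) (nm z / M) (M^-1) => u v w k; clear; ring.
have F0 : nm (0 : C) < M by rewrite nm0.
exists (fun t => h (tau t)), M; split.
- rewrite -G0; apply/ltW/(le_lt_trans _ Ga); rewrite ler_pM2r ?invr_gt0 //; exact: SG.
- by move=> z zM; apply: holo_at_comp; [exact: htau | exact: hh (tau1 z zM)].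
- move=> z zM; rewrite sF // ler_pdivrMr //; apply/GM/mob_disc/mz => //.
- have := sF 0 F0; rewrite nm0 mul0r expr0n subr0 mul1r mulr0 addr0 mob0 => ->.
  by rewrite divff // gt_eqF.
- have ok1 : mult_ok Delta c (fun t => h (q * t + 0)) (disc 1).
    apply: (mult_ok_inverse (tau := fun t => q * t + 0)) ok => z z1; split.
      by rewrite /disc /= addr0; exact: lt_trans (qlt z z1) half1.
    by exists (fun s => (s - 0) / q); exact: inverse_affine.
  have ok2 : mult_ok Delta c (fun t => h (q * mob a t + 0)) (disc 1).
    apply: (mult_ok_inverse (h := fun t => h (q * t + 0)) (tau := mob a)) ok1 => z z1; split.
      exact: mob_disc.
    by exists (mob (- a)); exact: inverse_mob.
  apply: (mult_ok_inverse (h := fun t => h (q * mob a t + 0)) (tau := fun t => m * t + 0)) ok2 => z zM; split.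
    exact: mz.
  by exists (fun s => (s - 0) / m); exact: inverse_affine.
Qed.

End Brody.

(** q lies midway between 1 and s, and e is chosen with e (q + 1) = (q - 1) / 2, so that (1 - e) q
    exceeds 1 + e; values u with u^2 so close to s^2 are above q. *)
Lemma speed_margin (R : realType) (s : R) : 1 < s -> exists q e : R, [/\ 0 < s ^+ 2 - q ^+ 2, 0 < e &
  forall u v k, 0 <= u -> v < e -> k < e -> `|u ^+ 2 - s ^+ 2| < s ^+ 2 - q ^+ 2 ->
    (1 - v) * u <= 1 + k -> False].
Proof.
move=> s1; pose q := (1 + s) / 2; have q1 : 1 < q by rewrite /q; lra.
have sq : q < s by rewrite /q; lra.
pose e := (q - 1) / (2 * (q + 1)); have e0 : 0 < e by rewrite divr_gt0; lra.
have eq : e * (2 * (q + 1)) = q - 1 by rewrite divfK // gt_eqF //; lra.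
move: q e q1 sq e0 eq => q e q1 sq e0 eq; exists q, e; split=> [||u v k u0 ve ke]; [nra | exact: e0 |].
rewrite ltr_norml => /andP[H _] H1; have uq : q < u by nra.
have e1 : 0 < 1 - e by nra.
have a1 : 0 < (1 - e) * (u - q) by rewrite mulr_gt0 // subr_gt0.
have a2 : 0 <= (e - v) * u by rewrite mulr_ge0 // subr_ge0 ltW.
by lra.
Qed.

Theorem theorem3 (R : realType) (X : complex_space R) (Delta : orbifold X)
    (N : hermitian_metric X) (c : morphism_kind) :
  compact_orbifold Delta ->
  ~ kobayashi_is_distance Delta c ->
  exists f : CC R -> X,
    [/\ holomorphic_on setT f,
        ~ (forall z w, f z = f w),
        plane_morphism Delta c f \/ f @` setT `<=` orb_support Delta,
        ereal_sup [set (speed N f z)%:E | z in [set: CC R]] = (speed N f 0)%:E &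
        0 < speed N f 0].
Proof.
move=> Dc nd; have Xc := Dc.1.
have fast (B : R) : exists2 h, disc_morphism Delta c h & B < speed N h 0.
  apply: contrapT => nB; apply: nd; apply: (distance_from_bound (N := N) Dc (B := B)) => h dh.
  by rewrite leNgt; apply/negP => lt; apply: nB; exists h.
pose FM := ((CC R -> X) * R)%type.
have /choice[p Hp] (n : nat) : exists p : FM, [/\ n.+1%:R <= p.2, forall z, nm z < p.2 -> holo_at p.1 z,
    forall z, nm z < p.2 -> (1 - (nm z / p.2) ^+ 2) * speed N p.1 z <= 1 + n.+1%:R^-1,
    speed N p.1 0 = 1 & mult_ok Delta c p.1 (disc p.2)].
  (* [brody_reparam] loses a factor 2 (1 + eps), at most 4. *)
  have [h dh sh] := fast (4 * n.+1%:R); have n0 : (0 : R) < n.+1%:R by rewrite ltr0n.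
  have i0 : (0 : R) < n.+1%:R^-1 by rewrite invr_gt0.
  have s0 : 0 < speed N h 0 by apply: lt_trans sh; rewrite mulr_gt0.
  have [F [M [h1 h2 h3 h4 h5]]] := brody_reparam Dc i0 dh s0.
  exists (F, M); split; [|exact: h2|exact: h3|exact: h4|exact: h5].
  apply: le_trans h1; rewrite ler_pdivlMr ?addr_gt0 //.
  have i1 : (n.+1%:R^-1 : R) <= 1 by rewrite invf_le1 // ler1n.
  move: sh i0 i1 n0; move: (speed N h 0) (n.+1%:R^-1 : R) (n.+1%:R : R) => u v w; clear; nra.
have [U [UU Uoo]] := ultraFilterLemma (F := \oo) _.
pose F n := (p n).1; pose M n := (p n).2.
have M0 n : 0 < M n by have [h _ _ _ _] := Hp n; apply: lt_le_trans h; rewrite ltr0n.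
have bigM (r : R) : \forall n \near U, r < M n.
  apply: Uoo; exists (Num.bound `|r|) => // n /= rn; have [h _ _ _ _] := Hp n.
  apply: lt_le_trans h; apply: le_lt_trans (ler_norm r) _.
  apply: lt_le_trans (archi_boundP (normr_ge0 r)) _; rewrite ler_nat; exact: leq_trans rn _.
have smallV (e : R) : 0 < e -> \forall n \near U, n.+1%:R^-1 < e.
  by move=> e0; apply: Uoo; have := @tends_harm R e e0; apply: filterS => k; rewrite subr0 nmV nm_nat.
have shrink (w : CC R) (e : R) : 0 < e -> \forall n \near U, (nm w / M n) ^+ 2 < e.
  move=> e0; have q0 : 0 < Num.min e 1 by rewrite lt_min e0 ltr01.
  apply: filterS (bigM (nm w / Num.min e 1)) => n; rewrite ltr_pdivrMr // mulrC -ltr_pdivrMr //.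
  have : 0 <= nm w / M n by rewrite divr_ge0 ?nm_ge0 ?(ltW (M0 n)).
  rewrite lt_min; move: (_ / _) => u u0 /andP[u1 u2]; rewrite expr2.
  apply: le_lt_trans u1; rewrite ler_piMl // ltW //.
(* For M n > 2 r the factor 1 - (|w| / M n)^2 is at least 3 / 4, so the speed is at most 8 / 3. *)
have bound (r : R) : \forall n \near U, forall w, nm w < r -> holo_at (F n) w /\ speed N (F n) w <= 4.
  apply: filterS (bigM (2 * r)) => n rM w wr; have [_ h1 h2 _ _] := Hp n.
  have w0 := nm_ge0 w; have wM : nm w < M n by lra.
  split; first exact: h1.
  have := h2 w wM; have s0 := speed_ge0 N (h1 w wM).
  have i1 : (n.+1%:R^-1 : R) <= 1 by rewrite invf_le1 ?ler1n ?ltr0n.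
  have : nm w / M n <= 1 / 2 by rewrite ler_pdivrMr //; lra.
  have : 0 <= nm w / M n by rewrite divr_ge0 // ltW.
  move: i1 s0; rewrite -/(F n) -/(M n); move: (nm w / M n) (speed N (F n) w) (n.+1%:R^-1 : R) => u v k; clear.
  move=> k1 v0 u0 u1 H; have u2 : 0 <= 1 / 4 - u ^+ 2 by nra.
  by have := mulr_ge0 u2 v0; lra.
have [f lu] := limit_exists Xc bound.
have hF x : holo_family U F x 1.
  apply: filterS (bound (nm x + 1)) => n h w w1.
  by have [] := h w; [have := nmD (w - x) x; rewrite subrK; lra |].
have lux x w : nm (w - x) < 1 -> loc_unif U F f w by move=> _; exact: lu.
have hf x : holo_at f x by exact: (limit_holo Xc ltr01 (lux x) (hF x)).
have st x := @limit_speed R X Xc nat U UU F f x 1 ltr01 (lux x) (hF x) N.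
have s1 : speed N f 0 = 1.
  have s0 := speed_ge0 N (hf 0).
  have t1 : tends U (fun n => real_complex R (speed N (F n) 0 ^+ 2) : CC R) (real_complex R 1).
    have -> : (fun n => real_complex R (speed N (F n) 0 ^+ 2) : CC R) = fun=> real_complex R 1.
      by apply/funext => n; have [_ _ _ -> _] := Hp n; rewrite expr1n.
    exact: tends_cst.
  have e : speed N f 0 ^+ 2 = 1 by apply: (@complexI R); exact: (tends_unique (st 0) t1).
  by apply/eqP; rewrite -(@eqrXn2 _ 2) // e expr1n.
(* At fixed x both corrections, (|x| / M n)^2 and 1 / (n + 1), tend to 0. *)
have le1 x : speed N f x <= 1.
  rewrite leNgt; apply/negP => /speed_margin[q [e [qs e0 margin]]].
  have h1 : \forall n \near U, nm x < M n /\ n.+1%:R^-1 < e.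
    by move: (bigM (nm x)) (smallV e e0); apply: filterS2.
  have h2 : \forall n \near U, (nm x / M n) ^+ 2 < e /\
      nm (real_complex R (speed N (F n) x ^+ 2) - real_complex R (speed N f x ^+ 2) : CC R) <
      speed N f x ^+ 2 - q ^+ 2.
    by move: (shrink x e e0) (st x _ qs); apply: filterS2.
  have [n [[xM ne] [xe]]] := near_ex2 h1 h2.
  have rcB (u v : R) : nm (real_complex R u - real_complex R v : CC R) = `|u - v| by rewrite -rmorphB nm_real.
  rewrite rcB => H; have [_ h3 h4 _ _] := Hp n.
  exact: margin (speed_ge0 N (h3 x xM)) xe ne H (h4 x xM).
exists f; split.
- by move=> z _; exact: hf.
(* If f were constant, it would equal its composite with the zero map, whose speed is 0. *)
- move=> fc; have h0 : holo_germ (0 : CC R) (fun t => 0 * t + 0).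
    by apply: hgD; [apply: hgM; [exact: hg_cst | exact: df_near_id] | exact: hg_cst].
  have := speed_comp N h0 (hf _); rewrite d1_affine nm0 mul0r.
  have -> : (fun t : CC R => f (0 * t + 0)) = f by apply/funext => t; exact: fc.
  by rewrite s1 => /eqP; rewrite oner_eq0.
- have [fS|fS] := pselect (f @` setT `<=` orb_support Delta); [by right | left].
  split; [by move=> z _; exact: hf | exact: fS | ].
  move=> g dg gS; apply/(disc_morphismE c Dc).
  have hg z : nm z < 1 -> holo_germ z g.
    move=> z1; apply: (@hol_germ _ _ 0 z 1); last by rewrite subr0.
    by move=> w; rewrite subr0 => w1; apply: dg; rewrite unit_discE.
  split.
  + by move=> z z1; exact: (holo_at_comp (hg z z1) (hf (g z))).
  + apply: contrapT => nz; apply: gS => _ [z + <-]; rewrite unit_discE => z1.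
    by apply: contrapT => nS; apply: nz; exists z.
  + apply: mult_ok_compose => //.
    apply: (mult_limit Xc (F := F) (U := U)) => // r.
    apply: filterS (bigM r) => n rM; have [_ h1 _ _ h5] := Hp n; split=> [w wr|].
      exact: h1 (lt_trans wr rM).
    by move=> i m x q im xr; apply: (h5 i m x q im); exact: lt_trans xr rM.
- apply/eqP; rewrite eq_le; apply/andP; split; last by apply: ereal_sup_ubound; exists 0.
  by apply: ge_ereal_sup => _ [x _ <-]; rewrite lee_fin s1.
- by rewrite s1.
Qed.
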